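(* Let $G$ be a compact Lie group, let $Y=\langle\nabla_G,\alpha\rangle$ (with $\alpha\in\mathbb{R}^n$, $n=\dim G$) be a left-invariant real vector field on $G$, and let $\delta\ge 1$. There exists $c>0$ such that $$\|\nabla_G f\|_{L^2(G)}^{\delta-1}\,\|Yf\|_{L^2(G)}\ \ge\ c\,\|f\|_{L^2(G)}^{\delta}\qquad\text{for every } f\in(\ker Y|_{H^1(G)})^\perp,$$ if and only if there exists $C>0$ such that $$\lambda_{\min}^{>0}[\sigma_Y(\xi)]\ \ge\ C\,\langle\xi\rangle^{-(\delta-1)}\qquad\text{for all }[\xi]\in\widehat G\text{ such that }\sigma_Y(\xi)\ne 0.$$
   Context: $G$ is connected, with normalized Haar measure. $\widehat G$ is the set of equivalence classes of continuous irreducible unitary representations $\xi$ (taken matrix-valued, of dimension $d_\xi$). $\widehat f(\xi)=\int_G f(x)\xi(x)^*dx\in\mathbb{C}^{d_\xi\times d_\xi}$ (for distributions, $\widehat u(\xi)=\langle u,\xi^*\rangle$ entrywise). $\mathcal{L}_G$ is the positive Laplace–Beltrami operator of a fixed bi-invariant Riemannian metric; the matrix entries of $\xi$ are eigenfunctions of $\mathcal L_G$ with a common eigenvalue $\nu_\xi\ge0$, and $\langle\xi\rangle=\sqrt{1+\nu_\xi}$. $H^s(G)$ is the Sobolev space of distributions with finite norm $\|u\|_{H^s(G)}^2=\sum_{[\xi]}d_\xi\langle\xi\rangle^{2s}\|\widehat u(\xi)\|_{HS}^2$ ($HS$ = Hilbert–Schmidt). $X_1,\dots,X_n$ is a basis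 of real left-invariant vector fields with $\mathcal L_G=-(X_1^2+\dots+X_n^2)$; $\nabla_Gf=(X_1f,\dots,X_nf)$, $\|\nabla_G f\|_{L^2}^2=\sum_j\|X_jf\|_{L^2}^2$, and $\langle\nabla_G,\alpha\rangle=\sum_j\alpha_jX_j$. The symbol of a left-invariant operator $P$ is $\sigma_P(\xi)=\xi(x)^*(P\xi)(x)\in\mathbb C^{d_\xi\times d_\xi}$ (independent of $x$), so that $\widehat{Pf}(\xi)=\sigma_P(\xi)\widehat f(\xi)$. For a nonzero matrix $A$, $\lambda_{\min}^{>0}[A]$ is its smallest nonzero singular value. $(\ker Y|_{H^1(G)})^\perp$ is the orthogonal complement in $H^1(G)$, with respect to the $H^1(G)$ inner product, of the kernel of $Y:H^1(G)\to L^2(G)$. For $\delta=1$ the factor $\|\nabla_G f\|^{\delta-1}$ is read as $1$. *)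

(* Defs.v *)
From HB Require Import structures.
From mathcomp Require Import all_boot all_order all_algebra.
From mathcomp Require Import complex.
From mathcomp Require Import all_classical all_reals all_analysis.
Set Implicit Arguments.
Unset Strict Implicit.
Unset Printing Implicit Defensive.
Import Order.TTheory GRing.Theory Num.Theory.
Import numFieldNormedType.Exports.
Local Open Scope classical_set_scope.
Local Open Scope complex_scope.
Local Open Scope sesquilinear_scope.
Local Open Scope ring_scope.

(* C^oo on an open set U: all iterated directional derivatives exist and are
   differentiable (hence continuous). *)
Definition smooth_on (R : realType) (V W : normedModType R)
    (U : set V) (f : V -> W) : Prop :=
  forall (s : seq V) (z : V), U z ->
    differentiable (foldr (fun v g => 'D_v g) f s) z.

(* An n-dimensional smooth manifold. The atlas is indexed by the points, the
   chart of index x being defined around x; [chart_inv x] is only meaningful on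
   the image of [chart x]. *)
HB.mixin Record isManifold (R : realType) (n : nat) M
    of PointedTopological M := {
  chart_dom : M -> set M ;
  chart : M -> M -> 'rV[R]_n ;
  chart_inv : M -> 'rV[R]_n -> M ;
  manifold_hausdorff : hausdorff_space M ;
  manifold_countable : @second_countable M ;
  chart_dom_open : forall x, open (chart_dom x) ;
  chart_dom_mem : forall x, chart_dom x x ;
  chart_img_open : forall x, open (chart x @` chart_dom x) ;
  chartK : forall x y, chart_dom x y -> chart_inv x (chart x y) = y ;
  chart_continuous : forall x y, chart_dom x y -> {for y, continuous (chart x)} ;
  chart_inv_continuous : forall x z, (chart x @` chart_dom x) z ->
    {for z, continuous (chart_inv x)} ;
  chart_transition : forall x y,
    smooth_on [set z | (chart x @` chart_dom x) z /\
                       chart_dom y (chart_inv x z)]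
              (chart y \o chart_inv x)
}.
#[short(type="manifoldType")]
HB.structure Definition Manifold (R : realType) (n : nat) :=
  { M of isManifold R n M & PointedTopological M }.

Definition chart_img (R : realType) (n : nat) (M : manifoldType R n) (x : M) :
  set 'rV[R]_n := chart x @` chart_dom x.

HB.mixin Record isLieGroup (R : realType) (n : nat) G
    of Manifold R n G & Group G := {
  lie_mul_continuous : continuous (fun p : G * G => (p.1 * p.2)%g) ;
  lie_inv_continuous : continuous (fun x : G => x^-1%g) ;
  lie_mul_smooth : forall x y w : G,
    smooth_on
      [set p : 'rV[R]_n * 'rV[R]_n |
        [/\ chart_img x p.1, chart_img y p.2 &
            chart_dom w (chart_inv x p.1 * chart_inv y p.2)%g]]
      (fun p => chart w (chart_inv x p.1 * chart_inv y p.2)%g) ;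
  lie_inv_smooth : forall x w : G,
    smooth_on
      [set z : 'rV[R]_n | chart_img x z /\ chart_dom w (chart_inv x z)^-1%g]
      (fun z => chart w (chart_inv x z)^-1%g)
}.
#[short(type="lieGroupType")]
HB.structure Definition LieGroup (R : realType) (n : nat) :=
  { G of isLieGroup R n G & Manifold R n G & Group G }.

Section ComplexFunctions.
Context {R : realType} {T : Type}.

(* The complex-linear extension of an operator on real-valued functions. *)
Definition clift (P : (T -> R) -> (T -> R)) (f : T -> R[i]) : T -> R[i] :=
  fun x => P (fun y => complex.Re (f y)) x +i* P (fun y => complex.Im (f y)) x.

(* Sums of absolutely summable families indexed by a set. *)
Definition rsum (I : choiceType) (S : set I) (a : I -> R) : R :=
  fine (\esum_(i in S) (Num.max (a i) 0)%:E)
  - fine (\esum_(i in S) (Num.max (- a i) 0)%:E).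

Definition csum (I : choiceType) (S : set I) (a : I -> R[i]) : R[i] :=
  rsum S (fun i => complex.Re (a i)) +i* rsum S (fun i => complex.Im (a i)).

End ComplexFunctions.

Section Matrices.
Context {R : realType}.

Definition hs_norm2 (m n : nat) (A : 'M[R[i]]_(m, n)) : R :=
  \sum_i \sum_j Normc.normc (A i j) ^+ 2.

Definition singular_value (m n : nat) (A : 'M[R[i]]_(m, n)) (s : R) : Prop :=
  0 <= s /\ eigenvalue (A^t* *m A) (s ^+ 2)%:C.

(* For A != 0 the set below is finite and nonempty, and inf is its minimum. *)
Definition lambda_min_pos (m n : nat) (A : 'M[R[i]]_(m, n)) : R :=
  inf [set s : R | 0 < s /\ singular_value A s].

End Matrices.

Section SmoothFunctions.
Context {R : realType} {n : nat} {M : manifoldType R n}.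

Definition smooth (f : M -> R) : Prop :=
  forall x : M, smooth_on (chart_img x) (f \o chart_inv x).

Definition csmooth (f : M -> R[i]) : Prop :=
  smooth (fun x => complex.Re (f x)) /\ smooth (fun x => complex.Im (f x)).

(* [m x z] is the Gram matrix of the metric at the point of coordinate z in the
   chart [chart x]; F is isometric for m when m is its own pull-back by F.
   Vectors are rows, hence the position of the transpose. *)
Definition isometric (m : M -> 'rV[R]_n -> 'M[R]_n) (F : M -> M) : Prop :=
  forall (x y : M) (z : 'rV[R]_n),
    chart_img x z -> chart_dom y (F (chart_inv x z)) ->
    let Floc := chart y \o F \o chart_inv x in
    m x z = 'J Floc z *m m y (Floc z) *m ('J Floc z)^T.

(* [metric_coherent] says that the local expressions agree on overlaps. *)
Record riemannian_metric := RiemannianMetric {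
  metric :> M -> 'rV[R]_n -> 'M[R]_n ;
  metric_smooth : forall x i j, smooth_on (chart_img x) (fun z => metric x z i j) ;
  metric_sym : forall x z, chart_img x z -> (metric x z)^T = metric x z ;
  metric_pos : forall x z (v : 'rV[R]_n), chart_img x z -> v != 0 ->
    0 < (v *m metric x z *m v^T) 0 0 ;
  metric_coherent : isometric metric idfun
}.

(* - div grad f, in the local coordinates around x. *)
Definition laplace_beltrami (g : riemannian_metric) (f : M -> R) (x : M) : R :=
  let vol z := Num.sqrt (\det (g x z)) in
  - ((vol (chart x x))^-1 *
     \sum_i \sum_j
       'D_(delta_mx 0 i)
         (fun z => vol z * invmx (g x z) i j *
                   'D_(delta_mx 0 j) (f \o chart_inv x) z) (chart x x)).

End SmoothFunctions.
Arguments riemannian_metric {R n} M.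

Section LieGroupTheory.
Context {R : realType} {n : nat} {G : lieGroupType R n}.

Definition biinvariant (g : riemannian_metric G) : Prop :=
  forall a : G, isometric g (fun x => (a * x)%g) /\
                isometric g (fun x => (x * a)%g).

(* The left-invariant vector field whose value at the identity is the tangent
   vector with coordinates v in the chart [chart 1]: its value at x is the image
   of that vector by the differential of left translation by x. *)
Definition lvf (v : 'rV[R]_n) (f : G -> R) : G -> R :=
  fun x => 'D_v (fun z => f (x * chart_inv (1%g : G) z)%g) (chart (1%g : G) 1%g).

(* <nabla, alpha>, the j-th row of X being the value at 1 of X_j. *)
Definition lin_comb_vf (X : 'M[R]_n) (alpha : 'rV[R]_n) (f : G -> R) : G -> R :=
  fun x => \sum_j alpha 0 j * lvf (row j X) f x.

Record irrep := Irrep {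
  irrep_dim : nat ;
  irrep_fun :> G -> 'M[R[i]]_irrep_dim ;
  irrep_dim_gt0 : (0 < irrep_dim)%N ;
  irrep_mul : forall x y, irrep_fun (x * y)%g = irrep_fun x *m irrep_fun y ;
  irrep_unitary : forall x, irrep_fun x \is unitarymx ;
  irrep_continuous : forall i j,
    continuous (fun x => complex.Re (irrep_fun x i j)) /\
    continuous (fun x => complex.Im (irrep_fun x i j)) ;
  (* W stands for the span of the columns of W^T. *)
  irrep_irreducible : forall W : 'M[R[i]]_irrep_dim,
    (forall x, (W *m (irrep_fun x)^T <= W)%MS) -> W = 0 \/ row_full W
}.

HB.instance Definition _ := gen_eqMixin irrep.
HB.instance Definition _ := gen_choiceMixin irrep.

Definition irrep_equiv (xi eta : irrep) : Prop :=
  exists T : 'M[R[i]]_(irrep_dim xi, irrep_dim eta),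
    [/\ T \is unitarymx, T^t* \is unitarymx & forall x, xi x *m T = T *m eta x].

(* The unitary dual, as the set of the canonically chosen representatives of
   the equivalence classes of irreducible representations. *)
Definition dual : set irrep :=
  [set xi | xi = xget xi [set eta | irrep_equiv xi eta]].

Definition symbol (P : (G -> R[i]) -> (G -> R[i])) (xi : irrep) :
    'M[R[i]]_(irrep_dim xi) :=
  (xi 1%g)^t* *m \matrix_(i, j) P (fun y => xi y i j) 1%g.

Definition nu (g : riemannian_metric G) (xi : irrep) : R :=
  xget 0 [set l : R | forall i j x,
    clift (laplace_beltrami g) (fun y => xi y i j) x = l%:C * xi x i j].

Definition jbracket (g : riemannian_metric G) (xi : irrep) : R :=
  Num.sqrt (1 + nu g xi).

(* Functionals on C^oo(G) are total functions on G -> R[i], of which only the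
   values on smooth functions matter. *)
Definition functional := (G -> R[i]) -> R[i].

(* Linearity, and continuity for the seminorms given by the sup norms of the
   iterated left-invariant derivatives. *)
Definition is_distribution (u : functional) : Prop :=
  (forall (a : R[i]) (phi psi : G -> R[i]), csmooth phi -> csmooth psi ->
     u (fun x => a * phi x + psi x) = a * u phi + u psi) /\
  exists (C : R) (N : nat), forall (phi : G -> R[i]) (K : R), csmooth phi ->
    (forall (w : seq 'I_n) (x : G), (size w <= N)%N ->
       Normc.normc
         (foldr (fun i f => clift (lvf (delta_mx 0 i)) f) phi w x) <= K) ->
    Normc.normc (u phi) <= C * K.

Definition vf_distr (Z : (G -> R) -> (G -> R)) (u : functional) : functional :=
  fun phi => - u (clift Z phi).

Definition fourier (u : functional) (xi : irrep) : 'M[R[i]]_(irrep_dim xi) :=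
  \matrix_(i, j) u (fun x => (xi x)^t* i j).

Section Sobolev.
Variable g : riemannian_metric G.

Definition sobolev (s : R) (u : functional) : Prop :=
  is_distribution u /\
  (\esum_(xi in dual)
     ((irrep_dim xi)%:R * jbracket g xi `^ (2 * s) *
      hs_norm2 (fourier u xi))%:E < +oo)%E.

Definition sobolev_dot (s : R) (u v : functional) : R[i] :=
  csum dual (fun xi =>
    ((irrep_dim xi)%:R * jbracket g xi `^ (2 * s))%:C *
    \tr (fourier u xi *m (fourier v xi)^t*)).

(* (ker Z|_{H^1})^perp; Z v = 0 is equality of distributions. *)
Definition ker_perp (Z : (G -> R) -> (G -> R)) (u : functional) : Prop :=
  sobolev 1 u /\
  forall v, sobolev 1 v ->
    (forall phi, csmooth phi -> vf_distr Z v phi = 0) ->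
    sobolev_dot 1 u v = 0.

End Sobolev.

Definition borel := g_sigma_algebraType (@open G).

Section Haar.
Variable mu : probability borel R.

Definition is_haar : Prop :=
  forall (x : G) (A : set borel), measurable A ->
    mu ([set y | A (x * y)%g]) = mu A.

Definition cintegral (f : G -> R[i]) : R[i] :=
  Rintegral mu [set: borel] (fun x : borel => complex.Re (f x)) +i*
  Rintegral mu [set: borel] (fun x : borel => complex.Im (f x)).

Definition lnorm2 (h : G -> R[i]) : \bar R :=
  'N[mu]_2%:E[(fun x : borel => (Normc.normc (h x))%:E)]%E.

Definition square_integrable (h : G -> R[i]) : Prop :=
  [/\ measurable_fun [set: borel] (fun x : borel => complex.Re (h x)),
      measurable_fun [set: borel] (fun x : borel => complex.Im (h x)) &
      (lnorm2 h < +oo)%E].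

Definition represents (h : G -> R[i]) (u : functional) : Prop :=
  square_integrable h /\
  forall phi, csmooth phi -> u phi = cintegral (fun x => h x * phi x).

(* The L^2 norm of a distribution, +oo if it is not a square-integrable
   function. All representatives of u have the same norm. *)
Definition L2norm (u : functional) : \bar R :=
  ereal_inf [set lnorm2 h | h in [set h | represents h u]].

Definition gradient_L2norm (X : 'M[R]_n) (u : functional) : \bar R :=
  ((\sum_j L2norm (vf_distr (lvf (row j X)) u) `^ 2) `^ 2^-1)%E.

End Haar.

End LieGroupTheory.
Arguments irrep {R n} G.
Arguments dual {R n} G.
Arguments functional {R n} G.
Arguments borel {R n} G.

(* Main.v *)
(* On the Fourier side [Y] acts as left multiplication of [fourier f xi] by
   [sigma xi v], and by Plancherel all three norms are weighted sums over the
   dual of [G].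

   The spectral condition is necessary: for a singular value [s] of [sigma xi v]
   with singular vector [w], the trigonometric polynomial with the single
   Fourier coefficient [A = w^* e_0] at [xi] is orthogonal to [ker Y] and turns
   the gradient inequality into [c <= nu^((delta - 1) / 2) * s].

   It is sufficient: put [p = delta - 1], [y xi = 1 + nu xi] and
   [a xi = d_xi * ||fourier f xi||^2].  Orthogonality to [ker Y] makes
   [fourier f xi] orthogonal to the kernel of [sigma xi v], so that
   [||Y f||^2 >= C^2 * \sum y^-p a], while Jensen's inequality for the convex
   function [y^-p] gives
   [(\sum a)^(1 + p) <= (\sum y a)^p * \sum y^-p a].  It remains to bound
   [\sum y a = \sum (1 + nu) a] by a multiple of [||grad f||^2 = \sum nu a]; this
   needs a lower bound on [nu xi] when [sigma xi v <> 0], and it exists because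
   a function on a compact connected group oscillates no more than its gradient
   allows, so that for small [nu xi] the representation [xi] stays close to the
   identity, hence is trivial.

   Plancherel's formula for distributions rests on the Peter-Weyl theorem
   (proved by diagonalising compact convolution operators), and
   [nu xi] is identified with the scalar [- \sum_j sigma_(X_j)^2] through the
   invariance of the Casimir element under the adjoint representation. *)

From HB Require Import structures.
Require Import Defs.
From mathcomp Require Import all_boot all_order all_algebra.
From mathcomp Require Import complex finmap.
From mathcomp Require Import all_classical all_reals all_analysis.
From mathcomp Require Import measurable_realfun ring lra.
Set Implicit Arguments.
Unset Strict Implicit.
Unset Printing Implicit Defensive.
Import Order.TTheory GRing.Theory Num.Theory.
Import numFieldNormedType.Exports.
Local Open Scope classical_set_scope.
Local Open Scope ring_scope.

(** * Calculus of smooth functions *)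

(** The obstacle is that [f] is only a distribution and that each norm is an infimum over
    representatives in the extended reals. Every estimate is therefore made on finite subsets of the
    dual, with the constant [C * (kappa / (1 + kappa)) ^ ((delta - 1) / 2)], which does not depend
    on the subset; [kappa] is the lower bound on [nu xi]. Bessel's inequality bounds the norms on
    the larger side below by finite sums; Riesz-Fischer and the uniqueness of Fourier coefficients
    bound the norm of [f] above by their supremum.

    Uniqueness for distributions requires trigonometric polynomials to be dense together with
    derivatives: a smooth function is convolved with a polynomial close to a bump. Peter-Weyl itself
    is run on continuous functions and uniform cluster points, without the completeness of L2.

    The invariance of the Casimir element rests on [X] being orthonormal at the identity; this is
    read off the hypothesis on the Laplacian by comparing principal symbols. In the converse
    direction [c] itself serves as [C]. *)

Section IteratedDerivatives.
Context {R : realType} {V : normedModType R}.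

Definition iter_derive (W : normedModType R) (s : seq V) (f : V -> W) : V -> W :=
  foldr (fun v g => 'D_v g) f s.

Lemma iter_derive_rcons (W : normedModType R) (s : seq V) v (f : V -> W) :
  iter_derive (rcons s v) f = iter_derive s ('D_v f).
Proof. by rewrite /iter_derive foldr_rcons. Qed.

Lemma near_derive (W : normedModType R) (f g : V -> W) (v z : V) :
  (\forall x \near z, f x = g x) -> \forall x \near z, 'D_v f x = 'D_v g x.
Proof.
move=> fg.
have : \forall x \near z, \forall y \near x, f y = g y.
  exact: (near_join fg).
by apply: filterS => x; exact: near_eq_derive.
Qed.

Lemma near_iter_derive (W : normedModType R) (f g : V -> W) (s : seq V) (z : V) :
  (\forall x \near z, f x = g x) ->
  \forall x \near z, iter_derive s f x = iter_derive s g x.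
Proof. by move=> fg; elim: s => [//|v s ih] /=; apply: near_derive. Qed.

(** The differential inside [differentiable] is a chosen one: ['d f z] fits [g] up to a little-o,
    and uniqueness then identifies it with ['d g z]. *)
Lemma near_eq_differentiable (W : normedModType R) (f g : V -> W) (z : V) :
  (\forall x \near z, f x = g x) -> differentiable f z -> differentiable g z.
Proof.
move=> fg df; have fz : f z = g z := nbhs_singleton fg.
have fgl : g \o shift z = f \o shift z +o_ 0 id.
  apply/eqaddoP => e e0 /=.
  have : \forall y \near 0, f (y + z) = g (y + z).
    by have := fg; rewrite (near_shift 0 z) /= subr0.
  apply: filterS => y fgy; change (`|g (y + z) - f (y + z)| <= e * `|y|).
  by rewrite fgy subrr normr0 mulr_ge0 // ltW.
apply/diff_locallyP.
suff [c E] : continuous ('d f z) /\ g \o shift z = cst (g z) + 'd f z +o_ 0 id.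
  have -> : 'd g z = 'd f z :> (V -> W) by apply: diff_unique.
  by split.
split; first exact: diff_continuous.
rewrite fgl; have /diff_locallyP[_ ->] := df.
by rewrite -fz -addrA addo.
Qed.

(** Bounding the order makes induction possible: the rules of calculus express a first derivative
    through functions that are known to be differentiable one time less, whereas [smooth_on] does
    not decrease. *)
Definition Ck (W : normedModType R) (k : nat) (U : set V) (f : V -> W) : Prop :=
  forall s z, (size s <= k)%N -> U z -> differentiable (iter_derive s f) z.

Lemma smooth_on_Ck (W : normedModType R) (U : set V) (f : V -> W) :
  smooth_on U f <-> forall k, Ck k U f.
Proof.
split=> [h k s z _ Uz|h s z Uz]; first exact: h.
exact: (h (size s)).
Qed.

Lemma Ck0 (W : normedModType R) (U : set V) (f : V -> W) :
  Ck 0 U f <-> forall z, U z -> differentiable f z.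
Proof.
split=> [h z Uz|h [|//] z _ Uz]; last exact: h.
exact: (h [::]).
Qed.

(** The innermost direction is split off, since [rcons] turns an iterated derivative of [f] into one
    of ['D_v f]. The closure properties below all follow this recursion. *)
Lemma CkS (W : normedModType R) k (U : set V) (f : V -> W) :
  Ck k.+1 U f <-> Ck 0 U f /\ forall v, Ck k U ('D_v f).
Proof.
split=> [h|[h0 h] s z].
  split=> [s z s0|v s z sk Uz]; first by apply: h; exact: leq_trans s0 _.
  by rewrite -iter_derive_rcons; apply: h => //; rewrite size_rcons.
case/lastP: s => [|s v] sk Uz; first exact: h0.
by rewrite iter_derive_rcons; apply: h => //; rewrite size_rcons in sk.
Qed.

Lemma CkW (W : normedModType R) k (U : set V) (f : V -> W) : Ck k.+1 U f -> Ck k U f.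
Proof. by move=> h s z sk; apply: h; exact: leqW. Qed.

(** Openness makes the equality hold near each point, so that it passes to all derivatives. This
    allows ['D_v] of a sum, product or composition to be replaced by a formula valid on [U] only. *)
Lemma Ck_eq (W : normedModType R) k (U : set V) (f g : V -> W) : open U ->
  (forall x, U x -> f x = g x) -> Ck k U f -> Ck k U g.
Proof.
move=> oU fg h s z sk Uz; apply: near_eq_differentiable (h s z sk Uz).
apply: near_iter_derive; have := open_nbhs_nbhs (conj oU Uz).
by apply: filterS => x; exact: fg.
Qed.

Lemma smooth_on_eq (W : normedModType R) (U : set V) (f g : V -> W) : open U ->
  (forall x, U x -> f x = g x) -> smooth_on U f -> smooth_on U g.
Proof.
by move=> oU fg /smooth_on_Ck h; apply/smooth_on_Ck => k; apply: Ck_eq (h k).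
Qed.

Lemma smooth_on_derive (W : normedModType R) (U : set V) (f : V -> W) v :
  smooth_on U f -> smooth_on U ('D_v f).
Proof.
move=> h s z Uz; rewrite -/(iter_derive s _) -iter_derive_rcons.
exact: h.
Qed.

Lemma smooth_on_differentiable (W : normedModType R) (U : set V) (f : V -> W) z :
  smooth_on U f -> U z -> differentiable f z.
Proof. by move=> h; exact: (h [::]). Qed.

Lemma Ck_cst (W : normedModType R) k (U : set V) (a : W) : Ck k U (cst a).
Proof.
elim: k a => [a|k ih a]; first by apply/Ck0 => z _.
apply/CkS; split => [|v]; first by apply/Ck0 => z _.
rewrite (_ : 'D_v (cst a) = cst 0); first exact: ih.
by apply/funext => z; rewrite derive_cst.
Qed.

Lemma smooth_on_cst (W : normedModType R) (U : set V) (a : W) : smooth_on U (cst a).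
Proof. by apply/smooth_on_Ck => k; exact: Ck_cst. Qed.

Lemma CkD (W : normedModType R) k (U : set V) (f g : V -> W) : open U ->
  Ck k U f -> Ck k U g -> Ck k U (f + g).
Proof.
move=> oU; elim: k f g => [f g /Ck0 hf /Ck0 hg|k ih f g /CkS[/Ck0 f0 f1] /CkS[/Ck0 g0 g1]].
  by apply/Ck0 => z Uz; apply: differentiableD; [exact: hf|exact: hg].
apply/CkS; split => [|v].
  by apply/Ck0 => z Uz; apply: differentiableD; [exact: f0|exact: g0].
apply: (Ck_eq oU _ (ih _ _ (f1 v) (g1 v))) => x Ux.
by rewrite deriveD //; apply: diff_derivable; [exact: f0|exact: g0].
Qed.

Lemma smooth_onD (W : normedModType R) (U : set V) (f g : V -> W) : open U ->
  smooth_on U f -> smooth_on U g -> smooth_on U (f + g).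
Proof.
by move=> oU /smooth_on_Ck hf /smooth_on_Ck hg; apply/smooth_on_Ck => k; apply: CkD.
Qed.

Lemma CkZ (W : normedModType R) k (U : set V) (a : R) (f : V -> W) : open U ->
  Ck k U f -> Ck k U (a *: f).
Proof.
move=> oU; elim: k f => [f /Ck0 hf|k ih f /CkS[/Ck0 f0 f1]].
  by apply/Ck0 => z Uz; apply: differentiableZ; exact: hf.
apply/CkS; split => [|v].
  by apply/Ck0 => z Uz; apply: differentiableZ; exact: f0.
apply: (Ck_eq oU _ (ih _ (f1 v))) => x Ux.
by rewrite deriveZ //; apply: diff_derivable; exact: f0.
Qed.

Lemma smooth_onZ (W : normedModType R) (U : set V) a (f : V -> W) : open U ->
  smooth_on U f -> smooth_on U (a *: f).
Proof.
by move=> oU /smooth_on_Ck hf; apply/smooth_on_Ck => k; apply: CkZ.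
Qed.

Lemma CkM k (U : set V) (f g : V -> R) : open U ->
  Ck k U f -> Ck k U g -> Ck k U (f * g).
Proof.
move=> oU; elim: k f g => [f g /Ck0 hf /Ck0 hg|k ih f g hf hg].
  by apply/Ck0 => z Uz; apply: differentiableM; [exact: hf|exact: hg].
have /CkS[/Ck0 f0 f1] := hf; have /CkS[/Ck0 g0 g1] := hg.
apply/CkS; split => [|v].
  by apply/Ck0 => z Uz; apply: differentiableM; [exact: f0|exact: g0].
apply: (Ck_eq oU _ (CkD oU (ih _ _ (CkW hf) (g1 v)) (ih _ _ (CkW hg) (f1 v)))) => x Ux.
by rewrite deriveM //; apply: diff_derivable; [exact: f0|exact: g0].
Qed.

Lemma smooth_onM (U : set V) (f g : V -> R) : open U ->
  smooth_on U f -> smooth_on U g -> smooth_on U (f * g).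
Proof.
by move=> oU /smooth_on_Ck hf /smooth_on_Ck hg; apply/smooth_on_Ck => k; apply: CkM.
Qed.

Lemma Ck_sum (W : normedModType R) k (U : set V) m (f : 'I_m -> V -> W) : open U ->
  (forall i, Ck k U (f i)) -> Ck k U (\sum_i f i).
Proof.
move=> oU h; elim/big_ind : _ => //; first exact: Ck_cst.
by move=> ? ? ? ?; exact: CkD.
Qed.

End IteratedDerivatives.

(** * Chain rule and affine substitutions *)

Section Composition.
Context {R : realType} {n : nat}.

Lemma row_delta_sum (v : 'rV[R]_n) : v = \sum_i v 0 i *: delta_mx 0 i.
Proof. exact: row_sum_delta. Qed.

Lemma diff_row_sum (f : 'rV[R]_n -> R) (z v : 'rV[R]_n) : differentiable f z ->
  'D_v f z = \sum_i v 0 i * 'D_(delta_mx 0 i) f z.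
Proof.
move=> df; rewrite deriveE// {1}(row_delta_sum v) linear_sum.
by apply: eq_bigr => i _; rewrite linearZ deriveE.
Qed.

Lemma differentiable_comp_coord (V : normedModType R) (f : V -> 'rV[R]_n) (z : V) i :
  differentiable f z -> differentiable (fun x => f x 0 i) z.
Proof.
move=> df; apply: (@differentiable_comp _ _ _ _ f (fun N : 'rV[R]_n => N 0 i : R)) => //.
exact: differentiable_coord.
Qed.

Lemma derive_coord (V : normedModType R) (f : V -> 'rV[R]_n) (z v : V) i :
  differentiable f z -> 'D_v (fun x => f x 0 i) z = ('D_v f z) 0 i.
Proof. by move=> df; rewrite derive_mx ?mxE//; exact: diff_derivable. Qed.

Lemma Ck_coord (V : normedModType R) k (U : set V) (f : V -> 'rV[R]_n) i : open U ->
  Ck k U f -> Ck k U (fun x => f x 0 i).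
Proof.
move=> oU; elim: k f => [f /Ck0 hf|k ih f /CkS[/Ck0 f0 f1]].
  by apply/Ck0 => z Uz; apply: differentiable_comp_coord; exact: hf.
apply/CkS; split => [|v].
  by apply/Ck0 => z Uz; apply: differentiable_comp_coord; exact: f0.
apply: (Ck_eq oU _ (ih _ (f1 v))) => x Ux.
by rewrite derive_coord//; exact: f0.
Qed.

Lemma derive_comp_row (V : normedModType R) (f : V -> 'rV[R]_n) (g : 'rV[R]_n -> R)
    (z v : V) : differentiable f z -> differentiable g (f z) ->
  'D_v (g \o f) z = \sum_i 'D_v (fun x => f x 0 i) z * 'D_(delta_mx 0 i) g (f z).
Proof.
move=> df dg; rewrite deriveE; last exact: differentiable_comp.
rewrite diff_comp//= -(deriveE ('d f z v) dg) diff_row_sum//; apply: eq_bigr => i _.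
by rewrite derive_coord// (deriveE v df).
Qed.

(** By the chain rule a derivative of [g \o f] is a sum of products of a derivative of a coordinate
    of [f] with a partial derivative of [g] composed with [f], to which the induction hypothesis
    applies. *)
Lemma Ck_comp (V : normedModType R) k (U : set V) (U' : set 'rV[R]_n)
    (f : V -> 'rV[R]_n) (g : 'rV[R]_n -> R) : open U ->
  (forall x, U x -> U' (f x)) -> Ck k U f -> Ck k U' g -> Ck k U (g \o f).
Proof.
move=> oU fU; elim: k g => [g /Ck0 hf /Ck0 hg|k ih g hf hg].
  by apply/Ck0 => z Uz; apply: differentiable_comp; [exact: hf|apply/hg/fU].
have /CkS[/Ck0 f0 f1] := hf; have /CkS[/Ck0 g0 g1] := hg.
apply/CkS; split => [|v].
  by apply/Ck0 => z Uz; apply: differentiable_comp; [exact: f0|apply/g0/fU].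
apply: (@Ck_eq _ _ _ _ U (\sum_i ('D_v (fun x => f x 0 i)) * ('D_(delta_mx 0 i) g \o f))) => //.
  move=> x Ux; rewrite derive_comp_row; [|exact: f0|exact/g0/fU].
  by rewrite fct_sumE.
apply: Ck_sum => // i; apply: CkM => //; last first.
  by apply: ih (g1 _); exact: CkW.
by have /CkS[_] := Ck_coord i oU hf; exact.
Qed.

Lemma smooth_on_coord (V : normedModType R) (U : set V) (f : V -> 'rV[R]_n) i : open U ->
  smooth_on U f -> smooth_on U (fun x => f x 0 i).
Proof.
by move=> oU /smooth_on_Ck hf; apply/smooth_on_Ck => k; apply: Ck_coord.
Qed.

Lemma smooth_on_comp (V : normedModType R) (U : set V) (U' : set 'rV[R]_n)
    (f : V -> 'rV[R]_n) (g : 'rV[R]_n -> R) : open U ->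
  (forall x, U x -> U' (f x)) -> smooth_on U f -> smooth_on U' g -> smooth_on U (g \o f).
Proof.
move=> oU fU /smooth_on_Ck hf /smooth_on_Ck hg; apply/smooth_on_Ck => k.
exact: Ck_comp (hf k) (hg k).
Qed.

Lemma smooth_on_coord_fun (U : set 'rV[R]_n) i : smooth_on U (fun z => z 0 i).
Proof.
move=> s z _; rewrite -/(iter_derive s _).
case/lastP: s => [|s v]; first exact: differentiable_coord.
rewrite iter_derive_rcons.
have -> : 'D_v (fun z : 'rV[R]_n => z 0 i) = cst (v 0 i).
  apply/funext => x; rewrite deriveE; last exact: differentiable_coord.
  have @f : {linear 'rV[R]_n -> R}.
    by exists (fun N : 'rV[R]_n => N 0 i); do 2![eexists]; do ?[constructor];
     rewrite ?mxE// => ? *; rewrite ?mxE//; move=> ?; rewrite !mxE.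
  rewrite (_ : (fun z : 'rV[R]_n => z 0 i) = f) // diff_lin //.
  exact: coord_continuous.
exact: (@Ck_cst _ _ _ (size s) setT).
Qed.

End Composition.

Section AffineSubstitution.
Context {R : realType}.

Lemma iter_derive_affine (V V' W : normedModType R) (f : V -> W) (A : V' -> V)
    (L : V' -> V) (s : seq V') :
  (forall z v (h : R), A (h *: v + z) = h *: L v + A z) ->
  iter_derive s (f \o A) = iter_derive (map L s) f \o A.
Proof.
move=> AL; elim: s => [//|v s ih] /=.
rewrite -/(iter_derive s _) ih; apply/funext => z /=.
rewrite /derive; set F := iter_derive _ f.
suff -> : (fun h => h^-1 *: ((F \o A \o shift z) (h *: v) - F (A z))) =
  (fun h : R => h^-1 *: ((F \o shift (A z)) (h *: L v) - F (A z))) by [].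
by apply/funext => h /=; rewrite AL.
Qed.

(** An affine substitution turns derivatives along [v] into derivatives along [L v], difference
    quotient by difference quotient. It serves to freeze one variable of a smooth function of two
    variables. *)
Lemma smooth_on_affine (V V' W : normedModType R) (U : set V) (U' : set V')
    (f : V -> W) (A : V' -> V) (L : V' -> V) :
  (forall z v (h : R), A (h *: v + z) = h *: L v + A z) ->
  (forall z, differentiable A z) ->
  (forall z, U' z -> U (A z)) -> smooth_on U f -> smooth_on U' (f \o A).
Proof.
move=> AL dA UU h s z Uz; rewrite -/(iter_derive s _) (iter_derive_affine _ _ AL).
by apply: differentiable_comp => //; apply/h/UU.
Qed.

End AffineSubstitution.

(** * The Haar integral of continuous functions *)

Lemma continuous_fct_comp (T U W : topologicalType) (u : T -> U) (f : U -> W) :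
  continuous u -> continuous f -> continuous (fun t => f (u t)).
Proof. by move=> cu cf t; apply: continuous_comp; [exact: cu|exact: cf]. Qed.

Lemma continuous_pair (T U W : topologicalType) (u : T -> U) (v : T -> W) :
  continuous u -> continuous v -> continuous (fun t => (u t, v t)).
Proof. by move=> cu cv t; apply: cvg_pair; [exact: cu|exact: cv]. Qed.

Lemma continuous_pair_for (T U W : topologicalType) (u : T -> U) (v : T -> W) t :
  {for t, continuous u} -> {for t, continuous v} ->
  {for t, continuous (fun t => (u t, v t))}.
Proof. by move=> cu cv; exact: (cvg_pair cu cv). Qed.

Lemma continuous_fst (T U : topologicalType) : continuous (@fst T U).
Proof. by move=> p; exact: cvg_fst. Qed.

Lemma continuous_snd (T U : topologicalType) : continuous (@snd T U).
Proof. by move=> p; exact: cvg_snd. Qed.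

Lemma continuous_cst (T U : topologicalType) (a : U) : continuous (fun _ : T => a).
Proof. by move=> t; exact: cvg_cst. Qed.

Lemma continuous_idfun (T : topologicalType) : continuous (fun x : T => x).
Proof. by move=> t; exact: cvg_id. Qed.

Lemma continuous_section1 (T U W : topologicalType) (F : T -> U -> W) y :
  continuous (fun p : T * U => F p.1 p.2) -> continuous (fun x => F x y).
Proof.
apply: (@continuous_fct_comp _ _ _ (fun x => (x, y)) (fun p => F p.1 p.2)).
by apply: continuous_pair; [exact: continuous_idfun|exact: continuous_cst].
Qed.

Lemma continuous_section2 (T U W : topologicalType) (F : T -> U -> W) x :
  continuous (fun p : T * U => F p.1 p.2) -> continuous (fun y => F x y).
Proof.
apply: (@continuous_fct_comp _ _ _ (fun y => (x, y)) (fun p => F p.1 p.2)).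
by apply: continuous_pair; [exact: continuous_cst|exact: continuous_idfun].
Qed.

Section HaarIntegral.
Context {R : realType} {n : nat} {G : lieGroupType R n}.
Hypothesis compactG : compact [set: G].
Variable mu : probability (borel G) R.

Definition haar_integrable (f : G -> R) : Prop :=
  mu.-integrable [set: borel G] (fun x : borel G => (f x)%:E).

Definition haar_int (f : G -> R) : R :=
  Rintegral mu [set: borel G] (fun x : borel G => f x).

Lemma continuous_measurable (f : G -> R) : continuous f ->
  measurable_fun [set: borel G] (fun x : borel G => f x).
Proof.
move=> /continuousP cf; apply: (measurability _ (RGenOpens.measurableE R)).
move=> _ [_ [a [b ->]] <-]; rewrite setTI.
apply: sub_sigma_algebra; apply: cf; exact: interval_open.
Qed.

Lemma continuous_bounded (f : G -> R) : continuous f ->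
  exists2 M : R, 0 < M & forall x, `|f x| <= M.
Proof.
move=> cf; have cnf : {within [set: G], continuous (fun x => `|f x|)}.
  apply: continuous_subspaceT => x; apply: cvg_norm; exact: cf.
have [|c _ hc] := @compact_EVT_max G R (fun x => `|f x|) setT _ compactG cnf.
  by exists 1%g.
exists (`|f c| + 1) => [|x]; first by rewrite ltr_wpDl.
by rewrite (le_trans (hc x _)) ?inE// lerDl.
Qed.

Lemma bounded_integrable (f : G -> R) (M : R) :
  measurable_fun [set: borel G] (fun x : borel G => f x) ->
  (forall x, `|f x| <= M) -> haar_integrable f.
Proof.
move=> mf fM; apply: measurable_bounded_integrable => //.
  by rewrite -ge0_fin_numE// fin_num_measure.
exists M; split; first exact: num_real.
by move=> N MN x _; exact: le_trans (fM x) (ltW MN).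
Qed.

Lemma continuous_integrable (f : G -> R) : continuous f -> haar_integrable f.
Proof.
move=> cf; have [M _ fM] := continuous_bounded cf.
apply: bounded_integrable fM; exact: continuous_measurable.
Qed.

Lemma haar_int_ext (f g : G -> R) : f =1 g -> haar_int f = haar_int g.
Proof. by move=> /funext ->. Qed.

Lemma haar_integrableD (f g : G -> R) : haar_integrable f -> haar_integrable g ->
  haar_integrable (fun x => f x + g x).
Proof. by move=> hf hg; apply: (integrableD _ hf hg). Qed.

Lemma haar_integrableZ c (f : G -> R) : haar_integrable f ->
  haar_integrable (fun x => c * f x).
Proof. by move=> hf; apply: (integrableZl _ _ hf). Qed.

Lemma haar_intD (f g : G -> R) : haar_integrable f -> haar_integrable g ->
  haar_int (fun x => f x + g x) = haar_int f + haar_int g.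
Proof. by move=> hf hg; rewrite /haar_int RintegralD. Qed.

Lemma haar_intZ c (f : G -> R) : haar_integrable f ->
  haar_int (fun x => c * f x) = c * haar_int f.
Proof. by move=> hf; rewrite /haar_int RintegralZl. Qed.

Lemma haar_intN (f : G -> R) : haar_integrable f ->
  haar_int (fun x => - f x) = - haar_int f.
Proof.
move=> hf; rewrite -mulN1r -haar_intZ//; apply: haar_int_ext => x.
by rewrite mulN1r.
Qed.

Lemma haar_integrableN (f : G -> R) : haar_integrable f ->
  haar_integrable (fun x => - f x).
Proof.
move=> /(haar_integrableZ (-1)); congr haar_integrable.
by apply/funext => x; rewrite mulN1r.
Qed.

Lemma haar_integrableB (f g : G -> R) : haar_integrable f -> haar_integrable g ->
  haar_integrable (fun x => f x - g x).
Proof. by move=> hf hg; apply: haar_integrableD => //; exact: haar_integrableN. Qed.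

Lemma haar_intB (f g : G -> R) : haar_integrable f -> haar_integrable g ->
  haar_int (fun x => f x - g x) = haar_int f - haar_int g.
Proof. by move=> hf hg; rewrite /haar_int RintegralB. Qed.

Lemma haar_int_cst c : haar_int (fun=> c) = c.
Proof. by rewrite /haar_int Rintegral_cst//= probability_setT mulr1. Qed.

Lemma haar_integrable_cst c : haar_integrable (fun=> c).
Proof. by apply: continuous_integrable => x; exact: cvg_cst. Qed.

Lemma le_haar_int (f g : G -> R) : haar_integrable f -> haar_integrable g ->
  (forall x, f x <= g x) -> haar_int f <= haar_int g.
Proof. by move=> hf hg fg; apply: le_Rintegral => // x _; exact: fg. Qed.

Lemma haar_int_ge0 (f : G -> R) : (forall x, 0 <= f x) -> 0 <= haar_int f.
Proof. by move=> f0; apply: Rintegral_ge0 => x _; exact: f0. Qed.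

Lemma haar_int_le (f : G -> R) M : haar_integrable f ->
  (forall x, f x <= M) -> haar_int f <= M.
Proof.
move=> hf fM; rewrite -(haar_int_cst M); apply: le_haar_int => //.
exact: haar_integrable_cst.
Qed.

Lemma norm_haar_int_le (f : G -> R) M : haar_integrable f ->
  (forall x, `|f x| <= M) -> `|haar_int f| <= M.
Proof.
move=> hf fM; rewrite ler_norml; apply/andP; split.
  rewrite -(haar_int_cst (- M)); apply: le_haar_int => //.
    exact: haar_integrable_cst.
  by move=> x; have := fM x; rewrite ler_norml => /andP[].
by apply: haar_int_le => // x; rewrite (le_trans (ler_norm _)).
Qed.

Lemma haar_int_sum (I : Type) (s : seq I) (F : I -> G -> R) :
  (forall i, haar_integrable (F i)) ->
  haar_integrable (fun x => \sum_(i <- s) F i x) /\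
  haar_int (fun x => \sum_(i <- s) F i x) = \sum_(i <- s) haar_int (F i).
Proof.
move=> hF; elim: s => [|i s [ih1 ih2]].
  under eq_fun do rewrite big_nil.
  by rewrite big_nil haar_int_cst; split => //; exact: haar_integrable_cst.
under eq_fun do rewrite big_cons.
by rewrite big_cons haar_intD// ih2; split => //; exact: haar_integrableD.
Qed.

(** Joint continuity gives a neighbourhood of [x0] for each [y]; compactness of the group, as a
    near-covering property, makes one neighbourhood serve all [y]. *)
Lemma near_uniform (T : topologicalType) (F : T -> G -> R) (x0 : T) (e : R) :
  (forall y, {for (x0, y), continuous (fun p : T * G => F p.1 p.2)}) -> 0 < e ->
  \forall x \near x0, forall y, `|F x y - F x0 y| < e.
Proof.
move=> cF e0; have /compact_near_coveringP nc := compactG.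
have : \forall x \near x0, [set: G] `<=` (fun y => `|F x y - F x0 y| < e).
  apply: nc => y _.
  have h1 : \forall p \near (x0, y), `|F x0 y - F p.1 p.2| < e / 2.
    by have /cvgr_dist_lt := cF y; apply; rewrite divr_gt0.
  have [[A B] [/= hA hB] AB] := h1.
  near=> y' x => /=.
  have p1 : `|F x0 y - F x y'| < e / 2.
    by apply: (AB (x, y')); split => /=; [near: x|near: y'].
  have p2 : `|F x0 y - F x0 y'| < e / 2.
    by apply: (AB (x0, y')); split => /=; [exact: nbhs_singleton hA|near: y'].
  rewrite -(subrKA (F x0 y)) (le_lt_trans (ler_normD _ _))// [ltRHS]splitr ltrD//.
  by rewrite distrC.
by apply: filterS => x h y; exact: h.
Unshelve. all: by end_near. Qed.

Lemma continuous_haar_int_param (T : topologicalType) (F : T -> G -> R) :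
  continuous (fun p : T * G => F p.1 p.2) ->
  continuous (fun x => haar_int (F x)).
Proof.
move=> cF x0; have iF x : haar_integrable (F x).
  by apply: continuous_integrable; exact: continuous_section2.
apply/cvgrPdist_le => e e0; have := near_uniform (fun y => cF (x0, y)) e0.
apply: filterS => x h; rewrite -haar_intB//.
apply: norm_haar_int_le; first exact: haar_integrableB.
by move=> y; rewrite distrC ltW.
Qed.

Section Fubini.
Variable F : G -> G -> R.
Hypothesis cF : continuous (fun p : G * G => F p.1 p.2).

(** The product sigma-algebra is generated by measurable rectangles, not by open sets of the
    product: second countability is what writes an open set as a countable union of open
    rectangles. *)
Lemma continuous_measurable2 :
  measurable_fun [set: borel G * borel G] (fun p : borel G * borel G => F p.1 p.2).
Proof.
have [B cB [Bo Bb]] := @manifold_countable R n G.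
apply: (measurability _ (RGenOpens.measurableE R)).
move=> _ [_ [a [b ->]] <-]; rewrite setTI.
set O := _ @^-1` _.
have oO : open (O : set (G * G)).
  by move/continuousP : cF; apply; exact: interval_open.
have -> : O = \bigcup_(P in [set P : set G * set G | [/\ B P.1, B P.2 & P.1 `*` P.2 `<=` O]])
    (P.1 `*` P.2).
  apply/seteqP; split=> [[x y] Oxy|[x y] [P [_ _ sO] Pxy]]; last exact: sO.
  have : nbhs ((x, y) : G * G) O by apply: open_nbhs_nbhs.
  move=> [[V W] [/= /Bb[V' [BV' xV'] sV] /Bb[W' [BW' xW'] sW]] sO].
  exists (V', W') => //; split => // -[p q] [/= /sV Vp /sW Wq].
  exact: (sO (p, q)).
rewrite bigcup_set_type; apply: countable_bigcupT_measurable => [|P]; last first.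
  have [BP1 BP2 _] := set_mem (valP P).
  by apply: measurableX; apply: sub_sigma_algebra; exact: Bo.
have -> : forall (T : Type) (D : set T), countable [set: D] = countable D.
  by move=> T D; apply: eq_countable; exact: card_setT.
apply: sub_countable (countableX cB cB).
by apply: subset_card_le => P [].
Qed.

Lemma haar_fubini :
  haar_int (fun x => haar_int (fun y => F x y)) =
  haar_int (fun y => haar_int (fun x => F x y)).
Proof.
have cx x : continuous (fun y => F x y) by exact: continuous_section2.
have cy y : continuous (fun x => F x y) by exact: continuous_section1.
have [M FM] : exists M : R, forall x y, `|F x y| <= M.
  have cG := continuous_haar_int_param cF.
  have cP : compact [set: G * G] by rewrite -setXTT; exact: compact_setX.
  have cnF : {within [set: G * G], continuous (fun p => `|F p.1 p.2|)}.
    by apply: continuous_subspaceT => p; apply: cvg_norm; exact: cF.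
  have [|c _ hc] := @compact_EVT_max (G * G)%type R (fun p => `|F p.1 p.2|) setT _ cP cnF.
    by exists (1%g, 1%g).
  by exists `|F c.1 c.2| => x y; apply: (hc (x, y)); rewrite inE.
have iF : (mu \x mu)%E.-integrable [set: borel G * borel G]
    (fun p => (F p.1 p.2)%:E).
  apply: measurable_bounded_integrable => //.
  - have := product_measure1E mu mu (@measurableT _ (borel G)) (@measurableT _ (borel G)).
    rewrite setXTT => E; rewrite [ltLHS]E.
    have fm := fin_num_measure mu [set: borel G] measurableT.
    by apply: lte_mul_pinfty; [exact: measure_ge0|exact: fm|rewrite -ge0_fin_numE].
  - exact: continuous_measurable2.
  exists M; split; first exact: num_real.
  by move=> N MN x _; exact: le_trans (FM _ _) (ltW MN).
rewrite /haar_int /Rintegral; congr fine.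
have e1 x : (fine (\int[mu]_(y in [set: borel G]) (F x y)%:E)%E)%:E =
    (\int[mu]_(y in [set: borel G]) (F x y)%:E)%E.
  by rewrite fineK//; apply: integrable_fin_num => //; exact: continuous_integrable (cx x).
have e2 y : (fine (\int[mu]_(x in [set: borel G]) (F x y)%:E)%E)%:E =
    (\int[mu]_(x in [set: borel G]) (F x y)%:E)%E.
  by rewrite fineK//; apply: integrable_fin_num => //; exact: continuous_integrable (cy y).
under eq_integral do rewrite e1.
under [RHS]eq_integral do rewrite e2.
exact: (Fubini iF).
Qed.
End Fubini.

Lemma continuous_mulg_comp (T : topologicalType) (u v : T -> G) :
  continuous u -> continuous v -> continuous (fun t => (u t * v t)%g).
Proof.
move=> cu cv; have := @lie_mul_continuous R n G.
by apply: (@continuous_fct_comp _ _ _ (fun t => (u t, v t))); exact: continuous_pair.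
Qed.

Lemma continuous_invg_comp (T : topologicalType) (u : T -> G) :
  continuous u -> continuous (fun t => (u t)^-1%g).
Proof. by move=> cu; apply: continuous_fct_comp cu _; exact: lie_inv_continuous. Qed.

Lemma continuous_mulgl (a : G) : continuous (fun x : G => (a * x)%g).
Proof.
by apply: continuous_mulg_comp; [exact: continuous_cst|exact: continuous_idfun].
Qed.

Lemma continuous_mulgr (a : G) : continuous (fun x : G => (x * a)%g).
Proof.
by apply: continuous_mulg_comp; [exact: continuous_idfun|exact: continuous_cst].
Qed.

Section Invariance.
Hypothesis haar_mu : is_haar mu.

Lemma haar_int_left (f : G -> R) (a : G) : continuous f ->
  haar_int (fun x => f (a * x)%g) = haar_int f.
Proof.
move=> cf; rewrite /haar_int /Rintegral; congr fine.
have mphi : measurable_fun [set: borel G] (fun x : borel G => (a * x)%g : borel G).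
  apply: (@measurability _ _ (borel G) (borel G) setT _ (@open G)) => [//|_ [A oA <-]].
  rewrite setTI; apply: sub_sigma_algebra.
  by move: A oA; apply/continuousP; exact: continuous_mulgl.
transitivity (\int[pushforward mu (fun x : borel G => (a * x)%g : borel G)]_(y in [set: borel G]) (f y)%:E)%E.
  rewrite (@integral_pushforward _ _ _ _ _ _ mphi mu setT (fun y => (f y)%:E))//.
  - by apply/measurable_EFinP; exact: continuous_measurable.
  - rewrite preimage_setT; apply: (@continuous_integrable (fun x => f (a * x)%g)).
    by apply: continuous_fct_comp cf; exact: continuous_mulgl.
apply: eq_measure_integral => A mA _ /=.
by rewrite /pushforward; exact: haar_mu.
Qed.

(** Integrate [f (x^-1 * y)] over both variables: by left invariance the inner integral is the
    constant [haar_int f] in one order and the constant integral of [f x^-1] in the other. Right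
    invariance follows. *)
Lemma haar_int_inv (f : G -> R) : continuous f ->
  haar_int (fun x => f x^-1%g) = haar_int f.
Proof.
move=> cf; have cF : continuous (fun p : G * G => f (p.1^-1 * p.2)%g).
  apply: continuous_fct_comp cf; apply: continuous_mulg_comp.
    by apply: continuous_invg_comp; exact: continuous_fst.
  exact: continuous_snd.
have := @haar_fubini (fun x y => f (x^-1 * y)%g) cF.
rewrite (@haar_int_ext _ (fun=> haar_int f)); last by move=> x; rewrite haar_int_left.
rewrite haar_int_cst => ->.
rewrite [RHS](@haar_int_ext _ (fun=> haar_int (fun x => f x^-1%g))) ?haar_int_cst// => y.
rewrite -(@haar_int_left (fun x => f (x^-1 * y)%g) y).
  by apply: haar_int_ext => x; rewrite invgM mulgVK.
apply: continuous_fct_comp cf; apply: continuous_mulg_comp.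
  by apply: continuous_invg_comp => ?; exact: cvg_id.
by move=> ?; exact: cvg_cst.
Qed.

Lemma haar_int_right (f : G -> R) (a : G) : continuous f ->
  haar_int (fun x => f (x * a)%g) = haar_int f.
Proof.
move=> cf; have ci : continuous (fun x => f x^-1%g).
  by apply: continuous_fct_comp cf; apply: continuous_invg_comp => ?; exact: cvg_id.
rewrite -(@haar_int_inv (fun x => f (x * a)%g)); last first.
  by apply: continuous_fct_comp cf; exact: continuous_mulgr.
rewrite -(haar_int_inv cf) -(haar_int_left a^-1%g ci).
by apply: haar_int_ext => x; rewrite invgM invgK.
Qed.

(** Finitely many translates of the open set where [f] exceeds [f x0 / 2] cover the group, so a
    finite sum of translates of [f], each with the integral of [f], is at least [f x0 / 2]. *)
Lemma haar_int_gt0 (f : G -> R) (x0 : G) : continuous f -> (forall x, 0 <= f x) ->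
  0 < f x0 -> 0 < haar_int f.
Proof.
move=> cf f0 fx0; pose U (y : G) := [set x : G | f x0 / 2 < f (x0 * y^-1 * x)%g].
have ct y : continuous (fun x => f (x0 * y^-1 * x)%g).
  by apply: continuous_fct_comp cf; exact: continuous_mulgl.
have := compactG; rewrite compact_cover => /(_ G setT U) [].
- move=> y _; have -> : U y = (fun x => f (x0 * y^-1 * x)%g) @^-1` [set z | f x0 / 2 < z] by [].
  by have /continuousP := ct y; apply; exact: open_gt.
- by move=> y _; exists y => //; rewrite /U /= mulgVK ltr_pdivrMr// ltr_pMr// ltr1n.
move=> D _ cov.
have [iS eS] := @haar_int_sum G D (fun y x => f (x0 * y^-1 * x)%g)
  (fun y => continuous_integrable (ct y)).
have : f x0 / 2 <= haar_int (fun x => \sum_(y <- D) f (x0 * y^-1 * x)%g).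
  rewrite -[leLHS]haar_int_cst; apply: le_haar_int => //; first exact: haar_integrable_cst.
  move=> x; have [y /= yD] := cov x I.
  rewrite /U /= => /ltW /le_trans; apply; rewrite (big_rem y)//= lerDl.
  by apply: sumr_ge0.
rewrite eS (eq_bigr (fun=> haar_int f)); last by move=> y _; rewrite haar_int_left.
rewrite big_const_seq count_predT iter_addr addr0 => h.
rewrite ltNge; apply/negP => le0; move: h; apply/negP; rewrite -ltNge.
by rewrite (@le_lt_trans _ _ 0) ?divr_gt0//; exact: mulrn_wle0.
Qed.

End Invariance.
End HaarIntegral.

(** * Smooth bump functions *)

Section FlatFunction.
Context {R : realType}.
Implicit Types (p : {poly R}) (t u : R).

(* This family contains [exp (- 1 / t)] and is closed under differentiation. *)
Definition flat p t : R := if 0 < t then p.[t^-1] * expR (- t^-1) else 0.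

Definition flat_deriv p : {poly R} := 'X^2 * (p - p^`()).

Lemma exprn_le_expR i u : 0 <= u -> u ^+ i <= i%:R ^+ i * expR u.
Proof.
case: i => [|i] u0; first by rewrite !expr0 mul1r -expR0 ler_expR.
rewrite -ler_pdivrMl ?exprn_gt0// mulrC -expr_div_n.
have -> : expR u = expR (u / i.+1%:R) ^+ i.+1.
  by rewrite -expRM_natl mulrC divfK.
apply: lerXn2r; rewrite ?nnegrE ?divr_ge0 ?expR_ge0//.
by rewrite (le_trans _ (expR_ge1Dx _))// lerDr.
Qed.

Lemma poly_le_expR p : exists2 C, 0 <= C & forall u, 0 <= u -> `|p.[u]| <= C * expR u.
Proof.
exists (\sum_(i < size p) `|p`_i| * i%:R ^+ i).
  by apply: sumr_ge0 => i _; rewrite mulr_ge0// exprn_ge0.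
move=> u u0; rewrite horner_coef (le_trans (ler_norm_sum _ _ _))// mulr_suml.
apply: ler_sum => i _; rewrite normrM -mulrA ler_wpM2l//.
by rewrite normrX (ger0_norm u0) exprn_le_expR.
Qed.

(** A bound in [t^2] makes the difference quotient at 0 tend to 0, which gives the derivative at the
    only delicate point. *)
Lemma flat_quadratic p : exists2 C, 0 <= C & forall t, `|flat p t| <= C * t ^+ 2.
Proof.
have [C C0 hC] := poly_le_expR ('X^2 * p); exists C => // t; rewrite /flat.
case: ifPn => [t0|_]; last by rewrite normr0 mulr_ge0// sqr_ge0.
have := hC t^-1 (ltW _); rewrite invr_gt0 => /(_ t0).
rewrite hornerM hornerXn normrM (ger0_norm (sqr_ge0 t^-1)) => h.
rewrite normrM (ger0_norm (expR_ge0 _)) expRN ler_pdivrMr ?expR_gt0//.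
have -> : `|p.[t^-1]| = (t^-1 ^+ 2 * `|p.[t^-1]|) * t ^+ 2.
  by rewrite mulrAC -exprMn mulVf ?gt_eqF// expr1n mul1r.
by rewrite [leRHS]mulrAC ler_wpM2r// sqr_ge0.
Qed.

Lemma is_derive_flat p t : is_derive t 1 (flat p) (flat (flat_deriv p) t).
Proof.
have [t0|t0|<-] := ltgtP 0 t.
- apply: (@near_eq_is_derive R R R (fun s => p.[s^-1] * expR (- s^-1))).
    near=> s; rewrite /flat ifT//; near: s; exact: lt_nbhsr.
  have tn : t != 0 by rewrite gt_eqF.
  have dV : is_derive t 1 (fun s : R => s^-1) (- t ^- 2).
    by have := @is_deriveV R id t 1 1 tn (is_derive_id _ _); rewrite /GRing.scale /= mulr1.
  have dN : is_derive t 1 (fun s : R => - s^-1) (t ^- 2).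
    by have := is_deriveN dV; rewrite opprK.
  have dE : is_derive t 1 (fun s : R => expR (- s^-1)) (t ^- 2 * expR (- t^-1)).
    have := @is_derive1_comp _ expR (fun s : R => - s^-1) t _ _ (is_derive_expR _) dN.
    by rewrite mulrC.
  have dP : is_derive t 1 (fun s : R => p.[s^-1]) (- t ^- 2 * p^`().[t^-1]).
    by have := @is_derive1_comp _ (horner p) (fun s : R => s^-1) t _ _ (is_derive_poly _ _) dV; rewrite mulrC.
  apply: (is_derive_eq (is_deriveM dP dE)).
  rewrite /flat ifT// /flat_deriv hornerM hornerXn hornerD hornerN /GRing.scale /= exprVn.
  by ring.
- apply: (@near_eq_is_derive R R R (cst 0)).
    near=> s; rewrite /flat ifF//; apply/negbTE; rewrite -leNgt ltW//.
    near: s; exact: lt_nbhsl.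
  apply: (is_derive_eq (is_derive_cst _ _ _)).
  by rewrite /flat ifF//; apply/negbTE; rewrite -leNgt ltW.
have [C C0 hC] := flat_quadratic p.
have -> : flat (flat_deriv p) 0 = 0 by rewrite /flat ltxx.
have cv : (fun h => h^-1 *: ((flat p \o shift 0) (h *: 1) - flat p 0)) @ 0^' --> 0.
  have f0 : flat p 0 = 0 by rewrite /flat ltxx.
  apply/cvgrPdist_le => e e0; near=> h.
  rewrite sub0r normrN f0 subr0 /= addr0 /GRing.scale /= mulr1 normrM.
  have h0 : h != 0 by near: h; exact: nbhs_dnbhs_neq.
  rewrite normfV ler_pdivrMl ?normr_gt0// (le_trans (hC _))//.
  rewrite -[h ^+ 2]real_normK ?num_real// expr2 mulrA mulrC ler_wpM2l//.
  have : `|h| <= e / (C + 1).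
    near: h; apply: dnbhs0_le; rewrite divr_gt0// ltr_wpDl//.
  rewrite ler_pdivlMr ?ltr_wpDl// => /(le_trans _); apply.
  by rewrite mulrC ler_wpM2l// lerDl.
apply: DeriveDef; first by apply/cvg_ex; exists 0.
exact/cvg_lim.
Unshelve. all: by end_near. Qed.

Lemma Ck_flat (V : normedModType R) k (U : set V) (q : V -> R) p : open U ->
  Ck k U q -> Ck k U (flat p \o q).
Proof.
move=> oU; have df p' t : differentiable (flat p') t.
  by apply/derivable1_diffP; have [] := is_derive_flat p' t.
elim: k p => [p /Ck0 hq|k ih p hq].
  by apply/Ck0 => z Uz; apply: differentiable_comp => //; exact: hq.
have /CkS[/Ck0 q0 q1] := hq; apply/CkS; split => [|v].
  by apply/Ck0 => z Uz; apply: differentiable_comp => //; exact: q0.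
apply: (Ck_eq oU _ (CkM oU (q1 v) (ih (flat_deriv p) (CkW hq)))) => x Ux.
have dq := q0 _ Ux; rewrite deriveE; last exact: differentiable_comp.
rewrite diff_comp//= deriv1E; last by have [] := is_derive_flat p (q x).
by rewrite derive1E; have [_ ->] := is_derive_flat p (q x); rewrite -deriveE.
Qed.

Lemma smooth_on_flat (V : normedModType R) (U : set V) (q : V -> R) p : open U ->
  smooth_on U q -> smooth_on U (flat p \o q).
Proof.
by move=> oU /smooth_on_Ck hq; apply/smooth_on_Ck => k; exact: Ck_flat.
Qed.

End FlatFunction.

Section BoxBump.
Context {R : realType} {n : nat}.

(** A product over the coordinates, because the norm of ['rV[R]_n] is the maximum norm and is not
    smooth; the denominators normalise the value at [z0] to 1. *)
Definition box_bump (z0 : 'rV[R]_n) (r : R) (z : 'rV[R]_n) : R :=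
  \prod_(i < n) (flat 1 (r ^+ 2 - (z 0 i - z0 0 i) ^+ 2) / flat 1 (r ^+ 2)).

Lemma flat1_gt0 (t : R) : 0 < t -> 0 < flat 1 t.
Proof. by move=> t0; rewrite /flat t0 hornerC mul1r expR_gt0. Qed.

Lemma flat1_ge0 (t : R) : 0 <= flat 1 t.
Proof. by rewrite /flat; case: ifP => // _; rewrite hornerC mul1r expR_ge0. Qed.

Lemma box_bump_ge0 z0 r z : 0 <= box_bump z0 r z.
Proof. by apply: prodr_ge0 => i _; rewrite divr_ge0// flat1_ge0. Qed.

Lemma box_bump_center z0 r : 0 < r -> box_bump z0 r z0 = 1.
Proof.
move=> r0; rewrite /box_bump big1// => i _; rewrite subrr expr0n subr0 divff//.
by rewrite gt_eqF// flat1_gt0// exprn_gt0.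
Qed.

Lemma box_bump_support z0 r z : 0 < r -> box_bump z0 r z != 0 -> `|z - z0| < r.
Proof.
move=> r0 h; rewrite [ltLHS]mx_normrE bigmax_lt//= => -[i j] _ /=.
rewrite !mxE (ord1 i); move: h; rewrite /box_bump (bigD1 j)//= mulf_eq0 negb_or => /andP[+ _].
rewrite mulf_eq0 negb_or => /andP[+ _]; rewrite /flat; case: ifP => [|_]; last by rewrite eqxx.
rewrite subr_gt0 => h _; rewrite -(@ltr_pXn2r _ 2)// ?nnegrE ?(ltW r0)//.
by rewrite real_normK ?num_real.
Qed.

Lemma smooth_on_prod (V : normedModType R) (U : set V) m (f : 'I_m -> V -> R) : open U ->
  (forall i, smooth_on U (f i)) -> smooth_on U (fun z => \prod_i f i z).
Proof.
move=> oU; elim: m f => [f _|m ih f hf].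
  by under eq_fun do rewrite big_ord0; exact: smooth_on_cst.
under eq_fun do rewrite big_ord_recl.
exact: (smooth_onM oU (hf _) (ih _ (fun i => hf _))).
Qed.

Lemma smooth_on_box_bump z0 r (U : set 'rV[R]_n) : open U -> smooth_on U (box_bump z0 r).
Proof.
move=> oU; apply: smooth_on_prod => // i.
have sc : smooth_on U (fun z : 'rV[R]_n => z 0 i - z0 0 i).
  by apply: (smooth_onD oU (smooth_on_coord_fun i)); exact: (@smooth_on_cst _ _ _ U (- z0 0 i)).
have sq : smooth_on U (fun z : 'rV[R]_n => r ^+ 2 - (z 0 i - z0 0 i) ^+ 2).
  have := smooth_onD oU (@smooth_on_cst _ _ _ U (r ^+ 2)) (smooth_onZ (-1) oU (smooth_onM oU sc sc)).
  congr smooth_on; apply/funext => z.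
  change (r ^+ 2 + -1 * ((z 0 i - z0 0 i) * (z 0 i - z0 0 i)) =
    r ^+ 2 - (z 0 i - z0 0 i) ^+ 2).
  by rewrite mulN1r -expr2.
have := smooth_onM oU (smooth_on_flat 1 oU sq) (@smooth_on_cst _ _ _ U (flat 1 (r ^+ 2))^-1).
by [].
Qed.

End BoxBump.

(** * Differentiability from an explicit estimate, and the mean value theorem on a segment *)

Section FrechetFromPartials.
Context {R : realType} {n : nat}.

Lemma differentiable_rV (F : 'rV[R]_n -> R) (z c : 'rV[R]_n) :
  (forall e, 0 < e -> \forall h \near (0 : 'rV[R]_n),
     `|F (h + z) - F z - \sum_i h 0 i * c 0 i| <= e * `|h|) ->
  differentiable F z /\ forall v, 'D_v F z = \sum_i v 0 i * c 0 i.
Proof.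
move=> hF; pose L (h : 'rV[R]_n) : R := \sum_i h 0 i * c 0 i.
have linL : linear L.
  move=> a u v; rewrite /L /GRing.scale /= mulr_sumr -big_split /=.
  by apply: eq_bigr => i _; rewrite !mxE mulrDl mulrA.
pose LM := GRing.isLinear.Build _ _ _ _ L linL.
pose LL : {linear 'rV[R]_n -> R} := HB.pack L LM.
have cL : continuous LL.
  have -> : (LL : 'rV[R]_n -> R) = \sum_i (fun h : 'rV[R]_n => h 0 i * c 0 i).
    by apply/funext => h; rewrite fct_sumE.
  move=> h; apply: differentiable_continuous; apply: differentiable_sum => i.
  apply: (@differentiableM _ _ (fun h : 'rV[R]_n => h 0 i) (cst (c 0 i))) => //.
  exact: differentiable_coord.
have dE : 'd F z = LL :> ('rV[R]_n -> R).
  apply: diff_unique => //; apply/eqaddoP => e e0 /=; have := hF _ e0; apply: filterS => h.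
  by rewrite /GRing.add /= /GRing.opp /= opprD addrA.
have dF : differentiable F z.
  apply/diff_locallyP; rewrite dE; split => //.
  apply/eqaddoP => e e0 /=; have := hF _ e0; apply: filterS => h.
  by rewrite /GRing.add /= /GRing.opp /= opprD addrA.
by split => // v; rewrite deriveE// dE.
Qed.

End FrechetFromPartials.

Lemma mvt_line (R : realType) (V : normedModType R) (f : V -> R) (z h : V) :
  (forall t : R, 0 <= t <= 1 -> differentiable f (t *: h + z)) ->
  exists2 t : R, 0 <= t <= 1 & f (h + z) - f z = 'D_h f (t *: h + z).
Proof.
move=> df; pose g (t : R) := f (t *: h + z).
have dg (t : R) : 0 <= t <= 1 -> is_derive t 1 g ('D_h f (t *: h + z)).
  move=> t01; have dP : derivable f (t *: h + z) h by exact/diff_derivable/df.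
  have E : (fun s : R => s^-1 *: ((g \o shift t) (s *: 1) - g t)) =
      (fun s : R => s^-1 *: ((f \o shift (t *: h + z)) (s *: h) - f (t *: h + z))).
    by apply/funext => s /=; rewrite /g -[s%:A]/(s * 1) mulr1 scalerDl addrA.
  by apply: DeriveDef; rewrite /derivable /derive E.
have [|t|t t01 E] := @MVT_segment R g (fun t => 'D_h f (t *: h + z)) 0 1 ler01.
- by move=> t; rewrite in_itv /= => /andP[t0 t1]; apply: dg; rewrite !ltW.
- apply: derivable_within_continuous => t'; rewrite in_itv /= => t01.
  by have [] := dg _ t01.
- exists t; first by move: t01; rewrite in_itv.
  by move: E; rewrite /g scale1r scale0r add0r subr0 mulr1.
Qed.

(** * Smooth functions and left-invariant derivatives *)

Section Charts.
Context {R : realType} {n : nat} {M : manifoldType R n}.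

Lemma chart_imgP (x y : M) : chart_dom x y -> chart_img x (chart x y).
Proof. by move=> xy; exists y. Qed.

Lemma chart_inv_dom (x : M) z : chart_img x z -> chart_dom x (chart_inv x z).
Proof. by move=> [y xy <-]; rewrite chartK. Qed.

Lemma chart_invK (x : M) z : chart_img x z -> chart x (chart_inv x z) = z.
Proof. by move=> [y xy <-]; rewrite chartK. Qed.

Lemma open_chart_img (x : M) : open (chart_img x).
Proof. exact: chart_img_open. Qed.

Local Arguments open_chart_img x : clear implicits.

Lemma nbhs_chart_img (x : M) z : chart_img x z -> nbhs z (chart_img x).
Proof. by move=> xz; apply: open_nbhs_nbhs; split => //; exact: open_chart_img. Qed.

Lemma nbhs_chart_dom (x y : M) : chart_dom x y -> nbhs y (chart_dom x).
Proof. by move=> xy; apply: open_nbhs_nbhs; split => //; exact: chart_dom_open. Qed.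

Lemma smooth_continuous (f : M -> R) : smooth f -> continuous f.
Proof.
move=> sf x; have xx := chart_dom_mem x.
have h : {for x, continuous (f \o chart_inv x \o chart x)}.
  apply: continuous_comp; first exact: chart_continuous.
  apply: differentiable_continuous.
  by apply: (smooth_on_differentiable (sf x)); exact: chart_imgP.
have : (f \o chart_inv x \o chart x) @ x --> f x.
  by rewrite -[X in _ --> f X](chartK _ _ xx); exact: h.
apply: cvg_trans; apply: near_eq_cvg.
by near=> y; rewrite /= chartK//; near: y; exact: nbhs_chart_dom.
Unshelve. all: by end_near. Qed.

Lemma smooth_cst (a : R) : smooth (fun _ : M => a).
Proof. by move=> x; exact: smooth_on_cst. Qed.

Lemma smoothD (f h : M -> R) : smooth f -> smooth h -> smooth (fun x => f x + h x).
Proof.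
by move=> sf sh x; exact (smooth_onD (open_chart_img x) (sf x) (sh x)).
Qed.

Lemma smoothM (f h : M -> R) : smooth f -> smooth h -> smooth (fun x => f x * h x).
Proof.
by move=> sf sh x; exact (smooth_onM (open_chart_img x) (sf x) (sh x)).
Qed.

Lemma smoothZ a (f : M -> R) : smooth f -> smooth (fun x => a * f x).
Proof. by move=> sf; apply: smoothM => //; exact: smooth_cst. Qed.

Lemma smoothN (f : M -> R) : smooth f -> smooth (fun x => - f x).
Proof.
move=> /(smoothZ (-1)); congr smooth; apply/funext => x; exact: mulN1r.
Qed.

Lemma smoothB (f h : M -> R) : smooth f -> smooth h -> smooth (fun x => f x - h x).
Proof. by move=> sf sh; apply: smoothD => //; exact: smoothN. Qed.

End Charts.
Arguments open_chart_img {R n M} x.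

(** * Functions depending jointly smoothly on a group element and a vector *)

Section SmoothFamilies.
Context {R : realType} {n : nat} {G : lieGroupType R n}.
Local Notation V := 'rV[R]_n.

Definition family_dom (U : set V) (y0 : G) : set (V * V) :=
  [set p | chart_img y0 p.1 /\ U p.2].

(* Joint smoothness: [y] is read in the charts of [G], [z] is a vector already. *)
Definition smooth_family (U : set V) (Phi : G -> V -> R) : Prop :=
  forall y0, smooth_on (family_dom U y0) (fun p => Phi (chart_inv y0 p.1) p.2).

Lemma smooth_family_derive (U : set V) Phi v : smooth_family U Phi ->
  smooth_family U (fun y z => 'D_v (Phi y) z).
Proof.
move=> sP y0; have := smooth_on_derive (0, v) (sP y0).
congr smooth_on; apply/funext => p; rewrite /derive.
suff -> : (fun h : R => h^-1 *: (((fun p : V * V => Phi (chart_inv y0 p.1) p.2) \o shift p)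
    (h *: ((0, v) : V * V)) - Phi (chart_inv y0 p.1) p.2)) =
  (fun h : R => h^-1 *: ((Phi (chart_inv y0 p.1) \o shift p.2) (h *: v) - Phi (chart_inv y0 p.1) p.2)) by [].
by apply/funext => h /=; rewrite scaler0 add0r.
Qed.

Lemma smooth_family_slice (U : set V) Phi z : smooth_family U Phi -> U z ->
  smooth (fun y => Phi y z).
Proof.
move=> sP Uz y0; pose A (w : V) : V * V := (w, z); pose L (w : V) : V * V := (w, 0).
apply: (smooth_on_affine (A := A) (L := L) _ _ _ (sP y0)) => [w v h|w|w yw //].
  by rewrite /A /L; congr pair; rewrite /= scaler0 add0r.
by apply: differentiable_pair.
Qed.

Lemma smooth_family_differentiable (U : set V) Phi y z : smooth_family U Phi -> U z ->
  differentiable (Phi y) z.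
Proof.
move=> sP Uz; pose A (w : V) : V * V := (chart y y, w).
have -> : Phi y = (fun p => Phi (chart_inv y p.1) p.2) \o A.
  by apply/funext => w /=; rewrite chartK//; exact: chart_dom_mem.
apply: differentiable_comp; first by apply: differentiable_pair.
apply: (smooth_on_differentiable (sP y)); split => //=.
by apply: chart_imgP; exact: chart_dom_mem.
Qed.

Lemma smooth_family_continuous (U : set V) Phi y z : smooth_family U Phi -> U z ->
  {for (z, y), continuous (fun p : V * G => Phi p.2 p.1)}.
Proof.
move=> sP Uz; have yy := chart_dom_mem y.
have c1 : {for (z, y), continuous (fun p : V * G => ((chart y p.2, p.1) : V * V))}.
  apply: continuous_pair_for; last exact: cvg_fst.
  apply: (@continuous_comp _ _ _ (fun p : V * G => p.2) (chart y)); first exact: cvg_snd.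
  exact: chart_continuous.
have c2 : {for (z, y), continuous (fun p : V * G => Phi (chart_inv y (chart y p.2)) p.1)}.
  apply: (@continuous_comp _ _ _ (fun p : V * G => ((chart y p.2, p.1) : V * V))
    (fun q => Phi (chart_inv y q.1) q.2)) => //.
  apply: differentiable_continuous; apply: (smooth_on_differentiable (sP y)); split => //=.
  exact: chart_imgP.
have : (fun p : V * G => Phi (chart_inv y (chart y p.2)) p.1) @ (z, y) --> Phi y z.
  by rewrite -[X in _ --> Phi X _](chartK _ _ yy); exact: c2.
apply: cvg_trans; apply: near_eq_cvg.
near=> p; rewrite /= chartK//; near: p.
have : (fun p : V * G => p.2) @ (z, y) --> y by exact: cvg_snd.
by apply; exact: nbhs_chart_dom.
Unshelve. all: by end_near. Qed.

(** The product need not stay in one chart when both factors vary, so smoothness is checked at each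
    point [p] separately, on the open set [Uq] where the product stays in the chart at its value [q]
    at [p]. *)
Lemma smooth_family_mul (f : G -> R) (x0 : G) : smooth f ->
  smooth_family (chart_img x0) (fun y z => f (y * chart_inv x0 z)%g).
Proof.
move=> sf y0 s p [p1 p2].
pose q := (chart_inv y0 p.1 * chart_inv x0 p.2)%g.
pose m (p : V * V) := (chart_inv y0 p.1 * chart_inv x0 p.2)%g.
pose Uq := [set p : V * V | [/\ chart_img y0 p.1, chart_img x0 p.2 & chart_dom q (m p)]].
have oUq : open Uq.
  rewrite openE => r [r1 r2 rq]; rewrite /interior.
  have cm : {for r, continuous m}.
    apply: (@continuous_comp _ _ _ (fun p : V * V => (chart_inv y0 p.1, chart_inv x0 p.2))
      (fun p => (p.1 * p.2)%g)); last exact: lie_mul_continuous.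
    apply: continuous_pair_for.
      apply: (@continuous_comp _ _ _ (fun p : V * V => p.1) (chart_inv y0)).
        exact: cvg_fst.
      exact: chart_inv_continuous.
    apply: (@continuous_comp _ _ _ (fun p : V * V => p.2) (chart_inv x0)).
      exact: cvg_snd.
    exact: chart_inv_continuous.
  near=> t; split.
  - near: t; have : (fun p : V * V => p.1) @ r --> r.1 by exact: cvg_fst.
    by apply; exact: nbhs_chart_img.
  - near: t; have : (fun p : V * V => p.2) @ r --> r.2 by exact: cvg_snd.
    by apply; exact: nbhs_chart_img.
  - by near: t; apply: cm; exact: nbhs_chart_dom.
have Up : Uq p by split => //; exact: chart_dom_mem.
suff : smooth_on Uq (fun p => f (m p)) by move=> /(_ s p Up).
apply: (@smooth_on_eq _ _ _ _ ((f \o chart_inv q) \o (chart q \o m))) => //.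
  by move=> r [_ _ rq] /=; rewrite chartK.
apply: (smooth_on_comp oUq _ _ (sf q)); last exact: lie_mul_smooth.
by move=> r [_ _ rq] /=; exact: chart_imgP.
Unshelve. all: by end_near. Qed.

Arguments smooth_family_mul {f} x0 sf.

Definition chart1_origin : V := chart (1%g : G) 1%g.

Lemma chart1_origin_img : chart_img (1%g : G) chart1_origin.
Proof. by apply: chart_imgP; exact: chart_dom_mem. Qed.

Lemma chart_inv1_origin : chart_inv (1%g : G) chart1_origin = 1%g.
Proof. by rewrite chartK//; exact: chart_dom_mem. Qed.

Lemma smooth_lvf (v : V) (f : G -> R) : smooth f -> smooth (lvf v f).
Proof.
move=> sf; exact (smooth_family_slice
  (smooth_family_derive v (smooth_family_mul 1%g sf)) chart1_origin_img).
Qed.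

Lemma differentiable_mul_chart (f : G -> R) (x : G) : smooth f ->
  differentiable (fun z => f (x * chart_inv (1%g : G) z)%g) chart1_origin.
Proof.
move=> sf; exact (smooth_family_differentiable x (smooth_family_mul 1%g sf)
  chart1_origin_img).
Qed.

Lemma lvfD v (f h : G -> R) : smooth f -> smooth h ->
  lvf v (fun x => f x + h x) = (fun x => lvf v f x + lvf v h x).
Proof.
move=> sf sh; apply/funext => x; rewrite /lvf.
exact (deriveD (@diff_derivable _ _ _ _ _ v (differentiable_mul_chart x sf))
  (@diff_derivable _ _ _ _ _ v (differentiable_mul_chart x sh))).
Qed.

Lemma lvfZ v a (f : G -> R) : smooth f ->
  lvf v (fun x => a * f x) = (fun x => a * lvf v f x).
Proof.
move=> sf; apply/funext => x; rewrite /lvf.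
exact (deriveZ a (@diff_derivable _ _ _ _ _ v (differentiable_mul_chart x sf))).
Qed.

Lemma lvfB v (f h : G -> R) : smooth f -> smooth h ->
  lvf v (fun x => f x - h x) = (fun x => lvf v f x - lvf v h x).
Proof.
move=> sf sh; apply/funext => x; rewrite /lvf.
exact (deriveB (@diff_derivable _ _ _ _ _ v (differentiable_mul_chart x sf))
  (@diff_derivable _ _ _ _ _ v (differentiable_mul_chart x sh))).
Qed.

Lemma lvfM v (f h : G -> R) x : smooth f -> smooth h ->
  lvf v (fun x => f x * h x) x = f x * lvf v h x + h x * lvf v f x.
Proof.
move=> sf sh; rewrite /lvf.
have := deriveM (@diff_derivable _ _ _ _ _ v (differentiable_mul_chart x sf))
  (@diff_derivable _ _ _ _ _ v (differentiable_mul_chart x sh)).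
by rewrite chart_inv1_origin mulg1 => ->.
Qed.

Lemma lvf_coord v (f : G -> R) x : smooth f ->
  lvf v f x = \sum_i v 0 i * lvf (delta_mx 0 i) f x.
Proof. by move=> sf; rewrite /lvf diff_row_sum//; exact: differentiable_mul_chart. Qed.

End SmoothFamilies.
Arguments smooth_family_mul {R n G f} x0 sf.

(** * Differentiation under the Haar integral *)

Section Integration.
Context {R : realType} {n : nat} {G : lieGroupType R n}.
Hypothesis compactG : compact [set: G].
Variable mu : probability (borel G) R.
Local Notation V := 'rV[R]_n.

Lemma family_integrable (U : set V) (Phi : G -> V -> R) (psi : G -> R) z :
  smooth_family U Phi -> U z -> continuous psi ->
  haar_integrable mu (fun y => Phi y z * psi y).
Proof.
move=> sP Uz cpsi; apply: continuous_integrable => // y.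
by apply: cvgM; [exact: (smooth_continuous (smooth_family_slice sP Uz))|exact: cpsi].
Qed.

(** The mean value theorem writes each increment of [Phi y] with partial derivatives at an
    intermediate point; by compactness these are close to those at [z] uniformly in [y], so the
    error survives integration as a little-o. *)
Lemma haar_int_family_Ck0 (U : set V) (Phi : G -> V -> R) (psi : G -> R) z :
  open U -> smooth_family U Phi -> continuous psi -> U z ->
  differentiable (fun z => haar_int mu (fun y => Phi y z * psi y)) z /\
  forall v, 'D_v (fun z => haar_int mu (fun y => Phi y z * psi y)) z =
    haar_int mu (fun y => 'D_v (Phi y) z * psi y).
Proof.
move=> oU sP cpsi Uz; set F := fun z => _.
pose c : V := \row_i haar_int mu (fun y => 'D_(delta_mx 0 i) (Phi y) z * psi y).
have sD i := smooth_family_derive (delta_mx 0 i) sP.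
have [K K0 psiK] := continuous_bounded compactG cpsi.
have [dF DF] : differentiable F z /\ forall v, 'D_v F z = \sum_i v 0 i * c 0 i.
  apply: differentiable_rV => e e0.
  (* [K] bounds [psi] and there are [n] directions to sum over; [n.+1] keeps the denominator nonzero
     in dimension 0. *)
  pose e' := e / (K * n.+1%:R); have e'0 : 0 < e' by rewrite divr_gt0// mulr_gt0.
  have nu i : \forall z' \near z, forall y,
      `|'D_(delta_mx 0 i) (Phi y) z' - 'D_(delta_mx 0 i) (Phi y) z| < e'.
    apply: (near_uniform compactG (F := fun z' y => 'D_(delta_mx 0 i) (Phi y) z') _ e'0).
    by move=> y; exact: smooth_family_continuous (sD i) Uz.
  have : \forall z' \near z, U z' /\ forall i y,
      `|'D_(delta_mx 0 i) (Phi y) z' - 'D_(delta_mx 0 i) (Phi y) z| < e'.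
    near=> z'; split; first by near: z'; exact: open_nbhs_nbhs.
    move=> i; move: i; near: z'; apply: filter_forall => i; exact: nu.
  move=> /nbhs_ballP[r /= r0 hr].
  near=> h.
  have hU t : 0 <= t <= 1 -> U (t *: h + z) /\ forall i y,
      `|'D_(delta_mx 0 i) (Phi y) (t *: h + z) - 'D_(delta_mx 0 i) (Phi y) z| < e'.
    move=> /andP[t0 t1]; apply: hr; rewrite -ball_normE /=.
    rewrite opprD addrCA subrr addr0 normrN normrZ ger0_norm//.
    apply: (@le_lt_trans _ _ `|h|); first by rewrite ler_piMl.
    near: h; have := @nbhsx_ballx _ _ (0 : V) r r0; apply: filterS => w.
    by rewrite -ball_normE /= sub0r normrN.
  have Uh : U (h + z) by have [] := hU 1; rewrite ?ler01 ?lexx// scale1r.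
  have mvt y : exists2 t : R, 0 <= t <= 1 & Phi y (h + z) - Phi y z = 'D_h (Phi y) (t *: h + z).
    apply: mvt_line => t t01; have [Ut _] := hU t t01.
    exact: (smooth_family_differentiable y sP Ut).
  have iP z' : U z' -> haar_integrable mu (fun y => Phi y z' * psi y).
    by move=> Uz'; exact: family_integrable.
  have iD i : haar_integrable mu (fun y => 'D_(delta_mx 0 i) (Phi y) z * psi y).
    exact: (family_integrable (sD i)).
  have [iS eS] := @haar_int_sum R n G compactG mu _ (index_enum 'I_n)
    (fun i y => h 0 i * ('D_(delta_mx 0 i) (Phi y) z * psi y))
    (fun i => haar_integrableZ (h 0 i) (iD i)).
  have -> : F (h + z) - F z - \sum_i h 0 i * c 0 i =
     haar_int mu (fun y => (Phi y (h + z) * psi y - Phi y z * psi y) -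
       \sum_i h 0 i * ('D_(delta_mx 0 i) (Phi y) z * psi y)).
    rewrite haar_intB//; last by apply: haar_integrableB => //; exact: iP.
    rewrite haar_intB//; [|exact: iP|exact: iP].
    by rewrite eS; congr (_ - _); apply: eq_bigr => i _; rewrite haar_intZ// mxE.
  apply: norm_haar_int_le => //.
    by apply: haar_integrableB => //; apply: haar_integrableB; exact: iP.
  move=> y; have [t t01 E] := mvt y; have [Ut ht] := hU t t01.
  rewrite -mulrBl E diff_row_sum; last exact: smooth_family_differentiable sP Ut.
  rewrite mulr_suml -sumrB (le_trans (ler_norm_sum _ _ _))//.
  apply: (@le_trans _ _ (\sum_(i < n) `|h| * e' * K)).
    apply: ler_sum => i _.
    have -> : forall a b c d : R, a * b * c - a * (d * c) = a * ((b - d) * c).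
      by move=> ????; ring.
    rewrite !normrM -[leRHS]mulrA.
    have hi : `|h 0 i| <= `|h|.
      rewrite [leRHS]mx_normrE; exact: (le_bigmax _ _ ((0 : 'I_1), i)).
    by rewrite ler_pM ?mulr_ge0// ler_pM// ltW.
  rewrite sumr_const card_ord -mulr_natr /e'.
  rewrite (_ : _ * _ * _ * _ = (e * `|h|) * (n%:R / n.+1%:R)); last first.
    have : K != 0 by rewrite gt_eqF.
    move: `|h| (n.+1%:R : R) (n%:R : R) => a m N K0'; rewrite invfM.
    transitivity (a * e * N * m^-1 * (K^-1 * K)); first by ring.
    by rewrite mulVf//; ring.
  rewrite ler_piMr// ?mulr_ge0 ?(ltW e0)//.
  by rewrite ler_pdivrMr// mul1r ler_nat.
split => // v; rewrite DF.
have [iS eS] := @haar_int_sum R n G compactG mu _ (index_enum 'I_n)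
    (fun i y => v 0 i * ('D_(delta_mx 0 i) (Phi y) z * psi y))
    (fun i => haar_integrableZ (v 0 i) (family_integrable (sD i) Uz cpsi)).
transitivity (haar_int mu (fun y => \sum_i v 0 i * ('D_(delta_mx 0 i) (Phi y) z * psi y))).
  rewrite eS; apply: eq_bigr => i _; rewrite mxE haar_intZ//.
  exact: (family_integrable (sD i)).
apply: haar_int_ext => y; rewrite diff_row_sum; last exact: smooth_family_differentiable sP Uz.
by rewrite mulr_suml; apply: eq_bigr => i _; rewrite mulrA.
Unshelve. all: by end_near. Qed.

Lemma smooth_haar_int_family (U : set V) (Phi : G -> V -> R) (psi : G -> R) :
  open U -> smooth_family U Phi -> continuous psi ->
  smooth_on U (fun z => haar_int mu (fun y => Phi y z * psi y)).
Proof.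
move=> oU sP cpsi; apply/smooth_on_Ck => k; elim: k Phi sP => [Phi sP|k ih Phi sP].
  by apply/Ck0 => z Uz; have [] := haar_int_family_Ck0 oU sP cpsi Uz.
apply/CkS; split => [|v].
  by apply/Ck0 => z Uz; have [] := haar_int_family_Ck0 oU sP cpsi Uz.
apply: (Ck_eq oU _ (ih _ (smooth_family_derive v sP))) => z Uz.
by have [_ ->] := haar_int_family_Ck0 oU sP cpsi Uz.
Qed.

Lemma haar_int_lvf_param (f psi : G -> R) (v : V) : smooth f -> continuous psi ->
  'D_v (fun z => haar_int mu (fun y => f (y * chart_inv (1%g : G) z)%g * psi y))
    (@chart1_origin R n G) = haar_int mu (fun y => lvf v f y * psi y).
Proof.
move=> sf cpsi.
have [_ ->] := haar_int_family_Ck0 (open_chart_img (1%g : G)) (smooth_family_mul 1%g sf) cpsi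
  (@chart1_origin_img R n G).
by [].
Qed.

(** A left-invariant field differentiates along right translations, under which the Haar integral is
    constant. *)
Lemma haar_int_lvf (f : G -> R) (v : V) : is_haar mu -> smooth f ->
  haar_int mu (lvf v f) = 0.
Proof.
move=> haar_mu sf; have := haar_int_lvf_param v sf (@continuous_cst G R 1).
rewrite (@haar_int_ext _ _ _ mu _ (lvf v f)); last by move=> y; rewrite mulr1.
move=> <-; rewrite (_ : (fun z => _) = cst (haar_int mu f)) ?derive_cst//.
apply/funext => z; transitivity (haar_int mu (fun y => f (y * chart_inv (1%g : G) z)%g)).
  by apply: haar_int_ext => y; rewrite mulr1.
by apply: haar_int_right => //; exact: smooth_continuous.
Qed.

End Integration.

(** * Extension by zero from a chart: bumps and cut-off coordinates *)

Section ChartExtension.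
Context {R : realType} {n : nat} {M : manifoldType R n}.
Local Notation V := 'rV[R]_n.

Definition chart_ext (x0 : M) (B : V -> R) (x : M) : R :=
  if `[< chart_dom x0 x >] then B (chart x0 x) else 0.

Lemma open_chart_preimage (x : M) (O : set M) : open O ->
  open [set z | chart_img x z /\ O (chart_inv x z)].
Proof.
move=> oO; rewrite openE => z [xz Oz]; rewrite /interior.
near=> w; split; first by near: w; exact: nbhs_chart_img.
near: w; have : {for z, continuous (chart_inv x)} by exact: chart_inv_continuous.
by apply; exact: open_nbhs_nbhs.
Unshelve. all: by end_near. Qed.

(** In a Hausdorff space the image of the compact [K] is closed, so a point outside the chart domain
    has a neighbourhood on which the extension vanishes. *)
Lemma smooth_chart_ext (x0 : M) (B : V -> R) (K : set V) :
  smooth_on setT B -> compact K -> K `<=` chart_img x0 ->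
  (forall z, B z != 0 -> K z) -> smooth (chart_ext x0 B).
Proof.
move=> sB cK Kx0 BK x s z xz.
have [pz|npz] := pselect (chart_dom x0 (chart_inv x z)).
  pose U := [set z | chart_img x z /\ chart_dom x0 (chart_inv x z)].
  have oU : open U by apply: open_chart_preimage; exact: chart_dom_open.
  suff : smooth_on U (chart_ext x0 B \o chart_inv x) by move=> /(_ s z (conj xz pz)).
  apply: (@smooth_on_eq _ _ _ _ (B \o (chart x0 \o chart_inv x))) => //.
    by move=> w [_ dw] /=; rewrite /chart_ext asboolT.
  apply: (smooth_on_comp oU _ _ sB) => //; exact: chart_transition.
pose C := chart_inv x0 @` K.
have cC : compact C.
  apply: continuous_compact => //; apply: continuous_in_subspaceT => w /set_mem /Kx0 xw.
  exact: chart_inv_continuous.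
have clC : closed C by apply: compact_closed cC; exact: manifold_hausdorff.
pose U := [set z | chart_img x z /\ (~` C) (chart_inv x z)].
have oU : open U by apply: open_chart_preimage; exact: closed_openC.
have Uz : U z.
  split=> // -[w Kw E]; apply: npz; rewrite -E; apply: chart_inv_dom; exact: Kx0.
suff : smooth_on U (chart_ext x0 B \o chart_inv x) by move=> /(_ s z Uz).
apply: (@smooth_on_eq _ _ _ _ (cst 0)) => //; last exact: smooth_on_cst.
move=> w [_ nC] /=; rewrite /chart_ext; case: asboolP => // dw.
apply/esym/eqP; rewrite -[_ == _]negbK; apply/negP => /BK Kw.
by apply: nC; exists (chart x0 (chart_inv x w)) => //; rewrite chartK.
Qed.

Lemma compact_rV_closed_ball (z0 : V) r : compact [set z : V | `|z - z0| <= r].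
Proof.
apply: bounded_closed_compact.
  exists (r + `|z0|); split; first exact: num_real.
  move=> N rN z /= zr; apply: ltW; apply: le_lt_trans rN.
  by rewrite -[z](subrK z0) (le_trans (ler_normD _ _))// lerD2r.
apply: (@closed_comp _ _ (fun z : V => `|z - z0|) [set t | t <= r]).
  move=> z _; apply: (@continuous_comp _ _ _ (fun z : V => z - z0) (fun z : V => `|z|)).
    exact (continuousB (@continuous_idfun _ z) (@continuous_cst _ _ z0 z)).
  exact: norm_continuous.
exact: closed_le.
Qed.

Lemma chart_ball (x0 : M) (N : set M) : nbhs x0 N ->
  exists2 r : R, 0 < r & forall z, `|z - chart x0 x0| <= r ->
    chart_img x0 z /\ N (chart_inv x0 z).
Proof.
move=> nN; have x00 := chart_imgP (chart_dom_mem x0).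
have : \forall z \near chart x0 x0, chart_img x0 z /\ N (chart_inv x0 z).
  near=> z; split; first by near: z; exact: nbhs_chart_img.
  near: z; have : {for chart x0 x0, continuous (chart_inv x0)} by exact: chart_inv_continuous.
  by apply; rewrite chartK//; exact: chart_dom_mem.
move=> /nbhs_ballP[r /= r0 hr]; exists (r / 2); first by rewrite divr_gt0.
move=> z zr; apply: hr; rewrite -ball_normE /= distrC (le_lt_trans zr)//.
by rewrite ltr_pdivrMr// ltr_pMr// ltr1n.
Unshelve. all: by end_near. Qed.

Lemma exists_bump (x0 : M) (N : set M) : nbhs x0 N ->
  exists phi : M -> R, [/\ smooth phi, forall x, 0 <= phi x, phi x0 = 1 &
    forall x, phi x != 0 -> N x].
Proof.
move=> /chart_ball[r r0 hr]; exists (chart_ext x0 (box_bump (chart x0 x0) r)).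
split.
- apply: (smooth_chart_ext (K := [set z | `|z - chart x0 x0| <= r])).
  + by apply: smooth_on_box_bump; exact: openT.
  + exact: compact_rV_closed_ball.
  + by move=> z /hr[].
  + by move=> z /(box_bump_support r0) /ltW.
- by move=> x; rewrite /chart_ext; case: ifP => // _; exact: box_bump_ge0.
- rewrite /chart_ext asboolT; last exact: chart_dom_mem.
  exact: box_bump_center.
- move=> x; rewrite /chart_ext; case: asboolP => [dx|]; last by rewrite eqxx.
  by move=> /(box_bump_support r0) /ltW /hr[_]; rewrite chartK.
Qed.

(** Global test functions with a prescribed differential at one point: a centred coordinate times a
    bump equal to 1 there, the product rule killing the derivative of the bump. *)
Lemma exists_cut_coord (x0 : M) (i : 'I_n) :
  exists a : M -> R, [/\ smooth a, a x0 = 0 &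
    forall v, 'D_v (a \o chart_inv x0) (chart x0 x0) = v 0 i].
Proof.
have [r r0 hr] := chart_ball (filterT : nbhs x0 setT).
set z0 := chart x0 x0; pose c (z : V) := z 0 i - z0 0 i.
pose B z := c z * box_bump z0 r z.
have sc : smooth_on setT c.
  apply: (smooth_onD openT (smooth_on_coord_fun i)).
  exact: (@smooth_on_cst _ _ _ setT (- z0 0 i)).
have sb : smooth_on setT (box_bump z0 r) by apply: smooth_on_box_bump; exact: openT.
have sB : smooth_on setT B by exact (smooth_onM openT sc sb).
exists (chart_ext x0 B); split.
- apply: (smooth_chart_ext (K := [set z | `|z - z0| <= r])) => //.
  + exact: compact_rV_closed_ball.
  + by move=> z /hr[].
  + by move=> z; rewrite mulf_eq0 negb_or => /andP[_] /(box_bump_support r0) /ltW.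
- rewrite /chart_ext asboolT; last exact: chart_dom_mem.
  by rewrite /B /c subrr mul0r.
move=> v; have x00 := chart_imgP (chart_dom_mem x0).
rewrite (@near_eq_derive _ _ _ _ B); last first.
  near=> z; have xz : chart_img x0 z by near: z; exact: nbhs_chart_img.
  rewrite /= /chart_ext asboolT; last exact: chart_inv_dom.
  by rewrite chart_invK.
have dc : differentiable c z0 by exact: (smooth_on_differentiable sc).
have db : differentiable (box_bump z0 r) z0 by exact: (smooth_on_differentiable sb).
have -> := deriveM (@diff_derivable _ _ _ _ _ v dc) (@diff_derivable _ _ _ _ _ v db).
rewrite box_bump_center// {1}/c subrr scale0r add0r scale1r.
have -> := @deriveB _ _ _ (fun z : V => z 0 i) (cst (z0 0 i)) z0 v
  (@diff_derivable _ _ _ _ _ v (differentiable_coord _ _ _)) (@derivable_cst _ _ _ _ _ _).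
rewrite derive_cst subr0.
by rewrite (@derive_coord _ _ _ id) ?derive_id.
Unshelve. all: by end_near. Qed.

End ChartExtension.

(** * Oscillation and left-invariant derivatives *)

Section Gap.
Context {R : realType} {n : nat} {G : lieGroupType R n}.
Hypothesis compactG : compact [set: G].
Hypothesis connectedG : connected [set: G].
Local Notation V := 'rV[R]_n.
Local Notation z0 := (@chart1_origin R n G).

Definition lvf_bound (F : G -> R) (e : R) : Prop :=
  [/\ smooth F, 0 <= e & forall i x, `|lvf (delta_mx 0 i) F x| <= e].

Definition local_mul (w z : V) : V :=
  chart (1%g : G) (chart_inv (1%g : G) w * chart_inv (1%g : G) z)%g.

Definition local_mul_dom : set (V * V) :=
  [set p : V * V | [/\ chart_img (1%g : G) p.1, chart_img (1%g : G) p.2 &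
            chart_dom (1%g : G) (chart_inv (1%g : G) p.1 * chart_inv (1%g : G) p.2)%g]].

Lemma open_local_mul_dom : open local_mul_dom.
Proof.
rewrite openE => p [p1 p2 pd]; rewrite /interior.
have cm : {for p, continuous (fun p : V * V => (chart_inv (1%g : G) p.1 * chart_inv (1%g : G) p.2)%g)}.
  apply: (@continuous_comp _ _ _ (fun p : V * V => (chart_inv (1%g : G) p.1, chart_inv (1%g : G) p.2))
      (fun p => (p.1 * p.2)%g)); last exact: lie_mul_continuous.
  apply: continuous_pair_for.
    apply: (@continuous_comp _ _ _ (fun p : V * V => p.1) (chart_inv (1%g : G))).
      exact: cvg_fst.
    exact: chart_inv_continuous.
  apply: (@continuous_comp _ _ _ (fun p : V * V => p.2) (chart_inv (1%g : G))).
    exact: cvg_snd.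
  exact: chart_inv_continuous.
near=> t; split.
- near: t; have : (fun p : V * V => p.1) @ p --> p.1 by exact: cvg_fst.
  by apply; exact: nbhs_chart_img.
- near: t; have : (fun p : V * V => p.2) @ p --> p.2 by exact: cvg_snd.
  by apply; exact: nbhs_chart_img.
- by near: t; apply: cm; exact: nbhs_chart_dom.
Unshelve. all: by end_near. Qed.

Lemma local_mul_dom_origin w : chart_img (1%g : G) w -> local_mul_dom (w, z0).
Proof.
move=> iw; split => //=; first exact: chart1_origin_img.
by rewrite chart_inv1_origin mulg1; exact: chart_inv_dom.
Qed.

Lemma smooth_local_mul : smooth_on local_mul_dom (fun p => local_mul p.1 p.2).
Proof. exact: lie_mul_smooth. Qed.

Lemma local_mul_differentiable w : chart_img (1%g : G) w ->
  differentiable (local_mul w) z0.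
Proof.
move=> iw; have -> : local_mul w = (fun p => local_mul p.1 p.2) \o (fun z => (w, z)) by [].
apply: differentiable_comp; first exact: differentiable_pair.
apply: (smooth_on_differentiable smooth_local_mul); exact: local_mul_dom_origin.
Qed.

(** The chain rule for [F] composed with left translation by [x]. The coefficients relating the
    left-invariant frame to the coordinate frame depend neither on [x] nor on [F], which makes the
    later constants uniform. *)
Lemma lvf_local (F : G -> R) (x : G) v w : smooth F -> chart_img (1%g : G) w ->
  lvf v F (x * chart_inv (1%g : G) w)%g =
  \sum_k 'D_v (fun z => local_mul w z 0 k) z0 *
     'D_(delta_mx 0 k) (fun z => F (x * chart_inv (1%g : G) z)%g) w.
Proof.
move=> sF iw; have mw : local_mul w z0 = w.
  by rewrite /local_mul chart_inv1_origin mulg1 chart_invK.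
have dF : differentiable (fun z => F (x * chart_inv (1%g : G) z)%g) (local_mul w z0).
  rewrite mw; exact (smooth_family_differentiable x (smooth_family_mul 1%g sF) iw).
have := derive_comp_row v (local_mul_differentiable iw) dF; rewrite mw => <-.
apply: near_eq_derive; near=> z.
have [_ _ dz] : local_mul_dom (w, z).
  near: z; have : {for z0, continuous (fun z => (w, z))}.
    by exact (continuous_pair_for (@continuous_cst _ _ w z0) (@continuous_idfun _ z0)).
  apply; apply: open_nbhs_nbhs; split; first exact: open_local_mul_dom.
  exact: local_mul_dom_origin.
by rewrite /= /local_mul chartK// mulgA.
Unshelve. all: by end_near. Qed.

(** At [w = z0] multiplication is the identity in the chart and the matrix is 1; the rest is
    continuity. The tolerance is such that the sum of [n] entries of the error stays below 1/2. *)
Lemma local_frame_near : \forall w \near z0, forall i k : 'I_n,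
  `|'D_(delta_mx 0 i) (fun z => local_mul w z 0 k) z0 - (i == k)%:R| <= (2 * n.+1%:R)^-1.
Proof.
have e0 : 0 < (2 * n.+1%:R)^-1 :> R by rewrite invr_gt0 mulr_gt0.
have key i k : \forall w \near z0,
  `|'D_(delta_mx 0 i) (fun z => local_mul w z 0 k) z0 - (i == k)%:R| <= (2 * n.+1%:R)^-1.
  pose m (p : V * V) := local_mul p.1 p.2 0 k.
  have sm : smooth_on local_mul_dom m.
    exact: (smooth_on_coord k open_local_mul_dom smooth_local_mul).
  have sDm := smooth_on_derive (0, delta_mx 0 i) sm.
  have Dm w : 'D_(delta_mx 0 i) (fun z => local_mul w z 0 k) z0 = 'D_(0, delta_mx 0 i) m (w, z0).
    rewrite /derive.
    suff -> : (fun h : R => h^-1 *: ((m \o shift (w, z0)) (h *: ((0, delta_mx 0 i) : V * V)) - m (w, z0))) =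
     (fun h : R => h^-1 *: (((fun z => local_mul w z 0 k) \o shift z0) (h *: (delta_mx 0 i : V)) - local_mul w z0 0 k)) by [].
    by apply/funext => h /=; rewrite /m /= scaler0 add0r.
  have D0 : 'D_(delta_mx 0 i) (fun z => local_mul z0 z 0 k) z0 = (i == k)%:R.
    rewrite (@near_eq_derive _ _ _ _ (fun z : V => z 0 k)); last first.
      near=> z; rewrite /local_mul chart_inv1_origin mul1g chart_invK//.
      by near: z; apply: nbhs_chart_img; exact: chart1_origin_img.
    by rewrite (@derive_coord _ _ _ id)// derive_id mxE eqxx eq_sym.
  have cD : {for z0, continuous (fun w => 'D_(delta_mx 0 i) (fun z => local_mul w z 0 k) z0)}.
    have -> : (fun w => 'D_(delta_mx 0 i) (fun z => local_mul w z 0 k) z0) =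
      'D_(0, delta_mx 0 i) m \o (fun w => (w, z0)) by apply/funext => w /=; rewrite Dm.
    apply: continuous_comp.
      by exact (continuous_pair_for (@continuous_idfun _ z0) (@continuous_cst _ _ z0 z0)).
    apply: differentiable_continuous; apply: (smooth_on_differentiable sDm).
    exact/local_mul_dom_origin/chart1_origin_img.
  have /cvgrPdist_le/(_ _ e0) := cD; rewrite D0.
  by apply: filterS => w; rewrite distrC.
have : \forall w \near z0, forall ik : 'I_n * 'I_n,
    `|'D_(delta_mx 0 ik.1) (fun z => local_mul w z 0 ik.2) z0 - (ik.1 == ik.2)%:R| <=
    (2 * n.+1%:R)^-1.
  by near=> w => ik; move: ik; near: w; apply: filter_forall => ik; exact: key.
by apply: filterS => w h i k; exact: (h (i, k)).
Unshelve. all: by end_near. Qed.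

(* Near the identity the left-invariant frame is a small perturbation of the
   coordinate frame of the chart, whose derivatives bound oscillations by the mean
   value theorem. *)
Lemma lvf_lipschitz_local : exists2 N : set G, nbhs 1%g N & exists2 K : R, 0 <= K &
  forall F e, lvf_bound F e -> forall x y, N y -> `|F (x * y)%g - F x| <= K * e.
Proof.
have : \forall w \near z0, chart_img (1%g : G) w /\ forall i k : 'I_n,
  `|'D_(delta_mx 0 i) (fun z => local_mul w z 0 k) z0 - (i == k)%:R| <= (2 * n.+1%:R)^-1.
  near=> w; split; near: w; last exact: local_frame_near.
  by apply: nbhs_chart_img; exact: chart1_origin_img.
move=> /nbhs_ballP[r /= r0 hr].
exists (chart_dom (1%g : G) `&` [set y | ball z0 r (chart (1%g : G) y)]).
  apply: filterI; first by apply: nbhs_chart_dom; exact: chart_dom_mem.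
  have : {for 1%g, continuous (chart (1%g : G))}.
    by apply: chart_continuous; exact: chart_dom_mem.
  by apply; exact: nbhsx_ballx.
(* In the mean value formula each of the [n] coordinates of the increment is at most [r] and each
   partial derivative at most [2 * e]. *)
exists (n%:R * (r * 2)); first by rewrite !mulr_ge0// ltW.
move=> F e [sF e0 bF] x y [dy by_].
pose f z := F (x * chart_inv (1%g : G) z)%g.
pose h := chart (1%g : G) y - z0.
have hn : `|h| < r by move: by_; rewrite -ball_normE /= distrC.
have inU t : 0 <= t <= 1 -> ball z0 r (t *: h + z0).
  move=> /andP[t0 t1]; rewrite -ball_normE /= opprD addrCA subrr addr0 normrN normrZ ger0_norm//.
  by apply: le_lt_trans hn; rewrite ler_piMl.
have df t : 0 <= t <= 1 -> differentiable f (t *: h + z0).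
  move=> /inU /hr[iw _].
  exact (smooth_family_differentiable x (smooth_family_mul 1%g sF) iw).
have [t t01 E] := mvt_line df.
have Ey : F (x * y)%g - F x = f (h + z0) - f z0.
  by rewrite /f /h subrK chartK// chart_inv1_origin mulg1.
have [iw hM] := hr _ (inU t t01); set w := t *: h + z0 in iw hM E.
pose D k := 'D_(delta_mx 0 k) f w.
pose d : V := \row_k D k.
have Dd k : `|D k| <= `|d|.
  rewrite [leRHS]mx_normrE.
  by have := le_bigmax (0 : R) (fun ij : 'I_1 * 'I_n => `|d ij.1 ij.2|) (0, k); rewrite /= mxE.
(* Replacing the left-invariant frame by the coordinate frame costs at most half of the unknown [d],
   which is then absorbed. *)
have dle : `|d| <= e + `|d| / 2.
  rewrite [leLHS]mx_normrE bigmax_le ?addr_ge0// => -[u i] _ /=.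
  rewrite (ord1 u) mxE.
  pose a k := 'D_(delta_mx 0 i) (fun z => local_mul w z 0 k) z0.
  have lE : lvf (delta_mx 0 i) F (x * chart_inv (1%g : G) w)%g = \sum_k a k * D k.
    exact: lvf_local.
  have -> : D i = lvf (delta_mx 0 i) F (x * chart_inv (1%g : G) w)%g -
     \sum_k (a k - (i == k)%:R) * D k.
    rewrite lE -sumrB (eq_bigr (fun k => (i == k)%:R * D k)); last by move=> k _; ring.
    rewrite (bigD1 i)//= eqxx mul1r big1 ?addr0// => k ki.
    by rewrite eq_sym (negbTE ki) mul0r.
  rewrite (le_trans (ler_normB _ _))// lerD//.
  rewrite (le_trans (ler_norm_sum _ _ _))//.
  apply: (@le_trans _ _ (\sum_(k < n) (2 * n.+1%:R)^-1 * `|d|)).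
    by apply: ler_sum => k _; rewrite normrM ler_pM//; exact: hM.
  rewrite sumr_const card_ord -[leLHS]mulr_natr.
  rewrite (_ : _ * n%:R = `|d| / 2 * (n%:R / n.+1%:R)); last by rewrite invfM; ring.
  by rewrite ler_piMr ?divr_ge0// ler_pdivrMr// mul1r ler_nat.
have d2 : `|d| <= 2 * e by lra.
rewrite Ey E diff_row_sum; last exact: df.
rewrite (le_trans (ler_norm_sum _ _ _))//.
apply: (@le_trans _ _ (\sum_(k < n) r * (2 * e))).
  apply: ler_sum => k _; rewrite normrM ler_pM//.
    rewrite (le_trans _ (ltW hn))// [leRHS]mx_normrE; exact: (le_bigmax _ _ ((0 : 'I_1), k)).
  exact: le_trans (Dd k) d2.
have -> : n%:R * (r * 2) * e = (r * (2 * e)) *+ n by rewrite -[RHS]mulr_natl; ring.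
by rewrite sumr_const card_ord.
Unshelve. all: by end_near. Qed.

(** The points reached from 1 in boundedly many steps inside [N] form sets [S k] whose union is open
    and closed, hence everything by connectedness; compactness makes a single [k] enough. *)
Lemma lvf_lipschitz : exists2 K : R, 0 <= K &
  forall F e, lvf_bound F e -> forall y, `|F y - F 1%g| <= K * e.
Proof.
have [N nN [K K0 hK]] := lvf_lipschitz_local.
pose S k := [set y : G | forall F e, lvf_bound F e -> `|F y - F 1%g| <= k%:R * K * e].
have SN k y w : S k y -> N w -> S k.+1 (y * w)%g.
  move=> Sy Nw F e bF; rewrite -(subrKA (F y)) (le_trans (ler_normD _ _))//.
  rewrite -natr1 addrC !mulrDl mul1r lerD//; first exact: Sy.
  exact: hK.
have nl (y : G) : nbhs y [set w | N (y^-1 * w)%g].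
  by have := @continuous_mulgl R n G y^-1%g y; apply; rewrite mulVg.
have nr (y : G) : nbhs y [set w | N (w^-1 * y)%g].
  have : continuous (fun w : G => (w^-1 * y)%g).
    apply: continuous_mulg_comp; last exact: continuous_cst.
    by apply: continuous_invg_comp; exact: continuous_idfun.
  by move=> /(_ y); apply; rewrite mulVg.
have HT : \bigcup_k S k = setT.
  apply: connectedG.
  - by exists 1%g, 0%N => //= F e _; rewrite subrr normr0 !mul0r.
  - exists (\bigcup_k S k); last by rewrite setTI.
    rewrite openE => y [k _ Sy]; rewrite /interior.
    apply: filterS (nl y) => w /= Nw; exists k.+1 => //.
    by rewrite -(mulVKg y w); exact: SN.
  - exists (\bigcup_k S k); last by rewrite setTI.
    rewrite -openC openE => y nSy; rewrite /interior.
    apply: filterS (nr y) => w /= Nw [k _ Sw]; apply: nSy; exists k.+1 => //.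
    by rewrite -(mulVKg w y); exact: SN.
have SS k k' : (k <= k')%N -> S k `<=` S k'.
  move=> kk' y Sy F e bF; apply: le_trans (Sy F e bF) _.
  have [_ e0 _] := bF; by rewrite !ler_wpM2r// ler_nat.
have : \forall k \near \oo, [set: G] `<=` S k.
  have /compact_near_coveringP nc := compactG.
  apply: nc => y _; have [k _ Sy] : (\bigcup_k S k) y by rewrite HT.
  near=> w k' => /=; apply: (SS k.+1); first by near: k'; exact: nbhs_infty_ge.
  rewrite -(mulVKg y w); apply: SN => //; near: w; exact: nl.
case=> k _ hk; exists (k%:R * K); first by rewrite mulr_ge0.
by move=> F e bF y; exact: (hk k (leqnn k) y I F e bF).
Unshelve. all: by end_near. Qed.

End Gap.

(** * The Laplacian at the identity *)

Section LaplaceFrame.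
Context {R : realType} {n : nat}.
Local Notation V := 'rV[R]_n.

Lemma continuous_sum_at (T : topologicalType) (I : Type) (s : seq I) (F : I -> T -> R) (t : T) :
  (forall i, {for t, continuous (F i)}) ->
  {for t, continuous (fun x => \sum_(i <- s) F i x)}.
Proof.
move=> cF; elim: s => [|i s ih].
  rewrite (_ : (fun x => _) = cst 0); last by apply/funext => x; rewrite big_nil.
  exact: cvg_cst.
rewrite (_ : (fun x => _) = (fun x => F i x + \sum_(i <- s) F i x)).
  exact: (continuousD (cF i) ih).
by apply/funext => x; rewrite big_cons.
Qed.

Lemma continuous_prod_at (T : topologicalType) (I : Type) (s : seq I) (F : I -> T -> R) (t : T) :
  (forall i, {for t, continuous (F i)}) ->
  {for t, continuous (fun x => \prod_(i <- s) F i x)}.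
Proof.
move=> cF; elim: s => [|i s ih].
  rewrite (_ : (fun x => _) = cst 1); last by apply/funext => x; rewrite big_nil.
  exact: cvg_cst.
rewrite (_ : (fun x => _) = (fun x => F i x * \prod_(i <- s) F i x)).
  exact: (continuousM (cF i) ih).
by apply/funext => x; rewrite big_cons.
Qed.

Lemma continuous_det_at (T : topologicalType) m (A : T -> 'M[R]_m) (t : T) :
  (forall i j, {for t, continuous (fun x => A x i j)}) ->
  {for t, continuous (fun x => \det (A x))}.
Proof.
move=> cA; rewrite /determinant; apply: continuous_sum_at => s.
exact (continuousM (@continuous_cst T R _ t)
  (continuous_prod_at (fun i => cA i _))).
Qed.

Lemma continuous_invmx_at (T : topologicalType) m (A : T -> 'M[R]_m) (t : T) i j :
  (forall i j, {for t, continuous (fun x => A x i j)}) -> \det (A t) != 0 ->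
  {for t, continuous (fun x => invmx (A x) i j)}.
Proof.
move=> cA At; have cd := continuous_det_at cA.
have c1 : {for t, continuous (fun x => (\det (A x))^-1 * cofactor (A x) j i)}.
  apply: continuousM; first exact: continuousV.
  apply: (@continuousM _ _ (fun=> (-1) ^+ (j + i))); first exact: cvg_cst.
  apply: (continuous_det_at (A := fun x => row' j (col' i (A x)))) => p q.
  rewrite (_ : (fun x => _) = (fun x => A x (lift j p) (lift i q))); first exact: cA.
  by apply/funext => x; rewrite !mxE.
have E x : A x \in unitmx -> invmx (A x) i j = (\det (A x))^-1 * cofactor (A x) j i.
  by move=> u; rewrite /invmx u !mxE.
have : (fun x => (\det (A x))^-1 * cofactor (A x) j i) @ t --> invmx (A t) i j.
  by rewrite E ?unitmxE ?unitfE//; exact: c1.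
apply: cvg_trans; apply: near_eq_cvg; near=> x; rewrite E// unitmxE unitfE.
near: x; have : nbhs (\det (A t)) [set s : R | s != 0].
  by apply: open_nbhs_nbhs; split => //; exact: open_neq.
exact: cd.
Unshelve. all: by end_near. Qed.

(** When [h] vanishes at the point, continuity of [c] suffices for the product rule. The volume
    density and the inverse metric thus never have to be differentiated. *)
Lemma derive_mul_vanish (V' : normedModType R) (c h : V' -> R) (z v : V') :
  {for z, continuous c} -> differentiable h z -> h z = 0 ->
  'D_v (fun w => c w * h w) z = c z * 'D_v h z.
Proof.
move=> cc dh hz; rewrite /derive; apply: cvg_lim => //.
have -> : (fun t : R => t^-1 *: (((fun w => c w * h w) \o shift z) (t *: v) - c z * h z)) =
   (fun t : R => c (t *: v + z) * (t^-1 *: ((h \o shift z) (t *: v) - h z))).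
  apply/funext => t /=; rewrite hz mulr0 !subr0 /GRing.scale /=; ring.
apply: cvgM; last first.
  by have /cvgP := @diff_derivable _ _ _ _ _ v dh; apply; exact: diff_derivable.
have c0 : (fun t : R => t *: v + z) @ 0^' --> z.
  apply: cvg_within_filter.
  have : {for 0, continuous (fun t : R => t *: v + z)}.
    apply: (@continuousD _ _ _ (fun t : R => t *: v)); last exact: cvg_cst.
    exact: scalel_continuous.
  by rewrite /prop_for /continuous_at scale0r add0r.
exact: (cvg_comp _ _ c0 cc).
Qed.

Context {G : lieGroupType R n}.
Local Notation z0 := (@chart1_origin R n G).
Variables (g : riemannian_metric G) (X : 'M[R]_n).
Hypothesis laplaceX : forall (f : G -> R) (x : G), smooth f ->
  laplace_beltrami g f x = - \sum_j lvf (row j X) (lvf (row j X) f) x.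

(** The product and its first derivatives vanish at the identity, so only the second-order
    coefficients of the Laplacian contribute. *)
Lemma laplace_product (a b : G -> R) : smooth a -> smooth b -> a 1%g = 0 -> b 1%g = 0 ->
  let A := a \o chart_inv (1%g : G) in let B := b \o chart_inv (1%g : G) in
  Num.sqrt (\det (g 1%g z0)) != 0 ->
  laplace_beltrami g (fun x => a x * b x) 1%g =
  - \sum_p \sum_q invmx (g 1%g z0) p q *
     ('D_(delta_mx 0 p) A z0 * 'D_(delta_mx 0 q) B z0 +
      'D_(delta_mx 0 p) B z0 * 'D_(delta_mx 0 q) A z0).
Proof.
move=> sa sb a1 b1 A B vol0.
have dg : \det (g 1%g z0) != 0.
  by apply: contraNneq vol0 => ->; rewrite sqrtr0.
rewrite /laplace_beltrami; congr (- _); set vol := fun z => Num.sqrt (\det (g 1%g z)).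
have i0 := @chart1_origin_img R n G.
have sA : smooth_on (chart_img (1%g : G)) A := sa 1%g.
have sB : smooth_on (chart_img (1%g : G)) B := sb 1%g.
have A0 : A z0 = 0 by rewrite /A /= chart_inv1_origin.
have B0 : B z0 = 0 by rewrite /B /= chart_inv1_origin.
have cg i j : {for z0, continuous (fun z => g 1%g z i j)}.
  by apply: differentiable_continuous; exact: (@smooth_on_differentiable _ _ _ _ _ z0 (@metric_smooth _ _ _ g 1%g i j)).
have cvol : {for z0, continuous vol}.
  apply: (@continuous_comp _ _ _ (fun z => \det (g 1%g z)) Num.sqrt).
    exact: continuous_det_at.
  exact: sqrt_continuous.
have D2 p q : 'D_(delta_mx 0 p) (fun z => vol z * invmx (g 1%g z) p q *
     'D_(delta_mx 0 q) ((fun x => a x * b x) \o chart_inv 1%g) z) z0 =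
   vol z0 * (invmx (g 1%g z0) p q * ('D_(delta_mx 0 p) A z0 * 'D_(delta_mx 0 q) B z0 +
      'D_(delta_mx 0 p) B z0 * 'D_(delta_mx 0 q) A z0)).
  have dA : differentiable A z0 by exact: smooth_on_differentiable sA i0.
  have dB : differentiable B z0 by exact: smooth_on_differentiable sB i0.
  have dDA : differentiable ('D_(delta_mx 0 q) A) z0.
    exact: smooth_on_differentiable (smooth_on_derive (delta_mx 0 q) sA) i0.
  have dDB : differentiable ('D_(delta_mx 0 q) B) z0.
    exact: smooth_on_differentiable (smooth_on_derive (delta_mx 0 q) sB) i0.
  rewrite (@near_eq_derive _ _ _ _ (fun z => vol z * invmx (g 1%g z) p q *
     (A * 'D_(delta_mx 0 q) B + B * 'D_(delta_mx 0 q) A) z)); last first.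
    near=> z; congr (_ * _).
    have iz : chart_img (1%g : G) z by near: z; exact: nbhs_chart_img.
    have dAz : differentiable A z by exact: smooth_on_differentiable sA iz.
    have dBz : differentiable B z by exact: smooth_on_differentiable sB iz.
    exact: (deriveM (@diff_derivable _ _ _ _ _ (delta_mx 0 q) dAz)
       (@diff_derivable _ _ _ _ _ (delta_mx 0 q) dBz)).
  rewrite derive_mul_vanish.
  - rewrite mulrA; congr (_ * _).
    have d1 := differentiableM dA dDB; have d2 := differentiableM dB dDA.
    rewrite (deriveD (@diff_derivable _ _ _ _ _ (delta_mx 0 p) d1)
      (@diff_derivable _ _ _ _ _ (delta_mx 0 p) d2)).
    rewrite (deriveM (@diff_derivable _ _ _ _ _ (delta_mx 0 p) dA)
      (@diff_derivable _ _ _ _ _ (delta_mx 0 p) dDB)).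
    rewrite (deriveM (@diff_derivable _ _ _ _ _ (delta_mx 0 p) dB)
      (@diff_derivable _ _ _ _ _ (delta_mx 0 p) dDA)).
    have key (x y r u a' b' c' d' : R) : x = 0 -> y = 0 ->
        x *: r + b' *: a' + (y *: u + d' *: c') = a' * b' + c' * d'.
      by move=> -> ->; rewrite !scale0r !add0r /GRing.scale /=; ring.
    exact: key.
  - apply: continuousM => //; exact: continuous_invmx_at.
  - by apply: differentiableD; exact: differentiableM.
  - change (A z0 * 'D_(delta_mx 0 q) B z0 + B z0 * 'D_(delta_mx 0 q) A z0 = 0).
    by rewrite A0 B0 !mul0r addr0.
under eq_bigr => p _ do (under eq_bigr => q _ do rewrite D2; rewrite -mulr_sumr).
by rewrite -mulr_sumr mulKf.
Unshelve. all: by end_near. Qed.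

Lemma lvf2_product (a b : G -> R) v : smooth a -> smooth b -> a 1%g = 0 -> b 1%g = 0 ->
  lvf v (lvf v (fun x => a x * b x)) 1%g = 2 * (lvf v a 1%g * lvf v b 1%g).
Proof.
move=> sa sb a1 b1.
have -> : lvf v (fun x => a x * b x) = (fun x => a x * lvf v b x + b x * lvf v a x).
  by apply/funext => x; rewrite lvfM.
have sva := smooth_lvf v sa; have svb := smooth_lvf v sb.
rewrite lvfD; [|exact: smoothM|exact: smoothM].
rewrite (lvfM v 1%g sa svb) (lvfM v 1%g sb sva).
have key (x y p q r s : R) : x = 0 -> y = 0 -> x * r + q * p + (y * s + p * q) = 2 * (p * q).
  by move=> -> ->; ring.
exact: key.
Qed.

Lemma sum_delta2 (c : 'I_n -> 'I_n -> R) i k :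
  \sum_p \sum_q c p q * ((p == i)%:R * (q == k)%:R) = c i k.
Proof.
rewrite (bigD1 i)//= [X in _ + X]big1 ?addr0 => [|p /negbTE pi]; last first.
  by apply: big1 => q _; rewrite pi mul0r mulr0.
rewrite (bigD1 k)//= big1 ?addr0 ?eqxx ?mulr1// => q /negbTE qk.
by rewrite qk !mulr0.
Qed.

(* Applying [laplaceX] to the product of two functions vanishing at the identity
   isolates the principal symbols of its two sides. *)
Lemma frame_metric_inv : X \in unitmx -> X^T *m X = invmx (g 1%g z0) /\ g 1%g z0 \in unitmx.
Proof.
move=> uX; have i0 := @chart1_origin_img R n G.
have coord i := exists_cut_coord (1%g : G) i.
have XX i k : \sum_j lvf (row j X) (lvf (row j X)
    (fun x => projT1 (cid (coord i)) x * projT1 (cid (coord k)) x)) 1%g = 2 * (X^T *m X) i k.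
  rewrite mxE mulr_sumr; apply: eq_bigr => j _.
  case: (cid (coord i)) => a [sa a1 Da] /=; case: (cid (coord k)) => b [sb b1 Db] /=.
  rewrite lvf2_product//; congr (_ * _).
  have E (c : G -> R) v : lvf v c 1%g = 'D_v (c \o chart_inv (1%g : G)) z0.
    rewrite /lvf (_ : (fun z => c (1 * chart_inv (1%g : G) z)%g) = c \o chart_inv (1%g : G))//.
    by apply/funext => z; rewrite /= mul1g.
  by rewrite !E Da Db !mxE.
(* If the density vanished, the convention [0^-1 = 0] would make the Laplacian zero at the identity
   and so [X^T *m X = 0]. As [X] is invertible this forces [n = 0], where the determinant is 1. *)
have vol0 : Num.sqrt (\det (g 1%g z0)) != 0.
  apply/negP => /eqP v0; have L0 (f : G -> R) : laplace_beltrami g f 1%g = 0.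
    by rewrite /laplace_beltrami -/(chart1_origin) v0 invr0 mul0r oppr0.
  have XX0 : X^T *m X = 0.
    apply/matrixP => i k; have := XX i k.
    have sab : smooth (fun x => projT1 (cid (coord i)) x * projT1 (cid (coord k)) x).
      case: (cid (coord i)) => a [sa a1 Da] /=; case: (cid (coord k)) => b [sb b1 Db] /=.
      exact: smoothM.
    have := laplaceX 1%g sab; rewrite L0 => /eqP; rewrite eq_sym oppr_eq0 => /eqP -> /esym/eqP.
    by rewrite mulf_eq0 pnatr_eq0 /= => /eqP ->; rewrite mxE.
  have uXX : X^T *m X \in unitmx by rewrite unitmx_mul unitmx_tr uX.
  have n0 : n = 0%N.
    have [//|n_gt0] := posnP n; move: uXX; rewrite XX0 => /mulmxV.
    rewrite mul0mx => /matrixP /(_ (Ordinal n_gt0) (Ordinal n_gt0)) /eqP.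
    by rewrite !mxE eqxx eq_sym oner_eq0.
  have det1 m (A : 'M[R]_m) : m = 0%N -> \det A = 1 by move=> m0; subst m; exact: det_mx00.
  by move/eqP: v0; rewrite det1// sqrtr1 oner_eq0.
have dg : \det (g 1%g z0) != 0.
  by apply: contraNneq vol0 => ->; rewrite sqrtr0.
split; last by rewrite unitmxE unitfE.
have gsym : (invmx (g 1%g z0))^T = invmx (g 1%g z0).
  by rewrite trmx_inv Defs.metric_sym.
apply/matrixP => i k; have := XX i k.
have sab : smooth (fun x => projT1 (cid (coord i)) x * projT1 (cid (coord k)) x).
  case: (cid (coord i)) => a [sa a1 Da] /=; case: (cid (coord k)) => b [sb b1 Db] /=.
  exact: smoothM.
rewrite -[X in X = _ -> _]opprK -laplaceX//.
case: (cid (coord i)) => a [sa a1 Da] /=; case: (cid (coord k)) => b [sb b1 Db] /=.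
rewrite laplace_product// opprK.
rewrite (eq_bigr (fun p => \sum_q (invmx (g 1%g z0) p q * ((p == i)%:R * (q == k)%:R) +
    invmx (g 1%g z0) p q * ((p == k)%:R * (q == i)%:R)))); last first.
  move=> p _; apply: eq_bigr => q _; rewrite !Da !Db !mxE !eqxx /= mulrDr.
  by rewrite ![i == _]eq_sym ![k == _]eq_sym.
under eq_bigr do rewrite big_split /=.
rewrite big_split /= !sum_delta2 => E; apply: (@mulfI _ 2); first by rewrite pnatr_eq0.
have /matrixP/(_ i k) := gsym; rewrite mxE => gs; rewrite -E gs; ring.
Qed.

End LaplaceFrame.

Local Open Scope complex_scope.
Local Open Scope sesquilinear_scope.
Local Notation conjC := Num.conj.

(** * Complex-valued functions *)

Section ComplexCoordinates.
Context {R : realType}.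
Implicit Types x y z : R[i].

Lemma cReD x y : complex.Re (x + y) = complex.Re x + complex.Re y.
Proof. by case: x; case: y. Qed.

Lemma cImD x y : complex.Im (x + y) = complex.Im x + complex.Im y.
Proof. by case: x; case: y. Qed.

Lemma cReN x : complex.Re (- x) = - complex.Re x.
Proof. by case: x. Qed.

Lemma cImN x : complex.Im (- x) = - complex.Im x.
Proof. by case: x. Qed.

Lemma cReM x y : complex.Re (x * y) =
  complex.Re x * complex.Re y - complex.Im x * complex.Im y.
Proof. by case: x; case: y. Qed.

Lemma cImM x y : complex.Im (x * y) =
  complex.Re x * complex.Im y + complex.Im x * complex.Re y.
Proof. by case: x => a b; case: y => c d. Qed.

Lemma cconjE x : conjC x = complex.Re x -i* complex.Im x.
Proof. by case: x. Qed.

Lemma cReJ x : complex.Re (conjC x) = complex.Re x.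
Proof. by rewrite cconjE. Qed.

Lemma cImJ x : complex.Im (conjC x) = - complex.Im x.
Proof. by rewrite cconjE. Qed.

Lemma cRe_sum (I : Type) (s : seq I) (F : I -> R[i]) :
  complex.Re (\sum_(i <- s) F i) = \sum_(i <- s) complex.Re (F i).
Proof. by elim: s => [|i s ih]; rewrite ?big_nil// !big_cons cReD ih. Qed.

Lemma cIm_sum (I : Type) (s : seq I) (F : I -> R[i]) :
  complex.Im (\sum_(i <- s) F i) = \sum_(i <- s) complex.Im (F i).
Proof. by elim: s => [|i s ih]; rewrite ?big_nil// !big_cons cImD ih. Qed.

Lemma complex_ext x y : complex.Re x = complex.Re y -> complex.Im x = complex.Im y -> x = y.
Proof. by case: x => a b; case: y => c d /= -> ->. Qed.

Lemma normc_sqr z : Normc.normc z ^+ 2 = complex.Re z ^+ 2 + complex.Im z ^+ 2.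
Proof. by case: z => a b /=; rewrite sqr_sqrtr// addr_ge0// sqr_ge0. Qed.

Lemma normc_ge0 z : 0 <= Normc.normc z.
Proof. by case: z => a b; rewrite /= sqrtr_ge0. Qed.

Lemma normc_sqrC z : (Normc.normc z ^+ 2)%:C = z * conjC z.
Proof.
rewrite normc_sqr; apply: complex_ext; rewrite ?cReM ?cImM ?cReJ ?cImJ /=; ring.
Qed.

Lemma Re_le_normc z : `|complex.Re z| <= Normc.normc z.
Proof.
rewrite -(@ler_pXn2r _ 2)// ?nnegrE ?normc_ge0// normc_sqr real_normK ?num_real//.
by rewrite lerDl sqr_ge0.
Qed.

Lemma Im_le_normc z : `|complex.Im z| <= Normc.normc z.
Proof.
rewrite -(@ler_pXn2r _ 2)// ?nnegrE ?normc_ge0// normc_sqr real_normK ?num_real//.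
by rewrite lerDr sqr_ge0.
Qed.

Lemma normc_le_ReIm z : Normc.normc z <= `|complex.Re z| + `|complex.Im z|.
Proof.
rewrite -(@ler_pXn2r _ 2)// ?nnegrE ?normc_ge0 ?addr_ge0// normc_sqr sqrrD.
rewrite !real_normK ?num_real// -addrA lerD2l lerDr.
by rewrite mulrn_wge0// mulr_ge0.
Qed.

End ComplexCoordinates.

Section ComplexContinuity.
Context {R : realType} {T : topologicalType}.
Implicit Types f h : T -> R[i].

Definition ccont f : Prop :=
  continuous (fun x => complex.Re (f x)) /\ continuous (fun x => complex.Im (f x)).

Lemma ccont_eq f h : f =1 h -> ccont f -> ccont h.
Proof. by move=> /funext ->. Qed.

Lemma ccont_cst (a : R[i]) : ccont (fun=> a).
Proof. by split; exact: continuous_cst. Qed.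

Lemma continuous_add (f h : T -> R) : continuous f -> continuous h ->
  continuous (fun x => f x + h x).
Proof. by move=> cf ch x; exact (continuousD (cf x) (ch x)). Qed.

Lemma continuous_mul (f h : T -> R) : continuous f -> continuous h ->
  continuous (fun x => f x * h x).
Proof. by move=> cf ch x; exact (continuousM (cf x) (ch x)). Qed.

Lemma continuous_opp (f : T -> R) : continuous f -> continuous (fun x => - f x).
Proof. by move=> cf x; exact (continuousN (cf x)). Qed.

Lemma continuous_sub (f h : T -> R) : continuous f -> continuous h ->
  continuous (fun x => f x - h x).
Proof. by move=> cf ch; apply: continuous_add => //; exact: continuous_opp. Qed.

Lemma ccontD f h : ccont f -> ccont h -> ccont (fun x => f x + h x).
Proof.
move=> [f1 f2] [h1 h2]; split.
  by under eq_fun do rewrite cReD; exact: continuous_add.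
by under eq_fun do rewrite cImD; exact: continuous_add.
Qed.

Lemma ccontM f h : ccont f -> ccont h -> ccont (fun x => f x * h x).
Proof.
move=> [f1 f2] [h1 h2]; split.
  by under eq_fun do rewrite cReM; apply: continuous_sub; exact: continuous_mul.
by under eq_fun do rewrite cImM; apply: continuous_add; exact: continuous_mul.
Qed.

Lemma ccontJ f : ccont f -> ccont (fun x => conjC (f x)).
Proof.
move=> [f1 f2]; split; first by under eq_fun do rewrite cReJ.
by under eq_fun do rewrite cImJ; exact: continuous_opp.
Qed.

Lemma ccont_sum (I : Type) (s : seq I) (F : I -> T -> R[i]) :
  (forall i, ccont (F i)) -> ccont (fun x => \sum_(i <- s) F i x).
Proof.
move=> cF; elim: s => [|i s ih].
  by under eq_fun do rewrite big_nil; exact: ccont_cst.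
by under eq_fun do rewrite big_cons; exact: ccontD.
Qed.

Lemma ccont_real (f : T -> R) : continuous f -> ccont (fun x => (f x)%:C).
Proof. by move=> cf; split => //=; exact: continuous_cst. Qed.

End ComplexContinuity.

Lemma ccont_comp (R : realType) (T U : topologicalType) (u : T -> U) (f : U -> R[i]) :
  continuous u -> ccont f -> ccont (fun x => f (u x)).
Proof. by move=> cu [f1 f2]; split; [exact (continuous_fct_comp cu f1)|exact (continuous_fct_comp cu f2)]. Qed.

Section ComplexIntegral.
Context {R : realType} {n : nat} {G : lieGroupType R n}.
Hypothesis compactG : compact [set: G].
Variable mu : probability (borel G) R.
Implicit Types f h : G -> R[i].

Definition cintegrable f : Prop :=
  haar_integrable mu (fun x => complex.Re (f x)) /\
  haar_integrable mu (fun x => complex.Im (f x)).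

Lemma ccont_integrable f : ccont f -> cintegrable f.
Proof. by move=> [f1 f2]; split; exact: continuous_integrable. Qed.

Lemma cintegralE f : cintegral mu f =
  haar_int mu (fun x => complex.Re (f x)) +i* haar_int mu (fun x => complex.Im (f x)).
Proof. by []. Qed.

Lemma cintegral_ext f h : f =1 h -> cintegral mu f = cintegral mu h.
Proof. by move=> /funext ->. Qed.

Lemma cintegrableD f h : cintegrable f -> cintegrable h ->
  cintegrable (fun x => f x + h x).
Proof.
move=> [f1 f2] [h1 h2]; split.
  by under eq_fun do rewrite cReD; exact: haar_integrableD.
by under eq_fun do rewrite cImD; exact: haar_integrableD.
Qed.

Lemma cintegralD f h : cintegrable f -> cintegrable h ->
  cintegral mu (fun x => f x + h x) = cintegral mu f + cintegral mu h.
Proof.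
move=> [f1 f2] [h1 h2]; rewrite !cintegralE; apply: complex_ext; rewrite /=.
  by rewrite -haar_intD//; apply: haar_int_ext => x; rewrite cReD.
by rewrite -haar_intD//; apply: haar_int_ext => x; rewrite cImD.
Qed.

Lemma cintegrableZ a f : cintegrable f -> cintegrable (fun x => a * f x).
Proof.
move=> [f1 f2]; split.
  under eq_fun do rewrite cReM.
  by apply: haar_integrableB; exact: haar_integrableZ.
under eq_fun do rewrite cImM.
by apply: haar_integrableD; exact: haar_integrableZ.
Qed.

Lemma cintegralZ a f : cintegrable f ->
  cintegral mu (fun x => a * f x) = a * cintegral mu f.
Proof.
move=> [f1 f2]; rewrite !cintegralE; apply: complex_ext; rewrite ?cReM ?cImM /=.
  rewrite -!haar_intZ// -haar_intB; [|exact: haar_integrableZ|exact: haar_integrableZ].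
  by apply: haar_int_ext => x; rewrite cReM.
rewrite -!haar_intZ// -haar_intD; [|exact: haar_integrableZ|exact: haar_integrableZ].
by apply: haar_int_ext => x; rewrite cImM.
Qed.

Lemma cintegral_cst a : cintegral mu (fun=> a) = a.
Proof. by rewrite cintegralE !haar_int_cst; case: a. Qed.

Lemma cintegral_sum (I : Type) (s : seq I) (F : I -> G -> R[i]) :
  (forall i, cintegrable (F i)) ->
  cintegrable (fun x => \sum_(i <- s) F i x) /\
  cintegral mu (fun x => \sum_(i <- s) F i x) = \sum_(i <- s) cintegral mu (F i).
Proof.
move=> cF; elim: s => [|i s [ih1 ih2]].
  split; first by under eq_fun do rewrite big_nil; apply: ccont_integrable; exact: ccont_cst.
  by under eq_fun do rewrite big_nil; rewrite big_nil cintegral_cst.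
split; first by under eq_fun do rewrite big_cons; exact: cintegrableD.
by under eq_fun do rewrite big_cons; rewrite big_cons cintegralD// ih2.
Qed.

Lemma cintegral_real (f : G -> R) : cintegral mu (fun x => (f x)%:C) = (haar_int mu f)%:C.
Proof. by rewrite cintegralE /= haar_int_cst. Qed.

Lemma cintegral_left f a : is_haar mu -> ccont f ->
  cintegral mu (fun x => f (a * x)%g) = cintegral mu f.
Proof.
move=> haar_mu [f1 f2]; rewrite !cintegralE; congr Complex.
  exact: (haar_int_left compactG haar_mu a f1).
exact: (haar_int_left compactG haar_mu a f2).
Qed.

Lemma cintegral_right f a : is_haar mu -> ccont f ->
  cintegral mu (fun x => f (x * a)%g) = cintegral mu f.
Proof.
move=> haar_mu [f1 f2]; rewrite !cintegralE; congr Complex.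
  exact: (haar_int_right compactG haar_mu a f1).
exact: (haar_int_right compactG haar_mu a f2).
Qed.

End ComplexIntegral.

Section ComplexSmooth.
Context {R : realType} {n : nat} {G : lieGroupType R n}.
Implicit Types f h : G -> R[i].

Lemma csmooth_ccont f : csmooth f -> ccont f.
Proof. by move=> [f1 f2]; split; exact: smooth_continuous. Qed.

Lemma csmooth_eq f h : f =1 h -> csmooth f -> csmooth h.
Proof. by move=> /funext ->. Qed.

Lemma csmooth_cst a : csmooth (fun _ : G => a).
Proof. by split; exact: smooth_cst. Qed.

Lemma csmoothD f h : csmooth f -> csmooth h -> csmooth (fun x => f x + h x).
Proof.
move=> [f1 f2] [h1 h2]; split.
  by under eq_fun do rewrite cReD; exact: smoothD.
by under eq_fun do rewrite cImD; exact: smoothD.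
Qed.

Lemma csmoothM f h : csmooth f -> csmooth h -> csmooth (fun x => f x * h x).
Proof.
move=> [f1 f2] [h1 h2]; split.
  by under eq_fun do rewrite cReM; apply: smoothB; exact: smoothM.
by under eq_fun do rewrite cImM; apply: smoothD; exact: smoothM.
Qed.

Lemma csmoothZ a f : csmooth f -> csmooth (fun x => a * f x).
Proof. by apply: csmoothM; exact: csmooth_cst. Qed.

Lemma csmoothJ f : csmooth f -> csmooth (fun x => conjC (f x)).
Proof.
move=> [f1 f2]; split; first by under eq_fun do rewrite cReJ.
by under eq_fun do rewrite cImJ; exact: smoothN.
Qed.

Lemma csmooth_sum (I : Type) (s : seq I) (F : I -> G -> R[i]) :
  (forall i, csmooth (F i)) -> csmooth (fun x => \sum_(i <- s) F i x).
Proof.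
move=> sF; elim: s => [|i s ih].
  by under eq_fun do rewrite big_nil; exact: csmooth_cst.
by under eq_fun do rewrite big_cons; exact: csmoothD.
Qed.

Lemma csmooth_real (f : G -> R) : smooth f -> csmooth (fun x => (f x)%:C).
Proof. by move=> sf; split => //; exact: smooth_cst. Qed.

Local Notation clvf v := (clift (lvf v)).

Lemma csmooth_lvf v f : csmooth f -> csmooth (clvf v f).
Proof. by move=> [f1 f2]; split => /=; exact: smooth_lvf. Qed.

Lemma clvfD v f h : csmooth f -> csmooth h ->
  clvf v (fun x => f x + h x) = (fun x => clvf v f x + clvf v h x).
Proof.
move=> [f1 f2] [h1 h2]; apply/funext => x; rewrite /clift; apply: complex_ext => /=.
  by rewrite (_ : (fun y => complex.Re (f y + h y)) = (fun y => complex.Re (f y) + complex.Re (h y)))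
    ?lvfD//; apply/funext => y; rewrite cReD.
by rewrite (_ : (fun y => complex.Im (f y + h y)) = (fun y => complex.Im (f y) + complex.Im (h y)))
    ?lvfD//; apply/funext => y; rewrite cImD.
Qed.

Lemma clvfM v f h x : csmooth f -> csmooth h ->
  clvf v (fun x => f x * h x) x = f x * clvf v h x + h x * clvf v f x.
Proof.
move=> [f1 f2] [h1 h2]; rewrite /clift; apply: complex_ext; rewrite ?cReD ?cImD ?cReM ?cImM /=.
  rewrite (_ : (fun y => complex.Re (f y * h y)) = (fun y => complex.Re (f y) * complex.Re (h y) -
    complex.Im (f y) * complex.Im (h y))); last by apply/funext => y; rewrite cReM.
  rewrite lvfB; [|exact: smoothM|exact: smoothM].
  rewrite (lvfM v x f1 h1) (lvfM v x f2 h2).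
  move: (lvf v _ x) (lvf v _ x) (lvf v _ x) (lvf v _ x) => p q r s; ring.
rewrite (_ : (fun y => complex.Im (f y * h y)) = (fun y => complex.Re (f y) * complex.Im (h y) +
    complex.Im (f y) * complex.Re (h y))); last by apply/funext => y; rewrite cImM.
rewrite lvfD; [|exact: smoothM|exact: smoothM].
rewrite (lvfM v x f1 h2) (lvfM v x f2 h1).
move: (lvf v _ x) (lvf v _ x) (lvf v _ x) (lvf v _ x) => p q r s; ring.
Qed.

Lemma lvf_cst v (a : R) : lvf v (fun _ : G => a) = (fun=> 0).
Proof. by apply/funext => x; rewrite /lvf derive_cst. Qed.

Lemma clvf_cst v (a : R[i]) : clvf v (fun _ : G => a) = (fun=> 0).
Proof. by apply/funext => x; rewrite /clift !lvf_cst. Qed.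

Lemma clvfZ v a f : csmooth f ->
  clvf v (fun x => a * f x) = (fun x => a * clvf v f x).
Proof.
move=> sf; apply/funext => x; rewrite clvfM//; last exact: csmooth_cst.
by rewrite clvf_cst mulr0 addr0.
Qed.

Lemma clvf_sum v (I : Type) (s : seq I) (F : I -> G -> R[i]) :
  (forall i, csmooth (F i)) ->
  clvf v (fun x => \sum_(i <- s) F i x) = (fun x => \sum_(i <- s) clvf v (F i) x).
Proof.
move=> sF; elim: s => [|i s ih].
  rewrite (_ : (fun x => _) = (fun=> 0)); last by apply/funext => x; rewrite big_nil.
  by rewrite clvf_cst; apply/funext => x; rewrite big_nil.
rewrite (_ : (fun x => _) = (fun x => F i x + \sum_(j <- s) F j x)).
  rewrite clvfD ?ih//; last exact: csmooth_sum.
  by apply/funext => x; rewrite big_cons.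
by apply/funext => x; rewrite big_cons.
Qed.

Lemma clvfJ v f x : csmooth f -> clvf v (fun x => conjC (f x)) x = conjC (clvf v f x).
Proof.
move=> [f1 f2]; rewrite /clift cconjE; apply: complex_ext => /=.
  by rewrite (_ : (fun y => complex.Re (conjC (f y))) = (fun y => complex.Re (f y)))//;
    apply/funext => y; rewrite cReJ.
rewrite (_ : (fun y => complex.Im (conjC (f y))) = (fun y => -1 * complex.Im (f y))).
  by rewrite lvfZ// mulN1r.
by apply/funext => y; rewrite cImJ mulN1r.
Qed.

Lemma clvf_left v f (a x : G) : clvf v (fun y => f (a * y)%g) x = clvf v f (a * x)%g.
Proof.
have L (F : G -> R) : lvf v (fun y => F (a * y)%g) x = lvf v F (a * x)%g.
  rewrite /lvf; set F1 := fun z => _; set F2 := fun z => _.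
  by have -> : F1 = F2 by apply/funext => z; rewrite /F1 mulgA.
by rewrite /clift (L (fun y => complex.Re (f y))) (L (fun y => complex.Im (f y))).
Qed.

Lemma smooth_right (f : G -> R) (a : G) : smooth f -> smooth (fun y => f (y * a)%g).
Proof.
move=> sf; have := smooth_family_slice (smooth_family_mul a sf) (chart_imgP (chart_dom_mem a)).
by rewrite chartK//; exact: chart_dom_mem.
Qed.

Lemma csmooth_right f (a : G) : csmooth f -> csmooth (fun y => f (y * a)%g).
Proof. by move=> [f1 f2]; split; [exact (smooth_right a f1)|exact (smooth_right a f2)]. Qed.

Lemma clin_comb_vf (X : 'M[R]_n) (alpha : 'rV[R]_n) f x :
  clift (lin_comb_vf X alpha) f x = \sum_j (alpha 0 j)%:C * clvf (row j X) f x.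
Proof.
rewrite /clift /lin_comb_vf; apply: complex_ext; rewrite ?cRe_sum ?cIm_sum /=.
  by apply: eq_bigr => j _; rewrite mul0r subr0.
by apply: eq_bigr => j _; rewrite mul0r addr0.
Qed.

Lemma clvf_coord v f x : csmooth f ->
  clvf v f x = \sum_i (v 0 i)%:C * clvf (delta_mx 0 i) f x.
Proof.
move=> [f1 f2]; rewrite /clift; apply: complex_ext; rewrite ?cRe_sum ?cIm_sum /=.
  by rewrite lvf_coord//; apply: eq_bigr => j _; rewrite mul0r subr0.
by rewrite lvf_coord//; apply: eq_bigr => j _; rewrite mul0r addr0.
Qed.

Lemma cintegral_clvf (compactG : compact [set: G]) (mu : probability (borel G) R) v f :
  is_haar mu -> csmooth f -> cintegral mu (clvf v f) = 0.
Proof.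
move=> haar_mu [f1 f2]; rewrite cintegralE.
by apply: complex_ext => /=; exact: haar_int_lvf.
Qed.

Lemma cintegral_by_parts (compactG : compact [set: G]) (mu : probability (borel G) R) v f h :
  is_haar mu -> csmooth f -> csmooth h ->
  cintegral mu (fun x => f x * clvf v h x) = - cintegral mu (fun x => clvf v f x * h x).
Proof.
move=> haar_mu sf sh; apply/eqP; rewrite -addr_eq0; apply/eqP.
have c1 := csmooth_ccont (csmoothM sf (csmooth_lvf v sh)).
have c2 := csmooth_ccont (csmoothM (csmooth_lvf v sf) sh).
rewrite -cintegralD; try exact: ccont_integrable.
rewrite -(cintegral_clvf compactG v haar_mu (csmoothM sf sh)).
apply: cintegral_ext => x; rewrite clvfM//; congr (_ + _); exact: mulrC.
Qed.

End ComplexSmooth.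

(** * Representations and the Casimir element *)

(** A matrix of maximal rank among those with rows in [P] spans [P], since adding a further vector
    of [P] cannot raise its rank. *)
Lemma subspace_mx (F : fieldType) d (P : 'rV[F]_d -> Prop) : P 0 ->
  (forall a u v, P u -> P v -> P (a *: u + v)) ->
  exists W : 'M[F]_d, forall u, P u <-> (u <= W)%MS.
Proof.
move=> P0 Plin; pose Q k := `[< exists W : 'M[F]_d, (forall i, P (row i W)) /\ \rank W = k >].
have subP m (W : 'M[F]_(m, d)) u : (forall i, P (row i W)) -> (u <= W)%MS -> P u.
  move=> PW /submxP[D ->]; rewrite mulmx_sum_row.
  elim/big_ind : _ => [//|v w Pv Pw|i _].
    by rewrite -[v]scale1r; exact: Plin.
  by rewrite -[_ *: _]addr0; exact: Plin.
have exQ : exists k, Q k.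
  by exists 0%N; apply/asboolP; exists 0; split; [move=> i; rewrite row0|rewrite mxrank0].
have bQ k : Q k -> (k <= d)%N by move=> /asboolP[W [_ <-]]; exact: rank_leq_row.
case: (ex_maxnP exQ bQ) => k /asboolP[W [PW rW]] kmax; exists W => u; split; last exact: subP.
move=> Pu; have PWu i : P (row i <<(W + u)%MS>>%MS).
  have /sub_addsmxP[[D1 D2] /= ->] : (row i <<(W + u)%MS>>%MS <= W + u)%MS.
    by rewrite (submx_trans (row_sub _ _))// genmxE.
  rewrite (_ : D1 *m W + D2 *m u = D2 0 0 *: u + D1 *m W).
    by apply: Plin => //; apply: (subP _ W) => //; exact: submxMl.
  by rewrite addrC -mul_scalar_mx -mx11_scalar.
have : (\rank <<(W + u)%MS>>%MS <= k)%N by apply: kmax; apply/asboolP; exists <<(W + u)%MS>>%MS.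
rewrite -rW genmxE => h; have /andP[_ +] : (W == W + u)%MS.
  by rewrite -(geq_leqif (mxrank_leqif_eq (addsmxSl W u))).
by apply: submx_trans; exact: addsmxSr.
Qed.

Lemma nbhs_gt_continuous (R : realType) (T : topologicalType) (f : T -> R) x a :
  continuous f -> a < f x -> nbhs x [set y | a < f y].
Proof. by move=> cf h; have /cvgr_gt/(_ _ h) := cf x. Qed.

Section Representations.
Context {R : realType} {n : nat} {G : lieGroupType R n}.
Hypothesis compactG : compact [set: G].
Variable mu : probability (borel G) R.
Hypothesis haar_mu : is_haar mu.
Local Notation C := R[i].
Local Notation z0 := (@chart1_origin R n G).

(** Possibly reducible representations: eigenspaces, conjugates and compressions to invariant
    subspaces are handled at this level before being decomposed. *)
Definition unirep d (A : G -> 'M[C]_d) : Prop :=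
  [/\ forall x y, A (x * y)%g = A x *m A y, forall x, A x \is unitarymx &
      forall i j, ccont (fun x => A x i j)].

Lemma irrep_unirep (xi : irrep G) : unirep xi.
Proof.
split; [exact: irrep_mul|exact: irrep_unitary|].
move=> i j; exact: irrep_continuous.
Qed.

Lemma unirep1 d (A : G -> 'M[C]_d) : unirep A -> A 1%g = 1%:M.
Proof.
move=> [AM AU _]; have u : A 1%g \in unitmx by exact: unitarymx_unit.
have : A 1%g *m A 1%g = A 1%g by rewrite -AM mulg1.
by move=> /(congr1 (mulmx (invmx (A 1%g)))); rewrite mulKmx// mulVmx.
Qed.

Lemma unirepV d (A : G -> 'M[C]_d) x : unirep A -> A x^-1%g = (A x)^t*.
Proof.
move=> rA; have [AM AU _] := rA; have u : A x \in unitmx by exact: unitarymx_unit.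
have := congr1 (mulmx (invmx (A x))) (AM x x^-1%g).
by rewrite mulgV unirep1// mulmx1 mulKmx// invmx_unitary.
Qed.

Lemma unirepCt d (A : G -> 'M[C]_d) x : unirep A -> (A x)^t* *m A x = 1%:M.
Proof. by move=> rA; rewrite -unirepV//; have [AM _ _] := rA; rewrite -AM mulVg unirep1. Qed.

Lemma trCE m p (A : 'M[C]_(m, p)) i j : (A^t*) i j = conjC (A j i).
Proof. by rewrite !mxE. Qed.

Definition mxint p q (F : G -> 'M[C]_(p, q)) : 'M[C]_(p, q) :=
  \matrix_(i, j) cintegral mu (fun x => F x i j).

Definition mxcont p q (F : G -> 'M[C]_(p, q)) : Prop := forall i j, ccont (fun x => F x i j).

Lemma mxcont_mul p q r (F : G -> 'M[C]_(p, q)) (H : G -> 'M[C]_(q, r)) :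
  mxcont F -> mxcont H -> mxcont (fun x => F x *m H x).
Proof.
move=> cF cH i j; apply: (@ccont_eq _ _ (fun x => \sum_k F x i k * H x k j)).
  by move=> x; rewrite mxE.
by apply: ccont_sum => k; exact: ccontM.
Qed.

Lemma mxcont_cst p q (A : 'M[C]_(p, q)) : mxcont (fun=> A).
Proof. by move=> i j; exact: ccont_cst. Qed.

Lemma mxcont_trC p q (F : G -> 'M[C]_(p, q)) : mxcont F -> mxcont (fun x => (F x)^t*).
Proof.
move=> cF i j; apply: (@ccont_eq _ _ (fun x => conjC (F x j i))).
  by move=> x; rewrite trCE.
exact: ccontJ.
Qed.

Lemma mxint_mull p q r (B : 'M[C]_(r, p)) (F : G -> 'M[C]_(p, q)) : mxcont F ->
  mxint (fun x => B *m F x) = B *m mxint F.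
Proof.
move=> cF; apply/matrixP => i j; rewrite !mxE.
rewrite (@cintegral_ext _ _ _ mu _ (fun x => \sum_k B i k * F x k j)); last first.
  by move=> x; rewrite mxE.
have [_ ->] := cintegral_sum compactG (index_enum 'I_p)
  (fun k => cintegrableZ (B i k) (ccont_integrable compactG mu (cF k j))).
by apply: eq_bigr => k _; rewrite cintegralZ ?mxE//; exact: ccont_integrable.
Qed.

Lemma mxint_mulr p q r (F : G -> 'M[C]_(p, q)) (B : 'M[C]_(q, r)) : mxcont F ->
  mxint (fun x => F x *m B) = mxint F *m B.
Proof.
move=> cF; apply/matrixP => i j; rewrite !mxE.
rewrite (@cintegral_ext _ _ _ mu _ (fun x => \sum_k B k j * F x i k)); last first.
  by move=> x; rewrite mxE; apply: eq_bigr => k _; exact: mulrC.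
have [_ ->] := cintegral_sum compactG (index_enum 'I_q)
  (fun k => cintegrableZ (B k j) (ccont_integrable compactG mu (cF i k))).
by apply: eq_bigr => k _; rewrite cintegralZ ?mxE 1?mulrC//; exact: ccont_integrable.
Qed.

Lemma mxint_left p q (F : G -> 'M[C]_(p, q)) a : mxcont F ->
  mxint (fun x => F (a * x)%g) = mxint F.
Proof.
move=> cF; apply/matrixP => i j; rewrite !mxE.
exact: (cintegral_left compactG a haar_mu (cF i j)).
Qed.

Lemma mxint_right p q (F : G -> 'M[C]_(p, q)) a : mxcont F ->
  mxint (fun x => F (x * a)%g) = mxint F.
Proof.
move=> cF; apply/matrixP => i j; rewrite !mxE.
exact: (cintegral_right compactG a haar_mu (cF i j)).
Qed.

Lemma mxint_ext p q (F H : G -> 'M[C]_(p, q)) : F =1 H -> mxint F = mxint H.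
Proof. by move=> /funext ->. Qed.

Lemma smooth_conv (phi psi : G -> R) : smooth phi -> continuous psi ->
  smooth (fun x => haar_int mu (fun y => phi (y * x)%g * psi y)).
Proof.
move=> sphi cpsi x0.
exact (smooth_haar_int_family compactG mu (open_chart_img x0) (smooth_family_mul x0 sphi) cpsi).
Qed.

(* The vectors with a smooth orbit form an invariant subspace; it is not zero, as
   averaging against a smooth bump at the identity shows. *)
Lemma irrep_csmooth (xi : irrep G) i j : csmooth (fun x => xi x i j).
Proof.
have rxi := irrep_unirep xi; have [xM xU xC] := rxi.
pose Sm (u : 'rV[C]_(irrep_dim xi)) := forall i, csmooth (fun x => \sum_k xi x i k * u 0 k).
have [W hW] : exists W : 'M[C]_(irrep_dim xi), forall u, Sm u <-> (u <= W)%MS.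
  apply: subspace_mx => [i'|a u v su sv i'].
    apply: (@csmooth_eq _ _ _ (fun=> 0)); last exact: csmooth_cst.
    by move=> x; rewrite big1// => k _; rewrite mxE mulr0.
  apply: (@csmooth_eq _ _ _ (fun x => a * (\sum_k xi x i' k * u 0 k) + \sum_k xi x i' k * v 0 k)).
    move=> x; rewrite mulr_sumr -big_split /=; apply: eq_bigr => k _; rewrite !mxE; ring.
  by apply: csmoothD => //; apply: csmoothZ.
have stab x : (W *m (xi x)^T <= W)%MS.
  apply/row_subP => l; apply/hW => i'; rewrite row_mul.
  have /hW sl : (row l W <= W)%MS by exact: row_sub.
  apply: (@csmooth_eq _ _ _ (fun y => \sum_k xi (y * x)%g i' k * row l W 0 k)); last first.
    exact: csmooth_right (sl i').
  move=> y; rewrite xM.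
  transitivity ((xi y *m (xi x *m (row l W)^T)) i' 0).
    by rewrite mulmxA mxE; apply: eq_bigr => k _; rewrite !mxE.
  rewrite mxE; apply: eq_bigr => k _; congr (_ * _).
  by rewrite !mxE; apply: eq_bigr => m _; rewrite !mxE mulrC.
have [W0|fW] := irrep_irreducible stab; last first.
  have /hW/(_ i) : ((delta_mx 0 j : 'rV[C]_(irrep_dim xi)) <= W)%MS by exact: submx_full.
  apply: csmooth_eq => x; rewrite (bigD1 j)//= mxE !eqxx mulr1 big1 ?addr0// => k kj.
  by rewrite mxE (negbTE kj) andbF mulr0.
exfalso; pose i0 := Ordinal (irrep_dim_gt0 xi).
have cV k l : ccont (fun y => xi y^-1%g k l).
  exact (ccont_comp (@lie_inv_continuous R n G) (xC k l)).
(* On the support of the bump this diagonal coefficient has positive real part, which keeps the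
   coordinate [i0] of the average [u] away from 0. *)
have nN : nbhs (1%g : G) [set y | 1 / 2 < complex.Re (xi y^-1%g i0 i0)].
  have [c _] := cV i0 i0; apply: (@nbhs_gt_continuous R G _ 1%g _ c).
  by rewrite /= invg1 unirep1// mxE eqxx /= ltr_pdivrMr// mul1r ltr1n.
have [phi [sphi phi0 phi1 phiN]] := exists_bump nN.
have cphi := smooth_continuous sphi.
(* Applying [xi x] to this average and replacing [y] by [y * x] moves the dependence on [x] from
   [xi], only continuous so far, to the smooth [phi]. *)
pose u : 'rV[C]_(irrep_dim xi) := \row_k cintegral mu (fun y => (phi y)%:C * xi y^-1%g k i0).
have cu k : ccont (fun y => (phi y)%:C * xi y^-1%g k i0).
  by apply: ccontM => //; exact: ccont_real.
have Smu : Sm u.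
  move=> i'; apply: (@csmooth_eq _ _ _ (fun x =>
     haar_int mu (fun y => phi (y * x)%g * complex.Re (xi y^-1%g i' i0)) +i*
     haar_int mu (fun y => phi (y * x)%g * complex.Im (xi y^-1%g i' i0)))); last first.
    have [c1 c2] := cV i' i0.
    by split => /=; exact: smooth_conv.
  move=> x; transitivity (cintegral mu (fun y => (phi (y * x)%g)%:C * xi y^-1%g i' i0)).
    rewrite cintegralE; congr Complex; apply: haar_int_ext => y.
      by rewrite cReM /= mul0r subr0.
    by rewrite cImM /= mul0r addr0.
  transitivity (cintegral mu (fun y => \sum_k xi x i' k * ((phi y)%:C * xi y^-1%g k i0))).
    rewrite -[RHS](cintegral_right compactG x haar_mu) /=; last first.
      by apply: ccont_sum => k; apply: ccontM => //; exact: ccont_cst.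
    apply: cintegral_ext => y.
    have -> : xi y^-1%g i' i0 = (xi x *m xi (y * x)^-1%g) i' i0.
      by rewrite -xM invgM mulVKg.
    by rewrite mxE mulr_sumr; apply: eq_bigr => k _; rewrite mulrCA.
  have [_ ->] := cintegral_sum compactG (index_enum 'I_(irrep_dim xi))
    (fun k => cintegrableZ (xi x i' k) (ccont_integrable compactG mu (cu k))).
  by apply: eq_bigr => k _; rewrite cintegralZ ?mxE//; exact: ccont_integrable.
have /hW : Sm u by [].
rewrite W0 submx0 => /eqP u0.
have : 0 < haar_int mu (fun y => phi y * complex.Re (xi y^-1%g i0 i0)).
  have [c1 _] := cV i0 i0.
  apply: (haar_int_gt0 compactG haar_mu (x0 := 1%g)).
  - exact: continuous_mul.
  - move=> y; have [->|/phiN h] := eqVneq (phi y) 0; first by rewrite mul0r.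
    rewrite mulr_ge0//; apply: ltW; apply: lt_trans h; lra.
  - by rewrite phi1 mul1r invg1 unirep1// mxE eqxx.
have := congr1 (fun M : 'rV[C]_(irrep_dim xi) => complex.Re (M 0 i0)) u0.
rewrite /u !mxE cintegralE /= => E; rewrite (_ : haar_int mu _ = 0) ?ltxx// -E.
by apply: haar_int_ext => y; rewrite cReM /= mul0r subr0.
Qed.

(** An eigenspace is invariant and not zero, hence everything. The transposes come from subspaces
    being row spaces. *)
Lemma schur_scalar (xi : irrep G) (M : 'M[C]_(irrep_dim xi)) :
  (forall x, M *m xi x = xi x *m M) -> exists c, M = c%:M.
Proof.
move=> cM; have [a Ma] := eigenvalue_closed M^T (irrep_dim_gt0 xi).
pose W := eigenspace M^T a.
have stab x : (W *m (xi x)^T <= W)%MS.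
  apply/eigenspaceP; rewrite -mulmxA -trmx_mul cM trmx_mul mulmxA.
  have /eigenspaceP -> : (W <= eigenspace M^T a)%MS by [].
  by rewrite scalemxAl.
have [W0|fW] := irrep_irreducible stab.
  by move: Ma; rewrite /eigenvalue -/W W0 eqxx.
exists a; apply: trmx_inj; rewrite tr_scalar_mx -[M^T]mul1mx.
have /eigenspaceP : (1%:M <= W)%MS by rewrite submx_full.
by move=> ->; rewrite scalemx1.
Qed.

Definition sigma (xi : irrep G) (v : 'rV[R]_n) : 'M[C]_(irrep_dim xi) :=
  symbol (clift (lvf v)) xi.

Lemma sigmaE (xi : irrep G) v i j :
  sigma xi v i j = clift (lvf v) (fun y => xi y i j) 1%g.
Proof.
rewrite /sigma /symbol unirep1; last exact: irrep_unirep.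
by rewrite trmx1 map_mx1 mul1mx mxE.
Qed.

Lemma clvf_irrep (xi : irrep G) v i j x :
  clift (lvf v) (fun y => xi y i j) x = (xi x *m sigma xi v) i j.
Proof.
have [xM _ _] := irrep_unirep xi.
rewrite -[x in LHS]mulg1 -clvf_left.
rewrite (_ : (fun y => xi (x * y)%g i j) = (fun y => \sum_k xi x i k * xi y k j)); last first.
  by apply/funext => y; rewrite xM mxE.
rewrite clvf_sum; last by move=> k; apply: csmoothZ; exact: irrep_csmooth.
rewrite mxE; apply: eq_bigr => k _; rewrite clvfZ; last exact: irrep_csmooth.
by rewrite sigmaE.
Qed.

(** Differentiate the unitarity relation for [xi] at the identity. *)
Lemma sigma_skew (xi : irrep G) v : (sigma xi v)^t* = - sigma xi v.
Proof.
have rxi := irrep_unirep xi; have sx k l : csmooth (fun x => xi x k l) by exact: irrep_csmooth.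
apply/matrixP => i j; rewrite trCE [RHS]mxE; apply/eqP; rewrite -addr_eq0; apply/eqP.
have : clift (lvf v) (fun x => \sum_k conjC (xi x k i) * xi x k j) 1%g = 0.
  rewrite (_ : (fun x => _) = fun=> (i == j)%:R) ?clvf_cst//; apply/funext => x.
  have := unirepCt x rxi => /matrixP/(_ i j); rewrite !mxE => <-.
  by apply: eq_bigr => k _; rewrite trCE.
rewrite clvf_sum; last by move=> k; apply: csmoothM => //; exact: csmoothJ.
move=> <-; rewrite (eq_bigr (fun k => (k == i)%:R * sigma xi v k j + (k == j)%:R * conjC (sigma xi v k i))).
  rewrite big_split /= (bigD1 i)//= eqxx mul1r big1 ?addr0; last first.
    by move=> k /negbTE ->; rewrite mul0r.
  rewrite (bigD1 j)//= eqxx mul1r big1 ?addr0 1?addrC//.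
  by move=> k /negbTE ->; rewrite mul0r.
move=> k _; rewrite clvfM//; last exact: csmoothJ.
rewrite clvfJ// -!sigmaE unirep1// !mxE; congr (_ + _).
by rewrite conjC_nat.
Qed.

Lemma sigma_linear (xi : irrep G) (v : 'rV[R]_n) :
  sigma xi v = \sum_i (v 0 i)%:C *: sigma xi (delta_mx 0 i).
Proof.
apply/matrixP => i j; rewrite sigmaE clvf_coord; last exact: irrep_csmooth.
by rewrite summxE; apply: eq_bigr => k _; rewrite mxE sigmaE.
Qed.

Lemma sigma_lin (xi : irrep G) (a : R) (u v : 'rV[R]_n) :
  sigma xi (a *: u + v) = a%:C *: sigma xi u + sigma xi v.
Proof.
rewrite sigma_linear (sigma_linear xi u) (sigma_linear xi v) scaler_sumr -big_split /=.
by apply: eq_bigr => i _; rewrite !mxE rmorphD rmorphM /= scalerDl scalerA.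
Qed.

Lemma sigma_sum (xi : irrep G) (I : Type) (s : seq I) (a : I -> R) (v : I -> 'rV[R]_n) :
  sigma xi (\sum_(k <- s) a k *: v k) = \sum_(k <- s) (a k)%:C *: sigma xi (v k).
Proof.
elim: s => [|k s ih]; last by rewrite !big_cons sigma_lin ih.
rewrite !big_nil sigma_linear big1// => i _; by rewrite mxE scale0r.
Qed.

End Representations.

(** * The adjoint representation, the Casimir scalar and the lower bound on the eigenvalues *)

Lemma derive_comp_jacobian (R : realType) n (F1 F2 : 'rV[R]_n -> 'rV[R]_n)
    (H : 'rV[R]_n -> R) z z1 z2 v : F1 z = z1 -> F2 z1 = z2 ->
  differentiable F1 z -> differentiable F2 z1 -> differentiable H z2 ->
  'D_v (H \o (F2 \o F1)) z = 'D_(v *m ('J F1 z *m 'J F2 z1)) H z2.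
Proof.
move=> e1 e2; subst z1 z2 => d1 d2 dH.
have d12 : differentiable (F2 \o F1) z by exact: differentiable_comp.
have dK : differentiable (H \o (F2 \o F1)) z by exact: differentiable_comp.
apply: (etrans (deriveE v dK)).
apply: (etrans (congr1 (fun f => f v) (diff_comp d12 dH))) => /=.
have E : 'd (F2 \o F1) z v = v *m ('J F1 z *m 'J F2 (F1 z)).
  apply: (etrans (congr1 (fun f => f v) (diff_comp d1 d2))) => /=.
  rewrite mulmxA; apply: (etrans (esym (deriveE _ d2))).
  apply: (etrans (deriveEjacobian _ d2)); congr (_ *m _).
  apply: (etrans (esym (deriveE _ d1))); exact: deriveEjacobian.
by apply: esym; apply: (etrans (deriveE _ dH)); rewrite -E.
Qed.

Lemma normc_col_isometry (R : realType) d p (U : 'M[R[i]]_d) (M : 'M[R[i]]_(d, p)) i :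
  U^t* *m U = 1%:M ->
  \sum_k Normc.normc ((U *m M) k i) ^+ 2 = \sum_k Normc.normc (M k i) ^+ 2.
Proof.
have H (N : 'M[R[i]]_(d, p)) : (\sum_k Normc.normc (N k i) ^+ 2)%:C = (N^t* *m N) i i.
  rewrite rmorph_sum mxE /=; apply: eq_bigr => k _; rewrite trCE normc_sqrC; exact: mulrC.
move=> UU; apply: complexI; rewrite !H trmx_mul map_mxM; congr (fun_of_matrix _ i i).
by rewrite mulmxA -(mulmxA _ _ U) UU mulmx1.
Qed.

Section Casimir.
Context {R : realType} {n : nat} {G : lieGroupType R n}.
Hypothesis compactG : compact [set: G].
Hypothesis connectedG : connected [set: G].
Variable mu : probability (borel G) R.
Hypothesis haar_mu : is_haar mu.
Variable g : riemannian_metric G.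
Hypothesis biinvariant_g : biinvariant g.
Local Notation C := R[i].
Local Notation V := 'rV[R]_n.
Local Notation z0 := (@chart1_origin R n G).

Lemma differentiable_left_chart (a : G) (y : G) z : chart_img y z ->
  differentiable (chart (a * chart_inv y z)%g \o (fun x => a * x)%g \o chart_inv y) z.
Proof.
move=> yz; pose w := (a * chart_inv y z)%g.
pose F (p : V * V) := chart w (chart_inv a p.1 * chart_inv y p.2)%g.
have aa := chart_dom_mem a.
have -> : chart w \o (fun x => a * x)%g \o chart_inv y = F \o (fun z => (chart a a, z)).
  by apply/funext => t; rewrite /F /= chartK.
apply: differentiable_comp; first exact: differentiable_pair.
apply: (smooth_on_differentiable (lie_mul_smooth a y w)); split => //=.
  exact: chart_imgP.
by rewrite chartK//; exact: chart_dom_mem.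
Qed.

Lemma differentiable_right_chart (a : G) (y : G) z : chart_img y z ->
  differentiable (chart (chart_inv y z * a)%g \o (fun x => x * a)%g \o chart_inv y) z.
Proof.
move=> yz; pose w := (chart_inv y z * a)%g.
pose F (p : V * V) := chart w (chart_inv y p.1 * chart_inv a p.2)%g.
have aa := chart_dom_mem a.
have -> : chart w \o (fun x => x * a)%g \o chart_inv y = F \o (fun z => (z, chart a a)).
  by apply/funext => t; rewrite /F /= chartK.
apply: differentiable_comp; first exact: differentiable_pair.
apply: (smooth_on_differentiable (lie_mul_smooth y a w)); split => //=.
  exact: chart_imgP.
by rewrite chartK//; exact: chart_dom_mem.
Qed.

(* [A] is the matrix of Ad(a) in the chart at the identity. *)
Lemma adjoint_isometry (a : G) : exists A : 'M[R]_n,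
  A *m g 1%g z0 *m A^T = g 1%g z0 /\
  forall (F : G -> R) (v : V), smooth F ->
    lvf v (fun x => F (a * x * a^-1)%g) 1%g = lvf (v *m A) F 1%g.
Proof.
have i0 := @chart1_origin_img R n G; have c0 := @chart_inv1_origin R n G.
have aa := chart_dom_mem a; pose z1 := chart a a.
have i1 : chart_img a z1 by exact: chart_imgP.
have c1 : chart_inv a z1 = a by rewrite chartK.
(* Conjugation is split into left translation by [a], from the chart at 1 to the chart at [a], and
   right translation by [a^-1] back, because bi-invariance speaks of these two separately. *)
pose F1 := chart a \o (fun x => a * x)%g \o chart_inv (1%g : G).
pose F2 := chart (1%g : G) \o (fun x => x * a^-1)%g \o chart_inv a.
have d1 : differentiable F1 z0.
  by have := differentiable_left_chart a i0; rewrite c0 mulg1.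
have d2 : differentiable F2 z1.
  by have := differentiable_right_chart a^-1%g i1; rewrite c1 mulgV.
have F10 : F1 z0 = z1 by rewrite /F1 /= c0 mulg1.
have F21 : F2 z1 = z0 by rewrite /F2 /= c1 mulgV.
have [isoL _] := biinvariant_g a; have [_ isoR] := biinvariant_g a^-1%g.
have E1 : g 1%g z0 = 'J F1 z0 *m g a z1 *m ('J F1 z0)^T.
  by rewrite -F10; apply: isoL => //; rewrite c0 mulg1.
have E2 : g a z1 = 'J F2 z1 *m g 1%g z0 *m ('J F2 z1)^T.
  by rewrite -F21; apply: isoR => //; rewrite c1 mulgV; exact: chart_dom_mem.
exists ('J F1 z0 *m 'J F2 z1); split.
  move: ('J F1 z0) ('J F2 z1) (g 1%g z0) (g a z1) E1 E2 => J1 J2 g1 ga E1 E2.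
  by rewrite [RHS]E1 E2 trmx_mul !mulmxA.
move=> F v sF; pose H := F \o chart_inv (1%g : G).
have dH : differentiable H z0 by exact: smooth_on_differentiable (sF 1%g) i0.
have -> : lvf (v *m ('J F1 z0 *m 'J F2 z1)) F 1%g = 'D_(v *m ('J F1 z0 *m 'J F2 z1)) H z0.
  rewrite /lvf (_ : (fun z => F (1 * chart_inv (1%g : G) z)%g) = H)//.
  by apply/funext => z; rewrite mul1g.
transitivity ('D_v (H \o (F2 \o F1)) z0).
  rewrite /lvf; apply: near_eq_derive; near=> z.
  have h1 : chart_dom a (a * chart_inv (1%g : G) z)%g.
    near: z; have : {for z0, continuous (fun z => a * chart_inv (1%g : G) z)%g}.
      apply: continuous_comp; first exact: chart_inv_continuous.
      exact: continuous_mulgl.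
    by apply; rewrite /= c0 mulg1; exact: nbhs_chart_dom.
  have h2 : chart_dom (1%g : G) (a * chart_inv (1%g : G) z * a^-1)%g.
    near: z; have : {for z0, continuous (fun z => a * chart_inv (1%g : G) z * a^-1)%g}.
      apply: (@continuous_comp _ _ _ (fun z => a * chart_inv (1%g : G) z)%g (fun x => x * a^-1)%g).
        apply: continuous_comp; first exact: chart_inv_continuous.
        exact: continuous_mulgl.
      exact: continuous_mulgr.
    by apply; rewrite /= c0 mulg1 mulgV; apply: nbhs_chart_dom; exact: chart_dom_mem.
  by rewrite /H /F2 /F1 /= (chartK _ _ h1) (chartK _ _ h2) mul1g.
exact: (derive_comp_jacobian v F10 F21 d1 d2 dH).
Unshelve. all: by end_near. Qed.

Variable X : 'M[R]_n.
Hypothesis basisX : X \in unitmx.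
Hypothesis laplaceX : forall (f : G -> R) (x : G), smooth f ->
  laplace_beltrami g f x = - \sum_j lvf (row j X) (lvf (row j X) f) x.

Definition casimir (xi : irrep G) : 'M[C]_(irrep_dim xi) :=
  \sum_j sigma xi (row j X) *m sigma xi (row j X).

(** [Q] is the matrix of Ad(a) in the basis [X]. It is orthogonal because Ad(a) preserves the metric
    at the identity, for which the rows of [X] are orthonormal by [frame_metric_inv]. *)
Lemma adjoint_sigma (xi : irrep G) (a : G) : exists Q : 'M[R]_n, Q^T *m Q = 1%:M /\
  forall j, xi a *m sigma xi (row j X) *m (xi a)^t* =
    \sum_k (Q j k)%:C *: sigma xi (row k X).
Proof.
have rxi := irrep_unirep xi; have [xM _ _] := rxi.
have [A [gA hA]] := adjoint_isometry a.
have [XX gu] := frame_metric_inv laplaceX basisX.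
pose O := X *m A *m invmx X; exists O; split.
  apply: mulmx1C.
  have XgX : X *m g 1%g z0 *m X^T = 1%:M.
    have XTu : X^T \in unitmx by rewrite unitmx_tr.
    have : X^T *m (X *m g 1%g z0 *m X^T) = X^T by rewrite !mulmxA XX mulVmx// mul1mx.
    by move/(congr1 (mulmx (invmx X^T))); rewrite mulKmx// mulVmx.
  have gE : g 1%g z0 = invmx X *m (invmx X)^T.
    have XTu : X^T \in unitmx by rewrite unitmx_tr.
    have e1 : X^T *m X *m (invmx X *m invmx X^T) = 1%:M.
      by rewrite !mulmxA mulmxK// mulmxV.
    by rewrite trmx_inv -[LHS]mulmx1 -e1 XX mulmxA mulmxV// mul1mx.
  have -> : O *m O^T = X *m (A *m (invmx X *m (invmx X)^T) *m A^T) *m X^T.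
    by rewrite /O !trmx_mul !mulmxA.
  by rewrite -gE gA.
move=> j; have sx k l : csmooth (fun x => xi x k l) by exact: (irrep_csmooth compactG haar_mu).
have -> : \sum_k (O j k)%:C *: sigma xi (row k X) = sigma xi (row j X *m A).
  have -> : row j X *m A = \sum_k O j k *: row k X.
    rewrite -row_mul (_ : X *m A = O *m X); last by rewrite mulmxKV.
    by rewrite row_mul mulmx_sum_row; apply: eq_bigr => k _; rewrite mxE.
  by rewrite (sigma_sum compactG haar_mu).
apply/matrixP => p q; rewrite sigmaE.
have -> : clift (lvf (row j X *m A)) (fun y => xi y p q) 1%g =
    clift (lvf (row j X)) (fun y => xi (a * y * a^-1)%g p q) 1%g.
  have [s1 s2] := sx p q.
  by rewrite /clift (hA _ _ s1) (hA _ _ s2).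
rewrite (_ : (fun y => _) = (fun y => \sum_k \sum_l (xi a p k * conjC (xi a q l)) * xi y k l)).
  rewrite clvf_sum; last by move=> k; apply: csmooth_sum => l; exact: csmoothZ.
  rewrite -mulmxA mxE; apply: eq_bigr => k _; rewrite clvf_sum; last by move=> l; exact: csmoothZ.
  rewrite mxE mulr_sumr; apply: eq_bigr => l _; rewrite clvfZ// sigmaE trCE; ring.
apply/funext => y; rewrite !xM unirepV// -mulmxA mxE; apply: eq_bigr => k _.
by rewrite mxE mulr_sumr; apply: eq_bigr => l _; rewrite trCE; ring.
Qed.

(** Conjugation by [xi a] transforms the [sigma xi (row j X)] by an orthogonal matrix, which leaves
    their sum of squares unchanged. *)
Lemma casimir_comm (xi : irrep G) a : casimir xi *m xi a = xi a *m casimir xi.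
Proof.
have rxi := irrep_unirep xi; have [Q [QQ hQ]] := adjoint_sigma xi a.
suff E : xi a *m casimir xi *m (xi a)^t* = casimir xi.
  by rewrite -[in LHS]E -!mulmxA unirepCt// mulmx1.
pose S j := sigma xi (row j X).
have e1 : xi a *m casimir xi *m (xi a)^t* =
    \sum_j (xi a *m S j *m (xi a)^t*) *m (xi a *m S j *m (xi a)^t*).
  rewrite /casimir mulmx_sumr mulmx_suml; apply: eq_bigr => j _.
  have := unirepCt a rxi; rewrite -/(S j); move: (xi a) (S j) => U T UU.
  by rewrite !mulmxA -(mulmxA (U *m T) (U^t*)) UU mulmx1.
rewrite e1 (eq_bigr (fun j => \sum_k \sum_l (Q j k * Q j l)%:C *: (S k *m S l))); last first.
  move=> j _; rewrite hQ mulmx_suml; apply: eq_bigr => k _.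
  rewrite mulmx_sumr; apply: eq_bigr => l _.
  by rewrite -scalemxAl -scalemxAr scalerA -rmorphM.
rewrite exchange_big; apply: eq_bigr => k _ /=.
rewrite exchange_big /= (bigD1 k)//= [X in _ + X]big1 ?addr0 => [|l lk].
  rewrite -scaler_suml -rmorph_sum /=.
  have /matrixP/(_ k k) := QQ; rewrite !mxE eqxx => E.
  rewrite (_ : \sum_j Q j k * Q j k = 1) ?scale1r// -[RHS]E.
  by apply: eq_bigr => j _; rewrite mxE.
rewrite -scaler_suml -rmorph_sum /=.
have /matrixP/(_ k l) := QQ; rewrite !mxE eq_sym (negbTE lk) => E.
rewrite (_ : \sum_j Q j k * Q j l = 0) ?scale0r// -[RHS]E.
by apply: eq_bigr => j _; rewrite mxE.
Qed.

Lemma casimir_diag (xi : irrep G) i :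
  casimir xi i i = - (\sum_j \sum_k Normc.normc (sigma xi (row j X) k i) ^+ 2)%:C.
Proof.
rewrite /casimir summxE rmorph_sum /= -sumrN; apply: eq_bigr => j _.
rewrite mxE rmorph_sum /= -sumrN; apply: eq_bigr => k _.
have sk : sigma xi (row j X) i k = - conjC (sigma xi (row j X) k i).
  have /matrixP/(_ i k) := sigma_skew compactG haar_mu xi (row j X).
  by rewrite trCE [X in _ = X -> _]mxE => ->; rewrite opprK.
by rewrite sk normc_sqrC mulNr mulrC.
Qed.

Lemma casimir_scalar (xi : irrep G) : exists2 c : R, 0 <= c &
  casimir xi = (- c%:C)%:M /\
  forall i, \sum_j \sum_k Normc.normc (sigma xi (row j X) k i) ^+ 2 = c.
Proof.
have [c E] := schur_scalar (casimir_comm xi).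
pose s i := \sum_j \sum_k Normc.normc (sigma xi (row j X) k i) ^+ 2.
have cs i : c = - (s i)%:C.
  by have := casimir_diag i; rewrite E mxE eqxx mulr1n.
pose i0 := Ordinal (irrep_dim_gt0 xi); exists (s i0).
  by apply: sumr_ge0 => j _; apply: sumr_ge0 => k _; exact: sqr_ge0.
split; first by rewrite E (cs i0).
by move=> i; have := cs i; rewrite (cs i0) => /oppr_inj [].
Qed.

Lemma clvf2_irrep (xi : irrep G) v i j x :
  clift (lvf v) (clift (lvf v) (fun y => xi y i j)) x =
  (xi x *m (sigma xi v *m sigma xi v)) i j.
Proof.
have sx k l : csmooth (fun x => xi x k l) by exact: (irrep_csmooth compactG haar_mu).
rewrite (_ : clift (lvf v) (fun y => xi y i j) = fun y => \sum_k sigma xi v k j * xi y i k).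
  rewrite clvf_sum; last by move=> k; exact: csmoothZ.
  rewrite mulmxA mxE; apply: eq_bigr => k _; rewrite clvfZ// (clvf_irrep compactG haar_mu)//.
  exact: mulrC.
apply/funext => y; rewrite (clvf_irrep compactG haar_mu)// mxE; apply: eq_bigr => k _; exact: mulrC.
Qed.

Lemma clift_laplace (xi : irrep G) i j x :
  clift (laplace_beltrami g) (fun y => xi y i j) x = - (xi x *m casimir xi) i j.
Proof.
have [s1 s2] : csmooth (fun x => xi x i j) by exact: (irrep_csmooth compactG haar_mu).
rewrite /casimir mulmx_sumr summxE (eq_bigr (fun k =>
  clift (lvf (row k X)) (clift (lvf (row k X)) (fun y => xi y i j)) x)); last first.
  by move=> k _; rewrite clvf2_irrep.
rewrite /clift !laplaceX//; apply: complex_ext; rewrite ?cReN ?cImN ?cRe_sum ?cIm_sum /=.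
  by [].
by [].
Qed.

(** [nu] is a chosen eigenvalue: the Casimir scalar is one, and evaluating at the identity, where a
    diagonal coefficient is 1, shows that it is the only one. *)
Lemma nu_casimir (xi : irrep G) : [/\ 0 <= nu g xi, casimir xi = (- (nu g xi)%:C)%:M &
  forall i, \sum_j \sum_k Normc.normc (sigma xi (row j X) k i) ^+ 2 = nu g xi].
Proof.
have rxi := irrep_unirep xi; have [c c0 [E hc]] := casimir_scalar xi.
pose S := [set l : R | forall i j x,
    clift (laplace_beltrami g) (fun y => xi y i j) x = l%:C * xi x i j].
have Sc : S c.
  move=> i j x; rewrite clift_laplace E mul_mx_scalar mxE; ring.
have : S (nu g xi) by apply: (xgetPex 0 (P := S)); exists c.
pose i0 := Ordinal (irrep_dim_gt0 xi).
move=> /(_ i0 i0 1%g); rewrite Sc unirep1// mxE eqxx !mulr1 => -[<-].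
by split.
Qed.

(* If [nu xi] is small, a diagonal coefficient of [xi] stays close to its value
   1 at the identity, so that the mean of [xi] over [G] is not zero and [xi] is
   trivial. *)
Lemma sigma_gap : exists2 kappa : R, 0 < kappa &
  forall (xi : irrep G) v, sigma xi v != 0 -> kappa <= nu g xi.
Proof.
have [K K0 hK] := lvf_lipschitz compactG connectedG.
pose B : R := \sum_i \sum_j `|invmx X i j|.
have B0 : 0 <= B by apply: sumr_ge0 => i _; apply: sumr_ge0.
(* Below this value [K * B * sqrt (nu g xi)] is at most 1/2. [B] converts bounds along the rows of
   [X] into bounds along the coordinate frame; adding 1 avoids a zero denominator. *)
exists ((2 * (K * B + 1))^-1 ^+ 2).
  by rewrite exprn_gt0// invr_gt0 mulr_gt0// ltr_wpDl// mulr_ge0.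
move=> xi v; apply: contraNT; rewrite -ltNge => small.
have rxi := irrep_unirep xi; have [xM xU xC] := rxi.
have [nu0 _ hnu] := nu_casimir xi.
pose i0 := Ordinal (irrep_dim_gt0 xi).
have sx k l : csmooth (fun x => xi x k l) by exact: (irrep_csmooth compactG haar_mu).
have [s1 s2] := sx i0 i0.
(* The squared derivative is bounded by one of the terms of the sum of squares equal to [nu g xi],
   the unitary matrix [xi x] preserving the norms of columns. *)
have dX j x : `|lvf (row j X) (fun y => complex.Re (xi y i0 i0)) x| <= Num.sqrt (nu g xi).
  rewrite -[lvf _ _ _]/(complex.Re (clift (lvf (row j X)) (fun y => xi y i0 i0) x)).
  suff e : Normc.normc ((xi x *m sigma xi (row j X)) i0 i0) <= Num.sqrt (nu g xi).
    by apply: le_trans (Re_le_normc _) _; rewrite (clvf_irrep compactG haar_mu).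
  rewrite -(@ler_pXn2r _ 2)// ?nnegrE ?normc_ge0 ?sqrtr_ge0//.
  rewrite (@sqr_sqrtr R)// -(hnu i0) (bigD1 j)//= ler_wpDr//.
    by apply: sumr_ge0 => k _; apply: sumr_ge0 => l _; exact: sqr_ge0.
  have -> : \sum_k Normc.normc (sigma xi (row j X) k i0) ^+ 2 =
      \sum_k Normc.normc ((xi x *m sigma xi (row j X)) k i0) ^+ 2.
    exact (esym (normc_col_isometry (sigma xi (row j X)) i0 (unirepCt x rxi))).
  by rewrite (bigD1 i0)//= lerDl; apply: sumr_ge0 => k _; exact: sqr_ge0.
have bF : lvf_bound (fun y => complex.Re (xi y i0 i0)) (B * Num.sqrt (nu g xi)).
  split => // [|i x]; first by rewrite mulr_ge0// sqrtr_ge0.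
  have -> : lvf (delta_mx 0 i) (fun y => complex.Re (xi y i0 i0)) x =
      \sum_j invmx X i j * lvf (row j X) (fun y => complex.Re (xi y i0 i0)) x.
    have e : delta_mx 0 i = \sum_j invmx X i j *: row j X :> V.
      have -> : delta_mx 0 i = row i (invmx X *m X) :> V by rewrite mulVmx// row1.
      by rewrite row_mul mulmx_sum_row; apply: eq_bigr => k _; rewrite mxE.
    have := congr1 (fun M : 'M[C]_(irrep_dim xi) => complex.Re ((xi x *m M) i0 i0))
      (congr1 (sigma xi) e).
    rewrite (sigma_sum compactG haar_mu)// -(clvf_irrep compactG haar_mu) mulmx_sumr summxE cRe_sum /= => ->.
    apply: eq_bigr => j _; rewrite -scalemxAr mxE -(clvf_irrep compactG haar_mu) cReM /=; ring.
  apply: (le_trans (ler_norm_sum _ _ _)).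
  apply: (@le_trans _ _ ((\sum_j `|invmx X i j|) * Num.sqrt (nu g xi))); last first.
    rewrite ler_wpM2r ?sqrtr_ge0// /B [leRHS](bigD1 i)//= lerDl.
    by apply: sumr_ge0 => k _; exact: sumr_ge0.
  rewrite mulr_suml; apply: ler_sum => j _; rewrite normrM ler_wpM2l//.
have near1 y : 1 / 2 <= complex.Re (xi y i0 i0).
  have := hK _ _ bF y; rewrite unirep1// mxE eqxx /= => h.
  have : K * (B * Num.sqrt (nu g xi)) <= 1 / 2.
    have KB : 0 < K * B + 1 by rewrite ltr_wpDl// mulr_ge0.
    have : Num.sqrt (nu g xi) <= (2 * (K * B + 1))^-1.
      rewrite -(@ler_pXn2r _ 2)// ?nnegrE ?sqrtr_ge0 ?invr_ge0 ?mulr_ge0 ?(ltW KB)//.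
      by rewrite sqr_sqrtr// ltW.
    rewrite invfM mulrA => h2; apply: le_trans (_ : K * B * (2^-1 * (K * B + 1)^-1) <= _).
      by rewrite ler_wpM2l// mulr_ge0.
    by rewrite mulrCA mul1r ler_piMr// ler_pdivrMr// mul1r lerDl.
  move=> h1; have := le_trans h h1; rewrite distrC ler_norml => /andP[_]; lra.
pose P := mxint mu xi.
have Pl a : xi a *m P = P.
  by rewrite -(mxint_mull compactG)// -[RHS](mxint_left compactG haar_mu a)//; apply: mxint_ext => x; rewrite xM.
have Pr a : P *m xi a = P.
  by rewrite -(mxint_mulr compactG)// -[RHS](mxint_right compactG haar_mu a)//; apply: mxint_ext => x; rewrite xM.
(* The mean absorbs [xi a] on both sides, hence commutes with it. Once the scalar is known not to
   vanish, [xi a *m P = P] gives [xi a = 1]. *)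
have [c Pc] : exists c, P = c%:M by apply: schur_scalar => x; rewrite Pl Pr.
have c0 : c != 0.
  have : 1 / 2 <= complex.Re (P i0 i0).
    rewrite mxE cintegralE /= -(haar_int_cst mu (1 / 2)).
    have [x1 _] := xC i0 i0.
    apply: le_haar_int => //; last exact: continuous_integrable.
    exact: haar_integrable_cst.
  rewrite Pc mxE eqxx mulr1n; apply: contraTneq => ->.
  by rewrite -ltNge /= divr_gt0.
have x1 a : xi a = 1%:M.
  have := Pl a; rewrite Pc mul_mx_scalar => /(congr1 (fun M => c^-1 *: M)).
  by rewrite scalerA mulVf// scale1r scale_scalar_mx mulVf.
apply/eqP/matrixP => i j; rewrite sigmaE mxE.
rewrite (_ : (fun y => xi y i j) = fun=> (1%:M : 'M[C]_(irrep_dim xi)) i j) ?clvf_cst//.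
by apply/funext => y; rewrite x1.
Qed.

End Casimir.

(** * Schur orthogonality *)

Section Schur.
Context {R : realType} {n : nat} {G : lieGroupType R n}.
Hypothesis compactG : compact [set: G].
Variable mu : probability (borel G) R.
Hypothesis haar_mu : is_haar mu.
Local Notation C := R[i].

Lemma trC_mul m p q (A : 'M[C]_(m, p)) (B : 'M[C]_(p, q)) : (A *m B)^t* = B^t* *m A^t*.
Proof. by rewrite trmx_mul map_mxM. Qed.

Lemma trC_scale m p (c : C) (A : 'M[C]_(m, p)) : (c *: A)^t* = conjC c *: A^t*.
Proof. by apply/matrixP => i j; rewrite trCE !mxE rmorphM. Qed.

(** The adjoint of the condition on [B'] reads [Q *m B *m Q = B *m Q]. *)
Lemma adjoint_commute d (B B' Q : 'M[C]_d) : B'^t* = B -> Q^t* = Q ->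
  Q *m B *m Q = Q *m B -> Q *m B' *m Q = Q *m B' -> Q *m B = B *m Q.
Proof.
move=> BB QQ <- /(congr1 (fun M => M^t*)); rewrite !trC_mul BB QQ => <-.
exact: esym (mulmxA _ _ _).
Qed.

Lemma irrep_equiv_refl (xi : irrep G) : irrep_equiv xi xi.
Proof.
have u : (1%:M : 'M[C]_(irrep_dim xi)) \is unitarymx.
  by apply/unitarymxP; rewrite trmx1 map_mx1 mulmx1.
by exists 1%:M; split; rewrite ?trmxC_unitary// => x; rewrite mulmx1 mul1mx.
Qed.

Lemma irrep_equiv_sym (xi eta : irrep G) : irrep_equiv xi eta -> irrep_equiv eta xi.
Proof.
move=> [T [TU TU' hT]]; exists (T^t*); split; rewrite ?trmxCK// => x.
move/unitarymxP: TU => TU; move/unitarymxP: TU'; rewrite trmxCK => TU'.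
transitivity (T^t* *m (T *m eta x) *m T^t*); first by rewrite !mulmxA TU' mul1mx.
by rewrite -hT -!mulmxA TU mulmx1.
Qed.

Lemma irrep_equiv_trans (xi eta zeta : irrep G) :
  irrep_equiv xi eta -> irrep_equiv eta zeta -> irrep_equiv xi zeta.
Proof.
move=> [T [TU TU' hT]] [S [SU SU' hS]]; exists (T *m S); split.
- exact: mul_unitarymx.
- by rewrite trC_mul; exact: mul_unitarymx.
- by move=> x; rewrite mulmxA hT -mulmxA hS mulmxA.
Qed.

Definition dual_rep (xi : irrep G) : irrep G := xget xi [set eta | irrep_equiv xi eta].

Lemma dual_rep_equiv xi : irrep_equiv xi (dual_rep xi).
Proof. by apply: (@xgetI _ xi [set eta | irrep_equiv xi eta] xi); exact: irrep_equiv_refl. Qed.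

(** The two calls of [xget] have different default values, but an equivalence class is never empty,
    so only the class matters. *)
Lemma dual_rep_eq xi eta : irrep_equiv xi eta -> dual_rep xi = dual_rep eta.
Proof.
move=> xe; rewrite /dual_rep.
rewrite (_ : [set zeta | irrep_equiv xi zeta] = [set zeta | irrep_equiv eta zeta]).
  rewrite /xget; case: pselect => // -[]; exists eta; apply/asboolP; exact: irrep_equiv_refl.
apply/seteqP; split => z /=; apply: irrep_equiv_trans => //; exact: irrep_equiv_sym.
Qed.

Lemma dual_repP xi : dual G (dual_rep xi).
Proof. by rewrite /dual /= -/(dual_rep _); apply: dual_rep_eq; exact: dual_rep_equiv. Qed.

Lemma dual_inj (xi eta : irrep G) : dual G xi -> dual G eta -> irrep_equiv xi eta -> xi = eta.
Proof. by rewrite /dual /= -!/(dual_rep _) => e1 e2 h; rewrite e1 e2; exact: dual_rep_eq. Qed.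

(** By Schur's lemma [T *m T^t*] and [T^t* *m T] are scalar, with the same scalar [r > 0] when [T]
    is not zero; dividing by the square root of [r] makes [T] unitary. *)
Lemma intertwiner_equiv (xi eta : irrep G) (T : 'M[C]_(irrep_dim xi, irrep_dim eta)) :
  (forall x, xi x *m T = T *m eta x) -> T = 0 \/ irrep_equiv xi eta.
Proof.
move=> hT; have rxi := irrep_unirep xi; have reta := irrep_unirep eta.
have hT' x : eta x *m T^t* = T^t* *m xi x.
  have := congr1 (fun M => M^t*) (hT x^-1%g); rewrite !unirepV// !trC_mul !trmxCK.
  by move=> ->.
have [c Ec] : exists c, T *m T^t* = c%:M.
  by apply: schur_scalar => x; rewrite -mulmxA -hT' !mulmxA hT.
have [c' Ec'] : exists c, T^t* *m T = c%:M.
  by apply: schur_scalar => x; rewrite -mulmxA -hT !mulmxA hT'.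
have [->|T0] := eqVneq T 0; [by left|right].
have cE i : c = (\sum_k Normc.normc (T i k) ^+ 2)%:C.
  have /matrixP/(_ i i) := Ec; rewrite !mxE eqxx mulr1n => <-; rewrite rmorph_sum /=.
  by apply: eq_bigr => k _; rewrite trCE normc_sqrC.
pose i0 := Ordinal (irrep_dim_gt0 xi); pose r := \sum_k Normc.normc (T i0 k) ^+ 2.
have r0 : 0 < r.
  rewrite lt_neqAle sumr_ge0 ?andbT => [|k _]; last exact: sqr_ge0.
  apply: contra T0 => /eqP r0; apply/eqP/matrixP => i k; rewrite mxE.
  have /eqP := cE i; rewrite (cE i0) -/r -r0 eq_complex /= eqxx andbT eq_sym.
  rewrite psumr_eq0 => [/allP/(_ k)|j _]; last exact: sqr_ge0.
  by rewrite mem_index_enum => /(_ isT); rewrite /= sqrf_eq0 => /eqP; exact: Normc.eq0_normc.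
have cc' : c' = c.
  apply/eqP; rewrite -subr_eq0; apply: contraT => cc.
  have : (c' - c) *: T^t* = 0.
    by rewrite scalerBl -mul_scalar_mx -Ec' -mulmxA Ec mul_mx_scalar subrr.
  move=> /eqP; rewrite scaler_eq0 (negbTE cc) /= => /eqP /(congr1 (fun M => M^t*)).
  by rewrite trmxCK trmx0 map_mx0 => /eqP; rewrite (negbTE T0).
have cr : c = r%:C by exact: cE.
pose s : C := ((Num.sqrt r)^-1)%:C.
have sJ : conjC s = s by apply: complex_ext; rewrite ?cReJ ?cImJ /= ?oppr0.
have ss : s * s * c = 1.
  rewrite cr /s -!rmorphM /= -invfM -expr2 sqr_sqrtr ?ltW// mulVf ?rmorph1//.
  by rewrite gt_eqF.
have sT : (s *: T)^t* = s *: T^t* by rewrite trC_scale sJ.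
exists (s *: T); split.
- by apply/unitarymxP; rewrite sT -scalemxAl -scalemxAr scalerA Ec scale_scalar_mx ss.
- apply/unitarymxP; rewrite trmxCK sT -scalemxAl -scalemxAr scalerA Ec' cc'.
  by rewrite scale_scalar_mx ss.
- by move=> x; rewrite -scalemxAr hT -scalemxAl.
Qed.

(** Averaging turns any matrix into an intertwiner: left translation of the variable by [a] absorbs
    the outer factors. *)
Lemma schur_mean (xi eta : irrep G) (E : 'M[C]_(irrep_dim xi, irrep_dim eta)) a :
  let M := mxint mu (fun x => xi x *m E *m (eta x)^t*) in xi a *m M = M *m eta a.
Proof.
move=> M; have rxi := irrep_unirep xi; have reta := irrep_unirep eta.
have [xM _ xC] := rxi; have [eM _ eC] := reta.
have cF : mxcont (fun x => xi x *m E *m (eta x)^t*).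
  apply: mxcont_mul; last exact: mxcont_trC.
  by apply: mxcont_mul => //; exact: mxcont_cst.
suff {2}<- : xi a *m M *m (eta a)^t* = M by rewrite -!mulmxA unirepCt// mulmx1.
rewrite /M -(mxint_mull compactG)// -(mxint_mulr compactG); last first.
  by apply: mxcont_mul => //; exact: mxcont_cst.
apply: etrans (mxint_left compactG haar_mu a cF); apply: mxint_ext => x.
by rewrite xM eM trC_mul !mulmxA.
Qed.

Lemma mxint_coef (xi eta : irrep G) i j k l :
  mxint mu (fun x => xi x *m delta_mx j l *m (eta x)^t*) i k =
  cintegral mu (fun x => xi x i j * conjC (eta x k l)).
Proof.
rewrite mxE; apply: cintegral_ext => x; rewrite mxE (bigD1 l)//= big1 => [|m ml].
  rewrite addr0 trCE; congr (_ * _); rewrite mxE (bigD1 j)//= big1 => [|m mj].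
    by rewrite mxE !eqxx mulr1 addr0.
  by rewrite mxE (negbTE mj) mulr0.
rewrite [X in X * _](_ : _ = 0) ?mul0r// mxE big1// => q _.
by rewrite mxE (negbTE ml) andbF mulr0.
Qed.

Lemma schur_orthogonal (xi eta : irrep G) i j k l : ~ irrep_equiv xi eta ->
  cintegral mu (fun x => xi x i j * conjC (eta x k l)) = 0.
Proof.
move=> ne; rewrite -mxint_coef.
by have [->|] := intertwiner_equiv (schur_mean (delta_mx j l)); rewrite ?mxE.
Qed.

(** The average is a scalar matrix, and the scalar is found by taking the trace, which unitarity
    makes independent of the group element. *)
Lemma schur_orthonormal (xi : irrep G) i j k l :
  cintegral mu (fun x => xi x i j * conjC (xi x k l)) =
  (irrep_dim xi)%:R^-1 * (i == k)%:R * (j == l)%:R.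
Proof.
rewrite -mxint_coef; have rxi := irrep_unirep xi; have [_ _ xC] := rxi.
have [c Ec] := schur_scalar (fun a => esym (schur_mean (delta_mx j l) a)).
have d0 : (irrep_dim xi)%:R != 0 :> C by rewrite pnatr_eq0 -lt0n; exact: irrep_dim_gt0.
rewrite Ec mxE; have := congr1 (@mxtrace _ _) Ec; rewrite mxtrace_scalar => E.
have : \tr (mxint mu (fun x => xi x *m delta_mx j l *m (xi x)^t*)) = (j == l)%:R.
  rewrite /mxtrace (eq_bigr (fun i => cintegral mu (fun x => xi x i j * conjC (xi x i l)))); last first.
    by move=> m _; rewrite mxint_coef.
  have [_ <-] := cintegral_sum compactG (index_enum 'I_(irrep_dim xi)) (F := fun m x => xi x m j * conjC (xi x m l))
    (fun m => ccont_integrable compactG mu (ccontM (xC m j) (ccontJ (xC m l)))).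
  rewrite (@cintegral_ext _ _ _ _ _ (fun=> (j == l)%:R)) ?cintegral_cst// => x.
  have /matrixP/(_ l j) := unirepCt x rxi; rewrite !mxE eq_sym => <-.
  by apply: eq_bigr => m _; rewrite trCE mulrC.
rewrite E => <-; case: eqP => _; rewrite ?mulr1n ?mulr0n ?mulr0 ?mul0r ?mulr1//.
by rewrite -[c *+ _]mulr_natl mulrA mulVf// mul1r.
Qed.

(** The span of the matrix coefficients of all irreducible representations, built one coefficient at
    a time so that its closure properties go by induction. *)
Inductive trig : (G -> C) -> Prop :=
| trig_zero : trig (fun=> 0)
| trig_add c (xi : irrep G) i j f : trig f -> trig (fun x => c * xi x i j + f x).

Lemma trig_eq f h : f =1 h -> trig f -> trig h.
Proof. by move=> /funext ->. Qed.

Lemma trigD f h : trig f -> trig h -> trig (fun x => f x + h x).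
Proof.
move=> tf th; elim: tf => [|c xi i j f' _ ih]; first by apply: trig_eq th => x; rewrite add0r.
by apply: trig_eq (trig_add c i j ih) => x; rewrite addrA.
Qed.

Lemma trigZ c f : trig f -> trig (fun x => c * f x).
Proof.
elim => [|c' xi i j f' _ ih]; first by apply: trig_eq trig_zero => x; rewrite mulr0.
by apply: trig_eq (trig_add (c * c') i j ih) => x; rewrite mulrDr mulrA.
Qed.

Lemma trig_sum (I : Type) (s : seq I) (F : I -> G -> C) :
  (forall i, trig (F i)) -> trig (fun x => \sum_(i <- s) F i x).
Proof.
move=> tF; elim: s => [|i s ih].
  by apply: trig_eq trig_zero => x; rewrite big_nil.
by apply: trig_eq (trigD (tF i) ih) => x; rewrite big_cons.
Qed.

Lemma trig_irrep (xi : irrep G) i j : trig (fun x => xi x i j).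
Proof. by apply: trig_eq (trig_add 1 i j trig_zero) => x; rewrite mul1r addr0. Qed.

(** The rows of [U1] and [U2] together form an orthonormal basis. As [d1 + d2] and [d] are equal
    only propositionally, a rank argument replaces the commutation of inverses of square
    matrices. *)
Lemma unitary_complement d1 d2 d (U1 : 'M[C]_(d1, d)) (U2 : 'M[C]_(d2, d)) :
  U1 \is unitarymx -> U2 \is unitarymx -> U1 *m U2^t* = 0 -> (d1 + d2)%N = d ->
  U1^t* *m U1 + U2^t* *m U2 = 1%:M.
Proof.
move=> /unitarymxP u1 /unitarymxP u2 u12 dd.
pose Q := col_mx U1 U2; pose Qs := row_mx (U1^t*) (U2^t*).
have u21 : U2 *m U1^t* = 0.
  by have := congr1 (fun M => M^t*) u12; rewrite trC_mul trmxCK trmx0 map_mx0.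
have QQ : Q *m Qs = 1%:M.
  by rewrite mul_col_row u1 u2 u12 u21 -scalar_mx_block.
have QsQ : Qs *m Q = U1^t* *m U1 + U2^t* *m U2 by rewrite mul_row_col.
have fr : row_free Qs.
  rewrite /row_free eqn_leq rank_leq_row /=.
  by have := mxrankM_maxr Q Qs; rewrite QQ mxrank1; apply: leq_trans; rewrite dd.
by rewrite -QsQ; apply: (row_free_injr fr) => /=; rewrite -mulmxA QQ mulmx1 mul1mx.
Qed.

(** The rows of [U] are an orthonormal basis of an invariant subspace and [U^t* *m U] is the
    projection onto it. Its commuting with the representation makes the compression
    multiplicative. *)
Lemma unirep_compress d d1 (A : G -> 'M[C]_d) (U : 'M[C]_(d1, d)) :
  unirep A -> U \is unitarymx ->
  (forall x, U^t* *m U *m (A x)^T = (A x)^T *m (U^t* *m U)) ->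
  unirep (fun x => (U *m (A x)^T *m U^t*)^T).
Proof.
move=> rA /unitarymxP UU cA; have [AM AU AC] := rA.
have UP : U *m (U^t* *m U) = U by rewrite mulmxA UU mul1mx.
have key B x : U *m (A x)^T *m U^t* *m (U *m B *m U^t*) = U *m (A x)^T *m B *m U^t*.
  transitivity (U *m ((A x)^T *m (U^t* *m U)) *m B *m U^t*); first by rewrite !mulmxA.
  by rewrite -cA (mulmxA U (U^t* *m U)) UP.
split.
- by move=> x y; rewrite -trmx_mul; congr (trmx _); rewrite key AM trmx_mul mulmxA.
- move=> x; rewrite trmx_unitary; apply/unitarymxP; rewrite !trC_mul trmxCK mulmxA.
  have := key ((A x)^T^t*) x; rewrite !mulmxA => ->.
  rewrite -(mulmxA U) (_ : (A x)^T *m _ = 1%:M) ?mulmx1//.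
  by have := AU x; rewrite -trmx_unitary => /unitarymxP.
- move=> i j; apply: (@ccont_eq _ _ (fun x => \sum_k (\sum_l U j l * A x k l) * conjC (U i k))).
    move=> x; rewrite mxE [RHS]mxE; apply: eq_bigr => k _; rewrite trCE; congr (_ * _).
    by rewrite mxE; apply: eq_bigr => l _; rewrite mxE.
  apply: ccont_sum => k; apply: ccontM; last exact: ccont_cst.
  by apply: ccont_sum => l; apply: ccontM => //; exact: ccont_cst.
Qed.

(** Complete reducibility, by induction on the dimension: a reducible representation splits along an
    invariant subspace and its orthogonal complement, of smaller dimensions both. *)
Lemma unirep_trig d (A : G -> 'M[C]_d) i j : unirep A -> trig (fun x => A x i j).
Proof.
have [m] := ubnP d; elim: m d A i j => // m ih d A i j dm rA.
have [AM AU AC] := rA; have d0 : (0 < d)%N by exact: leq_trans (ltn_ord i).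
have [irr|] := pselect (forall W : 'M[C]_d, (forall x, (W *m (A x)^T <= W)%MS) -> W = 0 \/ row_full W).
  exact: (@trig_irrep (@Irrep R n G d A d0 AM AU AC irr)).
move=> /existsNP[W /not_implyP[stab /not_orP[W0 /negP fW]]].
have r1 : (0 < \rank W)%N by rewrite lt0n mxrank_eq0; apply/eqP.
have r2 : (\rank W < d)%N by rewrite ltn_neqAle rank_leq_row andbT.
have dd := add_rank_ortho W.
set W' := (orthomx _ _ W) in dd.
have rW' : (\rank W' < d)%N by rewrite -[X in (_ < X)%N]dd -[X in (X < _)%N]add0n ltn_add2r.
pose U1 := schmidt (row_base W); pose U2 := schmidt (row_base W').
have u1 : U1 \is unitarymx by apply: schmidt_unitarymx; exact: rank_leq_col.
have u2 : U2 \is unitarymx by apply: schmidt_unitarymx; exact: rank_leq_col.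
have e1 : (U1 :=: W)%MS.
  by apply: eqmx_trans (eq_row_base W); apply: eqmx_schmidt_free; exact: row_base_free.
have e2 : (U2 :=: W')%MS.
  by apply: eqmx_trans (eq_row_base W'); apply: eqmx_schmidt_free; exact: row_base_free.
have u12 : U1 *m U2^t* = 0.
  by apply/orthomx1P; rewrite e1 orthomx_sym e2.
have sum1 := unitary_complement u1 u2 u12 dd.
pose P := U1^t* *m U1.
have PP x : P *m (A x)^T *m P = P *m (A x)^T.
  have /submxP[D E] : (U1 *m (A x)^T <= U1)%MS.
    by apply: submx_trans (submxMr _ _) _; rewrite ?e1.
  have /unitarymxP uu := u1.
  by rewrite /P -!mulmxA (mulmxA U1) E -!mulmxA (mulmxA U1) uu mul1mx.
have Ps : P^t* = P by rewrite trC_mul trmxCK.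
have cP x : P *m (A x)^T = (A x)^T *m P.
  have AV : (A x^-1%g)^T^t* = (A x)^T.
    by rewrite unirepV//; apply/matrixP => k l; rewrite !mxE conjCK.
  exact: adjoint_commute AV Ps (PP x) (PP x^-1%g).
have P2 : U2^t* *m U2 = 1%:M - P by rewrite -sum1 /P addrAC subrr add0r.
have cP2 x : U2^t* *m U2 *m (A x)^T = (A x)^T *m (U2^t* *m U2).
  by rewrite P2 mulmxBl mulmxBr mul1mx mulmx1 cP.
have rB1 := unirep_compress rA u1 cP; have rB2 := unirep_compress rA u2 cP2.
pose B1 x := (U1 *m (A x)^T *m U1^t*)^T; pose B2 x := (U2 *m (A x)^T *m U2^t*)^T.
have AE x : A x = U1^T *m B1 x *m (U1^t*)^T + U2^T *m B2 x *m (U2^t*)^T.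
  have key d1 (U : 'M[C]_(d1, d)) : U \is unitarymx ->
      U^t* *m U *m (A x)^T = (A x)^T *m (U^t* *m U) ->
      U^t* *m (U *m (A x)^T *m U^t*) *m U = U^t* *m U *m (A x)^T.
    move=> /unitarymxP UU cU; transitivity (U^t* *m U *m ((A x)^T *m (U^t* *m U))).
      by rewrite !mulmxA.
    by rewrite -cU mulmxA -(mulmxA (U^t*)) (mulmxA U) UU mul1mx.
  apply: trmx_inj; rewrite linearD /= !trmx_mul !trmxK !(mulmxA _ _ U1) !(mulmxA _ _ U2).
  by rewrite !key// -mulmxDl sum1 mul1mx.
have tB d1 d2 (L : 'M[C]_(d, d1)) (B : G -> 'M[C]_(d1, d2)) (M : 'M[C]_(d2, d)) :
    (forall k l, trig (fun x => B x k l)) -> trig (fun x => (L *m B x *m M) i j).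
  move=> tB; apply: (@trig_eq (fun x => \sum_k M k j * \sum_l L i l * B x l k)).
    by move=> x; rewrite mxE; apply: eq_bigr => k _; rewrite mulrC mxE.
  by apply: trig_sum => k; apply: trigZ; apply: trig_sum => l; exact: trigZ.
apply: (@trig_eq (fun x => (U1^T *m B1 x *m (U1^t*)^T) i j + (U2^T *m B2 x *m (U2^t*)^T) i j)).
  by move=> x /=; have /matrixP/(_ i j) := AE x; rewrite [X in _ = X -> _]mxE => ->.
apply: trigD; apply: tB => k l; apply: ih => //; [exact: leq_trans r2 _|exact: leq_trans rW' _].
Qed.

Lemma unirep_conj d (A : G -> 'M[C]_d) : unirep A -> unirep (fun x => map_mx conjC (A x)).
Proof.
move=> [AM AU AC]; split.
- by move=> x y; rewrite AM map_mxM.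
- by move=> x; rewrite conjC_unitary.
- by move=> i j; apply: ccont_eq (ccontJ (AC i j)) => x; rewrite mxE.
Qed.

(** The conjugate of an irreducible representation is a unitary representation, which [unirep_trig]
    decomposes; its irreducibility need not be examined. *)
Lemma trigJ f : trig f -> trig (fun x => conjC (f x)).
Proof.
elim => [|c xi i j f' _ ih]; first by apply: trig_eq trig_zero => x; rewrite conjC0.
apply: (@trig_eq (fun x => conjC c * conjC (xi x i j) + conjC (f' x))).
  by move=> x; rewrite rmorphD rmorphM.
apply: trigD => //; apply: trigZ.
by apply: trig_eq (unirep_trig i j (unirep_conj (irrep_unirep xi))) => x; rewrite mxE.
Qed.

Lemma trig_csmooth f : trig f -> csmooth f.
Proof.
elim => [|c xi i j f' _ ih]; first exact: csmooth_cst.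
by apply: csmoothD => //; apply: csmoothZ; exact: (irrep_csmooth compactG haar_mu).
Qed.

End Schur.

(** * The Peter-Weyl theorem *)

Section ConvolutionOperator.
Context {R : realType} {n : nat} {G : lieGroupType R n}.
Hypothesis compactG : compact [set: G].
Variable mu : probability (borel G) R.
Hypothesis haar_mu : is_haar mu.
Local Notation C := R[i].
Local Notation I := (haar_int mu).

Let ci (f : G -> R) (cf : continuous f) : haar_integrable mu f := continuous_integrable compactG mu cf.

Lemma cintD (f h : G -> R) : continuous f -> continuous h -> I (fun x => f x + h x) = I f + I h.
Proof. by move=> cf ch; rewrite haar_intD//; exact: ci. Qed.

Lemma cintB (f h : G -> R) : continuous f -> continuous h -> I (fun x => f x - h x) = I f - I h.
Proof. by move=> cf ch; rewrite haar_intB//; exact: ci. Qed.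

Lemma cintZ c (f : G -> R) : continuous f -> I (fun x => c * f x) = c * I f.
Proof. by move=> cf; rewrite haar_intZ//; exact: ci. Qed.

Lemma cint_norm_le (f : G -> R) (M : R) : continuous f -> (forall x, `|f x| <= M) -> `|I f| <= M.
Proof. by move=> cf; exact: (norm_haar_int_le compactG (ci cf)). Qed.

Lemma cint_le (f h : G -> R) : continuous f -> continuous h -> (forall x, f x <= h x) -> I f <= I h.
Proof. by move=> cf ch; apply: le_haar_int; exact: ci. Qed.

(* The pointwise limit along an ultrafilter, which is uniform by equicontinuity. *)
Lemma cluster_uniform (F : nat -> G -> R) (K : R) : (forall k x, `|F k x| <= K) ->
  (forall x (e : R), 0 < e -> \forall y \near x, forall k, `|F k y - F k x| <= e) ->
  exists h : G -> R, continuous h /\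
    forall e, 0 < e -> forall N, exists k, (N <= k)%N /\ forall x, `|F k x - h x| <= e.
Proof.
move=> FK eqF; have [U [UU sU]] := @ultraFilterLemma nat \oo _.
have UF : ProperFilter U by exact: ultra_proper.
have /(@choice G R)[h hh] : forall x, exists l : R, (F^~ x @ U) --> l.
  move=> x.
  have [|l [_ cl]] := @segment_compact R (- K) K (F^~ x @ U).
    have sub k : `[- K, K]%classic (F k x) by rewrite /= in_itv /= -ler_norml; exact: FK.
    exact: filterE sub.
  exists l; apply/cvgrPdist_lt => e e0.
  have [//|H] := in_ultra_setVsetC [set k | `|l - F k x| < e] UU; exfalso.
  have [z [/= h1 h2]] : [set z | ~ `|l - z| < e] `&` [set z | `|l - z| < e] !=set0.
    by apply: cl => //; exact: nbhsx_ballx.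
  exact: h1.
have hle x y (e : R) : (forall k, `|F k y - F k x| <= e) -> `|h y - h x| <= e.
  move=> hF; have c : (fun k => `|F k y - F k x|) @ U --> `|h y - h x|.
    by apply: cvg_norm; apply: cvgB.
  have H : \forall k \near U, [set z : R | z <= e] `|F k y - F k x| by apply: filterE => k; exact: hF.
  exact: (closed_cvg _ (@closed_le R e) H _ c).
have ch : continuous h.
  move=> x; apply/cvgrPdist_le => e e0; have := eqF x e e0.
  by apply: filterS => y hy; rewrite distrC; exact: hle.
exists h; split => // e e0 N.
have e30 : 0 < e / 3 by rewrite divr_gt0.
have /compact_near_coveringP nc := compactG.
have : \forall k \near U, [set: G] `<=` (fun x => `|F k x - h x| <= e).
  apply: nc => x _.
  have hx : \forall k \near U, `|h x - F k x| <= e / 3 by have /cvgrPdist_le := hh x; exact.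
  near=> y k => /=.
  have hy : forall k, `|F k y - F k x| <= e / 3 by near: y; exact: eqF.
  rewrite (_ : F k y - h y = (F k y - F k x) - (h x - F k x) - (h y - h x)); last by ring.
  rewrite (le_trans (ler_normB _ _))// (le_trans (lerD (ler_normB _ _) (lexx _)))//.
  have h1 := hy k; have h2 := hle _ _ _ hy.
  have h3 : `|h x - F k x| <= e / 3 by near: k.
  lra.
move=> HU; have HN : \forall k \near U, (N <= k)%N by apply: sU; exact: nbhs_infty_ge.
have [k [/= h1 h2]] := filter_ex (filterI HN HU).
by exists k; split => // x; exact: h2.
Unshelve. all: by end_near. Qed.

Variable kappa : G -> R.
Hypothesis ckappa : continuous kappa.
Hypothesis skappa : forall x, kappa x^-1%g = kappa x.

(** The kernel depends on [x^-1 * y], so the operator commutes with left translations and its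
    eigenspaces carry representations; the symmetry of [kappa] makes it self-adjoint. *)
Definition cvop (f : G -> R) : G -> R := fun x => I (fun y => kappa (x^-1 * y)%g * f y).
Local Notation T := cvop.

Lemma continuous_kernel : continuous (fun p : G * G => kappa (p.1^-1 * p.2)%g).
Proof.
apply: continuous_fct_comp ckappa; apply: continuous_mulg_comp; last exact: continuous_snd.
by apply: continuous_invg_comp; exact: continuous_fst.
Qed.

Lemma continuous_kernel1 x : continuous (fun y => kappa (x^-1 * y)%g).
Proof. exact: (@continuous_section2 _ _ _ (fun x y => kappa (x^-1 * y)%g)) continuous_kernel. Qed.

Lemma cvop_continuous (f : G -> R) : continuous f -> continuous (T f).
Proof.
move=> cf; apply: (@continuous_haar_int_param _ _ _ compactG mu G (fun x y => kappa (x^-1 * y)%g * f y)).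
apply: continuous_mul; first exact: continuous_kernel.
exact: (continuous_fct_comp (@continuous_snd G G) cf).
Qed.

Lemma cvop_lin a (f h : G -> R) x : continuous f -> continuous h ->
  T (fun y => a * f y + h y) x = a * T f x + T h x.
Proof.
move=> cf ch; rewrite /T -cintZ; last by apply: continuous_mul => //; exact: continuous_kernel1.
rewrite -cintD.
- by apply: haar_int_ext => y; ring.
- apply: continuous_mul; first exact: continuous_cst.
  by apply: continuous_mul => //; exact: continuous_kernel1.
- by apply: continuous_mul => //; exact: continuous_kernel1.
Qed.

Lemma cvop_symmetric (f h : G -> R) : continuous f -> continuous h ->
  I (fun x => T f x * h x) = I (fun x => f x * T h x).
Proof.
move=> cf ch; pose F x y := kappa (x^-1 * y)%g * f y * h x.
have cF : continuous (fun p : G * G => F p.1 p.2).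
  apply: continuous_mul; last exact: (continuous_fct_comp (@continuous_fst G G) ch).
  apply: continuous_mul; first exact: continuous_kernel.
  exact: (continuous_fct_comp (@continuous_snd G G) cf).
transitivity (I (fun x => I (fun y => F x y))).
  apply: haar_int_ext => x; rewrite /T mulrC -cintZ.
    by apply: haar_int_ext => y; rewrite /F mulrC.
  by apply: continuous_mul => //; exact: continuous_kernel1.
rewrite (haar_fubini compactG mu cF); apply: haar_int_ext => y.
rewrite /T -cintZ; last by apply: continuous_mul => //; exact: continuous_kernel1.
apply: haar_int_ext => x; rewrite /F -(skappa (y^-1 * x)%g) invgM invgK; ring.
Qed.

Lemma cvop_left (f : G -> R) a x : continuous f -> T (fun y => f (a * y)%g) x = T f (a * x)%g.
Proof.
move=> cf; rewrite /T -[RHS](haar_int_left compactG haar_mu a).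
  by apply: haar_int_ext => y; rewrite invgM -mulgA mulKg.
by apply: continuous_mul => //; exact: continuous_kernel1.
Qed.

(** A weighted arithmetic-geometric inequality in the role of Cauchy-Schwarz. The parameter is taken
    to be 1 on the unit ball, and a small [e] for functions of small or zero norm. *)
Lemma int_abs_le (f : G -> R) (s : R) : continuous f -> 0 < s ->
  I (fun x => `|f x|) <= (s + s^-1 * I (fun x => f x ^+ 2)) / 2.
Proof.
move=> cf s0; have cf2 : continuous (fun x => f x ^+ 2) by exact: continuous_mul.
rewrite -cintZ// -[X in X + _](haar_int_cst mu) -cintD; last first.
- by apply: continuous_mul => //; exact: continuous_cst.
- exact: continuous_cst.
rewrite mulrC -cintZ; last first.
  by apply: continuous_add; [exact: continuous_cst|apply: continuous_mul => //; exact: continuous_cst].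
apply: cint_le.
- by move=> x; apply: continuous_comp; [exact: cf|exact: norm_continuous].
- apply: continuous_mul; first exact: continuous_cst.
  by apply: continuous_add; [exact: continuous_cst|apply: continuous_mul => //; exact: continuous_cst].
move=> x; rewrite -(real_normK (num_real (f x))); move: `|f x| => t.
rewrite mulrC ler_pdivlMr// -subr_ge0.
have -> : s + s^-1 * t ^+ 2 - t * 2 = s^-1 * (s - t) ^+ 2 by field; rewrite gt_eqF.
by rewrite mulr_ge0// ?sqr_ge0// invr_ge0 ltW.
Qed.

Lemma cvop_bound (K : R) (f : G -> R) x : (forall z, `|kappa z| <= K) -> continuous f ->
  `|T f x| <= K * I (fun y => `|f y|).
Proof.
move=> hK cf; have ca : continuous (fun y => `|f y|).
  by move=> y; apply: continuous_comp; [exact: cf|exact: norm_continuous].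
have ck : continuous (fun y => kappa (x^-1 * y)%g * f y).
  by apply: continuous_mul => //; exact: continuous_kernel1.
have cK : continuous (fun y => K * `|f y|) by apply: continuous_mul => //; exact: continuous_cst.
have le1 y : `|kappa (x^-1 * y)%g * f y| <= K * `|f y| by rewrite normrM ler_wpM2r.
rewrite -cintZ// ler_norml; apply/andP; split; last first.
  by apply: cint_le => // y; exact: le_trans (ler_norm _) (le1 y).
rewrite -haar_intN; last exact: ci.
apply: cint_le => //; first exact: continuous_opp.
by move=> y; rewrite lerNl; apply: le_trans (le1 y); rewrite -normrN ler_norm.
Qed.

Lemma kernel_equicontinuous x (e : R) : 0 < e ->
  \forall y \near x, forall z, `|kappa (y^-1 * z)%g - kappa (x^-1 * z)%g| < e.
Proof.
move=> e0; apply: (@near_uniform R n G compactG G (fun x y => kappa (x^-1 * y)%g)) => // z.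
exact: continuous_kernel.
Qed.

(** Compactness of the operator: the images of the L2 unit ball are bounded and equicontinuous, both
    through the kernel. *)
Lemma cvop_cluster (K : R) (f : nat -> G -> R) : (forall z, `|kappa z| <= K) ->
  (forall k, continuous (f k)) -> (forall k, I (fun x => f k x ^+ 2) <= 1) ->
  exists h : G -> R, continuous h /\
    forall e, 0 < e -> forall N, exists k, (N <= k)%N /\ forall x, `|T (f k) x - h x| <= e.
Proof.
move=> hK cf f1; have a1 k : I (fun y => `|f k y|) <= 1.
  by apply: le_trans (int_abs_le (cf k) ltr01) _; rewrite invr1 mul1r; have := f1 k; lra.
have K0 : 0 <= K by apply: le_trans (hK 1%g).
apply: (@cluster_uniform (fun k => T (f k)) K) => [k x|x e e0].
  by rewrite (le_trans (cvop_bound _ hK (cf k)))// ler_piMr.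
have := kernel_equicontinuous x e0; apply: filterS => y hy k.
have ca : continuous (fun y => `|f k y|).
  by move=> z; apply: continuous_comp; [exact: cf|exact: norm_continuous].
have cd : continuous (fun z => (kappa (y^-1 * z)%g - kappa (x^-1 * z)%g) * f k z).
  by apply: continuous_mul => //; apply: continuous_sub; exact: continuous_kernel1.
have E : T (f k) y - T (f k) x = I (fun z => (kappa (y^-1 * z)%g - kappa (x^-1 * z)%g) * f k z).
  rewrite /T -cintB; first by apply: haar_int_ext => z; rewrite mulrBl.
  - by apply: continuous_mul => //; exact: continuous_kernel1.
  - by apply: continuous_mul => //; exact: continuous_kernel1.
have ce : continuous (fun z => e * `|f k z|) by apply: continuous_mul => //; exact: continuous_cst.
have le1 z : `|(kappa (y^-1 * z)%g - kappa (x^-1 * z)%g) * f k z| <= e * `|f k z|.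
  by rewrite normrM ler_wpM2r// ltW.
apply: (@le_trans _ _ (e * I (fun z => `|f k z|))); last by rewrite ler_piMr// ltW.
rewrite E -cintZ// ler_norml; apply/andP; split; last first.
  by apply: cint_le => // z; exact: le_trans (ler_norm _) (le1 z).
rewrite -haar_intN; last exact: ci.
apply: cint_le => //; first exact: continuous_opp.
by move=> z; rewrite lerNl; apply: le_trans (le1 z); rewrite -normrN ler_norm.
Qed.

End ConvolutionOperator.

Lemma eq0_small (R : realType) (x M : R) : (forall e, 0 < e -> `|x| <= M * e) -> x = 0.
Proof.
move=> h; apply/eqP; rewrite -normr_eq0; apply: contraT => x0.
have xp : 0 < `|x| by rewrite lt_def x0 normr_ge0.
have M1 : 0 < `|M| + 1 by rewrite ltr_wpDl.
have := h (`|x| / (2 * (`|M| + 1))); rewrite divr_gt0 ?mulr_gt0// => /(_ isT) H.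
suff : M * (`|x| / (2 * (`|M| + 1))) < `|x| by rewrite ltNge H.
rewrite mulrA ltr_pdivrMr ?mulr_gt0// mulrC ltr_pM2l//.
by rewrite (le_lt_trans (ler_norm _))//; have := normr_ge0 M; lra.
Qed.

(** * Eigenfunctions of convolution operators orthogonal to the trigonometric polynomials *)

Section PeterWeyl.
Context {R : realType} {n : nat} {G : lieGroupType R n}.
Hypothesis compactG : compact [set: G].
Variable mu : probability (borel G) R.
Hypothesis haar_mu : is_haar mu.
Local Notation C := R[i].
Local Notation I := (haar_int mu).

Definition trigR (p : G -> R) : Prop := trig (fun x => (p x)%:C).

Lemma trigR_continuous p : trigR p -> continuous p.
Proof. by move=> /(trig_csmooth compactG haar_mu) [sp _]; exact: smooth_continuous. Qed.

Lemma trigR_lin a p q : trigR p -> trigR q -> trigR (fun x => a * p x + q x).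
Proof.
move=> tp tq; apply: trig_eq (trigD (trigZ (a%:C) tp) tq) => x.
by rewrite rmorphD rmorphM.
Qed.

(** The coefficient of a product [x * u y] is a sum of products of coefficients, so the integral
    over [y] only changes the scalars. The map [u] is the identity for [cvop] and the inversion for
    [gconv]. *)
Lemma trig_conv (f : G -> C) (u : G -> G) (phi : G -> C) : trig f -> continuous u ->
  ccont phi -> trig (fun x => cintegral mu (fun y => f (x * u y)%g * phi y)).
Proof.
move=> tf cu cphi; elim: tf => [|c xi i j f' tf' ih].
  apply: trig_eq (@trig_zero R n G) => x.
  by rewrite (@cintegral_ext _ _ _ mu _ (fun=> 0)) ?cintegral_cst// => y; rewrite mul0r.
have [xM _ xC] := irrep_unirep xi.
have cx k : ccont (fun y => xi (u y) k j * phi y).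
  by apply: ccontM => //; exact (ccont_comp cu (xC k j)).
have cf' x : ccont (fun y => f' (x * u y)%g * phi y).
  apply: ccontM => //; have /csmooth_ccont cf := trig_csmooth compactG haar_mu tf'.
  by apply: (@ccont_comp _ _ _ (fun y => x * u y)%g _ _ cf); exact (continuous_fct_comp cu (@continuous_mulgl R n G x)).
apply: (@trig_eq _ _ _ (fun x => (\sum_k (c * cintegral mu (fun y => xi (u y) k j * phi y)) * xi x i k) +
  cintegral mu (fun y => f' (x * u y)%g * phi y))); last first.
  by apply: trigD => //; apply: trig_sum => k; apply: trigZ; exact: trig_irrep.
move=> x.
have cs : ccont (fun y => \sum_k c * xi x i k * (xi (u y) k j * phi y)).
  by apply: ccont_sum => k; apply: ccontM => //; exact: ccont_cst.
rewrite [RHS](@cintegral_ext _ _ _ mu _ (fun y =>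
   (\sum_k c * xi x i k * (xi (u y) k j * phi y)) + f' (x * u y)%g * phi y)); last first.
  move=> y; rewrite mulrDl xM mxE mulr_sumr mulr_suml; congr (_ + _).
  by apply: eq_bigr => k _; ring.
rewrite cintegralD; try exact: ccont_integrable.
congr (_ + _).
have [_ ->] := cintegral_sum compactG (index_enum 'I_(irrep_dim xi))
    (fun k => cintegrableZ (c * xi x i k) (ccont_integrable compactG mu (cx k))).
by apply: eq_bigr => k _; rewrite cintegralZ; [ring|exact: ccont_integrable].
Qed.

Lemma trigR_conv (p : G -> R) (u : G -> G) (phi : G -> R) : trigR p -> continuous u ->
  continuous phi -> trigR (fun x => I (fun y => p (x * u y)%g * phi y)).
Proof.
move=> tp cu cphi; apply: trig_eq (trig_conv tp cu (ccont_real cphi)) => x.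
by rewrite -cintegral_real; apply: cintegral_ext => y; rewrite rmorphM.
Qed.

Lemma trig_left (f : G -> C) a : trig f -> trig (fun x => f (a * x)%g).
Proof.
elim => [|c xi i j f' tf ih]; first exact: trig_zero.
have [xM _ _] := irrep_unirep xi.
apply: (@trig_eq _ _ _ (fun x => (\sum_k (c * xi a i k) * xi x k j) + f' (a * x)%g)); last first.
  by apply: trigD => //; apply: trig_sum => k; apply: trigZ; exact: trig_irrep.
move=> x; rewrite xM mxE mulr_sumr; congr (_ + _); apply: eq_bigr => k _; ring.
Qed.

Lemma trigR_left p a : trigR p -> trigR (fun x => p (a * x)%g).
Proof. exact: trig_left. Qed.

(** The orthogonal complement taken among continuous functions; it is stable under uniform limits,
    left translations and [cvop], and turns out to be zero. *)
Definition trig_perp (f : G -> R) : Prop :=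
  continuous f /\ forall p, trigR p -> I (fun x => f x * p x) = 0.

Lemma trig_perp_lin a f h : trig_perp f -> trig_perp h -> trig_perp (fun x => a * f x + h x).
Proof.
move=> [cf pf] [ch ph]; have caf : continuous (fun x => a * f x).
  by apply: continuous_mul => //; exact: continuous_cst.
split; first exact: continuous_add.
move=> p tp; have cp := trigR_continuous tp.
rewrite (@haar_int_ext _ _ _ mu _ (fun x => a * (f x * p x) + h x * p x)); last by move=> x; ring.
have cfp : continuous (fun x => f x * p x) by exact: continuous_mul.
rewrite (cintD compactG mu); [|apply: continuous_mul => //; exact: continuous_cst|exact: continuous_mul].
by rewrite (cintZ compactG mu)// pf// ph// mulr0 addr0.
Qed.

Lemma trig_perpZ a f : trig_perp f -> trig_perp (fun x => a * f x).
Proof.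
move=> pf; have [cf _] := pf.
rewrite (_ : (fun x => _) = (fun x => (a - 1) * f x + f x)); first exact: trig_perp_lin.
by apply/funext => x; ring.
Qed.

Lemma trig_perp_left a f : trig_perp f -> trig_perp (fun x => f (a * x)%g).
Proof.
move=> [cf pf]; split; first exact (continuous_fct_comp (@continuous_mulgl R n G a) cf).
move=> p tp; rewrite -(pf _ (trigR_left a^-1%g tp)).
rewrite -[RHS](haar_int_left compactG haar_mu a); last first.
  apply: continuous_mul => //.
  exact (continuous_fct_comp (@continuous_mulgl R n G a^-1%g) (trigR_continuous tp)).
by apply: haar_int_ext => x; rewrite mulKg.
Qed.

Lemma trig_perp_closed h : continuous h ->
  (forall e : R, 0 < e -> exists2 f, trig_perp f & forall x, `|f x - h x| <= e) -> trig_perp h.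
Proof.
move=> ch hl; split => // p tp; have cp := trigR_continuous tp.
have [M M0 hM] := continuous_bounded compactG cp.
apply: (@eq0_small _ _ M) => e e0; have [f [cf pf] fh] := hl e e0.
rewrite -[I _]subr0 -(pf p tp) -(cintB compactG mu); try exact: continuous_mul.
apply: (cint_norm_le compactG mu); first by apply: continuous_sub; exact: continuous_mul.
move=> x; rewrite -mulrBl normrM mulrC distrC ler_pM//.
Qed.

Lemma int_sq_lin a (f h : G -> R) : continuous f -> continuous h ->
  I (fun x => (a * f x + h x) ^+ 2) =
  a ^+ 2 * I (fun x => f x ^+ 2) + 2 * a * I (fun x => f x * h x) + I (fun x => h x ^+ 2).
Proof.
move=> cf ch; have cc := @continuous_cst G R.
have c1 : continuous (fun x => f x ^+ 2) by exact: continuous_mul.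
have c2 : continuous (fun x => h x ^+ 2) by exact: continuous_mul.
have c3 : continuous (fun x => f x * h x) by exact: continuous_mul.
have c4 : continuous (fun x => a ^+ 2 * f x ^+ 2) by apply: continuous_mul => //; exact: cc.
have c5 : continuous (fun x => 2 * a * (f x * h x)) by apply: continuous_mul => //; exact: cc.
rewrite -!(cintZ compactG mu)// -!(cintD compactG mu)//; last exact: continuous_add.
by apply: haar_int_ext => x; ring.
Qed.

Section Eigenfunction.
Variable kappa : G -> R.
Hypothesis ckappa : continuous kappa.
Hypothesis skappa : forall x, kappa x^-1%g = kappa x.
Local Notation T := (cvop mu kappa).

Lemma cvopE (f : G -> R) x : continuous f -> T f x = I (fun y => f (x * y)%g * kappa y).
Proof.
move=> cf; rewrite /cvop -(haar_int_left compactG haar_mu x).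
  by apply: haar_int_ext => y; rewrite mulKg mulrC.
by apply: continuous_mul => //; exact: (continuous_kernel1 ckappa).
Qed.

Lemma cvop_trigR p : trigR p -> trigR (T p).
Proof.
move=> tp; have cp := trigR_continuous tp.
have -> : T p = (fun x => I (fun y => p (x * y)%g * kappa y)).
  by apply/funext => x; exact: cvopE.
by apply: (trigR_conv (u := fun y => y)) => //; exact: continuous_idfun.
Qed.

Lemma cvop_perp f : trig_perp f -> trig_perp (T f).
Proof.
move=> [cf pf]; split; first exact: (cvop_continuous compactG).
move=> p tp; rewrite (cvop_symmetric compactG mu ckappa skappa)//; last exact: trigR_continuous.
by apply: pf; exact: cvop_trigR.
Qed.

Lemma cvopZ a (f : G -> R) x : continuous f -> T (fun y => a * f y) x = a * T f x.
Proof.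
move=> cf; rewrite -[RHS]addr0.
rewrite (_ : (fun y => a * f y) = (fun y => a * f y + (fun=> 0) y)); last first.
  by apply/funext => y; rewrite addr0.
rewrite (cvop_lin compactG)//; last exact: continuous_cst.
rewrite [X in _ + X](_ : _ = 0)// /cvop (@haar_int_ext _ _ _ mu _ (fun=> 0)) ?haar_int_cst// => y.
by rewrite mulr0.
Qed.

(* Along a sequence [h k] maximising [||T h||^2] over the unit ball, with supremum
   [L], one has [T (T (h k)) - L h k -> 0], so a uniform cluster point [h] of
   [T (h k)] satisfies [T (T h) = L h]; then [sqrt L h + T h] or [h] is an
   eigenfunction of [T]. *)
Lemma cvop_eigen f x0 : trig_perp f -> T f x0 != 0 ->
  exists l g, [/\ l != 0, trig_perp g, exists x, g x != 0 & forall x, T g x = l * g x].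
Proof.
move=> pf Tf0; have [K /ltW K0 hK] := continuous_bounded compactG ckappa.
have cT (h : G -> R) : continuous h -> continuous (T h) by exact: (cvop_continuous compactG).
have csq (h : G -> R) : continuous h -> continuous (fun x => h x ^+ 2) by move=> ch; exact: continuous_mul.
pose N2 (h : G -> R) := I (fun x => h x ^+ 2).
have N20 h : 0 <= N2 h by apply: haar_int_ge0 => x; exact: sqr_ge0.
pose S := [set N2 (T h) | h in [set h | trig_perp h /\ N2 h <= 1]].
have TK (h : G -> R) x (s : R) : continuous h -> 0 < s -> `|T h x| <= K * ((s + s^-1 * N2 h) / 2).
  move=> ch s0; apply: le_trans (cvop_bound compactG mu ckappa x hK ch) _.
  by rewrite ler_wpM2l//; exact: (int_abs_le compactG).
have p0 : trig_perp (fun=> 0).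
  by have := trig_perpZ 0 pf; rewrite (_ : (fun x => _) = (fun=> 0))//; apply/funext => x; rewrite mul0r.
have hS : has_sup S.
  split.
    exists (N2 (T (fun=> 0))), (fun=> 0) => //; split => //.
    by rewrite /N2 (@haar_int_ext _ _ _ mu _ (fun=> 0)) ?haar_int_cst// => x; rewrite expr0n.
  exists (K ^+ 2) => _ [h [[ch _] h1] <-]; rewrite /N2 -[leRHS](haar_int_cst mu).
  apply: (cint_le compactG mu); [by apply: csq; exact: cT|exact: continuous_cst|] => x.
  rewrite -(real_normK (num_real (T h x))) ler_sqr ?nnegrE//.
  by apply: le_trans (TK h x 1 ch ltr01) _; rewrite ler_piMr// invr1 mul1r; lra.
pose L := sup S.
have NL h : trig_perp h -> N2 (T h) <= L * N2 h.
  move=> ph; have [ch _] := ph; have [h0|h0] := eqVneq (N2 h) 0.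
    rewrite h0 mulr0 (_ : N2 _ = 0)// /N2 (@haar_int_ext _ _ _ mu _ (fun=> 0)) ?haar_int_cst// => x.
    rewrite (_ : T h x = 0) ?expr0n//; apply: (@eq0_small _ _ (K / 2)) => e e0.
    by have := TK h x e ch e0; rewrite h0 mulr0 addr0; lra.
  have hp : 0 < N2 h by rewrite lt_def h0 N20.
  pose c := (Num.sqrt (N2 h))^-1.
  have c2 : c ^+ 2 = (N2 h)^-1 by rewrite exprVn sqr_sqrtr.
  have cch : continuous (fun x => c * h x) by apply: continuous_mul => //; exact: continuous_cst.
  have : S (N2 (T (fun x => c * h x))).
    exists (fun x => c * h x) => //; split; first exact: trig_perpZ.
    rewrite /N2 (@haar_int_ext _ _ _ mu _ (fun x => c ^+ 2 * h x ^+ 2)); last by move=> x; rewrite exprMn.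
    by rewrite (cintZ compactG mu) ?c2 ?mulVf//; exact: csq.
  move=> /(ub_le_sup hS.2); rewrite -/L.
  rewrite /N2 (@haar_int_ext _ _ _ mu _ (fun x => c ^+ 2 * T h x ^+ 2)); last first.
    by move=> x; rewrite cvopZ// exprMn.
  rewrite (cintZ compactG mu); last by apply: csq; exact: cT.
  by rewrite c2 mulrC ler_pdivrMr.
have L0 : 0 < L.
  have [cf _] := pf; have h1 := NL f pf.
  have h2 : 0 < N2 (T f).
    apply: (haar_int_gt0 compactG haar_mu (x0 := x0)); first by apply: csq; exact: cT.
      by move=> x; exact: sqr_ge0.
    by rewrite exprn_even_gt0.
  have : 0 < L * N2 f by exact: lt_le_trans h2 h1.
  by rewrite pmulr_lgt0// lt_def N20 andbT; apply: contraTneq h1 => ->; rewrite mulr0 -ltNge.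
have /(@choice nat (G -> R))[fs hfs] : forall k : nat, exists h : G -> R,
    [/\ trig_perp h, N2 h <= 1 & L - k.+1%:R^-1 < N2 (T h)].
  move=> k; have k0 : 0 < k.+1%:R^-1 :> R by rewrite invr_gt0.
  by have [_ [h [h1 h2] <-] h3] := sup_adherent k0 hS; exists h.
have cfs k : continuous (fs k) by have [[]] := hfs k.
have [h [ch hh]] := cvop_cluster compactG ckappa hK cfs (fun k => let: And3 _ h _ := hfs k in h).
have ph : trig_perp h.
  apply: trig_perp_closed => // e e0; have [k [_ hk]] := hh e e0 0%N.
  by exists (T (fs k)) => //; apply: cvop_perp; have [] := hfs k.
have TL a x (f1 f2 : G -> R) : continuous f1 -> continuous f2 ->
    T (fun y => a * f1 y + f2 y) x = a * T f1 x + T f2 x by move=> *; exact: (cvop_lin compactG).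
have Tle (f1 f2 : G -> R) (e : R) x : continuous f1 -> continuous f2 -> 0 <= e ->
    (forall y, `|f1 y - f2 y| <= e) -> `|T f1 x - T f2 x| <= K * e.
  move=> c1 c2 e0 f12; rewrite (_ : T f1 x - T f2 x = T (fun y => -1 * f2 y + f1 y) x); last first.
    by rewrite TL// mulN1r addrC.
  have cd : continuous (fun y => -1 * f2 y + f1 y).
    by apply: continuous_add => //; apply: continuous_mul => //; exact: continuous_cst.
  apply: le_trans (cvop_bound compactG mu ckappa x hK cd) _; rewrite ler_wpM2l//.
  rewrite -[leRHS](haar_int_cst mu); apply: (cint_le compactG mu); last 1 first.
  - by move=> y; rewrite mulN1r addrC.
  - exact (continuous_fct_comp cd (@norm_continuous R R)).
  - exact: continuous_cst.
have TTh x : T (T h) x = L * h x.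
  apply/eqP; rewrite -subr_eq0; apply/eqP; apply: (@eq0_small _ _ (K + K * K + L)) => e e0.
  pose N := Num.truncn (L / e ^+ 2).
  have hN : L * N.+1%:R^-1 <= e ^+ 2.
    rewrite ler_pdivrMr// mulrC -ler_pdivrMr ?exprn_gt0// ltW//.
    by have /andP[] := truncn_itv (divr_ge0 (ltW L0) (sqr_ge0 e)).
  have [k [Nk hk]] := hh e e0 N; have [pk k1 kL] := hfs k.
  pose r y := - L * fs k y + T (T (fs k)) y.
  have cr : continuous r.
    apply: continuous_add; last exact: (cT _ (cT _ (cfs k))).
    by apply: continuous_mul => //; exact: continuous_cst.
  (* Expanding the square and using symmetry and [NL], the mean square of [r] is at most
     [L * (L - N2 (T (fs k)))], hence at most [L / (k + 1)]. *)
  have Nr : N2 r <= e ^+ 2.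
    apply: le_trans hN; apply: (@le_trans _ _ (L * k.+1%:R^-1)); last first.
      by rewrite ler_pM2l// lef_pV2 ?posrE// ler_nat.
    rewrite /N2 int_sq_lin//; last exact: (cT _ (cT _ (cfs k))).
    rewrite -(cvop_symmetric compactG mu ckappa skappa) ?cfs//; last exact: (cT _ (cfs k)).
    rewrite (@haar_int_ext _ _ _ mu (fun x => T (fs k) x * T (fs k) x) (fun x => T (fs k) x ^+ 2))//.
    rewrite -!/(N2 _); have := NL _ (cvop_perp pk).
    move: (N2 (T (T (fs k)))) (N2 (T (fs k))) (N2 (fs k)) (N20 (fs k)) kL k1 => A B D D0 kL k1 AB.
    have h1 : L ^+ 2 * D <= L ^+ 2 by rewrite ler_piMr// sqr_ge0.
    move: (k.+1%:R^-1) kL => t kL.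
    have h2 : L * (L - B) <= L * t by rewrite ler_pM2l//; lra.
    rewrite sqrrN; nra.
  have h1 : `|T r x| <= K * e.
    apply: le_trans (TK r x e cr e0) _; rewrite ler_wpM2l//.
    have : e^-1 * N2 r <= e by rewrite mulrC ler_pdivrMr// -expr2.
    lra.
  have Tr : T r x = - L * T (fs k) x + T (T (T (fs k))) x.
    by rewrite /r TL ?cfs//; exact: (cT _ (cT _ (cfs k))).
  have h2 : `|T (T (T (fs k))) x - T (T h) x| <= K * (K * e).
    apply: (Tle); [exact: (cT _ (cT _ (cfs k)))|exact: cT|by rewrite mulr_ge0// ltW|].
    by move=> y; apply: (Tle) => //; [exact: cT|exact: ltW].
  have h3 := hk x.
  have h4 : `|L * (T (fs k) x - h x)| <= L * e by rewrite normrM gtr0_norm// ler_pM2l.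
  rewrite (_ : _ - _ = T r x - (T (T (T (fs k))) x - T (T h) x) + L * (T (fs k) x - h x)); last first.
    by rewrite Tr; move: (T (fs k) x) (T (T (T (fs k))) x) (T (T h) x) (h x) => a b c d; ring.
  rewrite (le_trans (ler_normD _ _))// (le_trans (lerD (ler_normB _ _) (lexx _)))//.
  by rewrite !mulrDl -mulrA !lerD.
have [x1 hx1] : exists x, h x != 0.
  apply: contrapT => /forallNP h0; have hz x : h x = 0 by apply: contrapT => /eqP; exact: h0.
  (* If [h] vanished, some [T (fs k)] would have mean square at most [e ^+ 2 = L / 8] while
     exceeding [L / 2]. *)
  pose e := Num.sqrt (L / 2) / 2.
  have e0 : 0 < e by rewrite divr_gt0// sqrtr_gt0 divr_gt0.
  pose N := Num.truncn (2 / L).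
  have hN : N.+1%:R^-1 <= L / 2.
    rewrite -[L / 2]invrK lef_pV2 ?posrE ?invr_gt0 ?divr_gt0// invf_div ltW//.
    by have /andP[] := truncn_itv (divr_ge0 (ler0n R 2) (ltW L0)).
  have [k [Nk hk]] := hh e e0 N; have [pk k1 kL] := hfs k.
  have hkN : k.+1%:R^-1 <= L / 2 by apply: le_trans hN; rewrite lef_pV2 ?posrE// ler_nat.
  have : N2 (T (fs k)) <= e ^+ 2.
    rewrite /N2 -[leRHS](haar_int_cst mu); apply: (cint_le compactG mu).
    - by apply: csq; exact: cT.
    - exact: continuous_cst.
    move=> x; rewrite -(real_normK (num_real _)) ler_sqr ?nnegrE ?(ltW e0)//.
    by have := hk x; rewrite hz subr0.
  have -> : e ^+ 2 = L / 8 by rewrite /e exprMn sqr_sqrtr ?divr_ge0 ?(ltW L0)//; field.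
  move: (k.+1%:R^-1) (N2 _) kL hkN => t z kL hkN; lra.
pose s := Num.sqrt L; have s0 : 0 < s by rewrite sqrtr_gt0.
have ss : s * s = L by rewrite -expr2 sqr_sqrtr ?(ltW L0).
have pT := cvop_perp ph.
have [[x2 hx2]|hN] := pselect (exists x, s * h x + T h x != 0).
  exists s, (fun x => s * h x + T h x); split.
  - by rewrite gt_eqF.
  - exact: trig_perp_lin.
  - by exists x2.
  - by move=> x; rewrite TL ?TTh//; [rewrite -ss; ring|exact: cT].
exists (- s), h; split => //.
- by rewrite oppr_eq0 gt_eqF.
- by exists x1.
- move=> x; apply/eqP; rewrite mulNr -addr_eq0 addrC; apply: contrapT => /negP H.
  by apply: hN; exists x.
Qed.

Definition eigenfun (l : R) (f : G -> R) : Prop :=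
  trig_perp f /\ forall x, T f x = l * f x.

Lemma eigenfun_lin l a f h : eigenfun l f -> eigenfun l h -> eigenfun l (fun x => a * f x + h x).
Proof.
move=> [pf ef] [ph eh]; split; first exact: trig_perp_lin.
have [[cf _] [ch _]] := (pf, ph).
by move=> x; rewrite (cvop_lin compactG)// ef eh; ring.
Qed.

Lemma eigenfunZ l a f : eigenfun l f -> eigenfun l (fun x => a * f x).
Proof.
move=> ef; rewrite (_ : (fun x => _) = (fun x => (a - 1) * f x + f x)); first exact: eigenfun_lin.
by apply/funext => x; ring.
Qed.

Lemma eigenfun_sum l m (c : 'I_m -> R) (e : 'I_m -> G -> R) f : (forall i, eigenfun l (e i)) ->
  eigenfun l f -> eigenfun l (fun x => \sum_i c i * e i x + f x).
Proof.
move=> ee ef; rewrite /index_enum; elim: (Finite.enum _) => [|i s ih].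
  by rewrite (_ : (fun x => _) = f)//; apply/funext => x; rewrite big_nil add0r.
rewrite (_ : (fun x => _) = (fun x => c i * e i x + (\sum_(j <- s) c j * e j x + f x))).
  exact: eigenfun_lin.
by apply/funext => x; rewrite big_cons addrA.
Qed.

Lemma eigenfun_left l a f : eigenfun l f -> eigenfun l (fun x => f (a * x)%g).
Proof.
move=> [pf ef]; split; first exact: trig_perp_left.
by move=> x; rewrite (cvop_left compactG haar_mu)//; case: pf.
Qed.

Definition orthonormal m (e : 'I_m -> G -> R) : Prop :=
  forall i j, I (fun x => e i x * e j x) = (i == j)%:R.

Lemma int_lin_comb m (c : 'I_m -> R) (e : 'I_m -> G -> R) q : (forall i, continuous (e i)) ->
  continuous q ->
  I (fun x => (\sum_i c i * e i x) * q x) = \sum_i c i * I (fun x => e i x * q x).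
Proof.
move=> ce cq; have ceq i : continuous (fun x => e i x * q x) by exact: continuous_mul.
have [_ E] := haar_int_sum compactG (index_enum 'I_m)
  (fun i => haar_integrableZ (c i) (continuous_integrable compactG mu (ceq i))).
rewrite (@haar_int_ext _ _ _ mu _ (fun x => \sum_i c i * (e i x * q x))); last first.
  by move=> x; rewrite mulr_suml; apply: eq_bigr => i _; rewrite mulrA.
by rewrite E; apply: eq_bigr => i _; rewrite (cintZ compactG mu).
Qed.

Lemma continuous_lin_comb m (c : 'I_m -> R) (e : 'I_m -> G -> R) : (forall i, continuous (e i)) ->
  continuous (fun x => \sum_i c i * e i x).
Proof.
move=> ce; rewrite /index_enum; elim: (Finite.enum _) => [|i s ih].
  rewrite (_ : (fun x => _) = (fun=> 0)); first exact: continuous_cst.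
  by apply/funext => x; rewrite big_nil.
rewrite (_ : (fun x => _) = (fun x => c i * e i x + \sum_(j <- s) c j * e j x)).
  by apply: continuous_add => //; apply: continuous_mul => //; exact: continuous_cst.
by apply/funext => x; rewrite big_cons.
Qed.

Lemma orthonormal_bessel m (e : 'I_m -> G -> R) (k : G -> R) : (forall i, continuous (e i)) ->
  continuous k -> orthonormal e ->
  \sum_i I (fun x => k x * e i x) ^+ 2 <= I (fun x => k x ^+ 2).
Proof.
move=> ce ck oe; pose c i := I (fun x => k x * e i x).
pose s x := \sum_i c i * e i x; have cs : continuous s by exact: continuous_lin_comb.
have Is q : continuous q -> I (fun x => s x * q x) = \sum_i c i * I (fun x => e i x * q x).
  by move=> cq; exact: int_lin_comb.
have e1 : I (fun x => s x * k x) = \sum_i c i ^+ 2.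
  rewrite Is//; apply: eq_bigr => i _; rewrite expr2; congr (_ * _).
  by apply: haar_int_ext => x; exact: mulrC.
have e2 : I (fun x => s x ^+ 2) = \sum_i c i ^+ 2.
  rewrite (Is s)//; apply: eq_bigr => i _; rewrite expr2; congr (_ * _).
  rewrite (@haar_int_ext _ _ _ mu _ (fun x => s x * e i x)); last by move=> x; exact: mulrC.
  rewrite Is// (bigD1 i)//= oe eqxx mulr1 big1 ?addr0// => j ji.
  by rewrite oe (negbTE ji) mulr0.
have : 0 <= I (fun x => (-1 * s x + k x) ^+ 2) by apply: haar_int_ge0 => x; exact: sqr_ge0.
rewrite int_sq_lin// e1 e2 -/(\sum_i c i ^+ 2); move: (\sum_i _) (I _) => a b; lra.
Qed.

(* [l * e i x] is the coefficient on [e i] of the kernel [kappa (x^-1 y)] of [T]: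
   integrate Bessel's inequality over [x]. *)
Lemma eigenfun_dim_bounded l : l != 0 -> exists B : nat, forall m (e : 'I_m -> G -> R),
  (forall i, eigenfun l (e i)) -> orthonormal e -> (m <= B)%N.
Proof.
move=> l0; have [K _ hK] := continuous_bounded compactG ckappa.
have l2 : 0 < l ^+ 2 by rewrite exprn_even_gt0.
exists (Num.truncn (K ^+ 2 / l ^+ 2)) => m e ee oe.
have ce i : continuous (e i) by case: (ee i) => -[].
rewrite truncn_ge_nat; last by rewrite divr_ge0// sqr_ge0.
have cc := @continuous_cst G R.
rewrite ler_pdivlMr// -[leRHS](haar_int_cst mu).
have ce2 i : continuous (fun x => e i x * e i x) by exact: continuous_mul.
have -> : m%:R * l ^+ 2 = I (fun x => (\sum_i l ^+ 2 * (e i x * e i x)) * 1).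
  rewrite (int_lin_comb (e := fun i x => e i x * e i x) (q := fun=> 1) (fun=> l ^+ 2) ce2 (cc 1)).
  rewrite (eq_bigr (fun=> l ^+ 2)) ?sumr_const ?card_ord ?mulr_natl// => i _.
  rewrite (@haar_int_ext _ _ _ mu _ (fun x => e i x * e i x)) ?oe ?eqxx ?mulr1// => x.
  by rewrite mulr1.
apply: (cint_le compactG mu) => //.
  by apply: continuous_mul; [exact: continuous_lin_comb|exact: cc].
move=> x; rewrite mulr1.
have ck := @continuous_kernel1 R n G kappa ckappa x.
apply: (@le_trans _ _ (I (fun y => kappa (x^-1 * y)%g ^+ 2))).
  apply: le_trans (orthonormal_bessel ce ck oe); apply: ler_sum => i _.
  by rewrite -[I _]/(T (e i) x) (ee i).2 exprMn expr2.
rewrite -[leRHS](haar_int_cst mu); apply: (cint_le compactG mu).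
- exact: continuous_mul.
- exact: cc.
move=> y; rewrite -(real_normK (num_real _)) ler_sqr ?nnegrE//.
exact: le_trans (hK 1%g).
Qed.

(** An orthonormal family of maximal length exists by the bound on the dimension; a nonzero
    remainder of an expansion, once normalised, would lengthen it. *)
Lemma eigenfun_basis l : l != 0 -> exists m (e : 'I_m -> G -> R),
  [/\ forall i, eigenfun l (e i), orthonormal e &
    forall f, eigenfun l f -> forall x, f x = \sum_i I (fun y => f y * e i y) * e i x].
Proof.
move=> l0; have [B hB] := eigenfun_dim_bounded l0.
pose Q m := `[< exists e : 'I_m -> G -> R, (forall i, eigenfun l (e i)) /\ orthonormal e >].
have exQ : exists m, Q m by exists 0%N; apply/asboolP; exists (fun _ _ => 0); split => -[].
have bQ m : Q m -> (m <= B)%N by move=> /asboolP[e [h1 h2]]; exact: hB h1 h2.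
case: (ex_maxnP exQ bQ) => m /asboolP[e [ee oe]] mmax; exists m, e; split => // f ef x.
have ce i : continuous (e i) by case: (ee i) => -[].
have [[cf _] _] := ef.
pose c i := I (fun y => f y * e i y); pose r y := \sum_i (- c i) * e i y + f y.
have er : eigenfun l r by exact: eigenfun_sum.
have [[cr _] _] := er.
have ro i : I (fun y => r y * e i y) = 0.
  rewrite (@haar_int_ext _ _ _ mu _ (fun y => (\sum_i (- c i) * e i y) * e i y + f y * e i y)); last first.
    by move=> y; rewrite mulrDl.
  rewrite (cintD compactG mu); [|apply: continuous_mul => //; exact: continuous_lin_comb|exact: continuous_mul].
  rewrite int_lin_comb// (bigD1 i)//= oe eqxx mulr1 big1 ?addr0 ?addNr// => j ji.
  by rewrite oe (negbTE ji) mulr0.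
suff r0 : r x = 0.
  by move: r0; rewrite /r => /eqP; rewrite addrC addr_eq0 => /eqP ->; rewrite -sumrN; apply: eq_bigr => i _;
    rewrite mulNr opprK.
apply: contrapT => /eqP rx.
have N0 : 0 < I (fun y => r y ^+ 2).
  apply: (haar_int_gt0 compactG haar_mu (x0 := x)); first exact: continuous_mul.
    by move=> y; exact: sqr_ge0.
  by rewrite exprn_even_gt0.
pose d := (Num.sqrt (I (fun y => r y ^+ 2)))^-1.
have d2 : d * d * I (fun y => r y ^+ 2) = 1.
  by rewrite -expr2 exprVn sqr_sqrtr ?ltW// mulVf// gt_eqF.
pose e' (i : 'I_m.+1) := if unlift ord_max i is Some j then e j else fun y => d * r y.
suff : (m.+1 <= m)%N by rewrite ltnn.
have crr : continuous (fun y => r y ^+ 2) by exact: continuous_mul.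
have cre i : continuous (fun y => r y * e i y) by exact: continuous_mul.
apply: mmax; apply/asboolP; exists e'; split.
  by move=> i; rewrite /e'; case: unliftP => [j _|_]; [exact: ee|exact: eigenfunZ].
move=> i j; rewrite /e'; case: unliftP => [i' ->|->]; case: unliftP => [j' ->|->].
- by rewrite oe (inj_eq lift_inj).
- rewrite eq_sym (negbTE (neq_lift _ _)) (@haar_int_ext _ _ _ mu _ (fun y => d * (r y * e i' y))); last first.
    by move=> y; ring.
  by rewrite (cintZ compactG mu)// ro mulr0.
- rewrite (negbTE (neq_lift _ _)) (@haar_int_ext _ _ _ mu _ (fun y => d * (r y * e j' y))); last first.
    by move=> y; ring.
  by rewrite (cintZ compactG mu)// ro mulr0.
- rewrite eqxx (@haar_int_ext _ _ _ mu _ (fun y => d * d * r y ^+ 2)); last by move=> y; ring.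
  by rewrite (cintZ compactG mu).
Qed.

(* Eigenspaces are invariant under left translations, which yields a unitary
   representation with the matrix coefficients [a x i j]. *)
Lemma eigenfun_trigR l m (e : 'I_m -> G -> R) j :
  (forall i, eigenfun l (e i)) -> orthonormal e ->
  (forall f, eigenfun l f -> forall x, f x = \sum_i I (fun y => f y * e i y) * e i x) ->
  trigR (e j).
Proof.
move=> ee oe be; have ce i : continuous (e i) by case: (ee i) => -[].
pose a x i j := I (fun y => e j (x^-1 * y)%g * e i y).
have La x k y : e k (x^-1 * y)%g = \sum_i a x i k * e i y.
  by rewrite (be (fun y => e k (x^-1 * y)%g))//; exact: eigenfun_left.
pose A x : 'M[C]_m := \matrix_(i, j) (a x i j)%:C.
have aM x y i k : a (x * y)%g i k = \sum_q a x i q * a y q k.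
  rewrite {1}/a (@haar_int_ext _ _ _ mu _ (fun z => (\sum_q a y q k * e q (x^-1 * z)%g) * e i z)).
    rewrite int_lin_comb//; first by apply: eq_bigr => q _; exact: mulrC.
    by move=> q; exact (continuous_fct_comp (@continuous_mulgl R n G x^-1%g) (ce q)).
  by move=> z; rewrite -La invgM -mulgA.
have aO x i k : \sum_q a x q i * a x q k = (i == k)%:R.
  rewrite -oe -(haar_int_left compactG haar_mu x^-1%g); last exact: continuous_mul.
  rewrite (@haar_int_ext _ _ _ mu _ (fun z => (\sum_q a x q i * e q z) * e k (x^-1 * z)%g)); last first.
    by move=> z; rewrite -La.
  rewrite int_lin_comb//.
    by apply: eq_bigr => q _; congr (_ * _); apply: haar_int_ext => z; exact: mulrC.
  exact (continuous_fct_comp (@continuous_mulgl R n G x^-1%g) (ce k)).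
have ATA x : (A x)^T *m A x = 1%:M.
  apply/matrixP => i k; rewrite !mxE -(rmorph_nat (@real_complex R)) /= -(aO x) rmorph_sum.
  by apply: eq_bigr => q _; rewrite !mxE rmorphM.
have Aconj x : map_mx conjC (A x) = A x.
  by apply/matrixP => i k; rewrite !mxE cconjE /= oppr0.
have rA : unirep A.
  split.
  - move=> x y; apply/matrixP => i k; rewrite !mxE aM rmorph_sum.
    by apply: eq_bigr => q _; rewrite !mxE rmorphM.
  - move=> x; apply/unitarymxP; apply: mulmx1C.
    by rewrite -map_trmx Aconj; exact: ATA.
  - move=> i k; apply: (@ccont_eq _ _ (fun x => (a x i k)%:C)); first by move=> x; rewrite mxE.
    apply: ccont_real.
    apply: (@continuous_haar_int_param _ _ _ compactG mu G (fun x y => e k (x^-1 * y)%g * e i y)).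
    apply: continuous_mul; last exact: (continuous_fct_comp (@continuous_snd G G) (ce i)).
    exact: (continuous_kernel (ce k)).
have AV x : A x^-1%g = (A x)^T by rewrite unirepV// -map_trmx Aconj.
apply: (@trig_eq _ _ _ (fun x => \sum_i (e i 1%g)%:C * A x j i)).
  move=> x; have -> : e j x = \sum_i a x^-1%g i j * e i 1%g by rewrite -La invgK mulg1.
  rewrite rmorph_sum; apply: eq_bigr => i _.
  have /matrixP/(_ i j) := AV x; rewrite !mxE => <-.
  by rewrite rmorphM mulrC.
by apply: trig_sum => i; apply: trigZ; exact: unirep_trig.
Qed.

(** Otherwise there is an eigenspace inside [trig_perp] for a nonzero eigenvalue. Its basis consists
    of trigonometric polynomials orthogonal to themselves, so it is empty and the eigenfunction is
    zero. *)
Lemma cvop_perp0 f x : trig_perp f -> T f x = 0.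
Proof.
move=> pf; apply: contrapT => /eqP Tfx.
have [l [h [l0 ph [y hy] hT]]] := cvop_eigen pf Tfx.
have [m [e [ee oe be]]] := eigenfun_basis l0.
have z (i : 'I_m) : False.
  have [[_ pe] _] := ee i; have := pe _ (eigenfun_trigR i ee oe be).
  by rewrite oe eqxx => /eqP; rewrite oner_eq0.
move: hy; rewrite (be h)// big1 ?eqxx// => i _; by case: (z i).
Qed.

End Eigenfunction.

End PeterWeyl.

(** * Uniform density of trigonometric polynomials, also with derivatives *)

Section Density.
Context {R : realType} {n : nat} {G : lieGroupType R n}.
Hypothesis compactG : compact [set: G].
Variable mu : probability (borel G) R.
Hypothesis haar_mu : is_haar mu.
Local Notation C := R[i].
Local Notation I := (haar_int mu).

Lemma exists_symmetric_bump (N : set G) : nbhs (1%g : G) N ->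
  exists kappa : G -> R, [/\ continuous kappa, forall x, 0 <= kappa x,
    forall x, kappa x^-1%g = kappa x, I kappa = 1 & 0 < kappa 1%g] /\
    forall x, kappa x != 0 -> N x.
Proof.
move=> /exists_bump[phi [sphi phi0 phi1 phiN]]; have cphi := smooth_continuous sphi.
pose k (x : G) := phi x * phi x^-1%g.
have ck : continuous k.
  apply: continuous_mul => //; exact (continuous_fct_comp (@lie_inv_continuous R n G) cphi).
have k0 x : 0 <= k x by exact: mulr_ge0.
have k1 : k 1%g = 1 by rewrite /k invg1 phi1 mulr1.
have Ik : 0 < I k by apply: (haar_int_gt0 compactG haar_mu (x0 := 1%g)) => //; rewrite k1.
have Ik1 : 0 < (I k)^-1 by rewrite invr_gt0.
exists (fun x => (I k)^-1 * k x); split; first split.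
- by apply: continuous_mul => //; exact: continuous_cst.
- by move=> x; rewrite mulr_ge0// ltW.
- by move=> x; rewrite /k invgK; congr (_ * _); exact: mulrC.
- by rewrite (cintZ compactG mu)// mulVf// gt_eqF.
- by rewrite k1 mulr1.
- move=> x; rewrite mulf_eq0 negb_or => /andP[_]; rewrite mulf_eq0 negb_or => /andP[h _].
  exact: phiN.
Qed.

Lemma kernel_average (k F : G -> R) (e : R) : continuous k -> continuous F ->
  (forall y, 0 <= k y) -> I k = 1 -> (forall y, k y != 0 -> `|F y| <= e) ->
  `|I (fun y => k y * F y)| <= e.
Proof.
move=> ck cF k0 Ik Fe; have cd : continuous (fun y => k y * F y) by exact: continuous_mul.
have ce : continuous (fun y => e * k y) by apply: continuous_mul => //; exact: continuous_cst.
have Ie : I (fun y => e * k y) = e by rewrite (cintZ compactG mu)// Ik mulr1.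
have le1 y : `|k y * F y| <= e * k y.
  rewrite normrM (ger0_norm (k0 y)) mulrC.
  have [->|/Fe h] := eqVneq (k y) 0; first by rewrite !mulr0.
  by rewrite ler_wpM2r.
rewrite -[leRHS]Ie ler_norml; apply/andP; split; last first.
  by apply: (cint_le compactG mu) => // y; exact: le_trans (ler_norm _) (le1 y).
rewrite -haar_intN; last exact: continuous_integrable.
apply: (cint_le compactG mu) => //; first exact: continuous_opp.
by move=> y; rewrite lerNl; apply: le_trans (le1 y); rewrite -normrN ler_norm.
Qed.

(** A kernel concentrated near the identity would give a positive value at [x] to a function
    positive near [x], against [cvop_perp0]. *)
Lemma trig_perp_eq0 f x : trig_perp mu f -> f x = 0.
Proof.
move=> pf; apply: contrapT => /eqP fx; have [cf _] := pf.
(* Scaling by the constant [f x] makes the value at [x] positive without a case distinction on its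
   sign. *)
pose h y := f x * f y; have ph : trig_perp mu h by exact: (trig_perpZ compactG haar_mu).
have [ch _] := ph.
have hx : 0 < h x by rewrite /h -expr2 exprn_even_gt0.
have chx : continuous (fun z => h (x * z)%g) by exact (continuous_fct_comp (@continuous_mulgl R n G x) ch).
have nN : nbhs (1%g : G) [set z | 0 < h (x * z)%g].
  by apply: (@nbhs_gt_continuous R G _ _ _ chx); rewrite /= mulg1.
have [k [[ck k0 sk _ k1] kN]] := exists_symmetric_bump nN.
have := cvop_perp0 compactG haar_mu ck sk x ph.
suff : 0 < cvop mu k h x by move=> + E; rewrite E ltxx.
apply: (haar_int_gt0 compactG haar_mu (x0 := x)).
- by apply: continuous_mul => //; exact: (continuous_kernel1 ck).
- move=> y; have [->|/kN] := eqVneq (k (x^-1 * y)%g) 0; first by rewrite mul0r.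
  by rewrite /= mulVKg => /ltW; exact: mulr_ge0.
- by rewrite mulVg mulr_gt0.
Qed.

(* If [p k] minimises the [L2] distance from [f] to [trigR], then [T (f - p k)] has
   a uniform cluster point orthogonal to [trigR], which must vanish. *)
Lemma cvop_trig_approx (kappa f : G -> R) (e : R) : continuous kappa ->
  (forall x, kappa x^-1%g = kappa x) -> continuous f -> 0 < e ->
  exists2 p, trigR p & forall x, `|cvop mu kappa f x - p x| <= e.
Proof.
move=> ck sk cf e0; pose N2 (h : G -> R) := I (fun x => h x ^+ 2).
have ctr (p : G -> R) : trigR p -> continuous p by exact: (trigR_continuous compactG haar_mu).
have cc := @continuous_cst G R.
have [K _ hK] := continuous_bounded compactG ck.
have N20 h : 0 <= N2 h by apply: haar_int_ge0 => x; exact: sqr_ge0.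
pose S := [set N2 (fun x => -1 * p x + f x) | p in [set p | trigR p]].
have t0 : @trigR R n G (fun=> 0) by exact: trig_zero.
have hS : has_inf S.
  split; first by exists (N2 (fun x => -1 * 0 + f x)), (fun=> 0).
  by exists 0 => _ [p _ <-].
pose L := inf S.
have /(@choice nat (G -> R))[ps hps] : forall k : nat, exists p : G -> R,
    trigR p /\ N2 (fun x => -1 * p x + f x) < L + k.+1%:R^-1.
  move=> k; have k0 : 0 < k.+1%:R^-1 :> R by rewrite invr_gt0.
  by have [_ [p h1 <-] h3] := inf_adherent k0 hS; exists p.
have L0 : 0 <= L by apply: lb_le_inf; [case: hS|move=> _ [p _ <-]].
pose g k x := -1 * ps k x + f x.
have cg k : continuous (g k).
  apply: continuous_add => //; apply: continuous_mul; first exact: cc.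
  by apply: ctr; have [] := hps k.
have L1 : 0 < L + 1 by rewrite ltr_wpDl.
(* Brings all the remainders [g k], whose mean square is below [L + 1], into the unit ball required
   by [cvop_cluster]. *)
pose c := (Num.sqrt (L + 1))^-1.
have c0 : 0 < c by rewrite invr_gt0 sqrtr_gt0.
have c2 : c ^+ 2 * (L + 1) = 1 by rewrite exprVn sqr_sqrtr ?ltW// mulVf// gt_eqF.
have cg2 k : continuous (fun x => c * g k x) by apply: continuous_mul => //; exact: cc.
have Ng k : N2 (fun x => c * g k x) <= 1.
  rewrite /N2 (@haar_int_ext _ _ _ mu _ (fun x => c ^+ 2 * g k x ^+ 2)); last by move=> x; rewrite exprMn.
  rewrite (cintZ compactG mu); last exact: continuous_mul.
  rewrite -c2 ler_pM2l ?exprn_gt0//; have [_ /ltW h] := hps k; apply: le_trans h _.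
  by rewrite lerD2l invf_le1// ler1n.
have [h [ch hh]] := cvop_cluster compactG ck hK cg2 Ng.
have TZ k x : cvop mu kappa (fun y => c * g k y) x = c * cvop mu kappa (g k) x.
  exact: (cvopZ compactG).
have ph : trig_perp mu h.
  split => // p tp; have cp := ctr _ tp.
  have [M M0 hM] := continuous_bounded compactG cp.
  pose q := cvop mu kappa p; have tq : trigR q by exact: (cvop_trigR compactG haar_mu ck).
  have cq := ctr _ tq.
  apply: (@eq0_small _ _ (M + c * ((1 + N2 q) / 2))) => d d0.
  pose N := Num.truncn (d ^+ 2)^-1.
  have hN : N.+1%:R^-1 <= d ^+ 2.
    have d2 : 0 < (d ^+ 2)^-1 by rewrite invr_gt0 exprn_gt0.
    rewrite -[leRHS]invrK lef_pV2 ?posrE// ltW//.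
    by have /andP[] := truncn_itv (ltW d2).
  have [k [Nk hk]] := hh d d0 N.
  have k1 : k.+1%:R^-1 <= d ^+ 2 by apply: le_trans hN; rewrite lef_pV2 ?posrE// ler_nat.
  (* The polynomial [ps k - t q] also competes for the infimum [L]; the choices [t = d] and
     [t = - d] then make [g k] nearly orthogonal to [q]. *)
  have Hq t : - (t ^+ 2 * N2 q) - d ^+ 2 <= 2 * t * I (fun x => q x * g k x).
    have [tps lk] := hps k.
    have : L <= N2 (fun x => t * q x + g k x).
      apply: ge_inf; first by case: hS.
      exists (fun x => - t * q x + ps k x); first exact: (trigR_lin).
      by apply: haar_int_ext => x; congr (_ ^+ 2); rewrite /g; ring.
    rewrite /N2 (int_sq_lin compactG mu)// -!/(N2 _) => H.
    move: lk H k1; rewrite -/(g k); move: (N2 (g k)) (k.+1%:R^-1) => A B *; lra.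
  have Ig : `|I (fun x => q x * g k x)| <= d * ((1 + N2 q) / 2).
    have := Hq d; have := Hq (- d); move: (I _) (N2 q) => A B h1 h2.
    by rewrite ler_norml; apply/andP; split; rewrite -(ler_pM2l d0); nra.
  have ->: I (fun x => h x * p x) = c * I (fun x => q x * g k x) -
      I (fun x => (cvop mu kappa (fun y => c * g k y) x - h x) * p x).
    have E : c * I (fun x => q x * g k x) = I (fun x => cvop mu kappa (fun y => c * g k y) x * p x).
      rewrite (cvop_symmetric compactG mu ck sk)// -(cintZ compactG mu); last exact: continuous_mul.
      by apply: haar_int_ext => x; rewrite /q; ring.
    have cT := cvop_continuous compactG ck (mu := mu) (cg2 k).
    rewrite E -(cintB compactG mu).
    - by apply: haar_int_ext => x; ring.
    - exact: continuous_mul.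
    - by apply: continuous_mul => //; exact: continuous_sub.
  rewrite (le_trans (ler_normB _ _))// mulrDl addrC lerD//.
    apply: (cint_norm_le compactG mu).
      by apply: continuous_mul => //; apply: continuous_sub => //; exact: (cvop_continuous compactG).
    by move=> x; rewrite normrM mulrC ler_pM.
  by rewrite normrM gtr0_norm// -mulrA ler_pM2l// mulrC.
have [|k [_ hk]] := hh (c * e) _ 0%N; first by rewrite mulr_gt0.
have [tps _] := hps k; exists (cvop mu kappa (ps k)); first exact: (cvop_trigR compactG haar_mu ck).
move=> x; rewrite -(ler_pM2l c0) -[X in X * `|_|]gtr0_norm// -normrM.
have := hk x; rewrite (trig_perp_eq0 x ph) subr0 TZ; congr (`|c * _| <= _).
rewrite /g (cvop_lin compactG)//; last exact: ctr.
by rewrite mulN1r addrC.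
Qed.

(** Averaging against a narrow symmetric bump changes [f] by at most [e / 2], and the average is
    within [e / 2] of a trigonometric polynomial. *)
Theorem trig_dense (f : G -> R) (e : R) : continuous f -> 0 < e ->
  exists2 p, trigR p & forall x, `|f x - p x| <= e.
Proof.
move=> cf e0; have e2 : 0 < e / 2 by rewrite divr_gt0.
have cF : continuous (fun p : G * G => f (p.2 * p.1)%g).
  apply: continuous_fct_comp cf.
  by apply: continuous_mulg_comp; [exact: continuous_snd|exact: continuous_fst].
have nN := @near_uniform R n G compactG G (fun z x => f (x * z)%g) 1%g _ (fun y => cF (1%g, y)) e2.
have [k [[ck k0 sk Ik _] kN]] := exists_symmetric_bump nN.
have [p tp hp] := cvop_trig_approx ck sk cf e2; exists p => // x.
rewrite (_ : f x - p x = (f x - cvop mu k f x) + (cvop mu k f x - p x)); last by ring.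
rewrite (le_trans (ler_normD _ _))// [leRHS]splitr lerD//.
rewrite (cvopE compactG haar_mu ck)// distrC.
have cfx : continuous (fun y => f (x * y)%g) by exact (continuous_fct_comp (@continuous_mulgl R n G x) cf).
have cc := @continuous_cst G R.
rewrite (_ : _ - _ = I (fun y => k y * (f (x * y)%g - f x))); last first.
  rewrite -[X in _ - X]mulr1 -Ik -(cintZ compactG mu)// -(cintB compactG mu).
  - by apply: haar_int_ext => y; ring.
  - exact: continuous_mul.
  - by apply: continuous_mul => //; exact: cc.
apply: kernel_average => //; first by apply: continuous_sub => //; exact: cc.
by move=> y /kN /(_ x) /=; rewrite mulg1 => /ltW.
Qed.

(** Left-invariant derivatives of this convolution fall on [phi], whereas it inherits from [p] the
    property of being a trigonometric polynomial. *)
Definition gconv (p phi : G -> R) (x : G) : R := I (fun y => p (x * y^-1)%g * phi y).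

Lemma gconvE (p phi : G -> R) x : continuous p -> continuous phi ->
  gconv p phi x = I (fun y => p y * phi (y^-1 * x)%g).
Proof.
move=> cp cphi; rewrite /gconv.
have cF : continuous (fun y => p y * phi (y^-1 * x)%g).
  apply: continuous_mul => //; apply: continuous_fct_comp cphi.
  apply: continuous_mulg_comp; last exact: continuous_cst.
  by apply: continuous_invg_comp; exact: continuous_idfun.
have cFx := continuous_fct_comp (@continuous_mulgl R n G x) cF.
rewrite -(haar_int_left compactG haar_mu x cF) -(haar_int_inv compactG haar_mu cFx).
by apply: haar_int_ext => y; rewrite invgM invgK mulgVK.
Qed.

Lemma gconv_cont_aux (p : G -> R) x : continuous p -> continuous (fun y => p (x * y^-1)%g).
Proof.
move=> cp; apply: continuous_fct_comp cp.
apply: continuous_mulg_comp; first exact: continuous_cst.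
by apply: continuous_invg_comp; exact: continuous_idfun.
Qed.

Lemma gconv_smooth (p phi : G -> R) : continuous p -> smooth phi -> smooth (gconv p phi).
Proof.
move=> cp sphi; have cpV : continuous (fun y => p y^-1%g).
  exact (continuous_fct_comp (@lie_inv_continuous R n G) cp).
have := smooth_conv compactG mu sphi cpV.
rewrite (_ : (fun x => _) = gconv p phi)//; apply/funext => x.
rewrite gconvE//; last exact: smooth_continuous.
have cF : continuous (fun y => p y * phi (y^-1 * x)%g).
  apply: continuous_mul => //; apply: continuous_fct_comp (smooth_continuous sphi).
  apply: continuous_mulg_comp; last exact: continuous_cst.
  by apply: continuous_invg_comp; exact: continuous_idfun.
rewrite -(haar_int_inv compactG haar_mu cF).
by apply: haar_int_ext => y; rewrite invgK mulrC.
Qed.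

Lemma gconv_lvf (p phi : G -> R) v : continuous p -> smooth phi ->
  lvf v (gconv p phi) = gconv p (lvf v phi).
Proof.
move=> cp sphi; apply/funext => x; have cpx := gconv_cont_aux (x := x) cp.
have cphi := smooth_continuous sphi.
transitivity (I (fun y => lvf v phi y * p (x * y^-1)%g)); last first.
  by apply: haar_int_ext => y; exact: mulrC.
rewrite -(haar_int_lvf_param compactG mu v sphi cpx) /lvf.
rewrite (_ : (fun z => gconv p phi _) = (fun z =>
  I (fun y => phi (y * chart_inv (1%g : G) z)%g * p (x * y^-1)%g)))//.
apply/funext => z; set c := chart_inv _ _.
have cF : continuous (fun y => p (x * c * y^-1)%g * phi y).
  by apply: continuous_mul => //; exact: gconv_cont_aux.
rewrite /gconv -(haar_int_right compactG haar_mu c cF).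
by apply: haar_int_ext => y; rewrite invgM mulgA mulgK mulrC.
Qed.

Lemma gconv_lvf_iter (p phi : G -> R) (w : seq 'I_n) : continuous p -> smooth phi ->
  smooth (foldr (fun i f => lvf (delta_mx 0 i) f) phi w) /\
  foldr (fun i f => lvf (delta_mx 0 i) f) (gconv p phi) w =
  gconv p (foldr (fun i f => lvf (delta_mx 0 i) f) phi w).
Proof.
move=> cp sphi; elim: w => //= i w [sw ->]; split; first exact: smooth_lvf.
exact: gconv_lvf.
Qed.

Lemma gconv_close (p phi : G -> R) M e x : continuous p -> continuous phi ->
  (forall y, `|phi y| <= M) -> (forall y, `|p y| <= e) -> `|gconv p phi x| <= e * M.
Proof.
move=> cp cphi hM he; apply: (cint_norm_le compactG mu).
  by apply: continuous_mul => //; exact: gconv_cont_aux.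
by move=> y; rewrite normrM ler_pM.
Qed.

(** [phi] is close to [gconv k phi] for a narrow bump [k], and this to [gconv q phi] for a
    polynomial [q] uniformly close to [k]. Both steps commute with derivatives, so a single [q]
    serves all orders up to [N]. *)
Theorem smooth_trig_approx (phi : G -> R) (N : nat) (e : R) : smooth phi -> 0 < e ->
  exists p, [/\ trigR p, smooth p & forall (w : seq 'I_n) x, (size w <= N)%N ->
    `|foldr (fun i f => lvf (delta_mx 0 i) f) phi w x -
      foldr (fun i f => lvf (delta_mx 0 i) f) p w x| <= e].
Proof.
move=> sphi e0; pose D (w : seq 'I_n) := foldr (fun i f => lvf (delta_mx 0 i) f) phi w.
have sD w : smooth (D w) by have [] := gconv_lvf_iter w (@continuous_cst G R 0) sphi.
have cD w := smooth_continuous (sD w).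
have e2 : 0 < e / 2 by rewrite divr_gt0.
have near1 w : \forall z \near (1%g : G), forall x, `|D w (z^-1 * x)%g - D w (1^-1 * x)%g| < e / 2.
  apply: (@near_uniform R n G compactG G (fun z x => D w (z^-1 * x)%g)) => // y.
  have cF : continuous (fun p : G * G => D w (p.1^-1 * p.2)%g) by exact: continuous_kernel.
  exact: cF.
have nN : \forall z \near (1%g : G), forall k : 'I_N.+1, forall w : k.-tuple 'I_n,
    forall x, `|D w (z^-1 * x)%g - D w (1^-1 * x)%g| < e / 2.
  by apply: filter_forall => k; apply: filter_forall => w; exact: near1.
have [k [[ck k0 sk Ik _] kN]] := exists_symmetric_bump nN.
have /(@choice (seq 'I_n) R)[M hM] : forall w, exists M : R, 0 < M /\ forall x, `|D w x| <= M.
  by move=> w; have [M M0 hM] := continuous_bounded compactG (cD w); exists M.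
(* One bound for the finitely many derivatives of [phi] of order at most [N]; it fixes how close [q]
   must be to [k]. *)
pose B := 1 + \sum_(j < N.+1) \sum_(w : j.-tuple 'I_n) M w.
have B0 : 0 < B.
  rewrite ltr_pwDl// sumr_ge0// => j _; rewrite sumr_ge0// => w _.
  by apply: ltW; have [] := hM w.
have hB (w : seq 'I_n) x : (size w <= N)%N -> `|D w x| <= B.
  move=> wN; have [_ h] := hM w; apply: le_trans (h x) _.
  have w0 (v : seq 'I_n) : 0 <= M v by apply: ltW; have [] := hM v.
  have wN1 : (size w < N.+1)%N by [].
  rewrite /B (bigD1 (Ordinal wN1))//= (bigD1 (in_tuple w))//=.
  have s1 : 0 <= \sum_(i : (size w).-tuple 'I_n | i != in_tuple w) M i by exact: sumr_ge0.
  have s2 : 0 <= \sum_(i < N.+1 | i != Ordinal wN1) \sum_(v : i.-tuple 'I_n) M v.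
    by apply: sumr_ge0 => i _; exact: sumr_ge0.
  by move: s1 s2; move: (\sum_(_ | _) _) (\sum_(_ | _) _) => a b a0 b0; lra.
have [q tq hq] := trig_dense ck (divr_gt0 e2 B0).
have cq := trigR_continuous compactG haar_mu tq.
exists (gconv q phi); split.
- apply: (trigR_conv compactG haar_mu tq); last exact: smooth_continuous.
  by apply: continuous_invg_comp; exact: continuous_idfun.
- exact: gconv_smooth.
move=> w x wN; have [_ ->] := gconv_lvf_iter w cq sphi; rewrite -/(D w).
have E : gconv k (D w) x - gconv q (D w) x = gconv (fun y => k y - q y) (D w) x.
  rewrite /gconv -(cintB compactG mu).
  - by apply: haar_int_ext => y; rewrite mulrBl.
  - by apply: continuous_mul => //; exact: gconv_cont_aux.
  - by apply: continuous_mul => //; exact: gconv_cont_aux.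
rewrite (_ : _ - _ = (D w x - gconv k (D w) x) + (gconv k (D w) x - gconv q (D w) x)); last by ring.
rewrite (le_trans (ler_normD _ _))// [leRHS]splitr lerD//; last first.
  rewrite E; have -> : e / 2 = e / 2 / B * B by rewrite mulfVK// gt_eqF.
  apply: gconv_close => //; first exact: continuous_sub.
  by move=> y; exact: hB.
rewrite gconvE// distrC.
have cc := @continuous_cst G R.
have cwx : continuous (fun y => D w (y^-1 * x)%g).
  apply: continuous_fct_comp (cD w).
  apply: continuous_mulg_comp; last exact: continuous_cst.
  by apply: continuous_invg_comp; exact: continuous_idfun.
rewrite (_ : _ - _ = I (fun y => k y * (D w (y^-1 * x)%g - D w x))); last first.
  rewrite -[X in _ - X]mulr1 -Ik -(cintZ compactG mu)// -(cintB compactG mu).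
  - by apply: haar_int_ext => y; ring.
  - exact: continuous_mul.
  - by apply: continuous_mul => //; exact: cc.
apply: kernel_average => //; first by apply: continuous_sub => //; exact: cc.
move=> y /kN h; have := h (Ordinal (wN : (size w < N.+1)%N)) (in_tuple w) x.
by rewrite /= invg1 mul1g => /ltW.
Qed.

End Density.

(** * Fourier coefficients and the L2 norm of distributions *)

Section Distributions.
Context {R : realType} {n : nat} {G : lieGroupType R n}.
Hypothesis compactG : compact [set: G].
Variable mu : probability (borel G) R.
Hypothesis haar_mu : is_haar mu.
Local Notation C := R[i].
Local Notation iter_lvf := (foldr (fun i f => lvf (delta_mx 0 i) f)).
Local Notation iter_clvf := (foldr (fun i f => clift (lvf (delta_mx 0 i)) f)).

Lemma iter_lvfB (phi psi : G -> R) (w : seq 'I_n) : smooth phi -> smooth psi ->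
  smooth (iter_lvf phi w) /\ smooth (iter_lvf psi w) /\
  iter_lvf (fun x => phi x - psi x) w = (fun x => iter_lvf phi w x - iter_lvf psi w x).
Proof.
move=> s1 s2; elim: w => [//|i w [ih1 [ih2 ih3]]] /=.
by split; [exact: smooth_lvf|split; [exact: smooth_lvf|rewrite ih3; exact: lvfB]].
Qed.

Lemma iter_clvf_real (phi : G -> R) (w : seq 'I_n) :
  iter_clvf (fun x => (phi x)%:C) w = (fun x => (iter_lvf phi w x)%:C).
Proof.
elim: w => [//|i w ih] /=; rewrite ih; apply/funext => x.
by rewrite /clift /= lvf_cst.
Qed.

Lemma normc_real (a : R) : Normc.normc a%:C = `|a|.
Proof. by rewrite /= expr0n addr0 sqrtr_sqr. Qed.

Lemma normc_eq0 (z : C) : Normc.normc z = 0 -> z = 0.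
Proof. exact: Normc.eq0_normc. Qed.

Lemma fourierE (u : functional G) xi i j : fourier u xi i j = u (fun x => conjC (xi x j i)).
Proof. by rewrite mxE; congr u; apply/funext => x; rewrite trCE. Qed.

Section Linear.
Variable u : functional G.
Hypothesis du : is_distribution u.

Lemma distr_lin a (phi psi : G -> C) : csmooth phi -> csmooth psi ->
  u (fun x => a * phi x + psi x) = a * u phi + u psi.
Proof. by case: du => h _; exact: h. Qed.

Lemma distr0 : u (fun=> 0) = 0.
Proof.
have s0 : csmooth (fun _ : G => 0 : C) by exact: csmooth_cst.
have := distr_lin (-1) s0 s0; rewrite (_ : (fun x => _) = (fun=> 0)).
  by rewrite mulN1r addNr.
by apply/funext => x; rewrite mulr0 addr0.
Qed.

Lemma distrZ a phi : csmooth phi -> u (fun x => a * phi x) = a * u phi.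
Proof.
move=> sp; have s0 : csmooth (fun _ : G => 0 : C) by exact: csmooth_cst.
rewrite -[RHS]addr0 -distr0 -distr_lin//; congr u; apply/funext => x; exact/esym/addr0.
Qed.

Lemma distrD phi psi : csmooth phi -> csmooth psi ->
  u (fun x => phi x + psi x) = u phi + u psi.
Proof.
move=> s1 s2; rewrite -[u phi]mul1r -distr_lin//; congr u; apply/funext => x.
by rewrite mul1r.
Qed.

Lemma distr_sum (I : Type) (s : seq I) (F : I -> G -> C) : (forall i, csmooth (F i)) ->
  u (fun x => \sum_(i <- s) F i x) = \sum_(i <- s) u (F i).
Proof.
move=> sF; elim: s => [|i s ih].
  by rewrite big_nil -[RHS]distr0; congr u; apply/funext => x; rewrite big_nil.
rewrite big_cons -ih -distrD//; last exact: csmooth_sum.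
by congr u; apply/funext => x; rewrite big_cons.
Qed.

(** The coefficients are known to vanish only at the chosen representatives, so [ux] transports them
    along an equivalence. As [fourier] pairs with conjugate coefficients, the conclusion goes
    through [trigJ]. *)
Lemma distr_trig_eq0 f : (forall xi, dual G xi -> fourier u xi = 0) -> trig f -> u f = 0.
Proof.
move=> u0; have sx (xi : irrep G) i j : csmooth (fun x => conjC (xi x i j)).
  by apply: csmoothJ; exact: (irrep_csmooth compactG haar_mu).
have ux (xi : irrep G) i j : u (fun x => conjC (xi x i j)) = 0.
  have [T [TU _ hT]] := dual_rep_equiv xi.
  have E x : xi x = T *m dual_rep xi x *m T^t*.
    by rewrite -hT -mulmxA; move/unitarymxP : TU => ->; rewrite mulmx1.
  rewrite (_ : (fun x => _) = (fun x => \sum_k \sum_l (conjC (T i l) * T j k) * conjC (dual_rep xi x l k))).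
    rewrite distr_sum; last by move=> k; apply: csmooth_sum => l; exact: csmoothZ.
    rewrite big1// => k _; rewrite distr_sum; last by move=> l; exact: csmoothZ.
    rewrite big1// => l _; rewrite distrZ// -fourierE u0 ?mxE ?mulr0//.
    exact: dual_repP.
  apply/funext => x; rewrite E mxE rmorph_sum; apply: eq_bigr => k _ /=.
  rewrite mxE rmorphM rmorph_sum mulr_suml; apply: eq_bigr => l _ /=.
  by rewrite rmorphM trCE conjCK -mulrA [X in _ * X]mulrC mulrA.
have uJ h : trig h -> u (fun x => conjC (h x)) = 0.
  elim => [|c xi i j h' th ih].
    by rewrite (_ : (fun x => _) = (fun=> 0)) ?distr0//; apply/funext => x; rewrite conjC0.
  rewrite (_ : (fun x => _) = (fun x => conjC c * conjC (xi x i j) + conjC (h' x))).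
    rewrite distr_lin ?ux ?ih ?mulr0 ?addr0//.
    by apply: csmoothJ; exact: (trig_csmooth compactG haar_mu).
  by apply/funext => x; rewrite rmorphD rmorphM.
move=> tf; rewrite -(uJ _ (trigJ tf)); congr u; apply/funext => x.
by rewrite conjCK.
Qed.

(** A distribution is controlled by derivatives up to some finite order, and for these trigonometric
    polynomials are dense. Real and imaginary parts are treated separately. *)
Theorem distr_eq0 phi : (forall xi, dual G xi -> fourier u xi = 0) -> csmooth phi -> u phi = 0.
Proof.
move=> u0.
have real0 (psi : G -> R) : smooth psi -> u (fun x => (psi x)%:C) = 0.
  move=> sp; have [_ [K [N hu]]] := du.
  suff : Normc.normc (u (fun x => (psi x)%:C)) = 0 by exact: normc_eq0.
  apply: (@eq0_small R _ K) => e e0; rewrite ger0_norm ?normc_ge0//.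
  have [p [tp sp' hp]] := smooth_trig_approx compactG haar_mu N sp e0.
  have -> : u (fun x => (psi x)%:C) = u (fun x => (psi x - p x)%:C).
    have E : (fun x => (psi x)%:C) = (fun x => 1 * (psi x - p x)%:C + (p x)%:C).
      by apply/funext => x; rewrite mul1r -rmorphD subrK.
    rewrite E distr_lin ?mul1r ?(distr_trig_eq0 _ tp) ?addr0//; last exact: csmooth_real.
    by apply: csmooth_real; exact: smoothB.
  apply: hu; first by apply: csmooth_real; exact: smoothB.
  move=> w x wN; rewrite (iter_clvf_real (fun x => psi x - p x)) normc_real.
  by have [_ [_ ->]] := iter_lvfB w sp sp'; exact: hp.
move=> [s1 s2].
rewrite (_ : phi = (fun x => 'i * (complex.Im (phi x))%:C + (complex.Re (phi x))%:C)).
  by rewrite distr_lin ?real0 ?mulr0 ?addr0//; exact: csmooth_real.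
apply/funext => x; apply: complex_ext; rewrite ?cReD ?cImD ?cReM ?cImM /=; ring.
Qed.

End Linear.

End Distributions.

(** * Partial Fourier sums and Bessel's inequality *)

Section Bessel.
Context {R : realType} {n : nat} {G : lieGroupType R n}.
Hypothesis compactG : compact [set: G].
Variable mu : probability (borel G) R.
Hypothesis haar_mu : is_haar mu.
Local Notation C := R[i].
Local Notation I := (haar_int mu).

(** The term at [xi] of the Fourier inversion formula for the coefficient [A]. *)
Definition tterm (xi : irrep G) (A : 'M[C]_(irrep_dim xi)) (x : G) : C :=
  (irrep_dim xi)%:R * \tr (xi x *m A).

Lemma ttermE (xi : irrep G) (A : 'M[C]_(irrep_dim xi)) x :
  tterm A x = \sum_i \sum_j ((irrep_dim xi)%:R * A j i) * xi x i j.
Proof.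
rewrite /tterm /mxtrace mulr_sumr; apply: eq_bigr => i _.
by rewrite mxE mulr_sumr; apply: eq_bigr => j _; ring.
Qed.

Lemma tterm_csmooth (xi : irrep G) (A : 'M[C]_(irrep_dim xi)) : csmooth (tterm A).
Proof.
apply: (csmooth_eq (fun x => esym (ttermE A x))).
apply: csmooth_sum => i; apply: csmooth_sum => j; apply: csmoothZ.
exact: (irrep_csmooth compactG haar_mu).
Qed.

Lemma cint_tterm (xi eta : irrep G) (A : 'M[C]_(irrep_dim xi)) k l :
  cintegral mu (fun x => tterm A x * conjC (eta x k l)) =
  \sum_i \sum_j ((irrep_dim xi)%:R * A j i) * cintegral mu (fun x => xi x i j * conjC (eta x k l)).
Proof.
have ci i j : cintegrable mu (fun x => xi x i j * conjC (eta x k l)).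
  have [_ _ xC] := irrep_unirep xi; have [_ _ eC] := irrep_unirep eta.
  by apply: (ccont_integrable compactG); apply: ccontM => //; exact: ccontJ.
rewrite (@cintegral_ext _ _ _ _ _ (fun x => \sum_i \sum_j ((irrep_dim xi)%:R * A j i) *
   (xi x i j * conjC (eta x k l)))); last first.
  move=> x; rewrite ttermE mulr_suml; apply: eq_bigr => i _.
  by rewrite mulr_suml; apply: eq_bigr => j _; rewrite mulrA.
have [_ ->] := cintegral_sum compactG (index_enum 'I_(irrep_dim xi)) (fun i =>
  (cintegral_sum compactG (index_enum 'I_(irrep_dim xi))
    (fun j => cintegrableZ ((irrep_dim xi)%:R * A j i) (ci i j))).1).
apply: eq_bigr => i _.
have [_ ->] := cintegral_sum compactG (index_enum 'I_(irrep_dim xi))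
    (fun j => cintegrableZ ((irrep_dim xi)%:R * A j i) (ci i j)).
by apply: eq_bigr => j _; rewrite cintegralZ.
Qed.

Lemma cint_tterm_neq (xi eta : irrep G) (A : 'M[C]_(irrep_dim xi)) k l : ~ irrep_equiv xi eta ->
  cintegral mu (fun x => tterm A x * conjC (eta x k l)) = 0.
Proof.
move=> ne; rewrite cint_tterm big1// => i _; rewrite big1// => j _.
by rewrite (schur_orthogonal compactG haar_mu)// mulr0.
Qed.

Lemma cint_tterm_same (xi : irrep G) (A : 'M[C]_(irrep_dim xi)) k l :
  cintegral mu (fun x => tterm A x * conjC (xi x k l)) = A l k.
Proof.
have d0 : (irrep_dim xi)%:R != 0 :> C by rewrite pnatr_eq0 -lt0n; exact: irrep_dim_gt0.
rewrite cint_tterm (bigD1 k)//= (bigD1 l)//= (schur_orthonormal compactG haar_mu) !eqxx !mulr1.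
rewrite mulrAC mulfV// mul1r big1 ?addr0 => [|j jl]; last first.
  by rewrite (schur_orthonormal compactG haar_mu) (negbTE jl) !mulr0.
rewrite big1 ?addr0// => i ik; rewrite big1// => j _.
by rewrite (schur_orthonormal compactG haar_mu) (negbTE ik) mulr0 mul0r mulr0.
Qed.

Variable A : forall xi : irrep G, 'M[C]_(irrep_dim xi).

Definition psum (F : seq (irrep G)) (x : G) : C := \sum_(xi <- F) tterm (A xi) x.

Definition qsum (F : seq (irrep G)) : R := \sum_(xi <- F) (irrep_dim xi)%:R * hs_norm2 (A xi).

Definition dual_seq (F : seq (irrep G)) : Prop := uniq F /\ forall xi, xi \in F -> dual G xi.

Lemma psum_csmooth F : csmooth (psum F).
Proof. by apply: csmooth_sum => xi; exact: tterm_csmooth. Qed.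

Lemma hs_norm2_ge0 m p (B : 'M[C]_(m, p)) : 0 <= hs_norm2 B.
Proof. by apply: sumr_ge0 => i _; apply: sumr_ge0 => j _; exact: sqr_ge0. Qed.

Lemma qsum_ge0 F : 0 <= qsum F.
Proof. by apply: sumr_ge0 => xi _; rewrite mulr_ge0// hs_norm2_ge0. Qed.

Lemma cint_psum F (xi : irrep G) k l : dual_seq F -> dual G xi ->
  cintegral mu (fun x => psum F x * conjC (xi x k l)) = if xi \in F then A xi l k else 0.
Proof.
move=> [uF dF] dxi; have [_ _ xC] := irrep_unirep xi.
have ct eta : cintegrable mu (fun x => tterm (A eta) x * conjC (xi x k l)).
  apply: (ccont_integrable compactG); apply: ccontM; last exact: ccontJ.
  by apply: csmooth_ccont; exact: tterm_csmooth.
rewrite (@cintegral_ext _ _ _ _ _ (fun x => \sum_(eta <- F) tterm (A eta) x * conjC (xi x k l))); last first.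
  by move=> x; rewrite mulr_suml.
have [_ ->] := cintegral_sum compactG F ct.
have other eta : eta \in F -> eta != xi -> cintegral mu (fun x => tterm (A eta) x * conjC (xi x k l)) = 0.
  move=> eF ex; apply: cint_tterm_neq => H; case/eqP: ex.
  by apply: dual_inj => //; exact: dF.
case: ifPn => xF; last first.
  rewrite big_seq big1// => eta eF; apply: other => //.
  by apply: contraNneq xF => <-.
rewrite (bigD1_seq xi)//= cint_tterm_same big_seq_cond big1 ?addr0// => eta /andP[eF].
exact: other.
Qed.

(* [f] is any function whose pairings with the matrix coefficients are known,
   so that this covers partial sums as well as representatives. *)
Lemma cint_psum_conj (f : G -> C) F : dual_seq F ->
  (forall phi, ccont phi -> cintegrable mu (fun x => f x * phi x)) ->
  (forall xi k l, xi \in F -> cintegral mu (fun x => f x * conjC (xi x k l)) = A xi l k) ->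
  cintegral mu (fun x => f x * conjC (psum F x)) = (qsum F)%:C.
Proof.
move=> [uF dF] fi fA.
have cx (xi : irrep G) i j : ccont (fun x => conjC (xi x i j)).
  by have [_ _ xC] := irrep_unirep xi; exact: ccontJ.
rewrite (@cintegral_ext _ _ _ _ _ (fun x => \sum_(xi <- F) \sum_i \sum_j
   ((irrep_dim xi)%:R * conjC (A xi j i)) * (f x * conjC (xi x i j)))); last first.
  move=> x; rewrite /psum rmorph_sum mulr_sumr; apply: eq_bigr => xi _.
  rewrite ttermE rmorph_sum mulr_sumr; apply: eq_bigr => i _.
  rewrite rmorph_sum mulr_sumr; apply: eq_bigr => j _.
  by rewrite !rmorphM /= conjC_nat; ring.
have i1 (xi : irrep G) i j : cintegrable mu
    (fun x => ((irrep_dim xi)%:R * conjC (A xi j i)) * (f x * conjC (xi x i j))).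
  by apply: cintegrableZ; exact: fi.
have i2 (xi : irrep G) i := cintegral_sum compactG (index_enum 'I_(irrep_dim xi)) (i1 xi i).
have i3 (xi : irrep G) := cintegral_sum compactG (index_enum 'I_(irrep_dim xi)) (fun i => (i2 xi i).1).
have [_ ->] := cintegral_sum compactG F (fun xi => (i3 xi).1).
rewrite /qsum rmorph_sum big_seq [RHS]big_seq; apply: eq_bigr => xi xF.
rewrite (i3 xi).2 /hs_norm2 exchange_big rmorphM rmorph_nat rmorph_sum mulr_sumr; apply: eq_bigr => i _.
rewrite (i2 xi i).2 rmorph_sum mulr_sumr; apply: eq_bigr => j _.
rewrite cintegralZ ?fA//; last exact: fi.
transitivity ((irrep_dim xi)%:R * (A xi j i * conjC (A xi j i))); first by ring.
by congr (_ * _); exact: esym (normc_sqrC _).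
Qed.

Lemma qsum_integral F : dual_seq F ->
  I (fun x => Normc.normc (psum F x) ^+ 2) = qsum F.
Proof.
move=> dF; have [_ dF'] := dF; apply: (@complexI R).
rewrite -(cint_psum_conj dF (f := psum F)).
- by rewrite -cintegral_real; apply: cintegral_ext => x; exact: normc_sqrC.
- move=> phi cphi; apply: (ccont_integrable compactG); apply: ccontM => //.
  by apply: csmooth_ccont; exact: psum_csmooth.
- by move=> xi k l xF; rewrite cint_psum// ?xF//; exact: dF'.
Qed.

Definition sqint (h : G -> C) : Prop :=
  [/\ measurable_fun [set: borel G] (fun x : borel G => complex.Re (h x)),
      measurable_fun [set: borel G] (fun x : borel G => complex.Im (h x)) &
      haar_integrable mu (fun x => Normc.normc (h x) ^+ 2)].

Lemma le_haar_integrable (f h : G -> R) :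
  measurable_fun [set: borel G] (fun x : borel G => f x) ->
  haar_integrable mu h -> (forall x, `|f x| <= h x) -> haar_integrable mu f.
Proof.
move=> mf ih fh; apply: le_integrable ih => //; first exact/measurable_EFinP.
by move=> x _ /=; rewrite lee_fin; apply: le_trans (fh x) (ler_norm _).
Qed.

Lemma sqint_mul h phi : sqint h -> ccont phi -> cintegrable mu (fun x => h x * phi x).
Proof.
move=> [m1 m2 ih] [c1 c2].
have i1 : haar_integrable mu (fun x => 1 + Normc.normc (h x) ^+ 2).
  by apply: haar_integrableD => //; exact: (haar_integrable_cst compactG).
have key (a p : G -> R) : measurable_fun [set: borel G] (fun x : borel G => a x) -> continuous p ->
    (forall x, `|a x| <= Normc.normc (h x)) -> haar_integrable mu (fun x => a x * p x).
  move=> ma cp ah; have [M M0 hM] := continuous_bounded compactG cp.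
  apply: (@le_haar_integrable _ (fun x => M * (1 + Normc.normc (h x) ^+ 2))).
  - by apply: measurable_funM => //; exact: continuous_measurable.
  - exact: haar_integrableZ.
  move=> x; rewrite normrM mulrC ler_pM//; apply: le_trans (ah x) _.
  by have := sqr_ge0 (Normc.normc (h x) - 1 / 2); rewrite sqrrB; lra.
have k1 p cp := key _ p m1 cp (fun x => Re_le_normc (h x)).
have k2 p cp := key _ p m2 cp (fun x => Im_le_normc (h x)).
split.
  under eq_fun do rewrite cReM.
  by apply: haar_integrableB; [exact: k1|exact: k2].
under eq_fun do rewrite cImM.
by apply: haar_integrableD; [exact: k1|exact: k2].
Qed.

(** The mean square of [h - psum F] is nonnegative, and both its cross term and its last term reduce
    to [qsum F]. *)
Lemma bessel (h : G -> C) F : dual_seq F -> sqint h ->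
  (forall xi k l, xi \in F -> cintegral mu (fun x => h x * conjC (xi x k l)) = A xi l k) ->
  qsum F <= I (fun x => Normc.normc (h x) ^+ 2).
Proof.
move=> dF sh hA; have [m1 m2 ih] := sh.
have cp := csmooth_ccont (psum_csmooth F); have cpJ := ccontJ cp.
have [ip _] := sqint_mul sh cpJ.
have := congr1 (@complex.Re R) (cint_psum_conj dF (fun phi => sqint_mul sh) hA).
rewrite cintegralE /= => E.
have i2 : haar_integrable mu (fun x => Normc.normc (psum F x) ^+ 2).
  apply: (continuous_integrable compactG).
  rewrite (_ : (fun x => _) = (fun x => complex.Re (psum F x) * complex.Re (psum F x) +
    complex.Im (psum F x) * complex.Im (psum F x))).
    by case: cp => *; apply: continuous_add; exact: continuous_mul.
  by apply/funext => x; rewrite normc_sqr !expr2.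
have : 0 <= I (fun x => Normc.normc (h x) ^+ 2 + (- 2) * complex.Re (h x * conjC (psum F x)) +
   Normc.normc (psum F x) ^+ 2).
  apply: haar_int_ge0 => x; rewrite !normc_sqr cReM cReJ cImJ.
  move: (complex.Re (h x)) (complex.Im (h x)) (complex.Re (psum F x)) (complex.Im (psum F x)) => a b c d.
  have := addr_ge0 (sqr_ge0 (a - c)) (sqr_ge0 (b - d)); rewrite !sqrrB; nra.
rewrite haar_intD//; last by apply: haar_integrableD => //; exact: haar_integrableZ.
rewrite haar_intD//; last exact: haar_integrableZ.
rewrite haar_intZ// E qsum_integral//.
by move: (I _) (qsum F) => a b; lra.
Qed.

End Bessel.

(** * The Riesz-Fischer theorem for rapidly converging sequences *)

Lemma rapid_cvg (R : realType) (a : nat -> R) (r : R) : a 0%N = 0 ->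
  (forall k, 4 ^+ k * (a k.+1 - a k) ^+ 2 <= r) ->
  cvgn a /\ forall m, `|a m| <= 2 * Num.sqrt r.
Proof.
move=> a0 ha; have r0 : 0 <= r.
  by apply: le_trans (ha 0%N); apply: mulr_ge0; [exact: exprn_ge0|exact: sqr_ge0].
have step k : `|a k.+1 - a k| <= geometric (Num.sqrt r) 2^-1 k.
  rewrite /= -ler_sqr ?nnegrE ?mulr_ge0 ?sqrtr_ge0 ?exprn_ge0 ?invr_ge0//.
  rewrite real_normK ?num_real// exprMn sqr_sqrtr// -exprM mulnC exprM exprVn.
  rewrite (_ : 2 ^+ 2 = 4); last by ring.
  by rewrite exprVn ler_pdivlMr ?exprn_gt0// mulrC.
have bd m : `|a m| <= Num.sqrt r * (2 - 2 * 2^-1 ^+ m).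
  elim: m => [|m ih]; first by rewrite a0 normr0 expr0 mulr1 subrr mulr0.
  rewrite -[a m.+1](subrK (a m)) (le_trans (ler_normD _ _))//.
  apply: le_trans (lerD (step m) ih) _; rewrite /= exprS.
  move: (2^-1 ^+ m) (Num.sqrt r) => t q; nra.
split; last first.
  move=> m; apply: le_trans (bd m) _; rewrite mulrC ler_wpM2r ?sqrtr_ge0// lerBlDr lerDl.
  by rewrite mulr_ge0// exprn_ge0// invr_ge0.
have -> : a = series (fun k => a k.+1 - a k).
  apply/funext => m; elim: m => [|m ih]; first by rewrite /series /= big_geq.
  by rewrite /series /= big_nat_recr//= -[X in X + _]ih addrC subrK.
apply: normed_cvg; apply: series_le_cvg step _ => [k|k|].
- exact: normr_ge0.
- by rewrite /= mulr_ge0// ?sqrtr_ge0// exprn_ge0// invr_ge0.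
- apply: is_cvg_geometric_series; rewrite ger0_norm ?invr_ge0// invf_lt1// ltr1n//.
Qed.

Section RieszFischer.
Context {R : realType} {n : nat} {G : lieGroupType R n}.
Hypothesis compactG : compact [set: G].
Variable mu : probability (borel G) R.
Local Notation C := R[i].
Local Notation I := (haar_int mu).

Lemma EFin_haar_int (f : G -> R) : haar_integrable mu f ->
  ((I f)%:E = \int[mu]_(x in [set: borel G]) (f x)%:E)%E.
Proof. by move=> hf; rewrite /haar_int /Rintegral fineK//; exact: integrable_fin_num. Qed.

Section RapidSequence.
Variables (s : nat -> G -> R) (B : R).
Hypothesis cs : forall k, continuous (s k).
Hypothesis s0 : forall x, s 0%N x = 0.
Hypothesis sB : forall k, I (fun x => (s k.+1 x - s k x) ^+ 2) <= B * (8 ^+ k)^-1.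

(** The weight [4 ^+ k] is shared between two needs: against the decay [8 ^- k] in mean it leaves a
    summable [2 ^- k], and pointwise it makes the increments decay like [2 ^- k]. *)
Let a k (x : borel G) : \bar R := (4 ^+ k * (s k.+1 x - s k x) ^+ 2)%:E.
(* [H] is integrable, and [s] converges with [|s k|^2 <= 4 H] where [H] is finite. *)
Let H (x : borel G) : \bar R := (\sum_(k <oo) a k x)%E.

Let ca k : continuous (fun x : G => 4 ^+ k * (s k.+1 x - s k x) ^+ 2).
Proof.
apply: continuous_mul; first exact: continuous_cst.
by apply: continuous_mul; exact: continuous_sub.
Qed.

Let a0 k x : (0 <= a k x)%E.
Proof. by rewrite lee_fin; apply: mulr_ge0; [exact: exprn_ge0|exact: sqr_ge0]. Qed.

Let ma k : measurable_fun [set: borel G] (a k).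
Proof. by apply/measurable_EFinP; exact (continuous_measurable (@ca k)). Qed.

Let H0 x : (0 <= H x)%E.
Proof. by apply: nneseries_ge0 => k _ _; exact: a0. Qed.

Let mH : measurable_fun [set: borel G] H.
Proof. by apply: (@ge0_emeasurable_sum _ _ _ _ a xpredT) => // k x _ _; exact: a0. Qed.

Let iH : mu.-integrable [set: borel G] H.
Proof.
apply/integrableP; split=> //.
rewrite (eq_integral H) => [|x _]; last by rewrite gee0_abs.
rewrite integral_nneseries//.
apply: (@le_lt_trans _ _ (B * 2)%:E); last by rewrite ltry.
apply: lime_le; first by apply: is_cvg_nneseries => k _ _; apply: integral_ge0 => x _; exact: a0.
have B0 : 0 <= B.
  by have := sB 0; rewrite expr0 invr1 mulr1; apply: le_trans; apply: haar_int_ge0 => x; exact: sqr_ge0.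
have ia k : (\int[mu]_(x in [set: borel G]) a k x <= (B * 2^-1 ^+ k)%:E)%E.
  rewrite -(EFin_haar_int (continuous_integrable compactG mu (@ca k))) lee_fin.
  rewrite (cintZ compactG mu); last by apply: continuous_mul; exact: continuous_sub.
  apply: le_trans (ler_wpM2l _ (sB k)) _; first exact: exprn_ge0.
  rewrite mulrCA ler_wpM2l// exprVn -[8]/((2 * 4)%N%:R) natrM exprMn invfM mulrCA.
  by rewrite mulfV ?mulr1// expf_neq0.
apply: nearW => m.
have : (\sum_(0 <= k < m) \int[mu]_(x in [set: borel G]) a k x <= (B * (2 - 2 * 2^-1 ^+ m))%:E)%E.
  elim: m => [|m ih]; first by rewrite big_geq// expr0 mulr1 subrr mulr0.
  rewrite big_nat_recr//=; apply: le_trans (leeD ih (ia m)) _.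
  rewrite -EFinD lee_fin exprS; move: (2^-1 ^+ m) => t; nra.
move=> h; apply: le_trans h _; rewrite lee_fin ler_wpM2l// lerBlDr lerDl.
by rewrite mulr_ge0// exprn_ge0// invr_ge0.
Qed.

Let Hfin x : H x \is a fin_num -> cvgn (fun k => s k x) /\
  forall m, `|s m x| <= 2 * Num.sqrt (fine (H x)).
Proof.
move=> hx; apply: rapid_cvg => // k; rewrite -lee_fin fineK// -/(a k x).
apply: (@le_trans _ _ (\sum_(0 <= j < k.+1) a j x)%E); last first.
  by apply: nneseries_lim_ge => j _ _; exact: a0.
by rewrite big_nat_recr//= leeDr//; apply: sume_ge0 => j _; exact: a0.
Qed.

Let D := [set x : borel G | H x \is a fin_num].

Let mD : measurable D.
Proof. by have := emeasurable_fin_num measurableT mH; rewrite setTI. Qed.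

Let h (x : G) : R := if H x \is a fin_num then limn (fun k => s k x) else 0.

Let mh : measurable_fun [set: borel G] (fun x : borel G => h x).
Proof.
apply: (@measurable_fun_cvg _ (borel G) R setT (fun k (x : borel G) => s k x * \1_D x)
  (fun x : borel G => h x)) => [k|x _].
  apply: measurable_funM; first exact (continuous_measurable (@cs k)).
  exact: measurable_indic.
rewrite /h indicE; case: ifPn => hx.
  rewrite mem_set// (_ : (fun k => _) = (fun k => s k x)); first by have [] := Hfin hx.
  by apply/funext => k; rewrite mulr1.
rewrite memNset; last by apply/negP.
rewrite (_ : (fun k => _) = (fun=> 0)); first exact: cvg_cst.
by apply/funext => k; rewrite mulr0.
Qed.

(** Dominated convergence with the bound [M * (1 + H)], which is infinite, hence harmless, on the
    null set where [H] is. *)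
Let dominated (psi : nat -> G -> R) (psi' : G -> R) (M : R) : 0 < M ->
  (forall k, continuous (psi k)) ->
  measurable_fun [set: borel G] (fun x : borel G => psi' x) ->
  (forall x, H x \is a fin_num -> (fun k => psi k x) @ \oo --> psi' x) ->
  (forall k x, H x \is a fin_num -> `|psi k x| <= M * (1 + fine (H x))) ->
  haar_integrable mu psi' /\ (fun k => I (psi k)) @ \oo --> I psi'.
Proof.
move=> M0 cpsi mpsi cvpsi bpsi.
have i1 : mu.-integrable [set: borel G] (fun x => M%:E * (1 + H x))%E.
  apply: integrableZl => //; apply: integrableD => //.
  exact (haar_integrable_cst compactG mu 1).
have [|||||ipsi _ cv] := @dominated_convergence _ (borel G) R mu setT measurableT
  (fun k x => (psi k x)%:E) (fun x => (psi' x)%:E) (fun x => M%:E * (1 + H x))%E.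
- by move=> k; apply/measurable_EFinP; exact (continuous_measurable (cpsi k)).
- exact/measurable_EFinP.
- have := integrable_ae measurableT iH; apply: filterS => x /(_ Logic.I) hx _.
  by apply: cvg_EFin; [exact: nearW|exact: cvpsi].
- exact: i1.
- apply: nearW => x k _; have [hx|hx] := boolP (H x \is a fin_num).
    by rewrite -(fineK hx) -EFinD -EFinM lee_fin; exact: bpsi.
  have -> : H x = +oo%E by move: hx; have := H0 x; case: (H x).
  by rewrite addeC/= gt0_muley ?leey// lte_fin.
split => //; apply: fine_cvg; rewrite fineK//; exact: integrable_fin_num.
Qed.

Lemma riesz_fischer_real : exists f : G -> R,
  [/\ measurable_fun [set: borel G] (fun x : borel G => f x),
      haar_integrable mu (fun x => f x ^+ 2),
      (fun k => I (fun x => s k x ^+ 2)) @ \oo --> I (fun x => f x ^+ 2) &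
      forall phi, continuous phi ->
        (fun k => I (fun x => s k x * phi x)) @ \oo --> I (fun x => f x * phi x)].
Proof.
exists h; have hlim x : H x \is a fin_num -> (fun k => s k x) @ \oo --> h x.
  by move=> hx; rewrite /h hx; have [] := Hfin hx.
have s4 k x : H x \is a fin_num -> `|s k x| ^+ 2 <= 4 * fine (H x).
  move=> hx; have [_ /(_ k) hk] := Hfin hx.
  have f0 : 0 <= fine (H x) by exact: fine_ge0.
  apply: (@le_trans _ _ ((2 * Num.sqrt (fine (H x))) ^+ 2)).
    by rewrite ler_sqr ?nnegrE ?mulr_ge0 ?sqrtr_ge0.
  by rewrite exprMn sqr_sqrtr// -natrX.
have [i2 c2] : haar_integrable mu (fun x => h x ^+ 2) /\
    (fun k => I (fun x => s k x ^+ 2)) @ \oo --> I (fun x => h x ^+ 2).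
  apply: (@dominated (fun k x => s k x ^+ 2) _ 4) => //.
  - by move=> k; exact: continuous_mul.
  - exact: measurable_funX.
  - by move=> x /hlim hx; apply: cvgM.
  - move=> k x hx; rewrite normrX; apply: le_trans (s4 k x hx) _.
    by rewrite ler_wpM2l// lerDr.
split => // phi cphi; have [M M0 hM] := continuous_bounded compactG cphi.
apply: (@dominated (fun k x => s k x * phi x) _ (4 * M) _ _ _ _ _).2.
- by rewrite mulr_gt0.
- by move=> k; exact: continuous_mul.
- by apply: measurable_funM => //; exact: continuous_measurable.
- by move=> x /hlim hx; apply: cvgM => //; exact: cvg_cst.
- move=> k x hx; rewrite normrM mulrAC ler_pM//; have h4 := s4 k x hx.
  have f0 : 0 <= fine (H x) by exact: fine_ge0.
  have := sqr_ge0 (`|s k x| - 1); rewrite sqrrB; lra.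
Qed.

End RapidSequence.

End RieszFischer.

(** * The L2 norm of a distribution as a supremum of partial Fourier sums *)

Section L2norm.
Context {R : realType} {n : nat} {G : lieGroupType R n}.
Hypothesis compactG : compact [set: G].
Variable mu : probability (borel G) R.
Hypothesis haar_mu : is_haar mu.
Local Notation C := R[i].
Local Notation I := (haar_int mu).

Lemma lnorm2E (h : G -> C) : lnorm2 mu h =
  ((\int[mu]_(x in [set: borel G]) (Normc.normc (h x) ^+ 2)%:E) `^ 2^-1)%E.
Proof.
rewrite /lnorm2 unlock; congr (_ `^ _)%E; apply: eq_integral => x _ /=.
by rewrite ger0_norm ?normc_ge0// powR_mulrn ?normc_ge0.
Qed.

Lemma square_integrable_sqint (h : G -> C) : square_integrable mu h -> sqint mu h.
Proof.
move=> [m1 m2 hh]; split => //.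
have mn : measurable_fun [set: borel G] (fun x : borel G => (Normc.normc (h x) ^+ 2)%:E).
  apply/measurable_EFinP; rewrite (_ : (fun x => _) =
    (fun x : borel G => complex.Re (h x) ^+ 2 + complex.Im (h x) ^+ 2)).
    by apply: measurable_funD; exact: measurable_funX.
  by apply/funext => x; rewrite normc_sqr.
apply/integrableP; split=> //.
rewrite (eq_integral (fun x : borel G => (Normc.normc (h x) ^+ 2)%:E)) => [|x _]; last first.
  by rewrite gee0_abs// lee_fin sqr_ge0.
by move: hh; rewrite lnorm2E; apply: lty_poweRy; rewrite invr_eq0.
Qed.

Lemma lnorm2_sqint (h : G -> C) : sqint mu h ->
  lnorm2 mu h = (Num.sqrt (I (fun x => Normc.normc (h x) ^+ 2)))%:E.
Proof.
move=> [m1 m2 ih]; rewrite lnorm2E -(EFin_haar_int ih) poweR_EFin; congr EFin.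
by rewrite powR12_sqrt//; apply: haar_int_ge0 => x; exact: sqr_ge0.
Qed.

Lemma sqint_square_integrable (h : G -> C) : sqint mu h -> square_integrable mu h.
Proof. by move=> sh; have [m1 m2 _] := sh; split => //; rewrite lnorm2_sqint// ltry. Qed.

Lemma ccont_sqint (h : G -> C) : ccont h -> sqint mu h.
Proof.
move=> [c1 c2]; split; try exact: continuous_measurable.
apply: (continuous_integrable compactG).
rewrite (_ : (fun x => _) = (fun x => complex.Re (h x) * complex.Re (h x) +
    complex.Im (h x) * complex.Im (h x))).
  by apply: continuous_add; exact: continuous_mul.
by apply/funext => x; rewrite normc_sqr !expr2.
Qed.

(** Bessel's inequality for each representative; without any representative the infimum is [+oo] and
    the bound still holds. *)
Lemma L2norm_ge (u : functional G) F : dual_seq F ->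
  ((Num.sqrt (qsum (fourier u) F))%:E <= L2norm mu u)%E.
Proof.
move=> dF; apply/ereal_infP => _ [h [/square_integrable_sqint sh uh] <-].
rewrite lnorm2_sqint// lee_fin ler_wsqrtr//; apply: (bessel compactG haar_mu dF sh) => xi k l _.
rewrite fourierE uh//.
by apply: csmoothJ; exact: (irrep_csmooth compactG haar_mu).
Qed.

Lemma L2norm_le (u : functional G) (h : G -> C) : sqint mu h ->
  (forall phi, csmooth phi -> u phi = cintegral mu (fun x => h x * phi x)) ->
  (L2norm mu u <= (Num.sqrt (I (fun x => Normc.normc (h x) ^+ 2)))%:E)%E.
Proof.
move=> sh uh; rewrite -lnorm2_sqint//; apply: ge_ereal_inf.
by exists (lnorm2 mu h) => //; exists h => //; split => //; exact: sqint_square_integrable.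
Qed.

Lemma represented_distribution (h : G -> C) : sqint mu h ->
  is_distribution (fun phi => cintegral mu (fun x => h x * phi x)).
Proof.
move=> sh; have hi phi : csmooth phi -> cintegrable mu (fun x => h x * phi x).
  by move=> sp; apply: (sqint_mul compactG sh); exact: csmooth_ccont.
split.
  move=> a phi psi sp sq; rewrite -cintegralZ; last exact: hi.
  rewrite -cintegralD; [|by apply: cintegrableZ; exact: hi|exact: hi].
  by apply: cintegral_ext => x; ring.
have [m1 m2 ih] := sh.
pose J := I (fun x => 1 + Normc.normc (h x) ^+ 2).
have i1 : haar_integrable mu (fun x => 1 + Normc.normc (h x) ^+ 2).
  by apply: haar_integrableD => //; exact: (haar_integrable_cst compactG).
exists (2 * J), 0%N => phi K sp hK; have hK0 x : Normc.normc (phi x) <= K by exact: (hK [::]).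
have K0 : 0 <= K by apply: le_trans (normc_ge0 _) (hK0 1%g).
have [f1 f2] := hi _ sp.
apply: le_trans (normc_le_ReIm _) _; rewrite cintegralE /=.
have le1 x : Normc.normc (h x * phi x) <= K * (1 + Normc.normc (h x) ^+ 2).
  rewrite Normc.normcM mulrC ler_pM ?normc_ge0//.
  by have := sqr_ge0 (Normc.normc (h x) - 1 / 2); rewrite sqrrB; lra.
have key (f : G -> R) : haar_integrable mu f -> (forall x, `|f x| <= Normc.normc (h x * phi x)) ->
    `|I f| <= K * J.
  move=> fi hf; rewrite -haar_intZ// ler_norml; apply/andP; split; last first.
    apply: le_haar_int => //; first exact: haar_integrableZ.
    by move=> x; apply: le_trans (ler_norm _) (le_trans (hf x) (le1 x)).
  rewrite -haar_intN; last exact: haar_integrableZ.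
  apply: le_haar_int => //; first by apply: haar_integrableN; exact: haar_integrableZ.
  by move=> x; rewrite lerNl; apply: le_trans (le1 x); apply: le_trans (hf x); rewrite -normrN ler_norm.
have h1 := key _ f1 (fun x => Re_le_normc _); have h2 := key _ f2 (fun x => Im_le_normc _).
by move: (I (fun x => complex.Re _)) (I (fun x => complex.Im _)) h1 h2 => a b; nra.
Qed.

Section Reconstruction.
Variable u : functional G.
Hypothesis du : is_distribution u.
Variable K : R.
Hypothesis uK : forall F, dual_seq F -> qsum (fourier u) F <= K.
Local Notation A := (fourier u).
Local Notation Q := (qsum A).

Let S := [set Q F | F in [set F | dual_seq F]].

Let dual_seq_nil : dual_seq ([::] : seq (irrep G)).
Proof. by split. Qed.

Let hS : has_sup S.
Proof.
split; first by exists (Q [::]), [::].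
by exists K => _ [F dF <-]; exact: uK.
Qed.

Let L := sup S.

Let QL F : dual_seq F -> Q F <= L.
Proof. by move=> dF; apply: (ub_le_sup hS.2); exists F. Qed.

Let psum_dist F F' : dual_seq F -> dual_seq F' -> {subset F <= F'} ->
  I (fun x => Normc.normc (psum A F' x - psum A F x) ^+ 2) = Q F' - Q F.
Proof.
move=> dF dF' FF'; have cp F0 : ccont (psum A F0) by apply: csmooth_ccont; exact: (psum_csmooth compactG haar_mu).
have E : cintegral mu (fun x => psum A F' x * conjC (psum A F x)) = (Q F)%:C.
  apply: (cint_psum_conj compactG dF).
    by move=> phi cphi; apply: (ccont_integrable compactG); exact: ccontM.
  by move=> xi k l xF; rewrite (cint_psum compactG haar_mu)// ?FF'//; case: dF => _; apply.
have := congr1 (@complex.Re R) E; rewrite cintegralE /= => E1.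
have [_ _ i1] := ccont_sqint (cp F); have [_ _ i2] := ccont_sqint (cp F').
have [i3 _] := ccont_integrable compactG mu (ccontM (cp F') (ccontJ (cp F))).
rewrite (@haar_int_ext _ _ _ mu _ (fun x => (Normc.normc (psum A F' x) ^+ 2 +
   (- 2) * complex.Re (psum A F' x * conjC (psum A F x))) + Normc.normc (psum A F x) ^+ 2)); last first.
  move=> x; rewrite !normc_sqr cReD cImD cReN cImN cReM cReJ cImJ; ring.
rewrite haar_intD//; last by apply: haar_integrableD => //; exact: haar_integrableZ.
rewrite haar_intD//; last exact: haar_integrableZ.
by rewrite haar_intZ// E1 !(qsum_integral compactG haar_mu)//; lra.
Qed.

(** Unions of nearly optimal sets increase, and [qsum] increases with the set. The rate [8] is the
    one required of the increments by [riesz_fischer_real]. *)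
Let exFs : exists Fs : nat -> seq (irrep G), [/\ Fs 0%N = [::],
  forall k, dual_seq (Fs k), forall k, {subset Fs k <= Fs k.+1} &
  forall k, L - (8 ^+ k.+1)^-1 <= Q (Fs k.+1)].
Proof.
have /(@choice nat (seq (irrep G)))[E hE] : forall k : nat, exists F, dual_seq F /\ L - (8 ^+ k.+1)^-1 < Q F.
  move=> k; have k0 : 0 < (8 ^+ k.+1)^-1 :> R by rewrite invr_gt0 exprn_gt0.
  by have [_ [F dF <-] h] := sup_adherent k0 hS; exists F.
pose Fs := fix Fs k := if k is k'.+1 then undup (Fs k' ++ E k') else [::].
have dFs k : dual_seq (Fs k).
  elim: k => [//|k [_ ih]]; split; first exact: undup_uniq.
  move=> xi; rewrite mem_undup mem_cat => /orP[/ih//|].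
  by have [[_ h] _] := hE k; exact: h.
exists Fs; split => // [k xi xk|k].
  by rewrite /= mem_undup mem_cat xk.
have [dE /ltW h] := hE k; apply: le_trans h _; rewrite -subr_ge0 -psum_dist//; last first.
  by move=> xi xk; rewrite /= mem_undup mem_cat xk orbT.
by apply: haar_int_ge0 => x; exact: sqr_ge0.
Qed.

(** The partial sums along [Fs] converge to some [h] whose Fourier coefficients are those of [u];
    uniqueness, [distr_eq0], then makes [h] represent [u]. *)
Lemma riesz_fischer : exists2 h : G -> C, sqint mu h /\ I (fun x => Normc.normc (h x) ^+ 2) <= K &
  forall phi, csmooth phi -> u phi = cintegral mu (fun x => h x * phi x).
Proof.
have [Fs [F0 dF sF LF]] := exFs.
have L0 : 0 <= L by apply: le_trans (QL dual_seq_nil); exact: qsum_ge0.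
pose s k := psum A (Fs k).
have cs k : ccont (s k) by apply: csmooth_ccont; exact: (psum_csmooth compactG haar_mu).
have s0 x : s 0%N x = 0 by rewrite /s F0 /psum big_nil.
(* The first increment is only bounded by [L], the following ones by [8 ^- k]; the factor [L + 1]
   covers both. *)
have sB k : I (fun x => Normc.normc (s k.+1 x - s k x) ^+ 2) <= (L + 1) * (8 ^+ k)^-1.
  rewrite psum_dist//; have h1 := QL (dF k.+1).
  case: k h1 => [|k] h1.
    by rewrite F0 /qsum big_nil subr0 expr0 invr1 mulr1; move: h1; rewrite /qsum; lra.
  have h2 := LF k; apply: (@le_trans _ _ ((8 ^+ k.+1)^-1)); first lra.
  by rewrite ler_peMl ?invr_ge0 ?exprn_ge0//; lra.
have [c1 c2] : (forall k, continuous (fun x => complex.Re (s k x))) /\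
  (forall k, continuous (fun x => complex.Im (s k x))) by split => k; case: (cs k).
have cd k : ccont (fun x => s k.+1 x - s k x).
  have [d1 d2] := cs k; have [d3 d4] := cs k.+1.
  split; [under eq_fun do rewrite cReD cReN|under eq_fun do rewrite cImD cImN]; exact: continuous_sub.
have sB' (p : C -> R) : (forall z, p z ^+ 2 <= Normc.normc z ^+ 2) ->
    (forall z z', p (z - z') = p z - p z') -> (forall k, continuous (fun x => p (s k x))) ->
    forall k, I (fun x => (p (s k.+1 x) - p (s k x)) ^+ 2) <= (L + 1) * (8 ^+ k)^-1.
  move=> pn pB cpk k; apply: le_trans (sB k); apply: le_haar_int.
  - apply: (continuous_integrable compactG).
    by apply: continuous_mul; exact: continuous_sub.
  - by have [_ _] := ccont_sqint (cd k).
  - by move=> x; rewrite -pB; exact: pn.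
have [a [ma ia ca cva]] := @riesz_fischer_real _ _ _ compactG mu (fun k x => complex.Re (s k x)) (L + 1) c1
  (fun x => congr1 (@complex.Re R) (s0 x))
  (sB' (@complex.Re R) (fun z => ltac:(by rewrite normc_sqr lerDl sqr_ge0))
    (fun z z' => ltac:(by rewrite cReD cReN)) c1).
have [b [mb ib cb cvb]] := @riesz_fischer_real _ _ _ compactG mu (fun k x => complex.Im (s k x)) (L + 1) c2
  (fun x => congr1 (@complex.Im R) (s0 x))
  (sB' (@complex.Im R) (fun z => ltac:(by rewrite normc_sqr lerDr sqr_ge0))
    (fun z z' => ltac:(by rewrite cImD cImN)) c2).
pose h x := a x +i* b x.
have hn x : Normc.normc (h x) ^+ 2 = a x ^+ 2 + b x ^+ 2 by rewrite normc_sqr.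
have ihn : haar_integrable mu (fun x => Normc.normc (h x) ^+ 2).
  by rewrite (_ : (fun x => _) = (fun x => a x ^+ 2 + b x ^+ 2)); [exact: haar_integrableD|apply/funext].
have sh : sqint mu h by [].
exists h; first split => //.
  have cv : (fun k => I (fun x => complex.Re (s k x) ^+ 2) + I (fun x => complex.Im (s k x) ^+ 2)) @ \oo -->
      I (fun x => Normc.normc (h x) ^+ 2).
    rewrite (_ : I (fun x => Normc.normc (h x) ^+ 2) = I (fun x => a x ^+ 2) + I (fun x => b x ^+ 2)).
      exact: cvgD.
    by rewrite -haar_intD//; apply: haar_int_ext.
  have H : \forall k \near \oo, [set z : R | z <= K]
      (I (fun x => complex.Re (s k x) ^+ 2) + I (fun x => complex.Im (s k x) ^+ 2)).
    apply: nearW => k; rewrite /= -haar_intD.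
    - rewrite (@haar_int_ext _ _ _ mu _ (fun x => Normc.normc (s k x) ^+ 2)) ?(qsum_integral compactG haar_mu)//.
        exact: uK.
      by move=> x; rewrite normc_sqr.
    - by apply: (continuous_integrable compactG); exact: continuous_mul.
    - by apply: (continuous_integrable compactG); exact: continuous_mul.
  exact: (closed_cvg _ (@closed_le R K) H _ cv).
pose v : functional G := fun phi => u phi - cintegral mu (fun x => h x * phi x).
have dh := represented_distribution sh.
have dv : is_distribution v.
  have [ul [C1 [N1 ub]]] := du; have [hl [C2 [N2 hb]]] := dh; split.
    by move=> c phi psi sp sq; rewrite /v ul// hl//; ring.
  exists (C1 + C2), (maxn N1 N2) => phi M sp hM; rewrite mulrDl.
  apply: le_trans (le_normcD _ _) _; rewrite normcN lerD//.
    by apply: ub => // w x wN; apply: hM; rewrite leq_max wN.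
  by apply: hb => // w x wN; apply: hM; rewrite leq_max wN orbT.
have uh (xi : irrep G) k l : dual G xi ->
    cintegral mu (fun x => h x * conjC (xi x k l)) = A xi l k.
  move=> dxi; have [_ _ xC] := irrep_unirep xi; have [e1 e2] := ccontJ (xC k l).
  have cvp (p : nat -> R) (z w : R) : p @ \oo --> z -> (exists N, forall m, (N <= m)%N -> p m = w) -> z = w.
    move=> pz [N hN]; apply: (@cvg_unique _ (@Rhausdorff R) (p @ \oo)) => //.
    by apply: cvg_near_cst; exists N => // m Nm; exact: hN.
  have [N hN] : exists N, forall m, (N <= m)%N -> cintegral mu (fun x => s m x * conjC (xi x k l)) = A xi l k.
    have [[N xN]|nx] := pselect (exists N, xi \in Fs N).
      exists N => m Nm; rewrite (cint_psum compactG haar_mu)//.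
      suff -> : xi \in Fs m by [].
      by rewrite -(subnK Nm); elim: (m - N)%N => [//|j ih]; rewrite addSn; exact: sF.
    exists 0%N => m _; rewrite (cint_psum compactG haar_mu)//.
    rewrite (negbTE (introN idP (fun H => nx (ex_intro _ m H)))).
    (* For [xi] outside all [Fs j]: adding it to [Fs j.+1] cannot push [qsum] beyond the supremum
       [L], so its coefficient is at most [8 ^- j.+1] for every [j]. *)
    have hA : hs_norm2 (A xi) <= 0.
      have d1 : 1 <= (irrep_dim xi)%:R :> R by rewrite ler1n; exact: irrep_dim_gt0.
      have bd j : hs_norm2 (A xi) <= (8 ^+ j.+1)^-1.
        have dF' : dual_seq (xi :: Fs j.+1).
          have [uF dF'] := dF j.+1; split => /=.
            by rewrite uF andbT; apply/negP => H; apply: nx; exists j.+1.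
          by move=> eta; rewrite in_cons => /orP[/eqP->//|]; exact: dF'.
        have := QL dF'; rewrite /qsum big_cons -/(qsum _ _) => h1; have h2 := LF j.
        have h3 := hs_norm2_ge0 (A xi); have h4 : hs_norm2 (A xi) <= (irrep_dim xi)%:R * hs_norm2 (A xi).
          by rewrite ler_peMl.
        lra.
      rewrite leNgt; apply/negP => p0.
      pose j := Num.truncn (hs_norm2 (A xi))^-1.
      have p1 : (hs_norm2 (A xi))^-1 < 8 ^+ j.+1.
        have p2 : 0 <= (hs_norm2 (A xi))^-1 by rewrite invr_ge0 ltW.
        have /andP[_ h2] := truncn_itv p2; apply: lt_trans h2 _.
        by rewrite -natrX ltr_nat; exact: ltn_expl.
      have := bd j; rewrite leNgt -[ltRHS]invrK ltf_pV2 ?posrE ?invr_gt0 ?exprn_gt0//.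
      by rewrite p1.
    have := hs_norm2_ge0 (A xi); move=> h1; have : hs_norm2 (A xi) == 0 by rewrite eq_le hA h1.
    rewrite psumr_eq0 => [/allP/(_ l)|i _]; last by apply: sumr_ge0 => j _; exact: sqr_ge0.
    rewrite mem_index_enum => /(_ isT) /=.
    rewrite psumr_eq0 => [/allP/(_ k)|i _]; last exact: sqr_ge0.
    rewrite mem_index_enum => /(_ isT) /=; rewrite sqrf_eq0 => /eqP /normc_eq0 ->.
    by [].
  have ia2 (p : G -> R) : continuous p ->
    haar_integrable mu (fun x => a x * p x) /\ haar_integrable mu (fun x => b x * p x).
    move=> cp; have [i1 i2] := sqint_mul compactG sh (ccont_real cp).
    split; [move: i1|move: i2]; congr haar_integrable; apply/funext => x; rewrite ?cReM ?cImM /=; ring.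
  have [a1 b1] := ia2 _ e1; have [a2 b2] := ia2 _ e2.
  have cJ := ccontJ (xC k l).
  have ip (p q : G -> R) : continuous p -> continuous q -> haar_integrable mu (fun x => p x * q x).
    by move=> cp cq; apply: (continuous_integrable compactG); exact: continuous_mul.
  rewrite cintegralE; apply: complex_ext => /=.
    apply: (cvp (fun m => complex.Re (cintegral mu (fun x => s m x * conjC (xi x k l))))); last first.
      by exists N => m /hN ->.
    rewrite (_ : I _ = I (fun x => a x * complex.Re (conjC (xi x k l))) -
                       I (fun x => b x * complex.Im (conjC (xi x k l)))); last first.
      by rewrite -haar_intB//; apply: haar_int_ext => x; rewrite cReM.
    rewrite (_ : (fun m => _) = (fun m => I (fun x => complex.Re (s m x) * complex.Re (conjC (xi x k l))) -
                       I (fun x => complex.Im (s m x) * complex.Im (conjC (xi x k l))))).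
      by apply: cvgB; [exact: cva|exact: cvb].
    apply/funext => m; rewrite cintegralE /= -haar_intB; [|exact: ip|exact: ip].
    by apply: haar_int_ext => x; rewrite cReM.
  apply: (cvp (fun m => complex.Im (cintegral mu (fun x => s m x * conjC (xi x k l))))); last first.
    by exists N => m /hN ->.
  rewrite (_ : I _ = I (fun x => a x * complex.Im (conjC (xi x k l))) +
                     I (fun x => b x * complex.Re (conjC (xi x k l)))); last first.
    by rewrite -haar_intD//; apply: haar_int_ext => x; rewrite cImM.
  rewrite (_ : (fun m => _) = (fun m => I (fun x => complex.Re (s m x) * complex.Im (conjC (xi x k l))) +
                     I (fun x => complex.Im (s m x) * complex.Re (conjC (xi x k l))))).
    by apply: cvgD; [exact: cva|exact: cvb].
  apply/funext => m; rewrite cintegralE /= -haar_intD; [|exact: ip|exact: ip].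
  by apply: haar_int_ext => x; rewrite cImM.
have v0 xi : dual G xi -> fourier v xi = 0.
  move=> dxi; apply/matrixP => i j; rewrite fourierE /v uh// -fourierE subrr mxE.
  by [].
move=> phi sp; apply/eqP; rewrite -subr_eq0; apply/eqP.
exact: (distr_eq0 compactG haar_mu dv v0 sp).
Qed.

Lemma L2norm_le_fourier : (L2norm mu u <= (Num.sqrt K)%:E)%E.
Proof.
have [h [sh hK] uh] := riesz_fischer.
apply: le_trans (L2norm_le sh uh) _; rewrite lee_fin; exact: ler_wsqrtr.
Qed.

End Reconstruction.

End L2norm.

(** * Singular values *)

Section SingularValues.
Context {R : realType}.
Local Notation C := R[i].

Lemma hs_norm2_trace m p (A : 'M[C]_(m, p)) : (hs_norm2 A)%:C = \tr (A^t* *m A).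
Proof.
rewrite /hs_norm2 exchange_big rmorph_sum; apply: eq_bigr => j _.
rewrite rmorph_sum mxE; apply: eq_bigr => i _ /=.
by rewrite trCE normc_sqrC mulrC.
Qed.

Lemma hs_norm2_eq0 m p (A : 'M[C]_(m, p)) : hs_norm2 A = 0 -> A = 0.
Proof.
move=> A0; apply/matrixP => i j; rewrite mxE; move/eqP: A0.
rewrite psumr_eq0 => [/allP/(_ i)|k _]; last by apply: sumr_ge0 => l _; exact: sqr_ge0.
rewrite mem_index_enum => /(_ isT) /=.
rewrite psumr_eq0 => [/allP/(_ j)|k _]; last exact: sqr_ge0.
by rewrite mem_index_enum => /(_ isT) /=; rewrite sqrf_eq0 => /eqP /normc_eq0.
Qed.

Lemma hs_norm2_unitary d p (U : 'M[C]_d) (A : 'M[C]_(d, p)) : U^t* *m U = 1%:M ->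
  hs_norm2 (U *m A) = hs_norm2 A.
Proof.
move=> UU; apply: (@complexI R).
by rewrite !hs_norm2_trace trC_mul mulmxA -(mulmxA (A^t*)) UU mulmx1.
Qed.

(** The spectral theorem for the Gram matrix, with the rows of [P] as eigenvectors; the eigenvalues
    are squared norms of their images, hence real and nonnegative. *)
Lemma gram_diagonalization d (S : 'M[C]_d) : exists P : 'M[C]_d, exists D : 'I_d -> R,
  [/\ P *m P^t* = 1%:M, P^t* *m P = 1%:M, forall i, 0 <= D i &
      P *m (S^t* *m S) = diag_mx (\row_i (D i)%:C) *m P].
Proof.
pose M := S^t* *m S; have MM : M^t* = M by rewrite trC_mul trmxCK.
have nM : M \is normalmx by apply/normalmxP; rewrite MM.
have /orthomx_spectralP E := nM.
pose P := spectralmx M; have uP : P \is unitarymx by exact: spectral_unitarymx.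
have PP : P *m P^t* = 1%:M by apply/unitarymxP.
have P'P : P^t* *m P = 1%:M by exact: mulmx1C.
have PM : P *m M = diag_mx (spectral_diag M) *m P.
  by rewrite {1}E !mulmxA mulmxV ?mul1mx//; exact: spectral_unit.
have DE i : spectral_diag M 0 i = (hs_norm2 (S *m (row i P)^t*))%:C.
  rewrite hs_norm2_trace trC_mul trmxCK mulmxA -(mulmxA (row i P)) -/M -row_mul PM.
  rewrite row_mul row_diag_mx -scalemxAl -rowE -scalemxAl linearZ /=.
  rewrite (_ : \tr (row i P *m (row i P)^t*) = 1) ?mulr1//.
  transitivity ((P *m P^t*) i i); last by rewrite PP mxE eqxx.
  by rewrite /mxtrace big_ord1 mxE [RHS]mxE; apply: eq_bigr => k _; rewrite !mxE.
exists P, (fun i => hs_norm2 (S *m (row i P)^t*)); split; [exact: PP|exact: P'P| |].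
  by move=> i; exact: hs_norm2_ge0.
rewrite PM; congr (diag_mx _ *m _); apply/rowP => i; rewrite [RHS]mxE; exact: DE.
Qed.

Lemma gram_norm d p (S P : 'M[C]_d) (D : 'I_d -> R) (A : 'M[C]_(d, p)) :
  P^t* *m P = 1%:M -> P *m (S^t* *m S) = diag_mx (\row_i (D i)%:C) *m P ->
  hs_norm2 (S *m A) = \sum_i D i * \sum_j Normc.normc ((P *m A) i j) ^+ 2.
Proof.
move=> PP PM; apply: (@complexI R); rewrite hs_norm2_trace trC_mul.
have -> : A^t* *m S^t* *m (S *m A) = (P *m A)^t* *m (diag_mx (\row_i (D i)%:C) *m (P *m A)).
  rewrite trC_mul (mulmxA (diag_mx _)) -PM !mulmxA.
  by rewrite -(mulmxA (A^t*) (P^t*)) PP mulmx1.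
rewrite mxtrace_mulC rmorph_sum /mxtrace; apply: eq_bigr => i _ /=.
rewrite rmorphM rmorph_sum mulr_sumr mxE; apply: eq_bigr => j _ /=.
by rewrite mul_diag_mx !mxE -mulrA; congr (_ * _); rewrite normc_sqrC.
Qed.

Lemma lambda_min_pos_ge0 m p (S : 'M[C]_(m, p)) : 0 <= lambda_min_pos S.
Proof.
rewrite /lambda_min_pos; set E := [set s : R | _].
have [E0|nE] := pselect (E !=set0); first by apply: lb_le_inf => // s [/ltW].
by rewrite (_ : E = set0) ?inf0//; apply/seteqP; split => // s Es; case: nE; exists s.
Qed.

Lemma lambda_min_pos_le m p (S : 'M[C]_(m, p)) s : 0 < s -> singular_value S s ->
  lambda_min_pos S <= s.
Proof. by move=> s0 hs; apply: ge_inf => //; exists 0 => t [/ltW]. Qed.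

Lemma gram_singular_value d (S P : 'M[C]_d) (D : 'I_d -> R) i :
  P *m P^t* = 1%:M -> 0 <= D i -> P *m (S^t* *m S) = diag_mx (\row_i (D i)%:C) *m P ->
  singular_value S (Num.sqrt (D i)).
Proof.
move=> PP Di PM; split; first exact: sqrtr_ge0.
rewrite sqr_sqrtr//; apply/eigenvalueP; exists (row i P).
  by rewrite -row_mul PM row_mul row_diag_mx -scalemxAl -rowE mxE.
apply/eqP => /(congr1 (fun v => v *m P^t*)); rewrite mul0mx -row_mul PP => /rowP/(_ i).
by rewrite !mxE eqxx => /eqP; rewrite oner_eq0.
Qed.

(** The matrix [B] built from the eigenvector [row i P] and this row of [P *m A] is killed by [S],
    and its pairing with [A] is the sum of squares in question. *)
Lemma gram_orthogonal_row d p (S P : 'M[C]_d) (D : 'I_d -> R) (A : 'M[C]_(d, p)) i :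
  P^t* *m P = 1%:M -> P *m P^t* = 1%:M -> P *m (S^t* *m S) = diag_mx (\row_i (D i)%:C) *m P ->
  (forall B : 'M[C]_(d, p), S *m B = 0 -> \tr (A *m B^t*) = 0) -> D i = 0 ->
  \sum_j Normc.normc ((P *m A) i j) ^+ 2 = 0.
Proof.
move=> PP PP' PM hA Di; pose B := (row i P)^t* *m row i (P *m A).
have SB : S *m B = 0.
  apply: hs_norm2_eq0; rewrite (gram_norm _ PP PM) big1// => k _.
  have -> : P *m B = delta_mx i 0 *m row i (P *m A).
    rewrite /B mulmxA; congr (_ *m _); apply/colP => l.
    have /matrixP/(_ l i) := PP'; rewrite !mxE eqxx andbT => <-.
    by apply: eq_bigr => q _; rewrite !mxE.
  have [->|ki] := eqVneq k i; first by rewrite Di mul0r.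
  rewrite big1 ?mulr0// => j _; rewrite mxE big_ord1 mxE (negbTE ki) mul0r.
  by rewrite Normc.normc0 expr0n.
have := hA B SB; rewrite /B trC_mul trmxCK mulmxA mxtrace_mulC mulmxA -row_mul => E.
apply: (@complexI R); rewrite -[RHS]E /mxtrace big_ord1 mxE rmorph_sum.
apply: eq_bigr => j _; rewrite trCE; set z := row i _ _ _.
have -> : (P *m A) i j = z by rewrite /z; move: (P *m A) => W; rewrite mxE.
exact: normc_sqrC.
Qed.

(** In the eigenbasis of the Gram matrix the rows of [A] over the eigenvalue 0 vanish, and every
    other eigenvalue is the square of a positive singular value. *)
Lemma lambda_min_pos_bound d p (S : 'M[C]_d) (A : 'M[C]_(d, p)) :
  (forall B : 'M[C]_(d, p), S *m B = 0 -> \tr (A *m B^t*) = 0) ->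
  lambda_min_pos S ^+ 2 * hs_norm2 A <= hs_norm2 (S *m A).
Proof.
move=> hA; have [P [D [PP PP' D0 PM]]] := gram_diagonalization S.
rewrite -(hs_norm2_unitary A PP') (gram_norm _ PP' PM) /hs_norm2 mulr_sumr.
apply: ler_sum => i _; have [Di|Di] := eqVneq (D i) 0.
  by rewrite (gram_orthogonal_row PP' PP PM hA Di) !mulr0.
rewrite ler_wpM2r//; first by apply: sumr_ge0 => j _; exact: sqr_ge0.
have Dp : 0 < D i by rewrite lt_def Di D0.
rewrite -[leRHS](sqr_sqrtr (D0 i)) ler_sqr ?nnegrE ?sqrtr_ge0 ?lambda_min_pos_ge0//.
by apply: lambda_min_pos_le; [rewrite sqrtr_gt0|exact: (gram_singular_value PP (D0 i) PM)].
Qed.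

Lemma singular_value_exists d (S : 'M[C]_d) : S != 0 ->
  exists s, 0 < s /\ singular_value S s.
Proof.
move=> S0; have [P [D [PP PP' D0 PM]]] := gram_diagonalization S.
have [[i Di]|nD] := pselect (exists i, D i != 0).
  exists (Num.sqrt (D i)); split; last exact: (gram_singular_value PP (D0 i) PM).
  by rewrite sqrtr_gt0 lt_def Di D0.
exfalso; move/eqP: S0; apply; rewrite -[S]mulmx1; apply: hs_norm2_eq0.
rewrite (gram_norm _ PP' PM) big1// => i _.
have [->|Di] := eqVneq (D i) 0; first by rewrite mul0r.
by case: nD; exists i.
Qed.

End SingularValues.

(** * The two inequalities *)

(** The tangent to [t^-p] at 1, from [1 + x <= exp x] used twice: once for the power, once for
    [ln t <= t - 1]. *)
Lemma powR_tangent (R : realType) (t p : R) : 0 < t -> 0 <= p ->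
  1 + p - p * t <= t `^ (- p).
Proof.
move=> t0 p0; rewrite /powR gt_eqF//; apply: le_trans (expR_ge1Dx _).
have : 1 + ln t <= t by apply: le_trans (expR_ge1Dx _) _; rewrite lnK// posrE.
by move: (ln t) => l hl; nra.
Qed.

(* Integrated tangent-line inequality for [y |-> y^-p] at the weighted mean. *)
Lemma weighted_powR_sum (R : realType) (I : Type) (F : seq I) (a y : I -> R) (p : R) :
  0 <= p -> (forall i, 0 <= a i) -> (forall i, 0 < y i) ->
  (\sum_(i <- F) a i) `^ (1 + p) <=
  (\sum_(i <- F) y i * a i) `^ p * \sum_(i <- F) y i `^ (- p) * a i.
Proof.
move=> p0 a0 y0; set M := \sum_(i <- F) a i; set Z := \sum_(i <- F) y i * a i.
have p1 : 1 + p != 0 by rewrite gt_eqF// ltr_pwDl.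
have M0 : 0 <= M by exact: sumr_ge0.
have S0 : 0 <= \sum_(i <- F) y i `^ (- p) * a i.
  by apply: sumr_ge0 => i _; rewrite mulr_ge0// powR_ge0.
have [->|Mn] := eqVneq M 0; first by rewrite powR0// mulr_ge0// powR_ge0.
have Mp : 0 < M by rewrite lt_def Mn M0.
have Zp : 0 < Z.
  rewrite lt_def sumr_ge0 ?andbT => [|i _]; last by rewrite mulr_ge0// ltW.
  apply: contra Mn => /eqP; rewrite /Z /M.
  elim: F {M Z M0 S0 Mp} => [|i F ih]; first by move=> _; rewrite big_nil.
  rewrite !big_cons => /eqP; rewrite paddr_eq0; last 2 first.
  - by rewrite mulr_ge0// ltW.
  - by apply: sumr_ge0 => j _; rewrite mulr_ge0// ltW.
  by rewrite mulf_eq0 gt_eqF//= => /andP[/eqP -> /eqP /ih]; rewrite add0r.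
pose z := Z / M; have zp : 0 < z by rewrite divr_gt0.
have key : M <= z `^ p * \sum_(i <- F) y i `^ (- p) * a i.
  (* [z] is the weighted mean of the [y i], so [z^-1 * Z] is [M]: the right-hand side is the
     weighted sum of the tangent lines at [y i / z]. *)
  have -> : M = (1 + p) * M - p * (z^-1 * Z) by rewrite /z; field; rewrite Mn gt_eqF.
  rewrite mulr_sumr /M /Z !mulr_sumr -sumrB; apply: ler_sum => i _.
  rewrite -/M -/Z mulrA.
  have -> : z `^ p * y i `^ (- p) = (y i / z) `^ (- p).
    by rewrite powRM ?(ltW (y0 i)) ?invr_ge0 ?(ltW zp)// mulrC -powR_inv1 ?ltW// -powRrM mulN1r opprK.
  have -> : (1 + p) * a i - p * (z^-1 * (y i * a i)) = (1 + p - p * (y i / z)) * a i.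
    by field; rewrite gt_eqF.
  by rewrite ler_wpM2r// powR_tangent// divr_gt0.
have -> : M `^ (1 + p) = M `^ p * M.
  by rewrite addrC powRD ?powRr1// Mn implybT.
have -> : Z `^ p = M `^ p * z `^ p.
  by rewrite -powRM ?ltW// /z mulrC mulfVK.
by rewrite -mulrA ler_wpM2l// powR_ge0.
Qed.

Lemma esum_single (R : realType) (I : choiceType) (S : set I) (a : I -> \bar R) x :
  S x -> (0 <= a x)%E -> (forall i, S i -> i != x -> a i = 0%E) ->
  (\esum_(i in S) a i = a x)%E.
Proof.
move=> Sx ax a0; rewrite -[RHS](esum_set1 ax) esum_mkcond [RHS]esum_mkcond.
apply: eq_esum => i _; have [->|ix] := eqVneq i x.
  by rewrite mem_set// mem_set.
rewrite [in RHS]memNset => [|/eqP]; last by rewrite (negbTE ix).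
by case: ifPn => // /set_mem Si; exact: a0.
Qed.

Lemma csum_single (R : realType) (I : choiceType) (S : set I) (a : I -> R[i]) x :
  S x -> (forall i, S i -> i != x -> a i = 0) -> csum S a = a x.
Proof.
move=> Sx a0; have single (b : I -> R) : (forall i, S i -> i != x -> b i = 0) -> rsum S b = b x.
  move=> b0; rewrite /rsum (@esum_single _ _ _ _ x)//=; last 2 first.
  - by rewrite lee_fin le_max lexx orbT.
  - by move=> i Si ix; rewrite b0// maxxx.
  rewrite (@esum_single _ _ _ _ x)//=; last 2 first.
  - by rewrite lee_fin le_max lexx orbT.
  - by move=> i Si ix; rewrite b0// oppr0 maxxx.
  by case: (lerP (b x) 0) => h; case: (lerP (- b x) 0) => h'; lra.
rewrite /csum !single; first by case: (a x).
  by move=> i Si ix; rewrite a0.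
by move=> i Si ix; rewrite a0.
Qed.

(** * Vector fields, kernels and norms on the Fourier side *)

Section Transference.
Context {R : realType} {n : nat} {G : lieGroupType R n}.
Hypothesis compactG : compact [set: G].
Hypothesis connectedG : connected [set: G].
Variable mu : probability (borel G) R.
Hypothesis haar_mu : is_haar mu.
Variable g : riemannian_metric G.
Hypothesis biinvariant_g : biinvariant g.
Variable X : 'M[R]_n.
Hypothesis basisX : X \in unitmx.
Hypothesis laplaceX : forall (f : G -> R) (x : G), smooth f ->
  laplace_beltrami g f x = - \sum_j lvf (row j X) (lvf (row j X) f) x.
Local Notation C := R[i].
Local Notation I := (haar_int mu).

Let sx (xi : irrep G) i j : csmooth (fun x => xi x i j).
Proof. exact: (irrep_csmooth compactG haar_mu). Qed.

Lemma fourier_ext (u w : functional G) xi : (forall phi, csmooth phi -> u phi = w phi) ->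
  fourier u xi = fourier w xi.
Proof. by move=> uw; apply/matrixP => i j; rewrite !fourierE uw//; exact: csmoothJ. Qed.

(** The sign from transposing the field onto test functions cancels against the skewness of
    [sigma xi v]. *)
Lemma fourier_vf_distr v (u : functional G) xi : is_distribution u ->
  fourier (vf_distr (lvf v) u) xi = sigma xi v *m fourier u xi.
Proof.
move=> du; apply/matrixP => i j; rewrite fourierE /vf_distr.
have -> : clift (lvf v) (fun x => conjC (xi x j i)) = (fun x => \sum_k conjC (sigma xi v k i) * conjC (xi x j k)).
  apply/funext => x; rewrite clvfJ// (clvf_irrep compactG haar_mu) mxE rmorph_sum.
  by apply: eq_bigr => k _; rewrite rmorphM mulrC.
rewrite (distr_sum du); last by move=> k; apply: csmoothZ; exact: csmoothJ.
rewrite -sumrN mxE; apply: eq_bigr => k _; rewrite (distrZ du); last exact: csmoothJ.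
rewrite fourierE -mulNr; congr (_ * _).
have /matrixP/(_ i k) := sigma_skew compactG haar_mu xi v.
by rewrite trCE [X in _ = X -> _]mxE => ->; rewrite opprK.
Qed.

Lemma clift_lin_comb alpha (phi : G -> C) : csmooth phi ->
  clift (lin_comb_vf X alpha) phi = clift (lvf (alpha *m X)) phi.
Proof.
move=> sp; apply/funext => x; rewrite clin_comb_vf (clvf_coord (alpha *m X) x sp).
transitivity (\sum_j \sum_i (alpha 0 j * X j i)%:C * clift (lvf (delta_mx 0 i)) phi x); last first.
  rewrite exchange_big; apply: eq_bigr => i _ /=.
  by rewrite -mulr_suml; congr (_ * _); rewrite mxE rmorph_sum.
apply: eq_bigr => j _; rewrite (clvf_coord (row j X) x sp) mulr_sumr; apply: eq_bigr => i _.
by rewrite mxE rmorphM mulrA.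
Qed.

Lemma vf_distr_lin_comb alpha (u : functional G) phi : csmooth phi ->
  vf_distr (lin_comb_vf X alpha) u phi = vf_distr (lvf (alpha *m X)) u phi.
Proof. by move=> sp; rewrite /vf_distr clift_lin_comb. Qed.

Lemma symbol_lvf alpha (xi : irrep G) :
  symbol (clift (lin_comb_vf X alpha)) xi = sigma xi (alpha *m X).
Proof.
rewrite /sigma /symbol; congr (_ *m _); apply/matrixP => i j.
by rewrite !mxE clift_lin_comb.
Qed.

(** By skewness the left-hand side is the trace of minus the Casimir element compressed by [A]; this
    is how the gradient norm meets [nu]. *)
Lemma nu_hs_norm2 (xi : irrep G) p (A : 'M[C]_(irrep_dim xi, p)) :
  \sum_j hs_norm2 (sigma xi (row j X) *m A) = nu g xi * hs_norm2 A.
Proof.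
have [_ E _] := nu_casimir compactG haar_mu biinvariant_g basisX laplaceX xi.
apply: (@complexI R); rewrite rmorph_sum rmorphM /= [(hs_norm2 A)%:C]hs_norm2_trace.
rewrite (eq_bigr (fun j => \tr (A^t* *m (- (sigma xi (row j X) *m sigma xi (row j X)) *m A)))); last first.
  move=> j _; rewrite hs_norm2_trace trC_mul (sigma_skew compactG haar_mu); congr (\tr _).
  by rewrite mulmxN !mulNmx mulmxN !mulmxA.
transitivity (\tr (\sum_j A^t* *m (- (sigma xi (row j X) *m sigma xi (row j X)) *m A))).
  by rewrite raddf_sum.
rewrite -mulmx_sumr -mulmx_suml sumrN -/(casimir X xi) E.
by rewrite -scalemx1 -scaleNr opprK -scalemxAl mul1mx -scalemxAr mxtraceZ.
Qed.

Definition tdist (xi : irrep G) (A : 'M[C]_(irrep_dim xi)) : functional G :=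
  fun phi => cintegral mu (fun x => tterm A x * phi x).

Lemma tterm_sqint (xi : irrep G) (A : 'M[C]_(irrep_dim xi)) : sqint mu (tterm A).
Proof.
apply: (ccont_sqint compactG); apply: csmooth_ccont.
exact: (tterm_csmooth compactG haar_mu).
Qed.

Lemma tdist_distribution (xi : irrep G) (A : 'M[C]_(irrep_dim xi)) : is_distribution (tdist A).
Proof. apply: (represented_distribution compactG); exact: tterm_sqint. Qed.

Lemma fourier_tdist (xi : irrep G) (A : 'M[C]_(irrep_dim xi)) : fourier (tdist A) xi = A.
Proof.
by apply/matrixP => i j; rewrite fourierE /tdist (cint_tterm_same compactG haar_mu).
Qed.

Lemma fourier_tdist_neq (xi eta : irrep G) (A : 'M[C]_(irrep_dim xi)) :
  dual G xi -> dual G eta -> eta != xi -> fourier (tdist A) eta = 0.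
Proof.
move=> dx de ex; apply/matrixP => i j; rewrite fourierE /tdist.
rewrite (cint_tterm_neq compactG haar_mu) ?mxE// => H.
by case/eqP: ex; apply: esym; exact: dual_inj.
Qed.

Lemma vf_tdist v (xi : irrep G) (A : 'M[C]_(irrep_dim xi)) phi : csmooth phi ->
  vf_distr (lvf v) (tdist A) phi = tdist (sigma xi v *m A) phi.
Proof.
move=> sp; have st := tterm_csmooth compactG haar_mu A.
rewrite /vf_distr /tdist (cintegral_by_parts compactG v haar_mu st sp) opprK.
apply: cintegral_ext => x; congr (_ * _).
have -> : tterm A = (fun x => \sum_i \sum_j ((irrep_dim xi)%:R * A j i) * xi x i j).
  by apply/funext => y; exact: ttermE.
rewrite clvf_sum => [|i]; last by apply: csmooth_sum => j; exact: csmoothZ.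
rewrite /tterm mulmxA /mxtrace mulr_sumr; apply: eq_bigr => i _.
rewrite clvf_sum => [|j]; last exact: csmoothZ.
rewrite mxE mulr_sumr; apply: eq_bigr => j _.
by rewrite clvfZ// (clvf_irrep compactG haar_mu); ring.
Qed.

Lemma dual_seq1 (xi : irrep G) : dual G xi -> dual_seq [:: xi].
Proof. by move=> dx; split => // eta; rewrite inE => /eqP ->. Qed.

(** The lower bound is Bessel's inequality for the one-element set; the upper bound takes the
    trigonometric polynomial itself as representative. *)
Lemma L2norm_tdist (xi : irrep G) (A : 'M[C]_(irrep_dim xi)) (u : functional G) : dual G xi ->
  (forall phi, csmooth phi -> u phi = tdist A phi) ->
  L2norm mu u = (Num.sqrt ((irrep_dim xi)%:R * hs_norm2 A))%:E.
Proof.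
move=> dx uA; have qE : qsum (fourier u) [:: xi] = (irrep_dim xi)%:R * hs_norm2 A.
  by rewrite /qsum big_seq1 (fourier_ext _ uA) fourier_tdist.
apply/eqP; rewrite eq_le; apply/andP; split; last first.
  by rewrite -qE; exact: (L2norm_ge compactG haar_mu u (dual_seq1 dx)).
have := L2norm_le (tterm_sqint A) uA; congr (_ <= (Num.sqrt _)%:E)%E.
rewrite -qE -(qsum_integral compactG haar_mu _ (dual_seq1 dx)).
apply: haar_int_ext => x; rewrite /psum big_seq1 (fourier_ext _ uA).
by rewrite fourier_tdist.
Qed.

Lemma gradient_tdist (xi : irrep G) (A : 'M[C]_(irrep_dim xi)) : dual G xi ->
  gradient_L2norm mu X (tdist A) = (Num.sqrt (nu g xi * ((irrep_dim xi)%:R * hs_norm2 A)))%:E.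
Proof.
move=> dx; rewrite /gradient_L2norm.
rewrite (eq_bigr (fun j => ((irrep_dim xi)%:R * hs_norm2 (sigma xi (row j X) *m A))%:E)).
  rewrite sumEFin poweR_EFin powR12_sqrt; last first.
    by apply: sumr_ge0 => j _; rewrite mulr_ge0// hs_norm2_ge0.
  by rewrite -mulr_sumr nu_hs_norm2 mulrCA.
move=> j _; rewrite (L2norm_tdist dx (fun phi => @vf_tdist _ xi A phi)) poweR_EFin.
by rewrite powR_mulrn ?sqrtr_ge0// sqr_sqrtr// mulr_ge0// hs_norm2_ge0.
Qed.

Lemma gradient_ge (u : functional G) F : is_distribution u -> dual_seq F ->
  ((Num.sqrt (\sum_(xi <- F) nu g xi * ((irrep_dim xi)%:R * hs_norm2 (fourier u xi))))%:E <=
   gradient_L2norm mu X u)%E.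
Proof.
move=> du dF; rewrite /gradient_L2norm.
have q0 j : 0 <= qsum (fourier (vf_distr (lvf (row j X)) u)) F by exact: qsum_ge0.
have -> : \sum_(xi <- F) nu g xi * ((irrep_dim xi)%:R * hs_norm2 (fourier u xi)) =
    \sum_j qsum (fourier (vf_distr (lvf (row j X)) u)) F.
  rewrite /qsum exchange_big; apply: eq_bigr => xi _ /=.
  rewrite mulrCA -nu_hs_norm2 mulr_sumr; apply: eq_bigr => j _.
  by rewrite fourier_vf_distr.
rewrite -powR12_sqrt; last by apply: sumr_ge0.
rewrite -poweR_EFin; apply: gt0_ler_poweR => //.
- by rewrite in_itv /= leey andbT lee_fin sumr_ge0.
- by rewrite in_itv /= leey andbT sume_ge0// => j _; exact: poweR_ge0.
rewrite -sumEFin; apply: lee_sum => j _.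
have := L2norm_ge compactG haar_mu (vf_distr (lvf (row j X)) u) dF => h.
have -> : (qsum (fourier (vf_distr (lvf (row j X)) u)) F)%:E =
    ((Num.sqrt (qsum (fourier (vf_distr (lvf (row j X)) u)) F))%:E `^ 2)%E.
  by rewrite poweR_EFin powR_mulrn ?sqrtr_ge0// sqr_sqrtr.
apply: gt0_ler_poweR => //; rewrite in_itv /= leey andbT; last first.
  by apply: le_trans h; rewrite lee_fin sqrtr_ge0.
by rewrite lee_fin sqrtr_ge0.
Qed.

Lemma nu_ge0 xi : 0 <= nu g xi.
Proof. by have [] := nu_casimir compactG haar_mu biinvariant_g basisX laplaceX xi. Qed.

Lemma jbracket_gt0 xi : 0 < jbracket g xi.
Proof. by rewrite sqrtr_gt0 ltr_pwDl// nu_ge0. Qed.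

Lemma sobolev_tdist (xi : irrep G) (A : 'M[C]_(irrep_dim xi)) s : dual G xi ->
  sobolev g s (tdist A).
Proof.
move=> dx; split; first exact: tdist_distribution.
rewrite (@esum_single _ _ _ _ xi) ?ltry//.
  by rewrite lee_fin !mulr_ge0// ?powR_ge0// hs_norm2_ge0.
move=> eta de ex; rewrite fourier_tdist_neq// [hs_norm2 _](_ : _ = 0) ?mulr0//.
rewrite /hs_norm2 big1// => i _; rewrite big1// => j _.
by rewrite mxE Normc.normc0 expr0n.
Qed.

Section VectorField.
Variable alpha : 'rV[R]_n.
Local Notation Y := (lin_comb_vf X alpha).
Local Notation v := (alpha *m X).

(** Orthogonality is tested against [tdist B], which lies in the kernel of [Y] when [sigma xi v]
    kills [B]; the Sobolev weight at [xi] is positive and drops out. *)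
Lemma ker_perp_fourier (u : functional G) (xi : irrep G) (B : 'M[C]_(irrep_dim xi)) :
  ker_perp g Y u -> dual G xi -> sigma xi v *m B = 0 -> \tr (fourier u xi *m B^t*) = 0.
Proof.
move=> [_ hu] dx sB; have := hu (tdist B) (sobolev_tdist B 1 dx).
have -> : sobolev_dot g 1 u (tdist B) =
    ((irrep_dim xi)%:R * jbracket g xi `^ (2 * 1))%:C * \tr (fourier u xi *m B^t*).
  rewrite /sobolev_dot (@csum_single _ _ _ _ xi)// ?fourier_tdist// => eta de ex.
  by rewrite fourier_tdist_neq// trmx0 map_mx0 mulmx0 mxtrace0 mulr0.
have w0 phi : csmooth phi -> vf_distr Y (tdist B) phi = 0.
  move=> sp; rewrite vf_distr_lin_comb// vf_tdist// sB /tdist.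
  rewrite (@cintegral_ext _ _ _ mu _ (fun=> 0)) ?cintegral_cst// => x.
  by rewrite /tterm mulmx0 mxtrace0 mulr0 mul0r.
move=> /(_ w0) /eqP; rewrite mulf_eq0 => /orP[|/eqP//].
rewrite eq_complex /= eqxx andbT mulf_eq0 pnatr_eq0 => /orP[/eqP d0|].
  by exfalso; have := irrep_dim_gt0 xi; rewrite d0.
by rewrite gt_eqF// powR_gt0// jbracket_gt0.
Qed.

(** Coefficients of elements of the kernel of [Y] are killed by [sigma xi v], and only the one at
    [xi] meets the coefficient of [tdist A]. *)
Lemma ker_perp_tdist (xi : irrep G) (A : 'M[C]_(irrep_dim xi)) : dual G xi ->
  (forall B : 'M[C]_(irrep_dim xi), sigma xi v *m B = 0 -> \tr (A *m B^t*) = 0) ->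
  ker_perp g Y (tdist A).
Proof.
move=> dx hA; split; first exact: sobolev_tdist.
move=> w [dw _] Yw; rewrite /sobolev_dot (@csum_single _ _ _ _ xi)//.
  rewrite fourier_tdist hA ?mulr0// -fourier_vf_distr//.
  apply/matrixP => i j; rewrite fourierE mxE -vf_distr_lin_comb ?Yw//; exact: csmoothJ.
by move=> eta de ex; rewrite fourier_tdist_neq// mul0mx mxtrace0 mulr0.
Qed.

End VectorField.

End Transference.

(** * The two implications *)

Lemma sqr_sqrt_powR (R : realType) (x r : R) : 0 <= x -> (Num.sqrt x `^ r) ^+ 2 = x `^ r.
Proof.
move=> x0; rewrite -powR12_sqrt// -powR_mulrn ?powR_ge0// -!powRrM.
by congr (_ `^ _); field.
Qed.

Lemma powR_pred (R : realType) (q delta : R) : 0 < q -> q `^ delta = q `^ (delta - 1) * q.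
Proof.
move=> q0; have E : delta = (delta - 1) + 1 by rewrite subrK.
rewrite {1}E powRD ?powRr1 ?(ltW q0)//.
by rewrite (gt_eqF q0) implybT.
Qed.

(** Both sides are homogeneous of degree [delta] in the square root of [q], which cancels; then [nu]
    is replaced by the larger [1 + nu]. *)
Lemma single_mode_bound (R : realType) (c s q nu delta : R) : 1 <= delta -> 0 <= nu -> 0 < q ->
  0 < s ->
  c * Num.sqrt q `^ delta <= Num.sqrt (nu * q) `^ (delta - 1) * Num.sqrt (s ^+ 2 * q) ->
  c * Num.sqrt (1 + nu) `^ (- (delta - 1)) <= s.
Proof.
move=> d1 n0 q0 s0; have p0 : 0 <= delta - 1 by rewrite subr_ge0.
have r0 : 0 < Num.sqrt q by rewrite sqrtr_gt0.
rewrite (sqrtrM _ n0) (sqrtrM _ (sqr_ge0 s)) sqrtr_sqr gtr0_norm// powRM ?sqrtr_ge0// powR_pred//.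
set t := Num.sqrt q `^ _; have t0 : 0 < t by rewrite powR_gt0.
rewrite (_ : _ * t * _ = Num.sqrt nu `^ (delta - 1) * s * (t * Num.sqrt q)); last by ring.
rewrite ler_pM2r ?mulr_gt0// => h.
have J0 : 0 < Num.sqrt (1 + nu) by rewrite sqrtr_gt0 ltr_pwDl.
rewrite powRN ler_pdivrMr ?powR_gt0//; apply: le_trans h _.
rewrite mulrC ler_pM2l//; apply: ge0_ler_powR => //; rewrite ?nnegrE ?sqrtr_ge0//.
by rewrite ler_wsqrtr// lerDr.
Qed.

Lemma poweR_bound_closed (R : realType) (c r delta : R) (L : \bar R) : 0 < c -> 0 <= r -> 1 <= delta ->
  (0 <= L)%E -> (L <= ((r / c) `^ delta^-1)%:E)%E -> (c%:E * L `^ delta <= r%:E)%E.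
Proof.
move=> c0 r0 d1 L0 hL; have d0 : 0 < delta by exact: lt_le_trans d1.
have -> : r%:E = (c%:E * ((r / c) `^ delta^-1)%:E `^ delta)%E.
  rewrite poweR_EFin -EFinM -powRrM mulVf ?gt_eqF// powRr1; last by rewrite divr_ge0// ltW.
  by rewrite mulrC divfK// gt_eqF.
rewrite lee_pmul2l//; apply: gt0_ler_poweR => //; first exact: ltW.
  by rewrite in_itv /= leey andbT.
by rewrite in_itv /= leey andbT lee_fin powR_ge0.
Qed.

Section Equivalence.
Context {R : realType} {n : nat} {G : lieGroupType R n}.
Hypothesis compactG : compact [set: G].
Hypothesis connectedG : connected [set: G].
Variable mu : probability (borel G) R.
Hypothesis haar_mu : is_haar mu.
Variable g : riemannian_metric G.
Hypothesis biinvariant_g : biinvariant g.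
Variable X : 'M[R]_n.
Hypothesis basisX : X \in unitmx.
Hypothesis laplaceX : forall (f : G -> R) (x : G), smooth f ->
  laplace_beltrami g f x = - \sum_j lvf (row j X) (lvf (row j X) f) x.
Variables (alpha : 'rV[R]_n) (delta : R).
Hypothesis delta_ge1 : 1 <= delta.
Local Notation C := R[i].
Local Notation Y := (lin_comb_vf X alpha).
Local Notation v := (alpha *m X).

(** The adjoint of the row eigenvector [w] is a column eigenvector, so [s ^+ 2] times [A] is the
    image of [A] under the Gram matrix, which is orthogonal to the kernel. *)
Lemma singular_vector (xi : irrep G) (s : R) : 0 < s -> singular_value (sigma xi v) s ->
  exists A : 'M[C]_(irrep_dim xi), [/\ 0 < hs_norm2 A,
    hs_norm2 (sigma xi v *m A) = s ^+ 2 * hs_norm2 A &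
    forall B : 'M[C]_(irrep_dim xi), sigma xi v *m B = 0 -> \tr (A *m B^t*) = 0].
Proof.
move=> s0 [_ /eigenvalueP[w wM w0]]; pose S := sigma xi v.
pose i0 := Ordinal (irrep_dim_gt0 xi).
pose A : 'M[C]_(irrep_dim xi) := w^t* *m delta_mx 0 i0; exists A.
have MA : S^t* *m S *m A = (s ^+ 2)%:C *: A.
  have MM : (S^t* *m S)^t* = S^t* *m S by rewrite trC_mul trmxCK.
  rewrite /A mulmxA -MM -trC_mul wM trC_scale -scalemxAl; congr (_ *: _).
  by apply: complex_ext; rewrite ?cReJ ?cImJ /= ?oppr0.
have hA : 0 < hs_norm2 A.
  rewrite lt_def hs_norm2_ge0 andbT; apply: contra w0 => /eqP /hs_norm2_eq0 A0.
  apply/eqP/rowP => k; have /matrixP/(_ k i0) := A0; rewrite !mxE big_ord1 !mxE !eqxx mulr1.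
  by move/(congr1 (fun z => conjC z)); rewrite conjCK conjC0.
split => //.
  apply: (@complexI R); rewrite rmorphM /= !hs_norm2_trace trC_mul mulmxA -(mulmxA (A^t*)) -/S.
  by rewrite -mulmxA MA -scalemxAr mxtraceZ.
move=> B SB; have : (s ^+ 2)%:C * \tr (A *m B^t*) = 0.
  rewrite -mxtraceZ scalemxAl -MA -!mulmxA mxtrace_mulC -!mulmxA -trC_mul SB.
  by rewrite trmx0 map_mx0 !mulmx0 mxtrace0.
move=> /eqP; rewrite mulf_eq0 => /orP[|/eqP//].
by rewrite eq_complex /= eqxx andbT expf_eq0 /= gt_eqF.
Qed.

Lemma lambda_min_pos_lower (c : R) : 0 < c ->
  (forall f : functional G, ker_perp g Y f ->
     (c%:E * L2norm mu f `^ delta <=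
      gradient_L2norm mu X f `^ (delta - 1) * L2norm mu (vf_distr Y f))%E) ->
  forall xi : irrep G, dual G xi -> sigma xi v != 0 ->
    c * jbracket g xi `^ (- (delta - 1)) <= lambda_min_pos (sigma xi v).
Proof.
move=> c0 hc xi dx sv; apply: lb_le_inf; first exact: singular_value_exists.
move=> s [s0 hs]; have [A [hA hSA hB]] := singular_vector s0 hs.
have := hc _ (ker_perp_tdist compactG haar_mu g dx hB).
pose q := (irrep_dim xi)%:R * hs_norm2 A.
have q0 : 0 < q by rewrite mulr_gt0// ltr0n; exact: irrep_dim_gt0.
rewrite (gradient_tdist compactG haar_mu biinvariant_g basisX laplaceX)//.
rewrite (L2norm_tdist compactG haar_mu (A := A) dx)//.
rewrite (L2norm_tdist compactG haar_mu (A := sigma xi v *m A) dx); last first.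
  by move=> phi sp; rewrite vf_distr_lin_comb// (vf_tdist compactG haar_mu).
rewrite hSA (mulrCA _ (s ^+ 2)) -/q !poweR_EFin -!EFinM lee_fin.
by apply: single_mode_bound => //; exact: (nu_ge0 compactG haar_mu biinvariant_g basisX laplaceX).
Qed.

(** The whole inequality restricted to a finite set of representations, with a constant that does
    not depend on it. *)
Lemma partial_sum_bound (c kappa : R) (f : functional G) (F : seq (irrep G)) :
  0 < c -> 0 < kappa ->
  (forall (xi : irrep G) w, sigma xi w != 0 -> kappa <= nu g xi) ->
  (forall xi : irrep G, dual G xi -> sigma xi v != 0 ->
    c * jbracket g xi `^ (- (delta - 1)) <= lambda_min_pos (sigma xi v)) ->
  ker_perp g Y f -> dual_seq F ->
  c * Num.sqrt (kappa / (1 + kappa)) `^ (delta - 1) * Num.sqrt (qsum (fourier f) F) `^ delta <=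
  Num.sqrt (\sum_(xi <- F) nu g xi * ((irrep_dim xi)%:R * hs_norm2 (fourier f xi))) `^ (delta - 1) *
  Num.sqrt (qsum (fourier (vf_distr Y f)) F).
Proof.
move=> c0 k0 gap hC kf [uF dF]; have [[df _] _] := kf.
pose p := delta - 1; have p0 : 0 <= p by rewrite subr_ge0.
have n0 xi : 0 <= nu g xi by exact: (nu_ge0 compactG haar_mu biinvariant_g basisX laplaceX).
pose a xi := (irrep_dim xi)%:R * hs_norm2 (fourier f xi).
have a0 xi : 0 <= a xi by rewrite mulr_ge0// hs_norm2_ge0.
pose y xi := 1 + nu g xi; have y0 xi : 0 < y xi by rewrite ltr_pwDl.
(* The least value of [nu / (1 + nu)] for [nu >= kappa]: the price of replacing [1 + nu] by [nu]. *)
set th := kappa / (1 + kappa); have th0 : 0 < th by rewrite divr_gt0// ltr_pwDl// ltW.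
(* When the symbol vanishes its kernel is everything, so the coefficient of [f] is orthogonal to
   itself; such [xi], to which neither the gap nor [hC] applies, contribute nothing. *)
have sig0 xi : dual G xi -> sigma xi v = 0 -> hs_norm2 (fourier f xi) = 0.
  move=> dx s0; have := ker_perp_fourier compactG haar_mu biinvariant_g basisX laplaceX (B := fourier f xi) kf dx.
  rewrite s0 mul0mx => /(_ erefl); rewrite mxtrace_mulC => E.
  by apply: (@complexI R); rewrite hs_norm2_trace E.
have fY xi : fourier (vf_distr Y f) xi = sigma xi v *m fourier f xi.
  rewrite -(fourier_vf_distr compactG haar_mu)//; apply: (fourier_ext compactG haar_mu) => phi.
  exact: (vf_distr_lin_comb X alpha f).
set D := \sum_(xi <- F) _; set B := qsum (fourier (vf_distr Y f)) F; set M := qsum _ _.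
have M0 : 0 <= M by exact: qsum_ge0.
have B0 : 0 <= B by exact: qsum_ge0.
have D0 : 0 <= D by apply: sumr_ge0 => xi _; rewrite mulr_ge0//; exact: (a0 xi).
have H1 := weighted_powR_sum F p0 a0 y0; rewrite -/(qsum _ F) -/M in H1.
have H2 : th * (\sum_(xi <- F) y xi * a xi) <= D.
  rewrite mulr_sumr /D big_seq [leRHS]big_seq; apply: ler_sum => xi xF.
  have [s0|s0] := eqVneq (sigma xi v) 0.
    by rewrite /a (sig0 _ (dF _ xF) s0) !mulr0.
  rewrite -/(a xi) mulrA ler_wpM2r// /th /y mulrAC ler_pdivrMr; last by rewrite ltr_pwDl// ltW.
  by have := gap _ _ s0; nra.
have H3 : c ^+ 2 * (\sum_(xi <- F) y xi `^ (- p) * a xi) <= B.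
  rewrite mulr_sumr /B /qsum big_seq [leRHS]big_seq; apply: ler_sum => xi xF.
  rewrite fY /a; have [s0|s0] := eqVneq (sigma xi v) 0.
    by rewrite (sig0 _ (dF _ xF) s0) !mulr0 mulr_ge0// hs_norm2_ge0.
  rewrite mulrA [leLHS]mulrCA ler_wpM2l//.
  have hl := lambda_min_pos_bound (S := sigma xi v) (A := fourier f xi)
    (fun B => ker_perp_fourier compactG haar_mu biinvariant_g basisX laplaceX kf (dF _ xF)).
  apply: le_trans hl; rewrite ler_wpM2r ?hs_norm2_ge0//.
  rewrite -(sqr_sqrt_powR _ (ltW (y0 xi))) -exprMn ler_sqr ?nnegrE ?lambda_min_pos_ge0//.
    exact: (hC _ (dF _ xF) s0).
  by rewrite mulr_ge0 ?powR_ge0// ltW.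
have S0 : 0 <= \sum_(xi <- F) y xi * a xi by apply: sumr_ge0 => xi _; rewrite mulr_ge0// ltW.
have S1 : 0 <= \sum_(xi <- F) y xi `^ (- p) * a xi.
  by apply: sumr_ge0 => xi _; rewrite mulr_ge0// powR_ge0.
(* Squaring removes the square roots and leaves the product of [H1], [H2] raised to the power [p],
   and [H3]. *)
rewrite -/p -ler_sqr ?nnegrE; last 2 first.
- by rewrite !mulr_ge0 ?powR_ge0// ltW.
- by rewrite mulr_ge0 ?powR_ge0// sqrtr_ge0.
rewrite !exprMn !sqr_sqrt_powR ?(ltW th0)// sqr_sqrtr//.
have -> : delta = 1 + p by rewrite /p addrC subrK.
apply: (@le_trans _ _ ((th * (\sum_(xi <- F) y xi * a xi)) `^ p *
    (c ^+ 2 * (\sum_(xi <- F) y xi `^ (- p) * a xi)))).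
  rewrite powRM ?(ltW th0)//.
  rewrite (_ : th `^ p * _ * _ = c ^+ 2 * th `^ p * ((\sum_(xi <- F) y xi * a xi) `^ p *
    (\sum_(xi <- F) y xi `^ (- p) * a xi))); last by ring.
  by rewrite ler_wpM2l// mulr_ge0 ?sqr_ge0 ?powR_ge0.
apply: ler_pM => //; first exact: powR_ge0.
  by rewrite mulr_ge0// sqr_ge0.
by apply: ge0_ler_powR; rewrite ?nnegrE ?(mulr_ge0 (ltW th0) S0).
Qed.

(** The bound on finite sets is uniform, and its right-hand side is at most the right-hand side
    wanted; [L2norm_le_fourier] then passes to the supremum on the left. *)
Lemma gradient_inequality (c : R) : 0 < c ->
  (forall xi : irrep G, dual G xi -> sigma xi v != 0 ->
    c * jbracket g xi `^ (- (delta - 1)) <= lambda_min_pos (sigma xi v)) ->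
  exists2 b : R, 0 < b & forall f : functional G, ker_perp g Y f ->
     (b%:E * L2norm mu f `^ delta <=
      gradient_L2norm mu X f `^ (delta - 1) * L2norm mu (vf_distr Y f))%E.
Proof.
move=> c0 hC.
have [kappa k0 gap] := sigma_gap compactG connectedG haar_mu biinvariant_g basisX laplaceX.
have th0 : 0 < kappa / (1 + kappa) by rewrite divr_gt0// ltr_pwDl// ltW.
pose b := c * Num.sqrt (kappa / (1 + kappa)) `^ (delta - 1).
have b0 : 0 < b by rewrite mulr_gt0// powR_gt0// sqrtr_gt0.
have p0 : 0 <= delta - 1 by rewrite subr_ge0.
exists b => // f kf; have [[df _] _] := kf.
have bound F : dual_seq F -> ((b * Num.sqrt (qsum (fourier f) F) `^ delta)%:E <=
    gradient_L2norm mu X f `^ (delta - 1) * L2norm mu (vf_distr Y f))%E.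
  move=> dF; have := partial_sum_bound c0 k0 gap hC kf dF; rewrite -/b -lee_fin => h.
  apply: le_trans h _; rewrite EFinM; apply: lee_pmul.
  - by rewrite lee_fin powR_ge0.
  - by rewrite lee_fin sqrtr_ge0.
  - have hg := gradient_ge compactG haar_mu biinvariant_g basisX laplaceX df dF.
    rewrite -poweR_EFin; apply: gt0_ler_poweR => //; rewrite in_itv /= leey andbT.
      by rewrite lee_fin sqrtr_ge0.
    by apply: le_trans hg; rewrite lee_fin sqrtr_ge0.
  - exact: (L2norm_ge compactG haar_mu _ dF).
have L0 : (0 <= L2norm mu f)%E.
  by apply/ereal_infP => _ [h _ <-]; exact: Lnorm_ge0.
(* The empty set shows that the right-hand side is nonnegative, in particular not [-oo]. *)
have nil_dual : dual_seq ([::] : seq (irrep G)) by split.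
have rhs0 := le_trans _ (bound [::] nil_dual).
have {}rhs0 : (0 <= gradient_L2norm mu X f `^ (delta - 1) * L2norm mu (vf_distr Y f))%E.
  by apply: rhs0; rewrite lee_fin mulr_ge0 ?powR_ge0// ltW.
(* An infinite right-hand side leaves nothing to prove; a finite one, [r], bounds all partial sums
   and so provides the constant for Riesz-Fischer. *)
move: bound rhs0; case: (_ * _)%E => [r|_ _|//]; last by rewrite leey.
move=> bound; rewrite lee_fin => r0; apply: poweR_bound_closed => //.
have d0 : 0 < delta by exact: lt_le_trans delta_ge1.
have rc0 : 0 <= r / b by rewrite divr_ge0// ltW.
rewrite -[X in (_ <= X%:E)%E]ger0_norm ?powR_ge0// -sqrtr_sqr.
apply: (L2norm_le_fourier compactG haar_mu df) => F dF.
rewrite -[leLHS]sqr_sqrtr ?qsum_ge0// ler_sqr ?nnegrE ?sqrtr_ge0 ?powR_ge0//.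
have -> : Num.sqrt (qsum (fourier f) F) = (Num.sqrt (qsum (fourier f) F) `^ delta) `^ delta^-1.
  by rewrite -powRrM mulfV ?gt_eqF// powRr1// sqrtr_ge0.
apply: ge0_ler_powR; rewrite ?nnegrE ?invr_ge0 ?powR_ge0 ?(ltW d0)//.
by rewrite ler_pdivlMr// mulrC -lee_fin; exact: bound.
Qed.

End Equivalence.

Theorem theorem3p5 (R : realType) (n : nat) (G : lieGroupType R n)
    (compactG : compact [set: G]) (connectedG : connected [set: G])
    (mu : probability (borel G) R) (haar_mu : is_haar mu)
    (g : riemannian_metric G) (biinvariant_g : biinvariant g)
    (X : 'M[R]_n) (basisX : X \in unitmx)
    (laplaceX : forall (f : G -> R) (x : G), smooth f ->
       laplace_beltrami g f x = - \sum_j lvf (row j X) (lvf (row j X) f) x)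
    (alpha : 'rV[R]_n) (delta : R) (delta_ge1 : 1 <= delta) :
  let Y := lin_comb_vf X alpha in
  (exists2 c : R, 0 < c &
     forall f : functional G, ker_perp g Y f ->
       (c%:E * L2norm mu f `^ delta <=
        gradient_L2norm mu X f `^ (delta - 1) * L2norm mu (vf_distr Y f))%E)
  <->
  (exists2 C : R, 0 < C &
     forall xi : irrep G, dual G xi -> symbol (clift Y) xi != 0 ->
       C * jbracket g xi `^ (- (delta - 1)) <=
       lambda_min_pos (symbol (clift Y) xi)).
Proof.
move=> Y; split => [[c c0 hc]|[c c0 hc]].
  exists c => // xi dx; rewrite (symbol_lvf compactG haar_mu).
  move=> sv; exact: (lambda_min_pos_lower compactG haar_mu biinvariant_g basisX laplaceX delta_ge1 c0 hc dx sv).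
apply: (gradient_inequality compactG connectedG haar_mu biinvariant_g basisX laplaceX delta_ge1 c0).
by move=> xi dx; have := hc xi dx; rewrite (symbol_lvf compactG haar_mu).
Qed.
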